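(* Let $m\ge 1$ be a real number and let $u,v\in\mathcal F^2_m$, neither identically zero. The following conditions are equivalent: (1) The product $T=T_uT_{\overline v}$ is bounded on $\mathcal F^2_m$. (2) There exist a polynomial $g$ of degree at most $m$ and a nonzero complex constant $c$ such that $u(z)=e^{g(z)}$ and $v(z)=c\,e^{-g(z)}$ for all $z\in\mathbb C$. (3) The function $z\mapsto \widetilde{|u|^2}(z)\,\widetilde{|v|^2}(z)$ is bounded on $\mathbb C$. Furthermore, in the affirmative case, $\|T\|\le C_1 e^{C_2\|g\|_{H^2}^2}$, where $C_1,C_2$ are positive constants independent of $g$.
   Context: For real $m\ge1$, $d\lambda_m(z)=e^{-|z|^{2m}}\,dA(z)$ where $dA$ is Lebesgue area measure on $\mathbb C$, and $\mathcal F^2_m$ is the Hilbert space of entire functions in $L^2(\mathbb C,d\lambda_m)$. Its reproducing kernel is $K_m(z,w)=\frac{m}{\pi}\sum_{k=0}^\infty \frac{(z\overline w)^k}{\Gamma(\frac{k+1}{m})}$. $P$ denotes the orthogonal projection of $L^2(\mathbb C,d\lambda_m)$ onto $\mathcal F^2_m$, and for a symbol $\varphi$ the Toeplitz operator $T_\varphi f=P(\varphi f)$, i.e. $T_\varphi f(z)=\int_{\mathbb C}K_m(z,w)\varphi(w)f(w)\,d\lambda_m(w)$, is densely defined on finite linear combinations of kernel functions $K_m(\cdot,w)$; ''bounded'' means it extends to a bounded operator on $\mathcal F^2_m$. The Berezin transform of a function $\varphi\ge0$ (or integrable against it) is $\widetilde\varphi(z)=\int_{\mathbb C}\varphi(w)\frac{|K_m(w,z)|^2}{K_m(z,z)}\,d\lambda_m(w)$.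 For a polynomial $g(z)=\sum_k a_kz^k$, $\|g\|_{H^2}^2=\sum_k|a_k|^2$ is its norm in the Hardy space of the unit disc. *)

(* Defs.v *)
(* mathcomp-analysis (realType R, Lebesgue measure, integrals)
   + mathcomp-real-closed's complex numbers R[i]. *)
From HB Require Import structures.
From mathcomp Require Import all_boot all_order all_algebra.
From mathcomp Require Import all_classical all_reals all_analysis.
From mathcomp Require Import complex.
Set Implicit Arguments.
Unset Strict Implicit.
Unset Printing Implicit Defensive.
Import Order.TTheory GRing.Theory Num.Theory.
Local Open Scope ring_scope.

Section FockDefs.
Variable R : realType.

(** modulus of a complex number, as a real number *)
Definition cmod (z : R[i]) : R :=
  Num.sqrt (complex.Re z ^+ 2 + complex.Im z ^+ 2).

(** identification R x R = C *)
Definition toC (p : R * R) : R[i] := (p.1 +i* p.2)%C.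

(** Lebesgue area measure dA on C = R x R *)
Definition dA : set (R * R) -> \bar R :=
  (@lebesgue_measure R \x @lebesgue_measure R)%E.

(** density of d lambda_m = e^{-|z|^{2m}} dA *)
Definition wt (m : R) (z : R[i]) : R := expR (- (cmod z `^ (2 * m))).

(** complex exponential *)
Definition cexp (z : R[i]) : R[i] :=
  ((expR (complex.Re z) * cos (complex.Im z))
     +i* (expR (complex.Re z) * sin (complex.Im z)))%C.

(** Euler Gamma function, Gamma(s) = int_0^oo t^{s-1} e^{-t} dt *)
Definition Gamma (s : R) : R :=
  Rintegral (@lebesgue_measure R) `[0%R, +oo[%classic
            (fun t => t `^ (s - 1) * expR (- t)).

(** sum of a complex series (componentwise limits of partial sums) *)
Definition csum (a : nat -> R[i]) : R[i] :=
  ((limn (fun n => \sum_(k < n) complex.Re (a k)))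
   +i* (limn (fun n => \sum_(k < n) complex.Im (a k))))%C.

(** reproducing kernel K_m(z,w) = m/pi sum_k (z conj w)^k / Gamma((k+1)/m) *)
Definition Kern (m : R) (z w : R[i]) : R[i] :=
  (m / pi)%:C%C * csum (fun k => (z * (w^*)%C) ^+ k / (Gamma (k.+1%:R / m))%:C%C).

(** integrability against d lambda_m of a complex function *)
Definition lam_integrable (m : R) (h : R[i] -> R[i]) : Prop :=
  dA.-integrable setT (fun p => (complex.Re (h (toC p)) * wt m (toC p))%:E) /\
  dA.-integrable setT (fun p => (complex.Im (h (toC p)) * wt m (toC p))%:E).

(** complex integral int h d lambda_m *)
Definition lam_int (m : R) (h : R[i] -> R[i]) : R[i] :=
  ((Rintegral dA setT (fun p => complex.Re (h (toC p)) * wt m (toC p)))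
   +i* (Rintegral dA setT (fun p => complex.Im (h (toC p)) * wt m (toC p))))%C.

(** squared L^2(d lambda_m) norm, as an extended real *)
Definition l2sq (m : R) (f : R[i] -> R[i]) : \bar R :=
  (\int[dA]_p ((cmod (f (toC p)) ^+ 2 * wt m (toC p))%:E))%E.

(** entire function: complex differentiable at every point *)
Definition entire (f : R[i] -> R[i]) : Prop :=
  forall z : R[i], exists d : R[i], forall e : R, 0 < e ->
    exists del : R, 0 < del /\
      forall h : R[i], h != 0 -> cmod h < del ->
        cmod ((f (z + h) - f z) / h - d) < e.

(** the Fock space F^2_m *)
Definition inF2 (m : R) (f : R[i] -> R[i]) : Prop :=
  entire f /\ (l2sq m f < +oo)%E.

(** Toeplitz operator T_phi f (z) = int K_m(z,w) phi(w) f(w) d lambda_m(w),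
    and the integrability condition making it defined at z *)
Definition toep (m : R) (phi f : R[i] -> R[i]) (z : R[i]) : R[i] :=
  lam_int m (fun w => Kern m z w * phi w * f w).
Definition toep_defined (m : R) (phi f : R[i] -> R[i]) (z : R[i]) : Prop :=
  lam_integrable m (fun w => Kern m z w * phi w * f w).

Definition cconj (v : R[i] -> R[i]) : R[i] -> R[i] := fun w => ((v w)^*)%C.

(** the product T = T_u T_{conj v} *)
Definition TT (m : R) (u v f : R[i] -> R[i]) : R[i] -> R[i] :=
  toep m u (toep m (cconj v) f).
Definition TT_defined (m : R) (u v f : R[i] -> R[i]) : Prop :=
  (forall x, toep_defined m (cconj v) f x) /\
  (forall z, toep_defined m u (toep m (cconj v) f) z).

(** finite linear combinations of kernel functions K_m(., w) *)
Definition kspan (m : R) (f : R[i] -> R[i]) : Prop :=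
  exists (n : nat) (c w : nat -> R[i]),
    forall z, f z = \sum_(j < n) c j * Kern m z (w j).

(** ||T_u T_{conj v}|| <= M : on the dense domain, T f is defined and
    ||T f|| <= M ||f|| *)
Definition TT_bounded_by (m : R) (u v : R[i] -> R[i]) (M : R) : Prop :=
  forall f, kspan m f ->
    TT_defined m u v f /\
    (l2sq m (TT m u v f) <= (M ^+ 2)%:E * l2sq m f)%E.

Definition TT_bounded (m : R) (u v : R[i] -> R[i]) : Prop :=
  exists M : R, TT_bounded_by m u v M.

(** Berezin transform of a nonnegative function phi *)
Definition berezin (m : R) (phi : R[i] -> R) (z : R[i]) : \bar R :=
  (\int[dA]_p ((phi (toC p) * cmod (Kern m (toC p) z) ^+ 2
                 / complex.Re (Kern m z z)) * wt m (toC p))%:E)%E.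

(** squared Hardy-space norm of a polynomial *)
Definition h2sq (g : {poly R[i]}) : R :=
  \sum_(k < size g) cmod (g`_k) ^+ 2.

(** degree of g at most m (the zero polynomial included) *)
Definition deg_le (g : {poly R[i]}) (m : R) : Prop := ((size g).-1)%:R <= m.

End FockDefs.

(* Main.v *)
Require Import Defs.
From HB Require Import structures.
From mathcomp Require Import all_boot all_order all_algebra.
From mathcomp Require Import all_classical all_reals all_analysis.
From mathcomp Require Import measurable_realfun.
From mathcomp Require Import complex.
From mathcomp Require Import ring lra zify.
Set Implicit Arguments.
Unset Strict Implicit.
Unset Printing Implicit Defensive.
Import Order.TTheory GRing.Theory Num.Theory.
Import numFieldNormedType.Exports.
Local Open Scope ring_scope.
Local Open Scope classical_set_scope.

(** The heart of the matter is the positivity |E(z)| <= E(max(Re z, 0)) of E(z) = sum_k z^k / Gamma((k+1)/m).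
    By Gauss' product formula, E is a limit of functions sum_k c_k z^k / k! obtained from the exponential by
    steps c_k -> c_k (1 + b / (k + a)), b >= 0, each of which keeps the inequality because 1 / (k + a) is an
    integral of t^(k + a - 1). Together with E(x) <= C (1 + x)^(m - 1) exp(x^m) and convexity it gives
    |K(z,w)| exp(-(|z|^2m + |w|^2m) / 2) <= N T exp(-delta T |z - w|^2) with T = max(1, |z|, |w|)^(2m - 2).
    For deg g <= m, |g(z) - g(w)| is at most a constant times ||g|| T^(1/2) |z - w|, so the integral kernel of
    T_u T_vbar stays dominated by such a gaussian kernel at the price of a factor exp(C ||g||^2), and Schur's
    test bounds the operator.

    Conversely, testing on kernel functions, (1) and (3) both imply |v(w)|^2 ||u K_w||^2 <= M K(w,w). By
    Liouville uv is a nonzero constant. The functional f -> w f'(w) - mu f(w), with mu the mean of the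
    weights |w|^(2k) / Gamma((k+1)/m), kills K_w at w and its squared norm is K(w,w) times their variance V;
    applied to u K_w it gives |w u'(w) / u(w)|^2 <= M' V(|w|^2). As x mu'(x) = V(x) and mu(x) = O(x^m) by Jensen,
    V(r^2) = O(r^2m) on arbitrarily large circles, so u'/u is a polynomial of degree at most m - 1. *)

(** * Complex numbers and series *)

(** The kernel estimate has to hold for every real m >= 1 and uniformly in both variables, also
    where z conj(w) is far from the positive axis; positivity takes the place of asymptotic
    expansions of Mittag-Leffler functions. The product formula enters because k! / Gamma((k+1)/m)
    is Gamma(s) / Gamma(s/m) at s = k + 1, and the j-th factors of the two Gauss products have
    quotient m (s/m + j) / (s + j) = 1 + (m - 1) j / (s + j): this is where b and a come from, and m
    >= 1 is what makes b nonnegative. The squared Hardy norm comes from completing a square: the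
    difference of g is linear in T^(1/2) |z - w|, the gaussian is quadratic in the same quantity,
    and half of the gaussian pays for the linear term. In the converse, Cauchy estimates on some
    sequence of radii tending to infinity determine the degree, so control of V at one point per
    dyadic scale is enough. Goursat's lemma, Taylor expansion and Cauchy estimates are derived from
    [entire] itself; circles are handled as images of vertical segments under the exponential. *)

Section ComplexModulus.
Context {R : realType}.
Implicit Types (z w : R[i]) (x y : R).
Local Notation Re := complex.Re.
Local Notation Im := complex.Im.

Lemma ReD z w : Re (z + w) = Re z + Re w. Proof. by case: z; case: w. Qed.
Lemma ImD z w : Im (z + w) = Im z + Im w. Proof. by case: z; case: w. Qed.
Lemma ReN z : Re (- z) = - Re z. Proof. by case: z. Qed.
Lemma ImN z : Im (- z) = - Im z. Proof. by case: z. Qed.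
Lemma ReB z w : Re (z - w) = Re z - Re w. Proof. by rewrite ReD ReN. Qed.
Lemma ImB z w : Im (z - w) = Im z - Im w. Proof. by rewrite ImD ImN. Qed.
Lemma ReM z w : Re (z * w) = Re z * Re w - Im z * Im w. Proof. by case: z; case: w. Qed.
Lemma ImM z w : Im (z * w) = Re z * Im w + Im z * Re w. Proof. by case: z; case: w. Qed.
Lemma ReJ z : Re (z^*)%C = Re z. Proof. by case: z. Qed.
Lemma ImJ z : Im (z^*)%C = - Im z. Proof. by case: z. Qed.

Lemma ReZl x z : Re (x%:C%C * z) = x * Re z.
Proof. by rewrite ReM mul0r subr0. Qed.
Lemma ImZl x z : Im (x%:C%C * z) = x * Im z.
Proof. by rewrite ImM mul0r addr0. Qed.

Lemma Re_sum (I : Type) (r : seq I) (P : pred I) (F : I -> R[i]) :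
  Re (\sum_(i <- r | P i) F i) = \sum_(i <- r | P i) Re (F i).
Proof. by elim/big_rec2: _ => // i x y _ <-; rewrite ReD. Qed.
Lemma Im_sum (I : Type) (r : seq I) (P : pred I) (F : I -> R[i]) :
  Im (\sum_(i <- r | P i) F i) = \sum_(i <- r | P i) Im (F i).
Proof. by elim/big_rec2: _ => // i x y _ <-; rewrite ImD. Qed.

Lemma complex_eq z w : Re z = Re w -> Im z = Im w -> z = w.
Proof. by case: z; case: w => a b c d /= -> ->. Qed.

Lemma complexEta z : z = (Re z +i* Im z)%C. Proof. by case: z. Qed.

Lemma real_complexX x n : (x%:C%C) ^+ n = (x ^+ n)%:C%C :> R[i].
Proof. by rewrite rmorphXn. Qed.

Lemma cmod_normc z : cmod z = Normc.normc z. Proof. by case: z. Qed.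

Lemma cmod_norm z : (cmod z)%:C%C = `|z|. Proof. by rewrite normc_def. Qed.

Lemma cmod_ge0 z : 0 <= cmod z. Proof. exact: sqrtr_ge0. Qed.
Lemma cmod0 : cmod (0 : R[i]) = 0.
Proof. by rewrite /cmod /= expr0n addr0 sqrtr0. Qed.
Lemma cmod1 : cmod (1 : R[i]) = 1.
Proof. by rewrite /cmod /= expr0n addr0 expr1n sqrtr1. Qed.
Lemma cmod_eq0 z : (cmod z == 0) = (z == 0).
Proof.
apply/eqP/eqP => [|->]; last exact: cmod0.
by rewrite cmod_normc => /Normc.eq0_normc.
Qed.
Lemma cmod_gt0 z : (0 < cmod z) = (z != 0).
Proof. by rewrite lt_neqAle cmod_ge0 andbT eq_sym cmod_eq0. Qed.
Lemma cmodM z w : cmod (z * w) = cmod z * cmod w.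
Proof. by rewrite !cmod_normc Normc.normcM. Qed.
Lemma cmodV z : cmod z^-1 = (cmod z)^-1.
Proof. by rewrite !cmod_normc Normc.normcV. Qed.
Lemma cmodN z : cmod (- z) = cmod z.
Proof. by rewrite /cmod ReN ImN !sqrrN. Qed.
Lemma cmodX z n : cmod (z ^+ n) = cmod z ^+ n.
Proof. by elim: n => [|n IH]; rewrite ?expr0 ?cmod1// !exprS cmodM IH. Qed.
Lemma cmodD z w : cmod (z + w) <= cmod z + cmod w.
Proof. by rewrite -lecR rmorphD /= !cmod_norm ler_normD. Qed.
Lemma cmodB z w : cmod (z - w) = cmod (w - z).
Proof. by rewrite -cmodN opprB. Qed.
Lemma cmodBD z w : cmod (z - w) <= cmod z + cmod w.
Proof. by rewrite -(cmodN w) cmodD. Qed.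
Lemma cmod_dist z w : cmod z - cmod w <= cmod (z - w).
Proof. by rewrite lerBlDr -{1}(subrK w z) cmodD. Qed.
Lemma cmodJ z : cmod (z^*)%C = cmod z.
Proof. by rewrite /cmod ReJ ImJ sqrrN. Qed.
Lemma cmodR x : cmod (x%:C%C) = `|x|.
Proof. by rewrite /cmod /= expr0n addr0 sqrtr_sqr. Qed.
Lemma cmod_sqr z : cmod z ^+ 2 = Re z ^+ 2 + Im z ^+ 2.
Proof. by rewrite sqr_sqrtr// addr_ge0// sqr_ge0. Qed.
Lemma mulcJ z : z * (z^*)%C = (cmod z ^+ 2)%:C%C.
Proof.
by rewrite cmod_sqr; case: z => a b; apply: complex_eq; rewrite /= ; ring.
Qed.
Lemma cmod_sum (I : Type) (r : seq I) (P : pred I) (F : I -> R[i]) :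
  cmod (\sum_(i <- r | P i) F i) <= \sum_(i <- r | P i) cmod (F i).
Proof.
elim/big_rec2: _ => [|i x y _ h]; first by rewrite cmod0.
by rewrite (le_trans (cmodD _ _))// lerD2l.
Qed.
Lemma normRe_le z : `|Re z| <= cmod z.
Proof.
by rewrite -sqrtr_sqr /cmod ler_wsqrtr// lerDl sqr_ge0.
Qed.
Lemma normIm_le z : `|Im z| <= cmod z.
Proof.
by rewrite -sqrtr_sqr /cmod ler_wsqrtr// lerDr sqr_ge0.
Qed.
Lemma Re_le z : Re z <= cmod z.
Proof. exact: le_trans (ler_norm _) (normRe_le z). Qed.
Lemma cmod_le z : cmod z <= `|Re z| + `|Im z|.
Proof.
rewrite -[leRHS]ger0_norm ?addr_ge0// -sqrtr_sqr ler_wsqrtr//.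
rewrite sqrrD !real_normK ?num_real//.
by rewrite lerD2r lerDl mulrn_wge0// mulr_ge0.
Qed.

Lemma cexpD z w : cexp (z + w) = cexp z * cexp w.
Proof.
by case: z w => a b [c d]; apply: complex_eq; rewrite /cexp /= expRD ?cosD ?sinD; ring.
Qed.
Lemma cexp0 : cexp 0 = 1 :> R[i].
Proof. by apply: complex_eq; rewrite /cexp /= expR0 ?cos0 ?sin0; ring. Qed.
Lemma cmod_cexp z : cmod (cexp z) = expR (Re z).
Proof.
rewrite /cmod /= !exprMn -mulrDr cos2Dsin2 mulr1 sqrtr_sqr.
by rewrite ger0_norm// expR_ge0.
Qed.
Lemma cexp_neq0 z : cexp z != 0.
Proof. by rewrite -cmod_gt0 cmod_cexp expR_gt0. Qed.
Lemma cexpN z : cexp (- z) = (cexp z)^-1.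
Proof.
apply: (mulIf (cexp_neq0 z)); rewrite mulVf ?cexp_neq0//.
by rewrite -cexpD addNr cexp0.
Qed.
Lemma cexpX z n : cexp (n%:R * z) = cexp z ^+ n.
Proof.
elim: n => [|n IH]; first by rewrite mul0r cexp0 expr0.
by rewrite -natr1 mulrDl mul1r cexpD IH exprSr.
Qed.
Lemma cexpJ z : ((cexp z)^*)%C = cexp (z^*)%C.
Proof. by case: z => a b; rewrite /cexp /= sinN cosN mulrN. Qed.

(** Polar form: [acos] of Re z / |z| gives the argument up to sign, and the sign of Im z decides. It
    serves to move a constant factor of [u] into the constant term of [g]. *)
Lemma cexp_surj z : z != 0 -> exists w, z = cexp w.
Proof.
rewrite -cmod_gt0 => z0.
have nz : cmod z != 0 by rewrite gt_eqF.
pose a := Re z / cmod z; pose b := Im z / cmod z.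
have ab : a ^+ 2 + b ^+ 2 = 1.
  by rewrite /a /b !exprMn exprVn -mulrDl -cmod_sqr divff// expf_neq0.
have a1 : -1 <= a <= 1.
  by rewrite -ler_norml -(@expr_le1 _ 2)// -normrX ger0_norm ?sqr_ge0// -ab lerDl sqr_ge0.
have sb : b = sin (acos a) \/ b = - sin (acos a).
  suff : (b == sin (acos a)) || (b == - sin (acos a)).
    by case/orP => /eqP; [left|right].
  rewrite -eqf_sqr sin_acos// sqr_sqrtr ?subr_ge0 -?ab ?lerDl ?sqr_ge0//.
  by rewrite addrAC subrr add0r.
have e1 : z = (cmod z * a +i* (cmod z * b))%C.
  by rewrite /a /b ![cmod z * (_ / _)]mulrC !divfK// -complexEta.
case: sb => hb; [exists (ln (cmod z) +i* acos a)%C|exists (ln (cmod z) +i* (- acos a))%C];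
  by rewrite {1}e1 /cexp /= lnK ?posrE// ?cosN ?sinN acosK ?in_itv//= hb.
Qed.

End ComplexModulus.

(** * Componentwise limits and absolutely convergent complex series *)

Section ComplexLimits.
Context {R : realType}.
Implicit Types (s t : nat -> R[i]) (l : R[i]) (a b : nat -> R[i]).
Local Notation Re := complex.Re.
Local Notation Im := complex.Im.

Definition ccvg s l := (fun n => Re (s n)) @ \oo --> Re l /\ (fun n => Im (s n)) @ \oo --> Im l.

Lemma ccvgP s l : ccvg s l <-> (fun n => cmod (s n - l)) @ \oo --> (0 : R).
Proof.
split=> [[h1 h2]|h].
  have h : (fun n => `|Re l - Re (s n)| + `|Im l - Im (s n)|) @ \oo --> (0 : R).
    rewrite -(addr0 0); apply: cvgD; apply/cvgr0Pnorm_lt => e e0.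
      by move/cvgrPdist_lt: h1 => /(_ e e0); apply: filterS => n; rewrite normr_id.
    by move/cvgrPdist_lt: h2 => /(_ e e0); apply: filterS => n; rewrite normr_id.
  apply: (squeeze_cvgr _ (@cvg_cst _ (0:R) _ _ _) h).
  by apply: nearW => n; rewrite cmod_ge0 cmodB (le_trans (cmod_le _))// ReB ImB.
split; apply/cvgrPdist_lt => e e0; move/cvgr0Pnorm_lt: h => /(_ e e0);
  apply: filterS => n; apply: le_lt_trans;
  by rewrite [leRHS]ger0_norm ?cmod_ge0// cmodB -?ReB -?ImB ?normRe_le ?normIm_le.
Qed.

Lemma ccvg_cmod s l : ccvg s l -> (fun n => cmod (s n)) @ \oo --> cmod l.
Proof.
move=> /ccvgP h; apply/cvgrPdist_lt => e e0; move/cvgr0Pnorm_lt: h => /(_ e e0).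
apply: filterS => n; apply: le_lt_trans; rewrite [leRHS]ger0_norm ?cmod_ge0//.
by rewrite ler_norml lerNl opprB cmod_dist /= cmodB cmod_dist.
Qed.

Lemma ccvg_cst l : ccvg (fun=> l) l. Proof. by split; apply: cvg_cst. Qed.
Lemma ccvgD s t l k : ccvg s l -> ccvg t k -> ccvg (fun n => s n + t n) (l + k).
Proof.
move=> [a1 a2] [b1 b2]; split.
  by rewrite ReD; under eq_fun do rewrite ReD; exact: cvgD.
by rewrite ImD; under eq_fun do rewrite ImD; exact: cvgD.
Qed.
Lemma ccvgM s t l k : ccvg s l -> ccvg t k -> ccvg (fun n => s n * t n) (l * k).
Proof.
move=> [a1 a2] [b1 b2]; split.
  by rewrite ReM; under eq_fun do rewrite ReM; apply: cvgB; exact: cvgM.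
by rewrite ImM; under eq_fun do rewrite ImM; apply: cvgD; exact: cvgM.
Qed.
Lemma ccvgR (f : nat -> R) (x : R) : f @ \oo --> x -> ccvg (fun n => (f n)%:C%C) x%:C%C.
Proof. by move=> h; split => //=; apply: cvg_cst. Qed.
Lemma ccvg_unique s l k : ccvg s l -> ccvg s k -> l = k.
Proof.
move=> [a1 a2] [b1 b2]; apply: complex_eq.
  exact: (cvg_unique (@Rhausdorff R) a1 b1).
exact: (cvg_unique (@Rhausdorff R) a2 b2).
Qed.

Definition asum a := exists M : R, forall n, \sum_(k < n) cmod (a k) <= M.

Lemma asumW (u : nat -> R) a : (forall k, cmod (a k) <= u k) ->
  (exists M, forall n, \sum_(k < n) u k <= M) -> asum a.
Proof.
move=> h [M hM]; exists M => n; apply: le_trans (hM n).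
by apply: ler_sum.
Qed.

Lemma bounded_nneg_series_cvg (u : nat -> R) M : (forall k, 0 <= u k) ->
  (forall n, \sum_(k < n) u k <= M) -> cvgn (fun n => \sum_(k < n) u k).
Proof.
move=> u0 uM; apply: nondecreasing_is_cvgn.
  move=> p q pq; rewrite -!(big_mkord xpredT).
  rewrite (big_cat_nat _ pq)//= lerDl; apply: sumr_ge0 => *; exact: u0.
by exists M => _ [n _ <-].
Qed.

Lemma asum_cvg (a : nat -> R[i]) : asum a -> ccvg (fun n => \sum_(k < n) a k) (csum a).
Proof.
move=> [M hM].
have key (u : nat -> R) : (forall k, `|u k| <= cmod (a k)) ->
    cvgn (fun n => \sum_(k < n) u k).
  move=> hu.
  have : cvgn (fun n => \sum_(k < n) `|u k|).
    apply: (@bounded_nneg_series_cvg (fun k => `|u k|) M) => // n.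
    by apply: le_trans (hM n); apply: ler_sum.
  move=> h; have := @normed_cvg R R u.
  have e (v : nat -> R) : (fun n => \sum_(0 <= k < n) v k) = (fun n => \sum_(k < n) v k).
    by apply/funext => n; rewrite big_mkord.
  by rewrite /normed_series_of /series /= !e; apply.
split; rewrite /csum /=.
  under eq_fun do rewrite Re_sum; apply: (key (fun k => Re (a k))) => k; exact: normRe_le.
under eq_fun do rewrite Im_sum; apply: (key (fun k => Im (a k))) => k; exact: normIm_le.
Qed.

Lemma csum_eq a l : ccvg (fun n => \sum_(k < n) a k) l -> csum a = l.
Proof.
move=> [h1 h2]; apply: complex_eq => /=; apply/cvg_lim => //.
  by under eq_fun do rewrite -Re_sum.
by under eq_fun do rewrite -Im_sum.
Qed.

Lemma csumD a b : asum a -> asum b -> csum (fun k => a k + b k) = csum a + csum b.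
Proof.
move=> /asum_cvg ha /asum_cvg hb; apply: csum_eq.
by under eq_fun do rewrite big_split; apply: ccvgD.
Qed.
Lemma csumZ c a : asum a -> csum (fun k => c * a k) = c * csum a.
Proof.
move=> /asum_cvg ha; apply: csum_eq.
by under eq_fun do rewrite -mulr_sumr; apply: ccvgM => //; apply: ccvg_cst.
Qed.
Lemma asumZ c a : asum a -> asum (fun k => c * a k).
Proof.
move=> [M hM]; exists (cmod c * M) => n.
under eq_bigr do rewrite cmodM; rewrite -mulr_sumr ler_wpM2l ?cmod_ge0//.
Qed.
Lemma asumD a b : asum a -> asum b -> asum (fun k => a k + b k).
Proof.
move=> [M hM] [N hN]; exists (M + N) => n.
apply: le_trans (lerD (hM n) (hN n)); rewrite -big_split /=.
by apply: ler_sum => k _; exact: cmodD.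
Qed.

(** Dominated convergence for series. Beyond some [N] both tails are at most e / 4 by domination,
    and the finite part converges termwise; the three errors add up to less than e. *)
Lemma tannery (u : nat -> R) (F : nat -> nat -> R[i]) a :
  (exists M, forall n, \sum_(k < n) u k <= M) ->
  (forall n k, cmod (F n k) <= u k) ->
  (forall k, ccvg (F ^~ k) (a k)) ->
  asum a /\ ccvg (fun n => csum (F n)) (csum a).
Proof.
move=> [M hM] Fu Fa.
have u0 k : 0 <= u k by apply: le_trans (Fu 0%N k); exact: cmod_ge0.
have au k : cmod (a k) <= u k.
  have h := ccvg_cmod (Fa k).
  rewrite -(cvg_lim _ h)//; apply: limr_le; first exact: cvgP h.
  exact: nearW.
have asF n : asum (F n) by apply: asumW (Fu n) _; exists M.
have asa : asum a by apply: asumW au _; exists M.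
split => //; apply/ccvgP/cvgr0Pnorm_lt => e e0.
have cu := bounded_nneg_series_cvg u0 hM.
have [N hN] : exists N, forall n, \sum_(k < n) u k <= \sum_(k < N) u k + e / 4.
  move/cvgrPdist_lt: (cu) => /(_ (e / 4)) []; first by rewrite divr_gt0.
  move=> N _ /(_ N (leqnn N)) /= h; exists N => n.
  have ndu : {homo (fun n => \sum_(k < n) u k) : n m / (n <= m)%N >-> n <= m}.
    move=> p q pq; rewrite -!(big_mkord xpredT).
    rewrite (big_cat_nat _ pq)//= lerDl; apply: sumr_ge0 => *; exact: u0.
  have := nondecreasing_cvgn_le ndu cu n => /= h2.
  apply: (le_trans h2); rewrite -lerBlDl; apply: ltW; apply: le_lt_trans h.
  exact: ler_norm.
have tail b : (forall k, cmod (b k) <= u k) -> asum b ->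
    cmod (csum b - \sum_(k < N) b k) <= e / 4.
  move=> bu ab.
  have h := ccvgD (asum_cvg ab) (ccvg_cst (- \sum_(k < N) b k)).
  move/ccvg_cmod: h => h.
  rewrite -(cvg_lim _ h)//; apply: limr_le; first exact: cvgP h.
  exists N => // n /= Nn.
  rewrite -!(big_mkord xpredT b) (big_cat_nat _ Nn)//= addrAC subrr add0r.
  apply: le_trans (cmod_sum _ _ _) _.
  rewrite -(lerD2l (\sum_(k < N) u k)).
  have hu : \sum_(k < n) u k = \sum_(k < N) u k + \sum_(N <= k < n) u k.
    by rewrite -!(big_mkord xpredT u) -big_cat_nat.
  apply: le_trans (hN n); rewrite hu lerD2l.
  by apply: ler_sum => i _; exact: bu.
have fin : (fun n => cmod (\sum_(k < N) F n k - \sum_(k < N) a k)) @ \oo --> (0 : R).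
  apply/ccvgP; clear -Fa.
  elim: N => [|N IH].
    by rewrite big_ord0; under eq_fun do rewrite big_ord0; exact: ccvg_cst.
  rewrite big_ord_recr; under eq_fun do rewrite big_ord_recr /=.
  exact: ccvgD.
move/cvgr0Pnorm_lt: fin => /(_ (e / 4)) []; first by rewrite divr_gt0.
move=> K _ hK; exists K => // n /hK /=.
rewrite !ger0_norm ?cmod_ge0// => h.
have := tail _ (Fu n) (asF n); have := tail _ au asa.
set A := csum a; set B := csum (F n); set SA := \sum_(k < N) a k in h *.
set SB := \sum_(k < N) F n k in h *.
move=> h1 h2.
have -> : B - A = (B - SB) + ((SB - SA) - (A - SA)) by ring.
apply: le_lt_trans (cmodD _ _) _.
apply: le_lt_trans (lerD (lexx _) (cmodBD _ _)) _.
lra.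
Qed.

Lemma cmod_csum_le a (u : nat -> R) M : (forall k, cmod (a k) <= u k) ->
  (forall n, \sum_(k < n) u k <= M) -> cmod (csum a) <= M.
Proof.
move=> au uM.
have h := ccvg_cmod (asum_cvg (asumW au (ex_intro _ M uM))).
rewrite -(cvg_lim _ h)//; apply: limr_le; first exact: cvgP h.
apply: nearW => n; apply: le_trans (uM n); apply: le_trans (cmod_sum _ _ _) _.
exact: ler_sum.
Qed.

Lemma Re_csum_ge (a : nat -> R[i]) n : asum a -> (forall k, 0 <= Re (a k)) ->
  \sum_(k < n) Re (a k) <= Re (csum a).
Proof.
move=> sa a0; have [h _] := asum_cvg sa.
rewrite -(cvg_lim _ h)//; apply: limr_ge; first exact: cvgP h.
exists n => // p /= np; rewrite Re_sum -!(big_mkord xpredT (fun k => Re (a k))).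
by rewrite (big_cat_nat _ np)//= lerDl sumr_ge0.
Qed.

Lemma Re_csum_le (a : nat -> R[i]) (M : R) : asum a -> (forall n, \sum_(k < n) Re (a k) <= M) ->
  Re (csum a) <= M.
Proof.
move=> sa aM; have [h _] := asum_cvg sa.
rewrite -(cvg_lim _ h)//; apply: limr_le; first exact: cvgP h.
by apply: nearW => n; rewrite Re_sum.
Qed.

End ComplexLimits.

(** * Complex differentiation *)

Opaque csum.

Section ComplexDerivative.
Context {R : realType}.
Implicit Types (f g : R[i] -> R[i]) (z w d : R[i]).
Local Notation Re := complex.Re.
Local Notation Im := complex.Im.

(** The remainder form of complex differentiability, with explicit derivative and no quotient: it
    includes the increment 0, so that it composes without a case distinction. [entireP] links it to
    [entire]. *)
Definition cdiff f z d := forall e : R, 0 < e -> exists2 del : R, 0 < del &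
  forall h, cmod h < del -> cmod (f (z + h) - f z - d * h) <= e * cmod h.

Lemma entireP f : entire f <-> forall z, exists d, cdiff f z d.
Proof.
split=> h z; have [d hd] := h z; exists d => e e0.
  have [del [del0 hdel]] := hd e e0; exists del => // k kd.
  have [->|k0] := eqVneq k 0.
    by rewrite addr0 subrr mulr0 subrr cmod0 mulr0.
  have := hdel k k0 kd.
  have -> : (f (z + k) - f z) / k - d = (f (z + k) - f z - d * k) / k by field.
  by rewrite cmodM cmodV ltr_pdivrMr ?cmod_gt0// => /ltW.
have [del del0 hdel] := hd (e / 2) (divr_gt0 e0 (ltr0Sn _ _)); exists del; split => // k k0 kd.
have -> : (f (z + k) - f z) / k - d = (f (z + k) - f z - d * k) / k by field.
rewrite cmodM cmodV ltr_pdivrMr ?cmod_gt0//.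
apply: le_lt_trans (hdel k kd) _.
by rewrite ltr_pM2r ?cmod_gt0// ltr_pdivrMr// ltr_pMr// ltr1n.
Qed.

Lemma cdiff_cont f z d : cdiff f z d -> forall e : R, 0 < e -> exists2 del : R, 0 < del &
  forall w, cmod (w - z) < del -> cmod (f w - f z) < e.
Proof.
move=> hf e e0; have [del del0 h] := hf 1 ltr01.
have dd : 0 < 2 * (1 + cmod d) by rewrite mulr_gt0// ltr_pwDl// cmod_ge0.
exists (Num.min del (e / (2 * (1 + cmod d)))); first by rewrite lt_min del0 divr_gt0.
move=> w; rewrite lt_min => /andP[h1 h2].
have := h _ h1; rewrite [z + _]addrC subrK mul1r => h3.
have -> : f w - f z = (f w - f z - d * (w - z)) + d * (w - z) by rewrite subrK.
apply: le_lt_trans (cmodD _ _) _; rewrite cmodM.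
apply: le_lt_trans (lerD h3 (lexx _)) _.
rewrite -{1}[cmod (w - z)]mul1r -mulrDl mulrC.
move: h2; rewrite ltr_pdivlMr// => h2; apply: le_lt_trans h2.
by rewrite mulrCA ler_peMl ?ler1n// mulr_ge0 ?cmod_ge0// addr_ge0 ?cmod_ge0.
Qed.

Lemma cdiff_ext f g z d : f =1 g -> cdiff f z d -> cdiff g z d.
Proof. by move=> fg h e e0; have [k k0 hk] := h e e0; exists k => // x; rewrite -!fg; exact: hk. Qed.

Lemma cdiff_cst c z : cdiff (fun=> c) z 0.
Proof.
move=> e e0; exists 1 => // h _.
by rewrite subrr mul0r subrr cmod0 mulr_ge0 ?cmod_ge0// ltW.
Qed.

Lemma cdiff_id z : cdiff (fun w => w) z 1.
Proof.
move=> e e0; exists 1 => // h _.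
have -> : z + h - z - 1 * h = 0 by ring.
by rewrite cmod0 mulr_ge0 ?cmod_ge0// ltW.
Qed.

Lemma cdiffD f g z d1 d2 : cdiff f z d1 -> cdiff g z d2 ->
  cdiff (fun w => f w + g w) z (d1 + d2).
Proof.
move=> hf hg e e0; have e2 : 0 < e / 2 by rewrite divr_gt0.
have [a a0 ha] := hf _ e2; have [b b0 hb] := hg _ e2.
exists (Num.min a b); first by rewrite lt_min a0.
move=> h; rewrite lt_min => /andP[/ha h1 /hb h2].
have -> : f (z + h) + g (z + h) - (f z + g z) - (d1 + d2) * h =
  (f (z + h) - f z - d1 * h) + (g (z + h) - g z - d2 * h) by ring.
apply: le_trans (cmodD _ _) _; apply: le_trans (lerD h1 h2) _.
by rewrite -mulrDl -splitr.
Qed.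

Lemma cdiff_comp f g z d1 d2 : cdiff f (g z) d1 -> cdiff g z d2 ->
  cdiff (fun w => f (g w)) z (d1 * d2).
Proof.
move=> hf hg e e0.
pose K := 1 + cmod d2; have K0 : 0 < K by rewrite ltr_pwDl// cmod_ge0.
pose D := 1 + cmod d1; have D0 : 0 < D by rewrite ltr_pwDl// cmod_ge0.
have e1 : 0 < e / 2 / K by rewrite !divr_gt0.
have [a a0 ha] := hf _ e1.
have e2 : 0 < Num.min 1 (e / 2 / D) by rewrite lt_min ltr01 !divr_gt0.
have [b b0 hb] := hg _ e2.
exists (Num.min b (a / K)); first by rewrite lt_min b0 divr_gt0.
move=> h; rewrite lt_min => /andP[/hb h1 h2].
set k := g (z + h) - g z.
have kE : cmod k <= K * cmod h.
  have -> : k = (k - d2 * h) + d2 * h by rewrite subrK.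
  apply: le_trans (cmodD _ _) _; rewrite cmodM /K mulrDl mul1r lerD2r.
  apply: le_trans h1 _; rewrite ler_piMl ?cmod_ge0//.
  by rewrite ge_min lexx.
have ka : cmod k < a.
  by apply: le_lt_trans kE _; move: h2; rewrite ltr_pdivlMr// mulrC.
have := ha _ ka; rewrite {1}/k [g z + _]addrC subrK => h3.
have -> : f (g (z + h)) - f (g z) - d1 * d2 * h =
  (f (g (z + h)) - f (g z) - d1 * k) + d1 * (k - d2 * h) by ring.
apply: le_trans (cmodD _ _) _; rewrite cmodM [e]splitr mulrDl; apply: lerD.
  apply: le_trans h3 _; apply: le_trans (ler_wpM2l (ltW e1) kE) _.
  by rewrite mulrA divfK ?gt_eqF.
apply: le_trans (ler_wpM2l (cmod_ge0 _) h1) _.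
rewrite mulrA ler_wpM2r ?cmod_ge0//.
apply: (@le_trans _ _ (D * (e / 2 / D))); last by rewrite mulrC divfK// gt_eqF.
apply: ler_pM; rewrite ?cmod_ge0 ?(ltW e2)//; first by rewrite lerDr.
by rewrite ge_min lexx orbT.
Qed.

Lemma cdiff_sqr z : cdiff (fun w => w * w) z (z + z).
Proof.
move=> e e0; exists e => // h he.
have -> : (z + h) * (z + h) - z * z - (z + z) * h = h * h by ring.
by rewrite cmodM ler_wpM2r ?cmod_ge0// ltW.
Qed.

Lemma cdiffZ c f z d : cdiff f z d -> cdiff (fun w => c * f w) z (c * d).
Proof.
move=> hf; apply: (@cdiff_comp (fun w => c * w) f) => // e e0.
exists 1 => // h _; have -> : c * (f z + h) - c * f z - c * h = 0 by ring.
by rewrite cmod0 mulr_ge0 ?cmod_ge0// ltW.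
Qed.

(** Polarisation: f g = ((f + g)^2 - f^2 - g^2) / 2, so the chain rule and the derivative of the
    square suffice. *)
Lemma cdiffM f g z d1 d2 : cdiff f z d1 -> cdiff g z d2 ->
  cdiff (fun w => f w * g w) z (d1 * g z + f z * d2).
Proof.
move=> hf hg.
have hq := @cdiff_comp (fun w => w * w) (fun w => f w + g w) z _ _ (cdiff_sqr _) (cdiffD hf hg).
have h1 := @cdiff_comp (fun w => w * w) f z _ _ (cdiff_sqr _) hf.
have h2 := @cdiff_comp (fun w => w * w) g z _ _ (cdiff_sqr _) hg.
have h3 := cdiffZ (2^-1) (cdiffD hq (cdiffZ (-1) (cdiffD h1 h2))).
have two : (2 : R[i]) != 0 by rewrite pnatr_eq0.
have -> : d1 * g z + f z * d2 = 2^-1 * ((f z + g z + (f z + g z)) * (d1 + d2) +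
   -1 * ((f z + f z) * d1 + (g z + g z) * d2)) by field.
by apply: cdiff_ext h3 => w /=; field.
Qed.

Lemma cdiff_inv z : z != 0 -> cdiff (fun w => w^-1) z (- z^-2).
Proof.
move=> z0 e e0; have cz : 0 < cmod z by rewrite cmod_gt0.
pose del := Num.min (cmod z / 2) (e * cmod z ^+ 3 / 2).
exists del; first by rewrite lt_min !divr_gt0// mulr_gt0// exprn_gt0.
move=> h; rewrite lt_min => /andP[h1 h2].
have hz : cmod z / 2 <= cmod (z + h).
  by have := cmod_dist z (- h); rewrite opprK cmodN; lra.
have zh : z + h != 0 by rewrite -cmod_gt0 (lt_le_trans _ hz)// divr_gt0.
have -> : (z + h)^-1 - z^-1 - - z^-2 * h = h * h * (z ^- 2 * (z + h)^-1).
  by field; rewrite z0 zh.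
have -> : cmod (h * h * (z ^- 2 / (z + h))) =
    cmod h * (cmod h * ((cmod z ^+ 2)^-1 / cmod (z + h))).
  by rewrite !cmodM !cmodV cmodX -!mulrA.
rewrite [e * _]mulrC ler_wpM2l ?cmod_ge0//= -invfM ler_pdivrMr ?mulr_gt0 ?exprn_gt0 ?cmod_gt0//.
apply: le_trans (ltW h2) _; rewrite -mulrA ler_wpM2l ?(ltW e0)//.
by rewrite exprSr -mulrA ler_wpM2l// exprn_ge0// ltW.
Qed.

Lemma is_derive_eps (f : R -> R) (t l : R) :
  (forall e : R, 0 < e -> exists2 del : R, 0 < del & forall h, `|h| < del ->
     `|f (t + h) - f t - l * h| <= e * `|h|) -> is_derive t 1 f l.
Proof.
move=> H.
have key : h^-1 *: ((f \o shift t) (h *: 1) - f t) @[h --> (0 : R)^'] --> l.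
  apply/cvgrPdist_le => e e0; have [del del0 hd] := H e e0.
  exists del => //= h /=; rewrite sub0r normrN => hdel h0.
  have := hd h hdel.
  rewrite /shift /= [h *: 1]mulr1 [h + t]addrC => hh.
  have -> : l - h^-1 *: (f (t + h) - f t) = - ((f (t + h) - f t - l * h) / h).
    by rewrite /GRing.scale /=; field.
  by rewrite normrN normrM normfV ler_pdivrMr ?normr_gt0.
split; first by apply/cvg_ex; exists l.
by rewrite /derive; apply: cvg_lim.
Qed.

Lemma is_derive_epsP (f : R -> R) (t l : R) : is_derive t 1 f l ->
  forall e : R, 0 < e -> exists2 del : R, 0 < del & forall h, `|h| < del ->
     `|f (t + h) - f t - l * h| <= e * `|h|.
Proof.
move=> [df dl] e e0.
have key : h^-1 *: ((f \o shift t) (h *: 1) - f t) @[h --> (0 : R)^'] --> l by rewrite -dl.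
move/cvgrPdist_le : key => /(_ e e0) [del /= del0 hd].
exists del => // h hdel.
have [->|h0] := eqVneq h 0; first by rewrite addr0 subrr mulr0 subrr normr0 mulr0.
have := hd h; rewrite /= sub0r normrN => /(_ hdel h0).
rewrite /shift /= [h *: 1]mulr1 [h + t]addrC.
have -> : l - h^-1 *: (f (t + h) - f t) = - ((f (t + h) - f t - l * h) / h).
  by rewrite /GRing.scale /=; field.
by rewrite normrN normrM normfV ler_pdivrMr ?normr_gt0.
Qed.

Lemma cdiff_is_derive f (z w : R[i]) (t : R) d : cdiff f (z + t%:C%C * w) d ->
  is_derive t 1 (fun s : R => Re (f (z + s%:C%C * w))) (Re (d * w)) /\
  is_derive t 1 (fun s : R => Im (f (z + s%:C%C * w))) (Im (d * w)).
Proof.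
move=> hd.
have key e : 0 < e -> exists2 del : R, 0 < del & forall h : R, `|h| < del ->
    cmod (f (z + (t + h)%:C%C * w) - f (z + t%:C%C * w) - d * w * h%:C%C) <= e * `|h|.
  move=> e0; pose W := 1 + cmod w; have W0 : 0 < W by rewrite ltr_pwDl// cmod_ge0.
  have e1 : 0 < e / W by rewrite divr_gt0.
  have [del del0 h1] := hd _ e1.
  exists (del / W); first by rewrite divr_gt0.
  move=> h hl; have hw : cmod (h%:C%C * w) <= `|h| * W.
    by rewrite cmodM cmodR ler_wpM2l// lerDr.
  have /h1 : cmod (h%:C%C * w) < del.
    by apply: le_lt_trans hw _; rewrite -ltr_pdivlMr.
  rewrite rmorphD mulrDl addrA -mulrA [w * _]mulrC => /le_trans; apply.
  by apply: le_trans (ler_wpM2l (ltW e1) hw) _; rewrite mulrCA divfK ?gt_eqF// mulrC.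
have reE h : Re (d * w * h%:C%C) = Re (d * w) * h by rewrite mulrC ReZl mulrC.
have imE h : Im (d * w * h%:C%C) = Im (d * w) * h by rewrite mulrC ImZl mulrC.
split; apply: is_derive_eps => e /key [del del0 h1]; exists del => // h /h1; apply: le_trans.
  by apply: le_trans (normRe_le _); rewrite !ReB reE.
by apply: le_trans (normIm_le _); rewrite !ImB imE.
Qed.

(** Restricted to the line through 0 and z, real and imaginary parts are real functions with zero
    derivative. *)
Lemma cdiff0_cst f : (forall z, cdiff f z 0) -> forall z, f z = f 0.
Proof.
move=> h z.
have D (t : R) := cdiff_is_derive (h (0 + t%:C%C * z)).
have hr : forall t : R, is_derive t 1 (fun s : R => Re (f (0 + s%:C%C * z))) 0.
  by move=> t; have [] := D t; rewrite mul0r.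
have hi : forall t : R, is_derive t 1 (fun s : R => Im (f (0 + s%:C%C * z))) 0.
  by move=> t; have [_] := D t; rewrite mul0r.
have := is_derive_0_is_cst 1 0 hr; have := is_derive_0_is_cst 1 0 hi.
rewrite !add0r mul1r mul0r => h1 h2; exact: complex_eq.
Qed.

(** The addition formula reduces everything to the point 0, where the real derivatives of exp, sin
    and cos are combined. *)
Lemma cdiff_cexp z : cdiff (@cexp R) z (cexp z).
Proof.
suff h0 : cdiff (@cexp R) 0 1.
  have h1 : cdiff (fun w => w + - z) z 1.
    by have := cdiffD (cdiff_id z) (cdiff_cst (- z) z); rewrite addr0.
  have h2 : cdiff (fun w => cexp (w + - z)) z (1 * 1) by apply: cdiff_comp => //; rewrite subrr.
  have := cdiffZ (cexp z) h2; rewrite !mulr1; apply: cdiff_ext => w /=.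
  by rewrite -cexpD addrC subrK.
move=> e e0.
(* The remainder splits into four pieces worth 1, 2, 2 and 1 times e / 8 * |h|; the cap at 1 keeps
   |h| below 1/2 and hence [expR (Re h)] below 2. *)
pose e' := Num.min 1 (e / 8).
have e'0 : 0 < e' by rewrite lt_min ltr01 divr_gt0.
have [a a0 ha] := is_derive_epsP (@is_derive_expR R 0) e'0.
have [b b0 hb] := is_derive_epsP (@is_derive_sin R 0) e'0.
have [c c0 hc] := is_derive_epsP (@is_derive_cos R 0) e'0.
exists (Num.min (Num.min a (Num.min b c)) (e' / 2)).
  by rewrite !lt_min a0 b0 c0 divr_gt0.
move=> h; rewrite !lt_min => /andP[/andP[h1 /andP[h2 h3]] h4].
have le1 := normRe_le h; have le2 := normIm_le h.
have := ha _ (le_lt_trans le1 h1).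
have := hb _ (le_lt_trans le2 h2).
have := hc _ (le_lt_trans le2 h3).
rewrite !add0r cexp0 expR0 sin0 cos0 mulNr mul0r !oppr0 !addr0 !mul1r.
move: (Re h) (Im h) le1 le2 (complexEta h) => x y le1 le2 hE C S E.
have e'1 : e' <= 1 by rewrite ge_min lexx.
have e'e : e' <= e / 8 by rewrite ge_min lexx orbT.
have cy := cmod_ge0 h.
have Ex : `|expR x - 1| <= 2 * cmod h.
  have -> : expR x - 1 = (expR x - 1 - x) + x by rewrite subrK.
  apply: le_trans (ler_normD _ _) _; rewrite mulr2n mulrDl !mul1r; apply: lerD => //.
  by apply: le_trans E _; apply: le_trans le1; rewrite ler_piMl.
have Sy : `|sin y| <= 2 * cmod h.
  have -> : sin y = (sin y - y) + y by rewrite subrK.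
  apply: le_trans (ler_normD _ _) _; rewrite mulr2n mulrDl !mul1r; apply: lerD => //.
  by apply: le_trans S _; apply: le_trans le2; rewrite ler_piMl.
have E2 : `|expR x| <= 2.
  have -> : expR x = (expR x - 1) + 1 by rewrite subrK.
  apply: le_trans (ler_normD _ _) _; rewrite normr1.
  have : 2 * cmod h <= 1 by lra.
  by move=> q; rewrite [leRHS](_ : 2 = 1 + 1)// lerD2r (le_trans Ex q).
have -> : cexp h - 1 - h = (((expR x - 1 - x) + expR x * (cos y - 1)) +i*
    ((expR x - 1) * sin y + (sin y - y)))%C.
  by rewrite hE; apply: complex_eq => /=; ring.
apply: le_trans (cmod_le _) _ => /=.
have t1 : `|expR x - 1 - x| <= e / 8 * cmod h.
  by apply: le_trans E _; apply: ler_pM => //; exact: ltW.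
have t2 : `|expR x * (cos y - 1)| <= 2 * (e / 8 * cmod h).
  rewrite normrM; apply: ler_pM => //.
  by apply: le_trans C _; apply: ler_pM => //; exact: ltW.
have t3 : `|(expR x - 1) * sin y| <= e / 8 * cmod h * 2.
  rewrite normrM; apply: (@le_trans _ _ (e / 8 * (2 * cmod h))); last by lra.
  apply: ler_pM => //; apply: le_trans Ex _; lra.
have t4 : `|sin y - y| <= e / 8 * cmod h.
  by apply: le_trans S _; apply: ler_pM => //; exact: ltW.
apply: (@le_trans _ _ (e / 8 * cmod h + 2 * (e / 8 * cmod h) + (e / 8 * cmod h * 2 + e / 8 * cmod h))).
  by apply: lerD; (apply: le_trans (ler_normD _ _) _; apply: lerD).
nra.
Qed.

Lemma entireD f g : entire f -> entire g -> entire (fun z => f z + g z).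
Proof.
move=> /entireP hf /entireP hg; apply/entireP => z.
by have [a ha] := hf z; have [b hb] := hg z; exists (a + b); exact: cdiffD.
Qed.
Lemma entireM f g : entire f -> entire g -> entire (fun z => f z * g z).
Proof.
move=> /entireP hf /entireP hg; apply/entireP => z.
by have [a ha] := hf z; have [b hb] := hg z; eexists; exact: cdiffM ha hb.
Qed.
Lemma entire_comp f g : entire f -> entire g -> entire (fun z => f (g z)).
Proof.
move=> /entireP hf /entireP hg; apply/entireP => z.
by have [a ha] := hf (g z); have [b hb] := hg z; eexists; exact: cdiff_comp ha hb.
Qed.
Lemma entireV f : entire f -> (forall z, f z != 0) -> entire (fun z => (f z)^-1).
Proof.
move=> /entireP hf f0; apply/entireP => z.
have [a ha] := hf z; eexists; exact: (cdiff_comp (cdiff_inv (f0 z)) ha).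
Qed.
Lemma entire_cst c : entire (fun=> c : R[i]).
Proof. by apply/entireP => z; exists 0; exact: cdiff_cst. Qed.
Lemma entire_id : entire (fun z : R[i] => z).
Proof. by apply/entireP => z; exists 1; exact: cdiff_id. Qed.
Lemma entire_cexp : entire (@cexp R).
Proof. by apply/entireP => z; exists (cexp z); exact: cdiff_cexp. Qed.
Lemma entire_ext f g : f =1 g -> entire f -> entire g.
Proof.
move=> fg /entireP h; apply/entireP => z; have [d hd] := h z.
by exists d; exact: cdiff_ext hd.
Qed.
Lemma entire_horner (p : {poly R[i]}) : entire (fun z => p.[z]).
Proof.
elim/poly_ind: p => [|p c IH].
  by apply: entire_ext (entire_cst 0) => z; rewrite horner0.
apply: entire_ext (entireD (entireM IH entire_id) (entire_cst c)) => z /=.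
by rewrite hornerMXaddC.
Qed.

End ComplexDerivative.

(** * Power series *)

Section PowerSeries.
Context {R : realType}.
Implicit Types (a b : nat -> R[i]) (z w : R[i]).
Local Notation Re := complex.Re.
Local Notation Im := complex.Im.

Lemma geo2_bound n : \sum_(k < n) (2^-1 : R) ^+ k <= 2.
Proof.
have -> : \sum_(k < n) (2^-1 : R) ^+ k = 2 - 2 * 2^-1 ^+ n.
  elim: n => [|n IH]; first by rewrite big_ord0 expr0; ring.
  by rewrite big_ord_recr /= IH exprS; field.
by rewrite gerBl mulr_ge0// exprn_ge0.
Qed.

(* Equivalent to an infinite radius of convergence, and easier to check than summability. *)
Definition pscoef a := forall r : R, 0 <= r -> exists M : R, forall k, cmod (a k) * r ^+ k <= M.
Definition PS a z := csum (fun k => a k * z ^+ k).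

(** Terms bounded at radius 2 r are dominated at radius r by a geometric series of ratio 1/2. *)
Lemma pscoef_sum a (r : R) : pscoef a -> 0 <= r ->
  exists M : R, forall n, \sum_(k < n) cmod (a k) * r ^+ k <= M.
Proof.
move=> ha r0; have [M hM] := ha (2 * r) (mulr_ge0 (ler0n _ 2) r0).
exists (M * 2) => n.
have M0 : 0 <= M by apply: le_trans (hM 0%N); rewrite mulr_ge0 ?cmod_ge0.
apply: le_trans (ler_wpM2l M0 (geo2_bound n)); rewrite mulr_sumr.
apply: ler_sum => k _; apply: le_trans (ler_wpM2r _ (hM k)); last by rewrite exprn_ge0.
suff -> : cmod (a k) * (2 * r) ^+ k * 2^-1 ^+ k = cmod (a k) * r ^+ k by [].
by rewrite -mulrA -exprMn; congr (_ * _ ^+ _); field.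
Qed.

Lemma asum_ps a z : pscoef a -> asum (fun k => a k * z ^+ k).
Proof.
move=> ha; have [M hM] := pscoef_sum ha (cmod_ge0 z); exists M => n.
by under eq_bigr do rewrite cmodM cmodX.
Qed.

Lemma PS_bound a (r : R) : pscoef a -> exists M : R, forall z, cmod z <= r -> cmod (PS a z) <= M.
Proof.
move=> ha; have [r0|r0] := leP 0 r; last first.
  exists 0 => z zr; have := le_lt_trans zr r0; by rewrite ltNge cmod_ge0.
have [M hM] := pscoef_sum ha r0; exists M => z zr.
apply: (@cmod_csum_le _ _ (fun k => cmod (a k) * r ^+ k) M _ hM) => k; rewrite cmodM cmodX ler_wpM2l ?cmod_ge0//.
by rewrite lerXn2r// nnegrE ?cmod_ge0.
Qed.

Lemma pscoefD a b : pscoef a -> pscoef b -> pscoef (fun k => a k + b k).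
Proof.
move=> ha hb r r0; have [M hM] := ha r r0; have [N hN] := hb r r0; exists (M + N) => k.
apply: le_trans (lerD (hM k) (hN k)); rewrite -mulrDl ler_wpM2r ?exprn_ge0//.
exact: cmodD.
Qed.
Lemma pscoefZ c a : pscoef a -> pscoef (fun k => c * a k).
Proof.
move=> ha r r0; have [M hM] := ha r r0; exists (cmod c * M) => k.
by rewrite cmodM -mulrA ler_wpM2l ?cmod_ge0.
Qed.
Lemma PSD a b z : pscoef a -> pscoef b -> PS (fun k => a k + b k) z = PS a z + PS b z.
Proof.
move=> ha hb; rewrite /PS -csumD; [|exact: asum_ps..].
by congr csum; apply/funext => k; rewrite mulrDl.
Qed.
Lemma PSZ c a z : pscoef a -> PS (fun k => c * a k) z = c * PS a z.
Proof.
move=> ha; rewrite /PS -csumZ; last exact: asum_ps.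
by congr csum; apply/funext => k; rewrite mulrA.
Qed.

(** The factor k is at most 2^k and is absorbed by doubling the radius. *)
Lemma pscoef_nat a : pscoef a -> pscoef (fun k => k%:R * a k).
Proof.
move=> ha r r0; have [M hM] := ha (2 * r) (mulr_ge0 (ler0n _ 2) r0).
exists M => k; apply: le_trans (hM k).
rewrite cmodM [cmod _%:R * _]mulrC -mulrA ler_wpM2l ?cmod_ge0// exprMn ler_wpM2r ?exprn_ge0//.
have -> : cmod (k%:R : R[i]) = k%:R.
  have -> : (k%:R : R[i]) = (k%:R : R)%:C%C by rewrite rmorph_nat.
  by rewrite cmodR ger0_norm.
by rewrite -natrX ler_nat ltnW// ltn_expl.
Qed.

Lemma pscoef_shift a : pscoef a -> pscoef (fun k => a k.+1).
Proof.
move=> ha r r0; have [M hM] := ha (r + 1) (addr_ge0 r0 ler01).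
exists M => k; apply: le_trans (hM k.+1); rewrite ler_wpM2l ?cmod_ge0//.
apply: (@le_trans _ _ ((r + 1) ^+ k)).
  by rewrite lerXn2r ?nnegrE ?addr_ge0// lerDl.
by rewrite exprS ler_peMl ?exprn_ge0 ?addr_ge0// lerDr.
Qed.

Definition dcoef a := fun k => k.+1%:R * a k.+1.

Lemma pscoef_d a : pscoef a -> pscoef (dcoef a).
Proof. by move=> /pscoef_nat /pscoef_shift. Qed.

Lemma csum_shift a : asum a -> csum a = a 0%N + csum (fun k => a k.+1).
Proof.
move=> sa; have sa' : asum (fun k => a k.+1).
  case: sa => M hM; exists M => n; apply: le_trans (hM n.+1).
  by rewrite big_ord_recl lerDr cmod_ge0.
apply: csum_eq.
have := ccvgD (ccvg_cst (a 0%N)) (asum_cvg sa').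
move=> /ccvgP h; apply/ccvgP; rewrite -cvg_shiftS.
by under eq_fun do rewrite big_ord_recl.
Qed.

(** Second-order remainder of a power, by induction on the exponent together with the Lipschitz
    bound [lip]. The radius |z| + 1 dominates both z and z + h. *)
Lemma expX_expand z h n : (1 <= cmod z + 1)%R -> cmod h <= 1 ->
  cmod ((z + h) ^+ n - z ^+ n - n%:R * z ^+ n.-1 * h) <= n%:R ^+ 2 * (cmod z + 1) ^+ n * cmod h ^+ 2.
Proof.
set r := cmod z + 1 => r1 h1.
have r0 : 0 <= r by apply: le_trans r1.
have zr : cmod z <= r by rewrite lerDl.
have zhr : cmod (z + h) <= r by apply: le_trans (cmodD _ _) _; rewrite lerD2l.
have lip k : cmod ((z + h) ^+ k - z ^+ k) <= k%:R * r ^+ k * cmod h.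
  elim: k => [|k IH]; first by rewrite !expr0 subrr cmod0 !mul0r.
  have -> : (z + h) ^+ k.+1 - z ^+ k.+1 = (z + h) * ((z + h) ^+ k - z ^+ k) + h * z ^+ k.
    by rewrite !exprS; ring.
  apply: le_trans (cmodD _ _) _; rewrite !cmodM cmodX.
  apply: (@le_trans _ _ (r * (k%:R * r ^+ k * cmod h) + cmod h * r ^+ k.+1)).
    apply: lerD; first by apply: ler_pM; rewrite ?cmod_ge0.
    rewrite ler_wpM2l ?cmod_ge0// exprS -[leLHS]mul1r.
    by apply: ler_pM => //; rewrite ?exprn_ge0 ?cmod_ge0// lerXn2r ?nnegrE ?cmod_ge0.
  by rewrite -natr1 exprS le_eqVlt; apply/orP; left; apply/eqP; ring.
elim: n => [|n IH].
  by rewrite !expr0 subrr !mul0r subr0 cmod0 expr0n !mul0r.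
have -> : (z + h) ^+ n.+1 - z ^+ n.+1 - n.+1%:R * z ^+ n.+1.-1 * h =
    z * ((z + h) ^+ n - z ^+ n - n%:R * z ^+ n.-1 * h) + h * ((z + h) ^+ n - z ^+ n).
  rewrite !exprS -natr1 /=; case: n {IH} => [|n] /=; rewrite ?expr0 ?exprS; ring.
apply: le_trans (cmodD _ _) _; rewrite !cmodM.
apply: (@le_trans _ _ (r * (n%:R ^+ 2 * r ^+ n * cmod h ^+ 2) + cmod h * (n%:R * r ^+ n * cmod h))).
  apply: lerD; first by apply: ler_pM; rewrite ?cmod_ge0.
  by rewrite ler_wpM2l ?cmod_ge0.
have A0 : 0 <= r ^+ n * cmod h ^+ 2 by rewrite mulr_ge0 ?exprn_ge0 ?cmod_ge0.
have -> : r * (n%:R ^+ 2 * r ^+ n * cmod h ^+ 2) + cmod h * (n%:R * r ^+ n * cmod h) =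
  (n%:R ^+ 2 * r + n%:R) * (r ^+ n * cmod h ^+ 2) by ring.
have -> : n.+1%:R ^+ 2 * r ^+ n.+1 * cmod h ^+ 2 = (n.+1%:R ^+ 2 * r) * (r ^+ n * cmod h ^+ 2).
  by rewrite [r ^+ n.+1]exprS; ring.
rewrite ler_wpM2r// -natr1 sqrrD mulr1 expr1n.
have n0 : 0 <= (n%:R : R) by [].
have q1 : n%:R <= n%:R * r by rewrite ler_peMr.
have q2 : 0 <= n%:R * r by rewrite mulr_ge0.
by rewrite mulr2n; nra.
Qed.

(** Termwise differentiation: by [expX_expand] the remainders are quadratic in h with coefficients
    carrying a factor k^2, and two uses of [pscoef_nat] make these summable. *)
Lemma PS_cdiff a z : pscoef a -> cdiff (PS a) z (PS (dcoef a) z).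
Proof.
move=> ha e e0.
have [M hM] : exists M : R, forall n, \sum_(k < n) cmod (a k) * (k%:R ^+ 2 * (cmod z + 1) ^+ k) <= M.
  have h2 := pscoef_nat (pscoef_nat ha).
  have r0 : 0 <= cmod z + 1 by rewrite addr_ge0 ?cmod_ge0.
  have [M hM] := pscoef_sum h2 r0; exists M => n; apply: le_trans (hM n).
  apply: ler_sum => k _; rewrite !cmodM.
  have -> : cmod (k%:R : R[i]) = k%:R.
    have -> : (nat_of_ord k)%:R = ((nat_of_ord k)%:R : R)%:C%C :> R[i] by rewrite rmorph_nat.
    by rewrite cmodR ger0_norm.
  by rewrite le_eqVlt; apply/orP; left; apply/eqP; ring.
have M0 : 0 <= M by have := hM 0%N; rewrite big_ord0.
exists (Num.min 1 (e / (M + 1))); first by rewrite lt_min ltr01 divr_gt0// ltr_wpDl.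
move=> h; rewrite lt_min => /andP[/ltW h1 h2].
have sd : asum (fun k => k%:R * a k * z ^+ k.-1).
  have := asum_ps z (pscoef_d ha) => -[K hK].
  exists K => -[|n]; first by rewrite big_ord0; have := hK 0%N; rewrite big_ord0.
  by rewrite big_ord_recl /= mul0r mul0r cmod0 add0r; apply: hK.
(* Re-indexed with a zero term at k = 0, so that the three series can be combined term by term. *)
have -> : PS (dcoef a) z = csum (fun k => k%:R * a k * z ^+ k.-1).
  by rewrite [RHS]csum_shift//= !mul0r add0r.
have -> : PS a (z + h) - PS a z - csum (fun k => k%:R * a k * z ^+ k.-1) * h =
   csum (fun k => a k * ((z + h) ^+ k - z ^+ k - k%:R * z ^+ k.-1 * h)).
  rewrite /PS mulrC -csumZ// -[X in _ - X - _]mul1r -mulNr -csumZ; last exact: asum_ps.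
  rewrite -csumD; [|exact: asum_ps|apply: asumZ; exact: asum_ps].
  rewrite -[- csum _]mulN1r -csumZ; last exact: asumZ.
  rewrite -csumD; first by congr csum; apply/funext => k; ring.
    by apply: asumD; [exact: asum_ps|apply: asumZ; exact: asum_ps].
  by do 2!apply: asumZ.
apply: (@le_trans _ _ (M * cmod h ^+ 2)).
  apply: (@cmod_csum_le _ _ (fun k => cmod (a k) * (k%:R ^+ 2 * (cmod z + 1) ^+ k) * cmod h ^+ 2)) => [k|n].
    rewrite cmodM -[leRHS]mulrA ler_wpM2l ?cmod_ge0// expX_expand//.
    by rewrite lerDr cmod_ge0.
  by rewrite -mulr_suml ler_wpM2r// exprn_ge0 ?cmod_ge0.
rewrite expr2 mulrA ler_wpM2r ?cmod_ge0//.
move: h2; rewrite ltr_pdivlMr ?ltr_wpDl// => /ltW; apply: le_trans.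
by rewrite mulrC ler_wpM2l ?cmod_ge0// lerDl.
Qed.

Lemma entire_PS a : pscoef a -> entire (PS a).
Proof. by move=> ha; apply/entireP => z; eexists; exact: PS_cdiff. Qed.

Lemma PS0 a : PS a 0 = a 0%N.
Proof.
apply: csum_eq; apply/ccvgP; rewrite -cvg_shiftS.
have e n : cmod (\sum_(k < n.+1) a k * 0 ^+ k - a 0%N) = 0.
  rewrite big_ord_recl expr0 mulr1 big1 ?addr0 ?subrr ?cmod0// => i _.
  by rewrite exprS mul0r mulr0.
by under eq_fun do rewrite e; exact: cvg_cst.
Qed.

Definition expcoef : nat -> R[i] := fun k => (k`!%:R^-1 : R)%:C%C.

Lemma pscoef_exp : pscoef expcoef.
Proof.
move=> r r0; exists (expR r) => k.
rewrite cmodR ger0_norm ?invr_ge0//.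
have h := @is_cvg_series_exp_coeff R r.
have nd : {homo series (exp_coeff r) : n m / (n <= m)%N >-> n <= m}.
  apply/nondecreasing_seqP => n; rewrite seriesSr lerDl /exp_coeff /=.
  by rewrite divr_ge0 ?exprn_ge0.
have := nondecreasing_cvgn_le nd h k.+1.
rewrite seriesSr; apply: le_trans; rewrite {2}/exp_coeff /= mulrC lerDr.
by rewrite seriesEord sumr_ge0// => i _; rewrite divr_ge0// exprn_ge0.
Qed.

(** Both sides solve y' = y with value 1 at 0: the product of the series with exp(-x) has zero
    derivative. *)
Lemma PS_exp z : PS expcoef z = cexp z.
Proof.
have dE : dcoef expcoef = expcoef.
  apply/funext => k; rewrite /dcoef /expcoef factS natrM.
  have -> : (k.+1%:R : R[i]) = (k.+1%:R : R)%:C%C by rewrite rmorph_nat.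
  by rewrite -rmorphM /=; congr (_%:C)%C; rewrite invfM mulrA divff ?mul1r// pnatr_eq0.
have hE w : cdiff (fun x => PS expcoef x * cexp (- x)) w 0.
  have h1 := PS_cdiff w pscoef_exp; rewrite dE in h1.
  have h2 := @cdiff_comp _ (@cexp R) (fun x => -1 * x) w _ _ (cdiff_cexp _) (cdiffZ (-1) (cdiff_id w)).
  have h3 := cdiffM h1 h2.
  rewrite mulr1 mulrN1 mulrN subrr in h3.
  by apply: cdiff_ext h3 => x; rewrite mulN1r.
have := cdiff0_cst hE z; rewrite oppr0 cexp0 mulr1 PS0 /expcoef fact0 invr1 => h.
by apply: (mulIf (cexp_neq0 (- z))); rewrite h -cexpD subrr cexp0.
Qed.

Lemma PS_poly a N : (forall k, (N <= k)%N -> a k = 0) ->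
  forall z, PS a z = (\poly_(k < N) a k).[z].
Proof.
move=> ha z; apply: csum_eq; apply/ccvgP.
have h : \forall n \near \oo, cmod (\sum_(k < n) a k * z ^+ k - (\poly_(k < N) a k).[z]) = 0.
  exists N => // n /= Nn.
  rewrite horner_poly -!(big_mkord xpredT (fun k => a k * z ^+ k)) (big_cat_nat _ Nn)//=.
  rewrite addrAC subrr add0r big_nat big1 ?cmod0// => i /andP[/ha -> _].
  by rewrite mul0r.
apply: cvg_trans (@cvg_cst _ (0 : R) nat \oo _).
by apply: near_eq_cvg; apply: filterS h => n ->.
Qed.

(* The lowest nonzero coefficient keeps a power series away from zero on a punctured disc. *)
Lemma PS_isolated a : pscoef a -> (exists z, PS a z != 0) ->
  exists2 del : R, 0 < del & forall z, z != 0 -> cmod z < del -> PS a z != 0.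
Proof.
move=> ha [z0 hz0].
have [n [an hn]] : exists n, a n != 0 /\ forall k, (k < n)%N -> a k = 0.
  have ex : exists n, a n != 0.
    apply: contrapT => hno; move: hz0; rewrite (@PS_poly a 0) ?horner_poly ?big_ord0 ?eqxx//.
    move=> k _; apply/eqP; apply: contrapT => hk; apply: hno; exists k; exact/negP.
  have [n hn hmin] := ex_minnP ex; exists n; split => // k kn.
  by apply/eqP; apply: contraTT kn => /hmin; rewrite -leqNgt.
pose b k := a (n + k)%N.
have hb : pscoef b.
  elim: n @b {an hn} => [|n IH]; first by [].
  have := pscoef_shift IH.
  by congr pscoef; apply/funext => k; rewrite /= addnS addSn.
have hf z : PS a z = z ^+ n * PS b z.
  have : forall j, (j <= n)%N -> PS a z = z ^+ j * csum (fun k => a (j + k)%N * z ^+ k).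
    elim=> [|j IH] jn; first by rewrite expr0 mul1r.
    rewrite (IH (ltnW jn)) csum_shift; last first.
      have hs : pscoef (fun k => a (j + k)%N).
        elim: j {IH jn} => [|j IH]; first by [].
        have := pscoef_shift IH.
        by congr pscoef; apply/funext => k; rewrite /= addnS addSn.
      exact: asum_ps.
    rewrite addn0 hn// mul0r add0r exprSr -mulrA; congr (_ * _).
    rewrite -csumZ.
      by congr csum; apply/funext => k; rewrite addnS addSn exprS; ring.
    have hs : pscoef (fun k => a (j.+1 + k)%N).
      elim: (j.+1) => [|i IH2]; first by [].
      have := pscoef_shift IH2.
      by congr pscoef; apply/funext => k; rewrite /= addnS addSn.
    exact: asum_ps.
  by move=> /(_ n (leqnn n)).
have [|del del0 hdel] := @cdiff_cont _ _ _ _ (PS_cdiff 0 hb) (cmod (a n)); first by rewrite cmod_gt0.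
have b0 : PS b 0 = a n by rewrite PS0 /b addn0.
clear hz0; exists del; first exact: del0.
move=> z z0' zd; rewrite hf; apply: mulf_neq0; first exact: expf_neq0.
have := hdel z; rewrite subr0 b0 => /(_ zd) h.
by apply/eqP => h0; move: h; rewrite h0 sub0r cmodN ltxx.
Qed.

End PowerSeries.

(** * Goursat's lemma *)

Section SegmentIntegrals.
Context {R : realType}.
Local Notation Re := complex.Re.
Local Notation Im := complex.Im.
Local Notation mu := (@lebesgue_measure R).
Implicit Types (h g : R -> R[i]) (a b c : R).

Definition ccont h := continuous (fun t => Re (h t)) /\ continuous (fun t => Im (h t)).
Definition sint a b (u : R -> R) : R := \int[mu]_(t in `[a, b]) u t.
Definition cint a b h : R[i] := (sint a b (fun t => Re (h t)) +i* sint a b (fun t => Im (h t)))%C.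

Lemma cont_integrable (u : R -> R) a b : continuous u -> mu.-integrable `[a, b] (EFin \o u).
Proof.
move=> cu; apply: continuous_compact_integrable; first exact: segment_compact.
exact: continuous_subspaceT.
Qed.

Lemma sintD a b (u v : R -> R) : continuous u -> continuous v ->
  sint a b (fun t => u t + v t) = sint a b u + sint a b v.
Proof. by move=> cu cv; apply: RintegralD => //; apply: cont_integrable. Qed.
Lemma sintZ a b x (u : R -> R) : continuous u -> sint a b (fun t => x * u t) = x * sint a b u.
Proof. by move=> cu; apply: RintegralZl => //; apply: cont_integrable. Qed.
Lemma sint_cst a b x : a <= b -> sint a b (fun=> x) = (b - a) * x.
Proof.
move=> ab; have e := lebesgue_measure_itv (`[a, b]%R : interval R).
transitivity (x * fine (mu `[a, b])); first exact: Rintegral_cst.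
rewrite e /= lte_fin.
move: ab; rewrite le_eqVlt => /orP[/eqP ->|ab]; first by rewrite ltxx /= subrr mulr0 mul0r.
by rewrite ab /= mulrC.
Qed.
Lemma le_sint a b (u v : R -> R) : continuous u -> continuous v ->
  (forall t, a <= t <= b -> u t <= v t) -> sint a b u <= sint a b v.
Proof.
move=> cu cv uv; apply: le_Rintegral => //; exact: cont_integrable.
Qed.
Lemma sint_split a b c (u : R -> R) : continuous u -> a <= c <= b -> sint a b u = sint a c u + sint c b u.
Proof.
move=> cu /andP[ac cb]; apply/eqP; rewrite addrC -subr_eq.
rewrite /sint (@Rintegral_itvB _ u (BLeft a) (BRight b) c).
- rewrite Rintegral_itv_obnd_cbnd//.
  apply: (@integrableS _ _ _ mu `[c, b]) => //; last exact: cont_integrable.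
  exact: subset_itv_oc_cc.
- exact: cont_integrable.
- by rewrite bnd_simp.
- by rewrite bnd_simp.
Qed.

Lemma ccontD h g : ccont h -> ccont g -> ccont (fun t => h t + g t).
Proof.
move=> [h1 h2] [g1 g2]; split => t.
  by under eq_fun do rewrite ReD; apply: cvgD; [exact: h1|exact: g1].
by under eq_fun do rewrite ImD; apply: cvgD; [exact: h2|exact: g2].
Qed.
Lemma ccont_cst z : ccont (fun=> z).
Proof. by split => t; exact: cvg_cst. Qed.
Lemma ccontM h g : ccont h -> ccont g -> ccont (fun t => h t * g t).
Proof.
move=> [h1 h2] [g1 g2]; split => t.
  by under eq_fun do rewrite ReM; apply: cvgB; apply: cvgM; [exact: h1|exact: g1|exact: h2|exact: g2].
by under eq_fun do rewrite ImM; apply: cvgD; apply: cvgM; [exact: h1|exact: g2|exact: h2|exact: g1].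
Qed.
Lemma ccontZ z h : ccont h -> ccont (fun t => z * h t).
Proof. by apply: ccontM; exact: ccont_cst. Qed.
Lemma ccontB h g : ccont h -> ccont g -> ccont (fun t => h t - g t).
Proof.
move=> ch cg; have := ccontD ch (ccontZ (-1) cg).
by under [X in ccont X -> _]eq_fun do rewrite mulN1r.
Qed.

Lemma cintD a b h g : ccont h -> ccont g -> cint a b (fun t => h t + g t) = cint a b h + cint a b g.
Proof.
move=> [h1 h2] [g1 g2]; apply: complex_eq; rewrite /cint /=.
  by rewrite -sintD//; congr sint; apply/funext => t; rewrite ReD.
by rewrite -sintD//; congr sint; apply/funext => t; rewrite ImD.
Qed.
Lemma cintZ a b z h : ccont h -> cint a b (fun t => z * h t) = z * cint a b h.
Proof.
move=> [h1 h2]; have cN x (u : R -> R) : continuous u -> continuous (fun t => x * u t).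
  by move=> cu t; apply: cvgM; [exact: cvg_cst|exact: cu].
apply: complex_eq; rewrite /cint ?ReM ?ImM /=.
  rewrite -mulNr -!sintZ// -sintD; [|exact: cN..].
  by congr sint; apply/funext => t; rewrite ReM mulNr.
rewrite -!sintZ// -sintD; [|exact: cN..].
by congr sint; apply/funext => t; rewrite ImM.
Qed.
Lemma cintB a b h g : ccont h -> ccont g -> cint a b (fun t => h t - g t) = cint a b h - cint a b g.
Proof.
move=> ch cg; rewrite -[- cint _ _ _]mulN1r -cintZ// -cintD//; last exact: ccontZ.
by congr cint; apply/funext => t; rewrite mulN1r.
Qed.
Lemma cint_sum a b (n : nat) (F : nat -> R -> R[i]) : (forall k, ccont (F k)) ->
  ccont (fun t => \sum_(k < n) F k t) /\
  cint a b (fun t => \sum_(k < n) F k t) = \sum_(k < n) cint a b (F k).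
Proof.
move=> cF; elim: n => [|n [IH1 IH2]].
  have -> : (fun t : R => \sum_(k < 0) F k t) = (fun=> 0) by apply/funext => t; rewrite big_ord0.
  split; first exact: ccont_cst.
  rewrite big_ord0 -[0 in LHS](mul0r 0).
  by rewrite (@cintZ a b 0 (fun=> 0)) ?mul0r//; exact: ccont_cst.
have -> : (fun t : R => \sum_(k < n.+1) F k t) = (fun t => \sum_(k < n) F k t + F n t).
  by apply/funext => t; rewrite big_ord_recr.
split; first exact: ccontD.
by rewrite cintD// IH2 big_ord_recr.
Qed.
Lemma cint_cst a b z : a <= b -> cint a b (fun=> z) = (b - a)%:C%C * z.
Proof. by move=> ab; apply: complex_eq; rewrite ?ReZl ?ImZl /cint /= sint_cst. Qed.
Lemma cint_split a b c h : ccont h -> a <= c <= b -> cint a b h = cint a c h + cint c b h.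
Proof. by move=> [h1 h2] ab; apply: complex_eq; rewrite /cint /= (sint_split _ ab). Qed.

(** The factor 2 comes from estimating real and imaginary parts separately; it reappears in the
    Cauchy estimates and is harmless there. *)
Lemma cmod_cint a b h (u : R -> R) : ccont h -> continuous u ->
  (forall t, a <= t <= b -> cmod (h t) <= u t) -> cmod (cint a b h) <= 2 * sint a b u.
Proof.
move=> [h1 h2] cu hu; apply: le_trans (cmod_le _) _; rewrite /cint /= mulr2n mulrDl !mul1r.
have cn (v : R -> R) : continuous v -> continuous (fun t => `|v t|).
  by move=> cv t; apply: cvg_norm; exact: cv.
apply: lerD; apply: (le_trans (le_normr_Rintegral _ _)) => //; try exact: cont_integrable.
  apply: le_sint => //; first exact: cn.
  by move=> t /hu; apply: le_trans; exact: normRe_le.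
apply: le_sint => //; first exact: cn.
by move=> t /hu; apply: le_trans; exact: normIm_le.
Qed.

Lemma cmod_cint_cst a b h (M : R) : ccont h -> a <= b ->
  (forall t, a <= t <= b -> cmod (h t) <= M) -> cmod (cint a b h) <= 2 * ((b - a) * M).
Proof.
move=> ch ab hM; rewrite -sint_cst//; apply: cmod_cint => //.
by move=> t; exact: cvg_cst.
Qed.

Lemma entire_line_ccont (f : R[i] -> R[i]) z w : entire f -> ccont (fun t => f (z + t%:C%C * w)).
Proof.
move=> /entireP hf; split => t; have [d hd] := hf (z + t%:C%C * w);
  have [h1 h2] := cdiff_is_derive hd.
  by apply: differentiable_continuous; apply/derivable1_diffP; case: h1.
by apply: differentiable_continuous; apply/derivable1_diffP; case: h2.
Qed.

End SegmentIntegrals.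

Section Goursat.
Context {R : realType}.
Local Notation Re := complex.Re.
Local Notation Im := complex.Im.
Variable h : R[i] -> R[i].
Hypothesis eh : entire h.
Local Notation i1 := ('i%C : R[i]).
Implicit Types x y p q : R.

Definition hdiff y q := fun t : R => h (y%:C%C * i1 + t%:C%C * 1) - h ((y + q)%:C%C * i1 + t%:C%C * 1).
Definition vdiff x p := fun t : R => h ((x + p)%:C%C + t%:C%C * i1) - h (x%:C%C + t%:C%C * i1).
(* Boundary integral of [h] over [[x, x + p] x [y, y + q]], opposite sides being paired. *)
Definition bint x y p q : R[i] := cint x (x + p) (hdiff y q) + i1 * cint y (y + q) (vdiff x p).

Let ch y q : ccont (hdiff y q).
Proof. by apply: ccontB; exact: entire_line_ccont. Qed.
Let cv x p : ccont (vdiff x p).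
Proof. by apply: ccontB; exact: entire_line_ccont. Qed.

Lemma bint_hsplit x y p1 p2 q : 0 <= p1 -> 0 <= p2 ->
  bint x y (p1 + p2) q = bint x y p1 q + bint (x + p1) y p2 q.
Proof.
move=> p10 p20; rewrite /bint (@cint_split _ x (x + (p1 + p2)) (x + p1)) ?ch//; last first.
  by rewrite lerDl p10 addrA lerDl.
have -> : cint y (y + q) (vdiff x (p1 + p2)) =
    cint y (y + q) (vdiff x p1) + cint y (y + q) (vdiff (x + p1) p2).
  rewrite -cintD ?cv//; congr cint; apply/funext => t; rewrite /vdiff !addrA; ring.
by rewrite !addrA; ring.
Qed.

Lemma bint_vsplit x y p q1 q2 : 0 <= q1 -> 0 <= q2 ->
  bint x y p (q1 + q2) = bint x y p q1 + bint x (y + q1) p q2.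
Proof.
move=> q10 q20; rewrite /bint (@cint_split _ y (y + (q1 + q2)) (y + q1)) ?cv//; last first.
  by rewrite lerDl q10 addrA lerDl.
have -> : cint x (x + p) (hdiff y (q1 + q2)) =
    cint x (x + p) (hdiff y q1) + cint x (x + p) (hdiff (y + q1) q2).
  rewrite -cintD ?ch//; congr cint; apply/funext => t; rewrite /hdiff !addrA; ring.
by rewrite !addrA; ring.
Qed.

(** Subtracting the affine approximation at z changes the two paired side differences by constants,
    whose contributions p d i q and - i q d p cancel. What remains is at most 2 e (p + q) in each
    difference. *)
Lemma bint_small x y p q (z d : R[i]) (e : R) : 0 <= p -> 0 <= q -> 0 <= e ->
  (forall s t, x <= s <= x + p -> y <= t <= y + q ->
     cmod (h (s +i* t)%C - h z - d * ((s +i* t)%C - z)) <= e * (p + q)) ->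
  cmod (bint x y p q) <= 4 * e * (p + q) ^+ 2.
Proof.
move=> p0 q0 e0 H.
have e1 (s t : R) : t%:C%C * i1 + s%:C%C * 1 = (s +i* t)%C :> R[i].
  by apply: complex_eq => /=; ring.
have e2 (s t : R) : s%:C%C + t%:C%C * i1 = (s +i* t)%C :> R[i].
  by apply: complex_eq => /=; ring.
pose r1 := fun t => hdiff y q t + d * i1 * q%:C%C.
pose r2 := fun t => vdiff x p t - d * p%:C%C.
have c1 : ccont r1 by apply: ccontD; [exact: ch|exact: ccont_cst].
have c2 : ccont r2 by apply: ccontB; [exact: cv|exact: ccont_cst].
have -> : bint x y p q = cint x (x + p) r1 + i1 * cint y (y + q) r2.
  rewrite /r1 /r2 cintD ?ch//; try exact: ccont_cst.
  rewrite (@cintB _ _ _ (vdiff x p) _ (cv _ _) (ccont_cst _)).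
  rewrite !cint_cst ?lerDl// /bint !(addrC x) !(addrC y) !addrK; ring.
have b1 : cmod (cint x (x + p) r1) <= 2 * (p * (2 * (e * (p + q)))).
  have := @cmod_cint_cst _ x (x + p) r1 (2 * (e * (p + q))) c1.
  rewrite [x + p]addrC addrK [p + x]addrC; apply; first by rewrite lerDl.
  move=> t ht; rewrite /r1 /hdiff !e1.
  have A := H t y ht; have B := H t (y + q) ht.
  have -> : h (t +i* y)%C - h (t +i* (y + q))%C + d * i1 * q%:C%C =
    (h (t +i* y)%C - h z - d * ((t +i* y)%C - z)) - (h (t +i* (y + q))%C - h z - d * ((t +i* (y + q))%C - z)).
    have -> : (t +i* (y + q))%C = (t +i* y)%C + i1 * q%:C%C :> R[i] by apply: complex_eq => /=; ring.
    ring.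
  apply: le_trans (cmodBD _ _) _; rewrite mulr2n mulrDl !mul1r.
  by apply: lerD; [apply: A|apply: B]; rewrite ?lexx ?lerDl ?andbT.
have b2 : cmod (cint y (y + q) r2) <= 2 * (q * (2 * (e * (p + q)))).
  have := @cmod_cint_cst _ y (y + q) r2 (2 * (e * (p + q))) c2.
  rewrite [y + q]addrC addrK [q + y]addrC; apply; first by rewrite lerDl.
  move=> t ht; rewrite /r2 /vdiff !e2.
  have A := H x t _ ht; have B := H (x + p) t _ ht.
  have -> : h ((x + p) +i* t)%C - h (x +i* t)%C - d * p%:C%C =
    (h ((x + p) +i* t)%C - h z - d * (((x + p) +i* t)%C - z)) - (h (x +i* t)%C - h z - d * ((x +i* t)%C - z)).
    have -> : ((x + p) +i* t)%C = (x +i* t)%C + p%:C%C :> R[i] by apply: complex_eq => /=; ring.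
    ring.
  apply: le_trans (cmodBD _ _) _; rewrite mulr2n mulrDl !mul1r.
  by apply: lerD; [apply: B|apply: A]; rewrite ?lexx ?lerDl ?andbT.
apply: le_trans (cmodD _ _) _; rewrite cmodM.
have -> : cmod i1 = 1 by rewrite /cmod /= expr0n add0r expr1n sqrtr1.
rewrite mul1r; apply: le_trans (lerD b1 b2) _.
by rewrite le_eqVlt; apply/orP; left; apply/eqP; ring.
Qed.

(** Bisection: if the boundary integral exceeds e (p + q)^2, one of the four quarters exceeds the
    same bound at its own scale. The nested rectangles shrink to a point, where differentiability
    and [bint_small] contradict this. *)
Lemma goursat x y p q : 0 < p -> 0 < q -> bint x y p q = 0.
Proof.
move=> p0 q0; apply/eqP; rewrite -cmod_eq0 eq_le cmod_ge0 andbT.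
apply/ler_addgt0Pl => e0 he0; rewrite addr0.
pose e := e0 / (p + q) ^+ 2.
have e_gt0 : 0 < e by rewrite divr_gt0// exprn_gt0// addr_gt0.
have -> : e0 = e * (p + q) ^+ 2 by rewrite divfK// expf_neq0// gt_eqF// addr_gt0.
rewrite leNgt; apply/negP => hbig.
pose P (n : nat) := p / 2 ^+ n; pose Q (n : nat) := q / 2 ^+ n.
have P0 n : 0 < P n by rewrite divr_gt0// exprn_gt0.
have Q0 n : 0 < Q n by rewrite divr_gt0// exprn_gt0.
have PS' n : P n = P n.+1 + P n.+1.
  by rewrite /P exprS; field.
have QS n : Q n = Q n.+1 + Q n.+1.
  by rewrite /Q exprS; field.
pose big n (s : R * R) := e * (P n + Q n) ^+ 2 < cmod (bint s.1 s.2 (P n) (Q n)).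
(* The demand on the next rectangle is conditional on [big], so that every rectangle has a successor
   and dependent choice applies; [Fbig] discharges the condition afterwards. *)
pose rel (s s' : nat * (R * R)) := s'.1 = s.1.+1 /\ (big s.1 s.2 ->
   [/\ big s'.1 s'.2, s.2.1 <= s'.2.1, s'.2.1 + P s'.1 <= s.2.1 + P s.1,
       s.2.2 <= s'.2.2 & s'.2.2 + Q s'.1 <= s.2.2 + Q s.1]).
have step s : {s' | rel s s'}.
  apply: cid; case: s => n [a b].
  have [hb|hb] := pselect (big n (a, b)); last by exists (n.+1, (a, b)).
  have : exists s', [/\ big n.+1 s', a <= s'.1, s'.1 + P n.+1 <= a + P n,
       b <= s'.2 & s'.2 + Q n.+1 <= b + Q n].
    apply: contrapT => hno.
    have sm a' b' : (a' = a \/ a' = a + P n.+1) -> (b' = b \/ b' = b + Q n.+1) ->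
        cmod (bint a' b' (P n.+1) (Q n.+1)) <= e * (P n.+1 + Q n.+1) ^+ 2.
      move=> ha hb'; rewrite leNgt; apply/negP => hbb; apply: hno; exists (a', b').
      have := P0 n.+1; have := Q0 n.+1; have := PS' n; have := QS n => z1 z2 z3 z4.
      by case: ha => ?; case: hb' => ?; subst a' b'; split => //=; lra.
    move: hb; rewrite /big /= PS' QS.
    rewrite bint_hsplit ?ltW// !bint_vsplit ?ltW//; apply/negP; rewrite -leNgt.
    have -> : e * (P n.+1 + P n.+1 + (Q n.+1 + Q n.+1)) ^+ 2 =
      (e * (P n.+1 + Q n.+1) ^+ 2 + e * (P n.+1 + Q n.+1) ^+ 2) +
      (e * (P n.+1 + Q n.+1) ^+ 2 + e * (P n.+1 + Q n.+1) ^+ 2) by ring.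
    apply: le_trans (cmodD _ _) _; apply: lerD;
      (apply: le_trans (cmodD _ _) _; apply: lerD; apply: sm); by [left|right].
  by move=> [s' hs']; exists (n.+1, s').
have [F [F0 FS]] := dependent_choice step (0%N, (x, y)).
have F1 n : (F n).1 = n.
  by elim: n => [|n IH]; [rewrite F0|have [-> _] := FS n; rewrite IH].
pose X n := (F n).2.1; pose Y n := (F n).2.2.
have Fbig n : big n (X n, Y n).
  elim: n => [|n IH].
    by rewrite /X /Y F0 /big /P /Q /= !expr0 !divr1.
  have [_ H] := FS n; rewrite F1 in H; have /H[] : big n (F n).2 by move: IH; rewrite /X /Y; case: ((F n).2).
  by rewrite F1 /X /Y; case: ((F n.+1).2).
have FX n : [/\ X n <= X n.+1, X n.+1 + P n.+1 <= X n + P n, Y n <= Y n.+1 & Y n.+1 + Q n.+1 <= Y n + Q n].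
  have [_ H] := FS n; rewrite !F1 in H; have /H[] : big n (F n).2 by have := Fbig n; rewrite /X /Y; case: ((F n).2).
  by [].
have lim (S : nat -> R) (D : nat -> R) : (forall n, 0 < D n) -> (forall n, S n <= S n.+1) ->
    (forall n, S n.+1 + D n.+1 <= S n + D n) -> exists l, forall n, S n <= l <= S n + D n.
  move=> D0 S1 S2.
  have nd : {homo S : n m / (n <= m)%N >-> n <= m} by apply/nondecreasing_seqP.
  have S3 n m : (n <= m)%N -> S m <= S n + D n.
    move=> nm; apply: (@le_trans _ _ (S m + D m)); first by rewrite lerDl ltW.
    rewrite -(subnKC nm); elim: (m - n)%N => [|k IH]; first by rewrite addn0.
    by rewrite addnS; apply: le_trans (S2 _) IH.
  have cS : cvgn S.
    apply: nondecreasing_is_cvgn => //; exists (S 0%N + D 0%N) => _ [n _ <-]; exact: S3.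
  exists (limn S) => n; rewrite nondecreasing_cvgn_le//=.
  apply: limr_le => //; exists n => // m /= nm; exact: S3.
have [zx hzx] := lim X P P0 (fun n => let: And4 a _ _ _ := FX n in a) (fun n => let: And4 _ a _ _ := FX n in a).
have [zy hzy] := lim Y Q Q0 (fun n => let: And4 _ _ a _ := FX n in a) (fun n => let: And4 _ _ _ a := FX n in a).
have [d hd] := (entireP h).1 eh (zx +i* zy)%C.
have e4 : 0 < e / 4 by rewrite divr_gt0.
have [del del0 hdel] := hd _ e4.
have [n hn] : exists n, P n + Q n < del.
  have g : geometric (p + q) (2^-1) @ \oo --> (0 : R).
    by apply: cvg_geometric; rewrite ger0_norm// invf_lt1// ltr1n.
  move/cvgr0Pnorm_lt: g => /(_ del del0) [n _ /(_ n (leqnn n)) /=].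
  move=> g; exists n; rewrite /P /Q -mulrDl; apply: le_lt_trans g.
  by rewrite exprVn ler_norm.
have := Fbig n; rewrite /big /=; apply/negP; rewrite -leNgt.
(* Matches the constant 4 of [bint_small]. *)
have -> : e = 4 * (e / 4) by field.
apply: (@bint_small _ _ _ _ (zx +i* zy)%C d); rewrite ?ltW//.
move=> s t /andP[s1 s2] /andP[t1 t2].
have /andP[x1 x2] := hzx n; have /andP[y1 y2] := hzy n.
set k := (s +i* t)%C - (zx +i* zy)%C.
have kE : cmod k <= P n + Q n.
  apply: le_trans (cmod_le _) _; rewrite /k /=; apply: lerD.
    by rewrite ler_norml; apply/andP; split; lra.
  by rewrite ler_norml; apply/andP; split; lra.
have := hdel k (le_lt_trans kE hn).
rewrite {1}/k [(zx +i* zy)%C + _]addrC subrK => /le_trans; apply.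
by rewrite ler_wpM2l// ltW.
Qed.

End Goursat.

(** * Taylor expansion of entire functions *)

Section EntirePowerSeries.
Context {R : realType}.
Local Notation Re := complex.Re.
Local Notation Im := complex.Im.
Local Notation i1 := ('i%C : R[i]).
Implicit Types (f H : R[i] -> R[i]) (r x : R) (z w : R[i]) (k : R[i]).

Definition tau : R := 2 * pi.

Definition oval H : R[i] := cint 0 tau (fun t => H (t%:C%C * i1)).

Lemma tau_gt0 : 0 < tau. Proof. by rewrite mulr_gt0// pi_gt0. Qed.

Lemma entire_oval_cont H : entire H -> ccont (fun t : R => H (t%:C%C * i1)).
Proof.
move=> eH; have := entire_line_ccont 0 i1 eH.
by under eq_fun do rewrite add0r.
Qed.

Lemma entire_scale c : entire (fun z : R[i] => c * z).
Proof. by apply: entireM; [exact: entire_cst|exact: entire_id]. Qed.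

(** With s = i t this is f on the circle of radius r times a character. Written as an entire
    function of s, it brings circle integrals within reach of Goursat's lemma for rectangles. *)
Definition circ_fun f r k := fun s : R[i] => f (r%:C%C * cexp s) * cexp (k * s).

Lemma entire_circ_fun f r k : entire f -> entire (circ_fun f r k).
Proof.
move=> ef; apply: entireM.
  by apply: (@entire_comp _ f) => //; apply: entireM; [exact: entire_cst|exact: entire_cexp].
by apply: (@entire_comp _ (@cexp R)); [exact: entire_cexp|exact: entire_scale].
Qed.

Lemma entire_circle_ccont f r : entire f -> ccont (fun t : R => f (r%:C%C * cexp (t%:C%C * i1))).
Proof.
move=> ef; have := entire_oval_cont (entire_circ_fun r 0 ef).
rewrite /circ_fun (_ : (fun t : R => _ * _) = (fun t : R => f (r%:C%C * cexp (t%:C%C * i1))))//.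
by apply/funext => t; rewrite mul0r cexp0 mulr1.
Qed.

Lemma conjcM z w : ((z * w)^*)%C = ((z^*)%C * (w^*)%C).
Proof. exact: rmorphM. Qed.
Lemma conjcX z n : ((z ^+ n)^*)%C = ((z^*)%C) ^+ n.
Proof. exact: rmorphXn. Qed.
Lemma conjc_sum (I : Type) (s : seq I) (P : pred I) (F : I -> R[i]) :
  ((\sum_(i <- s | P i) F i)^*)%C = \sum_(i <- s | P i) ((F i)^*)%C.
Proof. exact: rmorph_sum. Qed.

Lemma cintJ a b (h : R -> R[i]) : ccont h -> cint a b (fun t => ((h t)^*)%C) = ((cint a b h)^*)%C.
Proof.
move=> [h1 h2]; apply: complex_eq; rewrite ?ReJ ?ImJ /cint /=.
  by congr sint; apply/funext => t; rewrite ReJ.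
rewrite -mulN1r -sintZ//.
by congr sint; apply/funext => t; rewrite ImJ mulN1r.
Qed.

Lemma cexp_tau : cexp (tau%:C%C * i1) = 1 :> R[i].
Proof.
have -> : tau%:C%C * i1 = (0 +i* tau)%C by apply: complex_eq => /=; ring.
by apply: complex_eq; rewrite /cexp /= expR0 mul1r /tau mulr_natl ?cos2pi ?sin2pi.
Qed.

(** Goursat on the rectangle with sides x and 2 pi: by periodicity the horizontal sides cancel, and
    the vertical sides are the circles of radii 1 and exp x. *)
Lemma goursat_circle f x k : entire f -> 0 < x -> cexp (k * (tau%:C%C * i1)) = 1 ->
  cexp (k * x%:C%C) * oval (circ_fun f (expR x) k) = oval (circ_fun f 1 k).
Proof.
move=> ef x0 kper.
pose h s := f (cexp s) * cexp (k * s).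
have eh : entire h.
  apply: entireM; first by apply: (@entire_comp _ f) => //; exact: entire_cexp.
  by apply: (@entire_comp _ (@cexp R)); [exact: entire_cexp|exact: entire_scale].
have := goursat eh 0 0 x0 tau_gt0.
rewrite /bint.
have -> : hdiff h 0 tau = fun=> 0.
  apply/funext => t; rewrite /hdiff !add0r mul0r add0r /h mulr1.
  rewrite mulrDr !cexpD kper mul1r.
  by rewrite cexp_tau mul1r subrr.
rewrite cint_cst ?add0r ?ltW// mulr0 add0r => /eqP; rewrite mulf_eq0 => /orP[/eqP /(congr1 (@complex.Im R)) /= /eqP|/eqP].
  by rewrite oner_eq0.
rewrite /vdiff cintB; [|exact: entire_line_ccont..].
rewrite !add0r => /eqP; rewrite subr_eq0 => /eqP e.
have ec := entire_circ_fun (expR x) k ef.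
rewrite /oval -cintZ; last exact: entire_oval_cont.
have expx (y : R) : cexp (y%:C%C) = (expR y)%:C%C :> R[i].
  by apply: complex_eq; rewrite /cexp /= ?cos0 ?sin0 ?mulr1 ?mulr0.
transitivity (cint 0 tau (fun t => h (x%:C%C + t%:C%C * i1))).
  congr cint; apply/funext => t; rewrite /h /circ_fun mulrDr !cexpD expx.
  by rewrite mulrCA.
rewrite e; congr cint; apply/funext => t; rewrite /h /circ_fun.
by rewrite rmorph0 add0r rmorph1 mul1r.
Qed.

Lemma goursat_circle_lt f x y k : entire f -> x < y -> cexp (k * (tau%:C%C * i1)) = 1 ->
  cexp (k * y%:C%C) * oval (circ_fun f (expR y) k) = cexp (k * x%:C%C) * oval (circ_fun f (expR x) k).
Proof.
move=> ef xy kper.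
pose g z := f ((expR x)%:C%C * z).
have eg : entire g by apply: (@entire_comp _ f) => //; exact: entire_scale.
have yx : 0 < y - x by rewrite subr_gt0.
have := goursat_circle eg yx kper.
have gE r : circ_fun g r k = circ_fun f (expR x * r) k.
  by apply/funext => s; rewrite /circ_fun /g rmorphM mulrA.
rewrite !gE mulr1 -expRD [x + _]addrC subrK => <-.
by rewrite mulrA -cexpD -mulrDr -rmorphD /= [x + _]addrC subrK.
Qed.

Lemma goursat_circle_eq f x y k : entire f -> cexp (k * (tau%:C%C * i1)) = 1 ->
  cexp (k * y%:C%C) * oval (circ_fun f (expR y) k) = cexp (k * x%:C%C) * oval (circ_fun f (expR x) k).
Proof.
move=> ef kper; have [xy|xy|->//] := ltgtP x y; first exact: goursat_circle_lt.
by apply/esym; exact: goursat_circle_lt.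
Qed.

(** Up to the factor [tau], these are the Fourier coefficients of f on the circle of radius r, of
    index n for [pmom] and - n for [nmom]. *)
Definition pmom f r (n : nat) := oval (circ_fun f r (- n%:R)).
Definition nmom f r (n : nat) := oval (circ_fun f r n%:R).

Lemma cexp_nat_per n : cexp ((n%:R : R[i]) * (tau%:C%C * i1)) = 1.
Proof. by rewrite cexpX cexp_tau expr1n. Qed.
Lemma cexp_natN_per n : cexp (- (n%:R : R[i]) * (tau%:C%C * i1)) = 1.
Proof. by rewrite mulNr cexpN cexp_nat_per invr1. Qed.

Lemma cexp_natR n (x : R) : cexp ((n%:R : R[i]) * x%:C%C) = (expR x ^+ n)%:C%C.
Proof.
rewrite cexpX -real_complexX; congr (_ ^+ _).
by apply: complex_eq; rewrite /cexp /= ?cos0 ?sin0 ?mulr1 ?mulr0.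
Qed.

Lemma pmom_scale f r n : entire f -> 0 < r -> pmom f r n = (r ^+ n)%:C%C * pmom f 1 n.
Proof.
move=> ef r0; have := goursat_circle_eq 0 (ln r) ef (cexp_natN_per n).
rewrite !mulNr !cexpN !cexp_natR expR0 lnK ?posrE// expr1n rmorph1 invr1 mul1r /pmom => <-.
by rewrite mulrA mulfV ?mul1r// fmorph_eq0 expf_neq0// gt_eqF.
Qed.

Lemma nmom_scale f r n : entire f -> 0 < r -> (r ^+ n)%:C%C * nmom f r n = nmom f 1 n.
Proof.
move=> ef r0; have := goursat_circle_eq 0 (ln r) ef (cexp_nat_per n).
by rewrite !cexp_natR expR0 lnK ?posrE// expr1n rmorph1 mul1r.
Qed.

Lemma cmod_cexp_i (t : R) : cmod (cexp (t%:C%C * i1)) = 1.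
Proof. by rewrite cmod_cexp /= mulr0 mul0r subrr expR0. Qed.

Lemma cmod_cexp_nat (n : nat) (t : R) : cmod (cexp (n%:R * (t%:C%C * i1))) = 1.
Proof. by rewrite cexpX cmodX cmod_cexp_i expr1n. Qed.
Lemma cmod_cexp_natN (n : nat) (t : R) : cmod (cexp (- n%:R * (t%:C%C * i1))) = 1.
Proof. by rewrite mulNr cexpN cmodV cmod_cexp_nat invr1. Qed.

Lemma cmod_mom_le f r n (B : R) : entire f -> 0 <= r ->
  (forall z, cmod z = r -> cmod (f z) <= B) ->
  cmod (pmom f r n) <= 2 * (tau * B) /\ cmod (nmom f r n) <= 2 * (tau * B).
Proof.
move=> ef r0 hB; have cf k := entire_oval_cont (entire_circ_fun r k ef).
have hf t : cmod (f (r%:C%C * cexp (t%:C%C * i1))) <= B.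
  by apply: hB; rewrite cmodM cmodR cmod_cexp_i mulr1 ger0_norm.
have t0 := ltW tau_gt0.
split; rewrite -[tau]subr0; apply: cmod_cint_cst => // t _; rewrite /circ_fun cmodM.
  by rewrite cmod_cexp_natN mulr1.
by rewrite cmod_cexp_nat mulr1.
Qed.

(** By [nmom_scale] the moment times r^(n+1) is independent of r, while f is bounded near 0:
    shrinking the circle forces it to vanish. *)
Lemma nmom0 f r n : entire f -> 0 < r -> nmom f r n.+1 = 0.
Proof.
move=> ef r0.
suff h : nmom f 1 n.+1 = 0.
  have := nmom_scale n.+1 ef r0; rewrite h => /eqP; rewrite mulf_eq0 fmorph_eq0.
  by rewrite expf_eq0 gt_eqF//= => /eqP.
have [d hd] := (entireP f).1 ef 0.
have [del del0 hdel] := cdiff_cont hd ltr01.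
pose B := cmod (f 0) + 1.
have B0 : 0 < B by rewrite ltr_wpDl ?cmod_ge0.
pose K := 2 * (tau * B); have K0 : 0 < K := mulr_gt0 (ltr0Sn _ 1) (mulr_gt0 tau_gt0 B0).
apply/eqP; rewrite -cmod_eq0 eq_le cmod_ge0 andbT; apply/ler_addgt0Pl => e e0; rewrite addr0.
pose s := Num.min (del / 2) (Num.min 1 (e / K)).
have s0 : 0 < s by rewrite !lt_min ltr01 !divr_gt0.
have sd : s < del.
  by apply: (@le_lt_trans _ _ (del / 2)); [rewrite /s ge_min lexx|lra].
have s1 : s <= 1 by rewrite !ge_min lexx !orbT.
have se : s <= e / K by rewrite !ge_min lexx !orbT.
rewrite -(nmom_scale n.+1 ef s0) cmodM cmodR ger0_norm ?exprn_ge0 ?(ltW s0)//.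
have [_ h] := @cmod_mom_le f s n.+1 B ef (ltW s0) (fun z (hz : cmod z = s) =>
  ltac:(have := hdel z; rewrite subr0 hz => /(_ sd) hh; rewrite /B -lerBlDl; exact: le_trans (cmod_dist _ _) (ltW hh))).
apply: le_trans (ler_wpM2l (exprn_ge0 _ (ltW s0)) h) _.
rewrite exprS -mulrA; apply: (@le_trans _ _ (e / K * (1 * K))); last by rewrite mul1r divfK// gt_eqF.
rewrite -/K; have K1 := ltW K0; have s1' := ltW s0.
apply: ler_pM => //; first by rewrite mulr_ge0// exprn_ge0.
by rewrite ler_wpM2r// exprn_ile1.
Qed.

Definition tcoef f n : R[i] := pmom f 1 n / tau%:C%C.

Lemma tauC_neq0 : tau%:C%C != 0 :> R[i].
Proof. by rewrite fmorph_eq0 gt_eqF// tau_gt0. Qed.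

Lemma pmom_tcoef f r n : entire f -> 0 < r -> pmom f r n = tau%:C%C * ((r ^+ n)%:C%C * tcoef f n).
Proof.
move=> ef r0; rewrite pmom_scale// /tcoef.
by field; rewrite tauC_neq0.
Qed.

Lemma tcoef_cauchy f r n (B : R) : entire f -> 0 < r ->
  (forall z, cmod z = r -> cmod (f z) <= B) -> cmod (tcoef f n) * r ^+ n <= 2 * B.
Proof.
move=> ef r0 hB; have [h _] := cmod_mom_le n ef (ltW r0) hB.
move: h; rewrite pmom_tcoef// !cmodM !cmodR !ger0_norm ?exprn_ge0 ?(ltW r0) ?(ltW tau_gt0)//.
by rewrite [2 * (tau * _)]mulrCA ler_pM2l ?tau_gt0// mulrC.
Qed.

(** The moment is bounded by the integral of |Re f| + |Im f| over the circle of radius r + 1, a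
    bound that does not involve n; the shift keeps the radius positive when r = 0. *)
Lemma pscoef_tcoef f : entire f -> pscoef (tcoef f).
Proof.
move=> ef r r0; have r1 : 0 < r + 1 by rewrite ltr_wpDl.
pose u t := `|Re (f ((r + 1)%:C%C * cexp (t%:C%C * i1)))| + `|Im (f ((r + 1)%:C%C * cexp (t%:C%C * i1)))|.
have cu : continuous u.
  have [c1 c2] : ccont (fun t : R => f ((r + 1)%:C%C * cexp (t%:C%C * i1))).
    exact: entire_circle_ccont.
  by move=> t; apply: cvgD; apply: cvg_norm; [exact: c1|exact: c2].
exists (2 * sint 0 tau u / tau) => n.
have h : cmod (pmom f (r + 1) n) <= 2 * sint 0 tau u.
  apply: cmod_cint => //; first exact: entire_oval_cont (entire_circ_fun _ _ ef).
  by move=> t _; rewrite /circ_fun cmodM cmod_cexp_natN mulr1 cmod_le.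
rewrite ler_pdivlMr ?tau_gt0//; apply: le_trans h.
rewrite pmom_tcoef// !cmodM !cmodR !ger0_norm ?exprn_ge0 ?(ltW r1) ?(ltW tau_gt0)//.
rewrite mulrC ler_wpM2l ?(ltW tau_gt0)// mulrC ler_wpM2r ?mulr_ge0 ?cmod_ge0//.
by rewrite lerXn2r ?nnegrE ?(ltW r1)// lerDl.
Qed.

(** * Fejer means on a circle *)

Section Fejer.
Variables (f : R[i] -> R[i]) (r : R) (w : R[i]).
Hypotheses (ef : entire f) (r0 : 0 < r) (w1 : cmod w = 1).

(** The (j, l) term of g times the Fejer kernel centred at [w], once the squared modulus of the
    geometric sum is expanded (see [fejerE]). *)
Definition fejer_term g j l := fun s : R[i] =>
  (((w^*)%C) ^+ j * w ^+ l) * circ_fun g r (j%:R - l%:R) s.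

Lemma oval_fejer_term g j l : entire g -> oval (fejer_term g j l) =
  if (j <= l)%N then tau%:C%C * (tcoef g (l - j) * (r%:C%C * w) ^+ (l - j)) else 0.
Proof.
move=> eg; have ec := entire_oval_cont (entire_circ_fun r (j%:R - l%:R) eg).
rewrite /oval /fejer_term cintZ//.
case: leqP => jl.
  have -> : cint 0 tau (fun t => circ_fun g r (j%:R - l%:R) (t%:C%C * i1)) = pmom g r (l - j).
    by rewrite /pmom natrB// opprB.
  rewrite pmom_tcoef//.
  have -> : ((w^*)%C) ^+ j * w ^+ l = w ^+ (l - j).
    rewrite -{1}(subnK jl) exprD mulrCA -exprMn [_ * w]mulrC mulcJ w1 expr1n.
    by rewrite rmorph1 expr1n mulr1.
  by rewrite exprMn real_complexX; ring.
have -> : cint 0 tau (fun t => circ_fun g r (j%:R - l%:R) (t%:C%C * i1)) = nmom g r (j - l).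
  by rewrite /nmom natrB// ltnW.
by rewrite -(ltn_predK (n := j - l) (m := 0)) ?subn_gt0// nmom0// mulr0.
Qed.

Definition fejer g N := fun s : R[i] => \sum_(j < N) \sum_(l < N) fejer_term g j l s.

Lemma fejerE g N (t : R) : fejer g N (t%:C%C * i1) =
  g (r%:C%C * cexp (t%:C%C * i1)) *
   (cmod (\sum_(j < N) (cexp (t%:C%C * i1) * (w^*)%C) ^+ j) ^+ 2)%:C%C.
Proof.
have cJ : ((cexp (t%:C%C * i1))^*)%C = (cexp (t%:C%C * i1))^-1.
  by rewrite cexpJ -cexpN; congr cexp; apply: complex_eq => /=; ring.
rewrite -mulcJ conjc_sum mulr_suml mulr_sumr /fejer.
apply: eq_bigr => j _; rewrite mulr_sumr mulr_sumr; apply: eq_bigr => l _.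
rewrite /fejer_term /circ_fun mulrBl cexpD cexpX cexpN cexpX conjcX conjcM conjcK cJ.
by rewrite !exprMn exprVn; ring.
Qed.

Lemma entire_fejer g N : entire g -> ccont (fun t : R => fejer g N (t%:C%C * i1)).
Proof.
move=> eg.
pose G (j : nat) := fun t : R => \sum_(l < N) fejer_term g j l (t%:C%C * i1).
suff cG j : ccont (G j) by have [] := cint_sum 0 tau N cG.
pose G2 (l : nat) := fun t : R => fejer_term g j l (t%:C%C * i1).
have cG2 l : ccont (G2 l).
  by apply: ccontZ; exact: entire_oval_cont (entire_circ_fun _ _ eg).
by have [] := cint_sum 0 tau N cG2.
Qed.

Lemma oval_fejer g N : entire g -> oval (fejer g N) =
  tau%:C%C * \sum_(j < N) \sum_(l < j.+1) tcoef g l * (r%:C%C * w) ^+ l.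
Proof.
move=> eg.
have ct j l : ccont (fun t : R => fejer_term g j l (t%:C%C * i1)).
  by apply: ccontZ; exact: entire_oval_cont (entire_circ_fun _ _ eg).
pose G (j : nat) := fun t : R => \sum_(l < N) fejer_term g j l (t%:C%C * i1).
have cG j : ccont (G j) by have [] := cint_sum 0 tau N (ct j).
have [_ h] := cint_sum 0 tau N cG.
(* Row j keeps only the indices l >= j, that is N - j consecutive coefficients; reversing the order
   of the rows turns them into partial sums of length j + 1. *)
rewrite /oval /fejer h mulr_sumr (reindex_inj rev_ord_inj) /=.
apply: eq_bigr => j _; have [_ ->] := cint_sum 0 tau N (ct (N - j.+1)%N).
rewrite -(big_mkord xpredT (fun l => cint 0 tau (fun t : R => fejer_term g (N - j.+1) l (t%:C%C * i1)))).
rewrite (@big_cat_nat _ _ _ (N - j.+1)) ?leq_subr//= big_nat big1 ?add0r; last first.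
  move=> l /andP[_ lj]; have := oval_fejer_term (N - j.+1) l eg.
  by rewrite leqNgt lj.
rewrite -{1}[(N - j.+1)%N]add0n big_addn subKn ?ltn_ord// big_mkord mulr_sumr.
apply: eq_bigr => l _; have := oval_fejer_term (N - j.+1) (l + (N - j.+1)) eg.
by rewrite leq_addl addnK.
Qed.

End Fejer.

Lemma tcoef1 n : tcoef (fun=> 1) n = (n == 0%N)%:R.
Proof.
have e1 : entire (fun=> 1 : R[i]) by exact: entire_cst.
case: n => [|n].
  rewrite /tcoef /pmom /oval /circ_fun.
  have -> : (fun t : R => 1 * cexp (- 0%:R * (t%:C%C * i1))) = (fun=> 1).
    by apply/funext => t; rewrite oppr0 mul0r cexp0 mulr1.
  by rewrite cint_cst ?ltW ?tau_gt0// subr0 mulr1 divff ?tauC_neq0.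
have h := @nmom0 (fun=> 1) 1 n e1 ltr01.
rewrite /tcoef.
(* For the constant 1 a positive moment is the conjugate of a negative one, and the negative ones
   vanish. *)
suff -> : pmom (fun=> 1) 1 n.+1 = ((nmom (fun=> 1) 1 n.+1)^*)%C by rewrite h rmorph0 mul0r.
rewrite /pmom /nmom /oval -cintJ; last exact: entire_oval_cont (entire_circ_fun _ _ e1).
congr cint; apply/funext => t; rewrite /circ_fun !mul1r cexpJ; congr cexp.
rewrite conjcM conjc_nat mulNr -mulrN; congr (_ * _).
by apply: complex_eq => /=; ring.
Qed.

Lemma geo_sum_bound (q : R[i]) N : cmod q = 1 -> q != 1 ->
  cmod (\sum_(j < N) q ^+ j) <= 2 / cmod (1 - q).
Proof.
move=> q1 qn1; have d0 : 0 < cmod (1 - q) by rewrite cmod_gt0 subr_eq0 eq_sym.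
rewrite ler_pdivlMr// -cmodM mulrC -opprB mulNr -subrX1 cmodN.
by apply: le_trans (cmodBD _ _) _; rewrite cmodX q1 expr1n cmod1.
Qed.

(** The Cesaro means of the Taylor sums tend to the sum of the absolutely convergent series, and
    also to f z by Fejer's argument: the kernel is nonnegative with mass tau (N + 1), f is close to
    f z near z, and away from z the kernel stays bounded. *)
Lemma entire_tcoef_sum f z : entire f -> z != 0 -> f z = PS (tcoef f) z.
Proof.
move=> ef z0.
pose r := cmod z; have r0 : 0 < r by rewrite cmod_gt0.
pose w := z / r%:C%C.
have rC : r%:C%C != 0 :> R[i] by rewrite fmorph_eq0 gt_eqF.
have zE : z = r%:C%C * w by rewrite mulrC divfK.
have w1 : cmod w = 1 by rewrite cmodM cmodV cmodR ger0_norm ?ltW// divff// gt_eqF.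
pose S n := \sum_(l < n.+1) tcoef f l * z ^+ l.
have cS : ccvg S (PS (tcoef f) z).
  have /ccvgP h := asum_cvg (asum_ps z (pscoef_tcoef ef)).
  by apply/ccvgP; have := h; rewrite -cvg_shiftS.
pose A N := (N.+1%:R^-1)%:C%C * \sum_(j < N.+1) S j.
have cA : ccvg A (PS (tcoef f) z).
  case: cS => /cesaro c1 /cesaro c2; split.
    rewrite (_ : (fun n => Re (A n)) = arithmetic_mean (fun n => Re (S n)))//.
    by apply/funext => n; rewrite /A ReZl Re_sum /arithmetic_mean /series /= big_mkord.
  rewrite (_ : (fun n => Im (A n)) = arithmetic_mean (fun n => Im (S n)))//.
  by apply/funext => n; rewrite /A ImZl Im_sum /arithmetic_mean /series /= big_mkord.
apply: (@ccvg_unique _ A) => //; apply/ccvgP/cvgr0Pnorm_lt => e e0.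
have [d hd] := (entireP f).1 ef z.
have [|del del0 hdel] := cdiff_cont hd (e := e / 4); first by rewrite divr_gt0.
pose G N (t : R) := cmod (\sum_(j < N) (cexp (t%:C%C * i1) * (w^*)%C) ^+ j) ^+ 2.
pose u t := cmod (f z) + (`|Re (f (r%:C%C * cexp (t%:C%C * i1)))| + `|Im (f (r%:C%C * cexp (t%:C%C * i1)))|).
have cu : continuous u.
  have [c1 c2] : ccont (fun t : R => f (r%:C%C * cexp (t%:C%C * i1))).
    exact: entire_circle_ccont.
  move=> t; apply: cvgD; first exact: cvg_cst.
  by apply: cvgD; apply: cvg_norm; [exact: c1|exact: c2].
(* Bound for the Fejer kernel at distance at least [del] from z: there |1 - q| >= del / r, and the
   geometric sum is at most 2 / |1 - q|. *)
pose c := 4 * r ^+ 2 / del ^+ 2.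
have c0 : 0 <= c by rewrite divr_ge0 ?exprn_ge0 ?mulr_ge0 ?exprn_ge0// ltW.
pose g (y : R[i]) := f z - f y.
have eg : entire g.
  apply: entire_ext (entireD (entire_cst (f z)) (entireM (entire_cst (-1)) ef)) => x.
  by rewrite mulN1r.
have e1 : entire (fun=> 1 : R[i]) by exact: entire_cst.
have t0 := ltW tau_gt0.
have key N : cmod (f z - A N) <= e / 2 + 2 * (c * sint 0 tau u) / tau / N.+1%:R.
  have N0 : 0 < (N.+1%:R : R) by [].
  have NC : (N.+1%:R : R)%:C%C != 0 :> R[i] by rewrite fmorph_eq0 gt_eqF.
  have f1 : oval (fejer r w (fun=> 1) N.+1) = (tau * N.+1%:R)%:C%C.
    rewrite oval_fejer// [RHS]rmorphM; congr (_ * _).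
    rewrite rmorph_nat; rewrite (eq_bigr (fun=> 1)) ?sumr_const ?card_ord// => j _.
    rewrite big_ord_recl tcoef1 expr0 mulr1 big1 ?addr0// => l _.
    by rewrite tcoef1 mul0r.
  have cG : continuous (G N.+1) /\ sint 0 tau (G N.+1) = tau * N.+1%:R.
    have E (t : R) : fejer r w (fun=> 1) N.+1 (t%:C%C * i1) = (G N.+1 t)%:C%C.
      by rewrite fejerE mul1r.
    split.
      have [h _] := entire_fejer r w N.+1 e1.
      by move: h; under [X in continuous X -> _]eq_fun do rewrite E.
    have := f1; rewrite /oval /cint => /(congr1 (@complex.Re R)) /= <-.
    by congr sint; apply/funext => t; rewrite E.
  have h : cmod (oval (fejer r w g N.+1)) <= 2 * sint 0 tau (fun t => e / 4 * G N.+1 t + c * u t).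
    apply: cmod_cint; first exact: entire_fejer.
      move=> t; apply: cvgD; apply: cvgM; try exact: cvg_cst; [exact: cG.1|exact: cu].
    move=> t _; rewrite fejerE cmodM cmodR -/(G N.+1 t).
    have G0 : 0 <= G N.+1 t by rewrite exprn_ge0// cmod_ge0.
    have u0 : 0 <= u t by rewrite !addr_ge0// cmod_ge0.
    rewrite [`|G _ _|]ger0_norm//.
    have [hlt|hge] := ltP (cmod (r%:C%C * cexp (t%:C%C * i1) - z)) del.
      apply: (@le_trans _ _ (e / 4 * G N.+1 t)); last by rewrite lerDl mulr_ge0.
      by rewrite ler_wpM2r// /g cmodB ltW// hdel.
    apply: (@le_trans _ _ (c * u t)); last first.
      by rewrite lerDr mulr_ge0// ltW// divr_gt0.
    rewrite mulrC; apply: ler_pM => //; rewrite ?cmod_ge0//; last first.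
      by apply: le_trans (cmodBD _ _) _; rewrite lerD2l cmod_le.
    set q := cexp (t%:C%C * i1) * (w^*)%C.
    have q1 : cmod q = 1 by rewrite cmodM cmodJ cmod_cexp_i w1 mulr1.
    have hq : cmod (1 - q) = cmod (r%:C%C * cexp (t%:C%C * i1) - z) / r.
      have -> : 1 - q = (w^*)%C * (z - r%:C%C * cexp (t%:C%C * i1)) / r%:C%C.
        rewrite {1}zE; have := mulcJ w; rewrite w1 expr1n rmorph1 => h.
        rewrite /q -mulrBr; apply: (mulIf rC); rewrite divfK// -[1]h; ring.
      by rewrite !cmodM cmodJ w1 mul1r cmodB cmodV cmodR ger0_norm// ltW.
    have hq0 : del / r <= cmod (1 - q) by rewrite hq ler_wpM2r// invr_ge0 ltW.
    have dr0 : 0 < del / r by rewrite divr_gt0.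
    have qn1 : q != 1.
      have : 0 < cmod (1 - q) by apply: lt_le_trans hq0.
      by rewrite cmod_gt0 subr_eq0 eq_sym.
    have -> : c = (2 / (del / r)) ^+ 2.
      by rewrite /c; field; rewrite !gt_eqF.
    have cc : 0 <= 2 / (del / r) := divr_ge0 (ler0n R 2) (ltW dr0).
    rewrite /G lerXn2r ?nnegrE ?cmod_ge0//.
    apply: le_trans (geo_sum_bound _ q1 qn1) _.
    by rewrite ler_wpM2l// lef_pV2 ?posrE// (lt_le_trans dr0).
  have -> : f z - A N = (tau * N.+1%:R)%:C%C^-1 * oval (fejer r w g N.+1).
    have -> : oval (fejer r w g N.+1) = f z * oval (fejer r w (fun=> 1) N.+1) - oval (fejer r w f N.+1).
      rewrite /oval -cintZ; last exact: entire_fejer.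
      rewrite -cintB; [|by apply: ccontZ; exact: entire_fejer|exact: entire_fejer].
      by congr cint; apply/funext => t; rewrite !fejerE /g; ring.
    rewrite f1 oval_fejer// -zE /A rmorphM fmorphV.
    have alg (F T a b : R[i]) : a != 0 -> b != 0 ->
        F - a^-1 * T = (b * a)^-1 * (F * (b * a) - b * T).
      by move=> a0 b0; field; rewrite a0 b0.
    exact: alg NC tauC_neq0.
  have tN : 0 < tau * N.+1%:R := mulr_gt0 tau_gt0 N0.
  rewrite cmodM cmodV cmodR ger0_norm ?(ltW tN)// mulrC ler_pdivrMr//.
  apply: le_trans h _; rewrite sintD ?sintZ ?(proj2 cG)//; last 3 first.
  - exact: cG.1.
  - by move=> t; apply: cvgM; [exact: cvg_cst|exact: cG.1].
  - by move=> t; apply: cvgM; [exact: cvg_cst|exact: cu].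
  have alg (T n x : R) : T != 0 -> n != 0 -> 2 * (e / 4 * (T * n) + x) = (e / 2 + 2 * x / T / n) * (T * n).
    by move=> T1 n1; field; rewrite n1 T1.
  by rewrite (alg tau) ?gt_eqF ?tau_gt0.
pose D := 2 * (c * sint 0 tau u) / tau.
have cD : (fun N : nat => D / N.+1%:R) @ \oo --> (0 : R).
  rewrite -[0](mulr0 D); apply: cvgM; first exact: cvg_cst.
  exact: cvg_harmonic.
move/cvgr0Pnorm_lt: cD => /(_ (e / 2)) []; first by rewrite divr_gt0.
move=> N0 _ hN; exists N0 => // N /hN /=; rewrite [`|cmod _|]ger0_norm ?cmod_ge0// => hh.
rewrite cmodB; apply: le_lt_trans (key N) _.
by rewrite [X in _ < X]splitr ltrD2l; apply: le_lt_trans hh; exact: ler_norm.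
Qed.

(** The last clause is the Cauchy estimate on one single circle, which later allows bounds known
    only on selected circles. Its factor 2 is that of [cmod_cint]. *)
Theorem entire_power_series f : entire f ->
  exists a : nat -> R[i], [/\ pscoef a, forall z, f z = PS a z &
    forall r (B : R) n, 0 < r -> (forall z, cmod z = r -> cmod (f z) <= B) ->
      cmod (a n) * r ^+ n <= 2 * B].
Proof.
move=> ef; exists (tcoef f); split; [exact: pscoef_tcoef| |by move=> *; exact: tcoef_cauchy].
move=> z; have [->|z0] := eqVneq z 0; last exact: entire_tcoef_sum.
(* At z = 0 the circle degenerates; both sides are continuous there and agree at the small positive
   point [m]. *)
apply/eqP; rewrite -subr_eq0 -cmod_eq0 eq_le cmod_ge0 andbT.
apply/ler_addgt0Pl => e e0; rewrite addr0.
have [d1 h1] := (entireP f).1 ef 0.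
have [a a0 ha] := cdiff_cont h1 (divr_gt0 e0 (ltr0Sn R 1)).
have [b b0 hb] := cdiff_cont (PS_cdiff 0 (pscoef_tcoef ef)) (divr_gt0 e0 (ltr0Sn R 1)).
pose m := Num.min a b / 2; have m0 : 0 < m by rewrite divr_gt0// lt_min a0.
have mC : m%:C%C != 0 :> R[i] by rewrite fmorph_eq0 gt_eqF.
have mm : m < Num.min a b by rewrite /m; have : 0 < Num.min a b by [rewrite lt_min a0]; lra.
have := ha m%:C%C; have := hb m%:C%C; rewrite !subr0 cmodR ger0_norm ?(ltW m0)//.
move: mm; rewrite lt_min => /andP[ma mb] /(_ mb) q1 /(_ ma); rewrite (entire_tcoef_sum ef mC) => q2.
have tri (A B C : R[i]) : A - B = (C - B) - (C - A) by ring.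
rewrite (tri _ _ (PS (tcoef f) m%:C%C)).
by apply: le_trans (cmodBD _ _) _; rewrite [e]splitr ltW// ltrD.
Qed.

End EntirePowerSeries.

(** * The Gamma function *)

Section GammaFunction.
Context {R : realType}.
Local Notation mu := (@lebesgue_measure R).
Implicit Types (s t a b : R).

Definition gfun s t : R := t `^ (s - 1) * expR (- t).
Definition Gammae s : \bar R := (\int[mu]_(t in `]0%R, +oo[) (gfun s t)%:E)%E.

Lemma gfun_ge0 s t : 0 <= gfun s t.
Proof. by rewrite mulr_ge0 ?powR_ge0 ?expR_ge0. Qed.

Lemma measurable_gfun s (D : set R) : measurable_fun D (gfun s).
Proof.
apply: measurable_funTS; apply: measurable_funM; first exact: measurable_powR.
by apply: measurableT_comp => //; exact: oppr_measurable.
Qed.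

Lemma measurable_gfunE s (D : set R) : measurable_fun D (EFin \o gfun s).
Proof. by apply/measurable_EFinP; exact: measurable_gfun. Qed.

Lemma Gammae_ge0 s : (0 <= Gammae s)%E.
Proof. by apply: integral_ge0 => t _; rewrite lee_fin gfun_ge0. Qed.

Lemma GammaE s : Gamma s = fine (Gammae s).
Proof.
rewrite /Gamma /Rintegral /Gammae; congr fine.
by rewrite integral_itv_obnd_cbnd//; exact: measurable_gfunE.
Qed.

Lemma Gammae1 : Gammae 1 = 1%E.
Proof.
have := integral_exponential_pdf (ltr01 : 0 < (1 : R)).
rewrite /exponential_pdf => <-.
rewrite /Gammae integral_itv_obnd_cbnd; last exact: measurable_gfunE.
rewrite integral_mkcond; apply: eq_integral => x _.
rewrite /patch; case: ifPn => // _; rewrite /gfun subrr powRr0 mul1r.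
by rewrite mul1r mulN1r.
Qed.

(** The boundary term of the integration by parts behind Gamma (s + 1) = s Gamma s. *)
Definition gprim s t := t `^ s * expR (- t).

Lemma gprim_is_derive s t : 0 < t ->
  is_derive t 1 (gprim s) (s * gfun s t - gfun (s + 1) t).
Proof.
move=> t0; have h1 := is_derive1_powR s t0.
have h2 : is_derive t 1 (fun x => expR (- x)) (expR (- t) * (-1)).
  apply: (@is_derive1_comp _ expR (fun x => - x) t).
apply: (is_derive_eq (is_deriveM h1 h2)).
rewrite /GRing.scale /= /gfun addrK; ring.
Qed.

Lemma gprim_cont s t : 0 < t -> {for t, continuous (gprim s)}.
Proof.
move=> t0; apply: differentiable_continuous; apply/derivable1_diffP.
by have [] := gprim_is_derive s t0.
Qed.

Lemma gfun_int_ae s a b : 0 < a -> a < b ->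
  mu.-integrable `[a, b] (EFin \o gfun s).
Proof.
move=> a0 ab; apply: continuous_compact_integrable; first exact: segment_compact.
apply: continuous_in_subspaceT => x /[!inE] /=; rewrite in_itv /= => /andP[ax _].
exact: gprim_cont (lt_le_trans a0 ax).
Qed.

Lemma gfun_ibp s a b : 0 < a -> a < b ->
  s * \int[mu]_(t in `[a, b]) gfun s t - \int[mu]_(t in `[a, b]) gfun (s + 1) t = gprim s b - gprim s a.
Proof.
move=> a0 ab; have b0 := lt_trans a0 ab.
have i1 := gfun_int_ae s a0 ab; have i2 := gfun_int_ae (s + 1) a0 ab.
have i3 : mu.-integrable `[a, b] (EFin \o (fun t => s * gfun s t)).
  apply: continuous_compact_integrable; first exact: segment_compact.
  apply: continuous_in_subspaceT => x /[!inE] /=; rewrite in_itv /= => /andP[ax _].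
  by apply: cvgM; [exact: cvg_cst|exact: gprim_cont (lt_le_trans a0 ax)].
rewrite -RintegralZl// -RintegralB//.
rewrite /Rintegral (@continuous_FTC2 _ _ (gprim s))//.
- apply: continuous_in_subspaceT => x /[!inE] /=; rewrite in_itv /= => /andP[ax _].
  have x0 := lt_le_trans a0 ax.
  apply: cvgB; last exact: gprim_cont.
  by apply: cvgM; [exact: cvg_cst|exact: gprim_cont].
- split.
  + move=> x; rewrite in_itv /= => /andP[ax _].
    by have [] := gprim_is_derive s (lt_trans a0 ax).
  + by apply: cvg_at_right_filter; exact: gprim_cont.
  + by apply: cvg_at_left_filter; exact: gprim_cont.
- move=> x; rewrite in_itv /= => /andP[ax _].
  by rewrite derive1E; have [_ ->] := gprim_is_derive s (lt_trans a0 ax).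
Qed.

(** Compact exhaustion of the half line, on which [gfun] is continuous; the shift by two keeps the
    end points distinct. *)
Definition gset n : set R := `[(n.+2%:R : R)^-1, n.+2%:R].
Definition Gpart s n : R := \int[mu]_(t in gset n) gfun s t.

Lemma gset_lt n : (n.+2%:R : R)^-1 < n.+2%:R.
Proof.
apply: (@lt_trans _ _ 1); last by rewrite ltr1n.
by rewrite invf_lt1// ltr1n.
Qed.

Lemma Gpart_EFin s n : (Gpart s n)%:E = (\int[mu]_(t in gset n) (gfun s t)%:E)%E.
Proof.
rewrite /Gpart /Rintegral fineK//.
apply: integrable_fin_num; first exact: measurable_itv.
by apply: gfun_int_ae; [rewrite invr_gt0|exact: gset_lt].
Qed.

Lemma Gpart_cvg s : (fun n => (Gpart s n)%:E) @ \oo --> Gammae s.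
Proof.
have U : `]0%R, +oo[%classic = \bigcup_n gset n.
  apply/seteqP; split=> t /=; rewrite ?in_itv /= ?andbT.
    move=> t0; pose n := Num.bound (t + t^-1); exists n => //; rewrite /gset /= in_itv /=.
    have : t + t^-1 < n%:R by apply: archi_boundP; rewrite addr_ge0 ?invr_ge0 ?(ltW t0).
    have ti : 0 < t^-1 by rewrite invr_gt0.
    have nn : n%:R <= (n.+2%:R : R) by rewrite ler_nat; lia.
    move=> h; apply/andP; split; last by lra.
    by rewrite -[t]invrK lef_pV2 ?posrE//; lra.
  by move=> [n _]; rewrite /gset /= in_itv /= => /andP[h _]; rewrite (lt_le_trans _ h)// invr_gt0.
have h : (\int[mu]_(x in gset i) (gfun s x)%:E)%E @[i --> \oo] --> Gammae s.
  rewrite /Gammae U; apply: ge0_nondecreasing_set_cvg_integral.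
  - apply/nondecreasing_seqP => n; apply/subsetPset => t; rewrite /gset /= !in_itv /= => /andP[h1 h2].
    have nn : n.+2%:R <= (n.+3%:R : R) by rewrite ler_nat.
    rewrite (le_trans h2 nn) andbT; apply: le_trans h1.
    by rewrite lef_pV2 ?posrE.
  - by move=> n; exact: measurable_itv.
  - by move=> n; exact: measurable_gfunE.
  - by move=> n t _; rewrite lee_fin gfun_ge0.
apply: cvg_trans h; apply: near_eq_cvg; apply: nearW => n.
by rewrite Gpart_EFin.
Qed.

Lemma Gpart_le s n : ((Gpart s n)%:E <= Gammae s)%E.
Proof.
rewrite Gpart_EFin.
apply: (@ge0_subset_integral _ _ _ mu (gset n) `]0, +oo[ _ _ (EFin \o gfun s)) => //; try exact: measurable_itv; try exact: measurable_gfunE.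
  by move=> t _; rewrite lee_fin gfun_ge0.
move=> t; rewrite /gset /= !in_itv /= andbT => /andP[h _].
by rewrite (lt_le_trans _ h)// invr_gt0.
Qed.

Lemma Gammae_le_bound s (M : R) : (forall n, Gpart s n <= M) -> (Gammae s <= M%:E)%E.
Proof.
move=> h; have c := @Gpart_cvg s.
rewrite -(cvg_lim _ c)//; apply: lime_le; first exact: cvgP c.
by apply: nearW => n; rewrite lee_fin.
Qed.

Lemma gprim_ge0 s t : 0 <= gprim s t.
Proof. by rewrite mulr_ge0 ?powR_ge0 ?expR_ge0. Qed.

Lemma Gpart_rec s n : s * Gpart s n - Gpart (s + 1) n = gprim s n.+2%:R - gprim s (n.+2%:R)^-1.
Proof. by apply: gfun_ibp; rewrite ?invr_gt0// gset_lt. Qed.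

Lemma gprim_le s t (k : nat) : 1 <= t -> s <= k%:R -> gprim s t <= (k.+1)`!%:R / t.
Proof.
move=> t1 sk; have t0 : 0 < t by apply: lt_le_trans t1.
rewrite ler_pdivlMr// /gprim expRN.
rewrite mulrAC ler_pdivrMr ?expR_gt0//.
apply: (@le_trans _ _ (t ^+ k.+1)).
  rewrite exprSr ler_wpM2r ?(ltW t0)// -powR_mulrn ?(ltW t0)//.
  by rewrite ler_powR.
have := expR_ge1Dxn k (ltW t0) => h.
rewrite mulrC -ler_pdivrMr ?ltr0n ?fact_gt0//; apply: le_trans h.
by rewrite lerDr.
Qed.

Lemma gprim_cvgy s : (fun n : nat => gprim s n.+2%:R) @ \oo --> (0 : R).
Proof.
pose k := Num.bound `|s|.
have sk : s <= k%:R by exact: le_trans (ler_norm s) (ltW (archi_boundP (normr_ge0 _))).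
have c : (fun n : nat => (k.+1)`!%:R / (n.+2%:R : R)) @ \oo --> (0 : R).
  rewrite -[0](mulr0 ((k.+1)`!%:R : R)); apply: cvgM; first exact: cvg_cst.
  by have := @cvg_harmonic R; rewrite -cvg_shiftS.
apply: (squeeze_cvgr _ (@cvg_cst _ (0 : R) _ _ _) c).
apply: nearW => n; rewrite gprim_ge0 /=; apply: gprim_le => //.
by rewrite ler1n.
Qed.

Lemma gprim_cvg0 s : 0 < s -> (fun n : nat => gprim s (n.+2%:R)^-1) @ \oo --> (0 : R).
Proof.
move=> s0.
have c : (fun n : nat => ((n.+2%:R : R)^-1) `^ s) @ \oo --> (0 : R).
  apply/cvgr0Pnorm_lt => e e0.
  have := powR_cvg0 s0 => /cvgr0Pnorm_lt /(_ e e0) [del /= del0 hd].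
  have := @cvg_harmonic R; rewrite -cvg_shiftS => /cvgr0Pnorm_lt /(_ del del0).
  apply: filterS => n hn; apply: hd; last by rewrite invr_gt0.
  by rewrite /= sub0r normrN.
apply: (squeeze_cvgr _ (@cvg_cst _ (0 : R) _ _ _) c).
apply: nearW => n; rewrite gprim_ge0 /= /gprim ler_piMr ?powR_ge0//.
Qed.

Lemma Gammae_fin_S s : 0 < s -> (Gammae s < +oo)%E -> (Gammae (s + 1) < +oo)%E.
Proof.
move=> s0 h; have fn : Gammae s \is a fin_num by rewrite ge0_fin_numE ?Gammae_ge0.
apply: (@le_lt_trans _ _ (s * fine (Gammae s) + 1)%:E); last exact: ltry.
apply: Gammae_le_bound => n.
have := Gpart_rec s n; have := gprim_ge0 s n.+2%:R.
have : gprim s (n.+2%:R)^-1 <= 1.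
  have g0 : 0 < (n.+2%:R : R)^-1 by rewrite invr_gt0.
  have nn : (n.+2%:R : R)^-1 <= 1 by rewrite invf_le1// ler1n.
  have p1 : ((n.+2%:R : R)^-1) `^ s <= 1.
    apply: (@le_trans _ _ (1 `^ s)); last by rewrite powR1.
    by apply: ge0_ler_powR; rewrite ?nnegrE// ltW.
  have e1 : expR (- (n.+2%:R : R)^-1) <= 1 by rewrite expR_le1 oppr_le0 ltW.
  apply: (@le_trans _ _ (1 * 1)); last by rewrite mulr1.
  by apply: ler_pM; rewrite ?powR_ge0 ?expR_ge0.
have : Gpart s n <= fine (Gammae s) by rewrite -lee_fin (fineK fn) Gpart_le.
move=> h1 h2 h3 h4; have := ler_wpM2l (ltW s0) h1; lra.
Qed.

Lemma Gammae_fin_P s : 0 < s -> (Gammae (s + 1) < +oo)%E -> (Gammae s < +oo)%E.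
Proof.
move=> s0 h; have fn : Gammae (s + 1) \is a fin_num by rewrite ge0_fin_numE ?Gammae_ge0.
pose k := Num.bound `|s|.
have sk : s <= k%:R by exact: le_trans (ler_norm s) (ltW (archi_boundP (normr_ge0 _))).
apply: (@le_lt_trans _ _ ((fine (Gammae (s + 1)) + (k.+1)`!%:R) / s)%:E); last exact: ltry.
apply: Gammae_le_bound => n; rewrite ler_pdivlMr// mulrC.
have := Gpart_rec s n; have := gprim_ge0 s (n.+2%:R)^-1.
have : Gpart (s + 1) n <= fine (Gammae (s + 1)) by rewrite -lee_fin (fineK fn) Gpart_le.
have n1 : 1 <= (n.+2%:R : R) by rewrite ler1n.
have := gprim_le n1 sk.
have : (k.+1)`!%:R / (n.+2%:R : R) <= (k.+1)`!%:R.
  by rewrite ler_pdivrMr ?ler_peMr.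
move=> q1 q2 q3 q4 q5; have q6 := le_trans q2 q1.
by move: q3 q4 q5 q6; move: (gprim s n.+2%:R) ((k.+1)`!%:R : R) => c d; lra.
Qed.

(** Finiteness climbs from 1 to all positive integers by the recursion; t^s <= 1 + t^k then gives it
    at s + 1, and the recursion read backwards at s. *)
Lemma Gammae_fin s : 0 < s -> (Gammae s < +oo)%E.
Proof.
move=> s0; apply: Gammae_fin_P => //.
have GN n : (Gammae n.+1%:R < +oo)%E.
  elim: n => [|n IH]; first by rewrite Gammae1 ltry.
  by rewrite -natr1; apply: Gammae_fin_S.
pose k := Num.bound `|s|.
have sk : s <= k%:R by exact: le_trans (ler_norm s) (ltW (archi_boundP (normr_ge0 _))).
apply: (@le_lt_trans _ _ (Gammae 1 + Gammae k.+1%:R)%E); last first.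
  by rewrite lte_add_pinfty// (GN 0%N).
rewrite /Gammae -ge0_integralD//=; last 4 first.
- by move=> t _; rewrite lee_fin gfun_ge0.
- exact: measurable_gfunE.
- by move=> t _; rewrite lee_fin gfun_ge0.
- exact: measurable_gfunE.
apply: ge0_le_integral => //.
- by move=> t _; rewrite lee_fin gfun_ge0.
- exact: measurable_gfunE.
- by apply: emeasurable_funD; exact: measurable_gfunE.
move=> t /=; rewrite in_itv /= andbT => t0.
rewrite -EFinD lee_fin /gfun -mulrDl ler_wpM2r ?expR_ge0// subrr powRr0 addrK.
have -> : k.+1%:R - 1 = k%:R :> R by rewrite -natr1 addrK.
have [t1|t1] := leP 1 t.
  by rewrite ler_wpDl// ler_powR.
rewrite ler_wpDr ?powR_ge0//.
by rewrite -(powRr0 t) ger_powR// ?t0 ?ltW.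
Qed.

Lemma Gammae_fin_num s : 0 < s -> Gammae s \is a fin_num.
Proof. by move=> s0; rewrite ge0_fin_numE ?Gammae_ge0// Gammae_fin. Qed.

Lemma Gpart_cvgR s : 0 < s -> Gpart s @ \oo --> Gamma s.
Proof.
move=> s0; rewrite GammaE; apply: fine_cvg.
rewrite (fineK (Gammae_fin_num s0)).
by under eq_fun do rewrite -Gpart_EFin; exact: Gpart_cvg.
Qed.

Lemma GammaS s : 0 < s -> Gamma (s + 1) = s * Gamma s.
Proof.
move=> s0.
have h1 : (fun n => s * Gpart s n - Gpart (s + 1) n) @ \oo --> s * Gamma s - Gamma (s + 1).
  apply: cvgB; last by apply: Gpart_cvgR; rewrite addr_gt0.
  by apply: cvgM; [exact: cvg_cst|exact: Gpart_cvgR].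
have h2 : (fun n => s * Gpart s n - Gpart (s + 1) n) @ \oo --> (0 - 0 : R).
  under eq_fun do rewrite Gpart_rec.
  by apply: cvgB; [exact: gprim_cvgy|exact: gprim_cvg0].
have : s * Gamma s - Gamma (s + 1) = 0 - 0 by exact: (cvg_unique (@Rhausdorff R) h1 h2).
by rewrite subrr => /eqP; rewrite subr_eq0 => /eqP.
Qed.

Lemma Gamma1 : Gamma 1 = 1 :> R.
Proof. by rewrite GammaE Gammae1. Qed.

Lemma Gamma_nat n : Gamma n.+1%:R = n`!%:R :> R.
Proof.
elim: n => [|n IH]; first by rewrite Gamma1.
by rewrite -natr1 GammaS// IH factS natrM.
Qed.

Lemma Gamma_ge0 s : 0 <= Gamma s.
Proof. by rewrite GammaE fine_ge0// Gammae_ge0. Qed.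

(** With y the right-hand side, ln a <= a - 1 is used at x / y and 1 / y with weights tau and 1 -
    tau; the weighted right-hand sides add up to 0. *)
Lemma bernoulli_powR (x tau : R) : 0 < x -> 0 <= tau <= 1 -> x `^ tau <= 1 - tau + tau * x.
Proof.
move=> x0 /andP[t0 t1]; set y := 1 - tau + tau * x.
have y0 : 0 < y.
  rewrite /y; have [->|tn] := eqVneq tau 1; first by rewrite subrr add0r mul1r.
  by rewrite ltr_wpDr ?mulr_ge0 ?(ltW x0)// subr_gt0 lt_neqAle tn.
rewrite /powR gt_eqF// -(lnK y0 : expR (ln y) = y) ler_expR.
have h1 : ln (x / y) <= x / y - 1.
  have := @le_ln1Dx R (x / y - 1); have -> : 1 + (x / y - 1) = x / y by ring.
  apply.
  by rewrite ltrBrDr addrC subrr divr_gt0.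
have h2 : ln (y^-1) <= y^-1 - 1.
  have := @le_ln1Dx R (y^-1 - 1); have -> : 1 + (y^-1 - 1) = y^-1 by ring.
  apply.
  by rewrite ltrBrDr addrC subrr invr_gt0.
rewrite ln_div ?posrE// in h1; rewrite lnV ?posrE// in h2.
have h3 := ler_wpM2l t0 h1.
have t1' : 0 <= 1 - tau by rewrite subr_ge0.
have h4 := ler_wpM2l t1' h2.
have e : tau * (x / y - 1) + (1 - tau) * (y^-1 - 1) = 0.
  have -> : tau * (x / y - 1) + (1 - tau) * (y^-1 - 1) = y / y - 1 by rewrite {3}/y; field; rewrite gt_eqF.
  by rewrite divff ?gt_eqF// subrr.
nra.
Qed.

Lemma Gammae_EFin s : 0 < s -> Gammae s = (Gamma s)%:E.
Proof. by move=> s0; rewrite GammaE fineK// Gammae_fin_num. Qed.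

(* Wendel's inequality, from the weighted AM-GM inequality under the integral sign. *)
Lemma Gamma_wendel a (tau : R) : 0 < a -> 0 <= tau <= 1 -> Gamma (a + tau) <= a `^ tau * Gamma a.
Proof.
move=> a0 t01; have /andP[t0 t1] := t01.
have at0 : 0 < a + tau by rewrite ltr_wpDr.
rewrite -lee_fin -Gammae_EFin//.
have -> : a `^ tau * Gamma a = a `^ tau * (1 - tau) * Gamma a + a `^ tau * (tau / a) * Gamma (a + 1).
  by rewrite GammaS//; field; rewrite gt_eqF.
rewrite EFinD !EFinM -!Gammae_EFin ?addr_gt0// /Gammae -!EFinM.
have c1 : 0 <= a `^ tau * (1 - tau) by rewrite mulr_ge0 ?powR_ge0 ?subr_ge0.
have c2 : 0 <= a `^ tau * (tau / a) by rewrite mulr_ge0 ?powR_ge0// divr_ge0// ltW.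
have g0 s t : (0 <= (gfun s t)%:E)%E by rewrite lee_fin gfun_ge0.
rewrite -!ge0_integralZl_EFin//; try exact: measurable_gfunE.
rewrite -ge0_integralD//; last 4 first.
- by move=> t _; rewrite mule_ge0.
- by apply: measurable_funeM; exact: measurable_gfunE.
- by move=> t _; rewrite mule_ge0.
- by apply: measurable_funeM; exact: measurable_gfunE.
apply: ge0_le_integral => //.
- exact: measurable_gfunE.
- by apply: emeasurable_funD; apply: measurable_funeM; exact: measurable_gfunE.
move=> t /=; rewrite in_itv /= andbT => tp.
rewrite -!EFinM -EFinD lee_fin /gfun.
have tn : t != 0 by rewrite gt_eqF.
have e1 : t `^ (a + tau - 1) = t `^ (a - 1) * t `^ tau.
  by rewrite -powRD ?tn ?implybT//; congr (_ `^ _); ring.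
have e2 : t `^ (a + 1 - 1) = t `^ (a - 1) * t.
  by rewrite -{3}[t]powRr1 ?(ltW tp)// -powRD ?tn ?implybT//; congr (_ `^ _); ring.
rewrite e1 e2.
have e3 : t `^ tau <= a `^ tau * (1 - tau + tau * (t / a)).
  rewrite -{1}[t](divfK (lt0r_neq0 a0)) powRM ?divr_ge0 ?(ltW tp) ?(ltW a0)//.
  by rewrite mulrC ler_wpM2l ?powR_ge0// bernoulli_powR// divr_gt0.
have w0 : 0 <= t `^ (a - 1) * expR (- t) by rewrite mulr_ge0 ?powR_ge0 ?expR_ge0.
have := ler_wpM2l w0 e3; rewrite [leLHS]mulrAC => /le_trans; apply.
by rewrite le_eqVlt; apply/orP; left; apply/eqP; ring.
Qed.

(** A zero at s would, by Wendel's inequality, force Gamma (n + 1) = n! <= 0 for n the integer part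
    of s. *)
Lemma Gamma_gt0 s : 0 < s -> 0 < Gamma s.
Proof.
move=> s0; rewrite lt_neqAle Gamma_ge0 andbT eq_sym; apply/eqP => h.
have [n /andP[h1 h2]] : exists n : nat, n%:R <= s < n.+1%:R.
  by exists (Num.truncn s); exact: truncn_itv (ltW s0).
have t01 : 0 <= n.+1%:R - s <= 1.
  by rewrite subr_ge0 (ltW h2)/= lerBlDr -natr1 addrC lerD2l.
have := Gamma_wendel s0 t01; rewrite h mulr0 addrC subrK Gamma_nat.
by rewrite leNgt ltr0n fact_gt0.
Qed.

End GammaFunction.

(** * Growth of the kernel series *)

Section GammaBounds.
Context {R : realType}.
Implicit Types (s t a b c m x y : R).

(** Wendel's inequality from c - 1 + t up to c, with exponent 1 - t, turned around by the functional
    equation. *)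
Lemma Gamma_wendel_lower c t : 1 < c -> 0 <= t <= 1 -> (c - 1) `^ t * Gamma c <= Gamma (c + t).
Proof.
move=> c1 /andP[t0 t1].
have a0 : 0 < c - 1 + t by rewrite ltr_wpDr// subr_gt0.
have h : Gamma c <= (c - 1 + t) `^ (1 - t) * Gamma (c - 1 + t).
  have t01 : 0 <= 1 - t <= 1 by rewrite subr_ge0 t1 /= gerBl.
  have := Gamma_wendel a0 t01; have -> : c - 1 + t + (1 - t) = c by ring.
  by [].
have -> : Gamma (c + t) = (c - 1 + t) * Gamma (c - 1 + t).
  by rewrite -(GammaS a0); congr Gamma; ring.
apply: (@le_trans _ _ ((c - 1 + t) `^ t * Gamma c)).
  rewrite ler_wpM2r ?Gamma_ge0//; apply: ge0_ler_powR => //; rewrite ?nnegrE ?(ltW a0)//.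
    by rewrite subr_ge0 ltW.
  by rewrite lerDl.
have -> : (c - 1 + t) * Gamma (c - 1 + t) =
    (c - 1 + t) `^ t * ((c - 1 + t) `^ (1 - t) * Gamma (c - 1 + t)).
  rewrite mulrA -powRD ?(gt_eqF a0) ?implybT//.
  by rewrite [t + _]addrC subrK powRr1 ?(ltW a0).
by rewrite ler_wpM2l ?powR_ge0.
Qed.

Lemma Gamma_shift_bounds b (i : nat) : 0 < b ->
  b ^+ i * Gamma b <= Gamma (b + i%:R) <= (b + i%:R) ^+ i * Gamma b.
Proof.
move=> b0; elim: i => [|i /andP[IH1 IH2]]; first by rewrite addr0 !expr0 !mul1r lexx.
have bi : 0 < b + i%:R by rewrite ltr_wpDr.
rewrite -natr1 addrA GammaS// !exprS; apply/andP; split.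
  rewrite -mulrA; apply: ler_pM; rewrite ?mulr_ge0 ?exprn_ge0 ?Gamma_ge0 ?(ltW b0)//.
  by rewrite lerDl.
rewrite -mulrA; apply: ler_pM; rewrite ?Gamma_ge0 ?(ltW bi)//.
  by rewrite lerDl.
apply: le_trans IH2 _; rewrite ler_wpM2r ?Gamma_ge0//.
by rewrite lerXn2r ?nnegrE ?addr_ge0 ?(ltW b0)// lerDl.
Qed.

(** The exponent is split into its integer part, handled by the functional equation, and its
    fractional part, handled by Wendel. With [Gamma_ratio_le] it gives the asymptotics Gamma (b + d)
    ~ b^d Gamma b. *)
Lemma Gamma_ratio_ge b d : 1 < b -> 0 <= d -> (b - 1) `^ d * Gamma b <= Gamma (b + d).
Proof.
move=> b1 d0; have /andP[i1 i2] := truncn_itv d0.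
set i := Num.Def.truncn d in i1 i2.
have b0 : 0 < b by apply: lt_trans b1.
pose t := d - i%:R.
have t01 : 0 <= t <= 1 by rewrite /t subr_ge0 i1 lerBlDr addrC natr1 ltW.
have -> : b + d = b + i%:R + t by rewrite /t; ring.
have bi1 : 1 < b + i%:R by rewrite ltr_wpDr.
apply: le_trans (Gamma_wendel_lower bi1 t01).
have bp : 0 <= b - 1 by rewrite subr_ge0 ltW.
have -> : (b - 1) `^ d = (b - 1) `^ t * (b - 1) ^+ i.
  rewrite -powR_mulrn// -powRD ?subr_eq0 ?(gt_eqF b1) ?implybT//.
  by congr (_ `^ _); rewrite /t subrK.
rewrite -mulrA; apply: ler_pM; rewrite ?powR_ge0 ?mulr_ge0 ?exprn_ge0 ?Gamma_ge0//.
  apply: ge0_ler_powR; rewrite ?nnegrE//; first by case/andP: t01.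
    by rewrite subr_ge0 ltW.
  by rewrite lerD2r lerDl.
have /andP[h _] := Gamma_shift_bounds i b0; apply: le_trans h.
by rewrite ler_wpM2r ?Gamma_ge0// lerXn2r ?nnegrE ?(ltW b0)// gerBl.
Qed.

Lemma Gamma_ratio_le b d : 0 < b -> 0 <= d ->
  Gamma (b + d) <= (b + (Num.Def.truncn d)%:R) `^ d * Gamma b.
Proof.
move=> b0 d0; have /andP[i1 i2] := truncn_itv d0.
set i := Num.Def.truncn d in i1 i2 *.
pose t := d - i%:R.
have t01 : 0 <= t <= 1 by rewrite /t subr_ge0 i1 lerBlDr addrC natr1 ltW.
have -> : b + d = b + i%:R + t by rewrite /t; ring.
have bi : 0 < b + i%:R by rewrite ltr_wpDr.
apply: le_trans (Gamma_wendel bi t01) _.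
have -> : (b + i%:R) `^ d = (b + i%:R) `^ t * (b + i%:R) ^+ i.
  rewrite -powR_mulrn ?(ltW bi)// -powRD ?(gt_eqF bi) ?implybT//.
  by congr (_ `^ _); rewrite /t subrK.
rewrite -mulrA ler_wpM2l ?powR_ge0//.
by have /andP[_] := Gamma_shift_bounds i b0.
Qed.

(** Interpolates between two consecutive terms of the exponential series: X^t <= n^t (1 + X / n) and
    n^t n! <= Gamma (n + 1 + t). The factor 2 comes from 1 / n <= 2 / (n + 1). *)
Lemma powR_div_Gamma_le (X t : R) (n : nat) : 0 < X -> (0 < n)%N -> 0 <= t <= 1 ->
  X `^ (n%:R + t) / Gamma (n.+1%:R + t) <= X ^+ n / n`!%:R + 2 * (X ^+ n.+1 / n.+1`!%:R).
Proof.
move=> X0 n0 t01.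
have n0' : 0 < (n%:R : R) by rewrite ltr0n.
have f0 : 0 < (n`!%:R : R) by rewrite ltr0n fact_gt0.
have n1 : 1 < (n.+1%:R : R) by rewrite ltr1n.
have := Gamma_wendel_lower n1 t01; rewrite Gamma_nat -natr1 addrK natr1 => h.
have g0 : 0 < Gamma (n.+1%:R + t) by apply: Gamma_gt0; rewrite ltr_wpDr//; case/andP: t01.
have p0 : 0 < n%:R `^ t * n`!%:R by rewrite mulr_gt0 ?powR_gt0.
apply: (@le_trans _ _ (X `^ (n%:R + t) / (n%:R `^ t * n`!%:R))).
  by rewrite ler_wpM2l ?powR_ge0// lef_pV2 ?posrE.
have -> : X `^ (n%:R + t) = X ^+ n * X `^ t.
  by rewrite powRD ?(gt_eqF X0) ?implybT// powR_mulrn ?ltW.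
have hb : X `^ t <= n%:R `^ t * (1 + X / n%:R).
  have -> : X `^ t = n%:R `^ t * (X / n%:R) `^ t.
    by rewrite -powRM ?divr_ge0 ?(ltW X0) ?(ltW n0')// mulrCA divff ?mulr1// gt_eqF.
  rewrite ler_wpM2l ?powR_ge0//; apply: le_trans (bernoulli_powR _ t01) _.
    by rewrite divr_gt0.
  case/andP: t01 => t0 t1; apply: lerD; first by rewrite gerBl.
  by rewrite ler_piMl ?divr_ge0 ?(ltW X0).
rewrite ler_pdivrMr//; apply: le_trans (ler_wpM2l (exprn_ge0 _ (ltW X0)) hb) _.
rewrite mulrCA [leRHS]mulrC -[leRHS]mulrA ler_wpM2l ?powR_ge0//.
rewrite [leRHS]mulrDr factS natrM exprS.
have -> : n`!%:R * (X ^+ n / n`!%:R) = X ^+ n by field; rewrite gt_eqF.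
have -> : n`!%:R * (2 * (X * X ^+ n / (n.+1%:R * n`!%:R))) = X ^+ n * (2 * X / n.+1%:R).
  by field; rewrite !gt_eqF// ltr_wpDl.
rewrite [leLHS]mulrDr mulr1 lerD2l ler_wpM2l ?exprn_ge0 ?(ltW X0)//.
rewrite ler_pdivrMr// mulrAC ler_pdivlMr// [2 * X]mulrC -!mulrA ler_wpM2l ?(ltW X0)//.
by rewrite -natrM ler_nat; lia.
Qed.

End GammaBounds.

(** * Mittag-Leffler coefficients and the size of their partial sums *)

Section MittagLeffler.
Context {R : realType}.
Variable m : R.
Hypothesis m1 : 1 <= m.
Implicit Types (x y : R).

Let m0 : 0 < m. Proof. exact: lt_le_trans m1. Qed.

(** Coefficients of the two-parameter Mittag-Leffler function with both parameters 1 / m. *)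
Definition mlc (k : nat) : R := (Gamma (k.+1%:R / m))^-1.

Lemma mlc_gt0 k : 0 < mlc k.
Proof. by rewrite invr_gt0 Gamma_gt0// divr_gt0. Qed.

(** Block boundary: for kap n <= k < kap (n + 1) the Gamma argument (k + 1) / m lies between n + 1
    and n + 2. *)
Let kap (n : nat) := Num.Def.truncn (m * n.+1%:R).

Let kap_itv n : (kap n)%:R <= m * n.+1%:R < (kap n).+1%:R.
Proof. by apply: truncn_itv; rewrite mulr_ge0// ltW. Qed.

Let kap_ge n : (n < kap n)%N.
Proof.
have /andP[_ h] := kap_itv n; rewrite -ltnS -(ltr_nat R); apply: le_lt_trans h.
by rewrite ler_peMl.
Qed.

Let kap_le n : (kap n <= kap n.+1)%N.
Proof.
have /andP[h1 _] := kap_itv n; have /andP[_ h2] := kap_itv n.+1.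
rewrite -ltnS -(ltr_nat R); apply: le_lt_trans h2; apply: le_trans h1 _.
by rewrite ler_wpM2l ?(ltW m0)// ler_nat.
Qed.

Let kap_diff n : (kap n.+1 - kap n)%:R <= m + 1.
Proof.
have /andP[_ h1] := kap_itv n; have /andP[h2 _] := kap_itv n.+1.
rewrite natrB ?kap_le//.
have e : m * n.+2%:R = m * n.+1%:R + m by rewrite -natr1 mulrDr mulr1.
rewrite e in h2; rewrite -natr1 in h1; lra.
Qed.

(** Writing k + 1 = m (n + 1 + t) gives x^k = x^(m - 1) (x^m)^(n + t), which is the origin of the
    factor x^(m - 1). *)
Lemma mlc_term_le x (n k : nat) : 1 <= x -> (0 < n)%N -> (kap n <= k < kap n.+1)%N ->
  mlc k * x ^+ k <= x `^ (m - 1) * ((x `^ m) ^+ n / n`!%:R + 2 * ((x `^ m) ^+ n.+1 / n.+1`!%:R)).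
Proof.
move=> x1 n0 /andP[k1 k2]; have x0 : 0 < x by apply: lt_le_trans x1.
have /andP[_ h1] := kap_itv n; have /andP[h2 _] := kap_itv n.+1.
pose t := k.+1%:R / m - n.+1%:R.
have t01 : 0 <= t <= 1.
  rewrite /t subr_ge0 lerBlDl natr1 ler_pdivlMr// ler_pdivrMr//.
  rewrite ![_ * m]mulrC (le_trans _ h2) ?ler_nat// andbT.
  by rewrite (le_trans (ltW h1))// ler_nat.
have X0 : 0 < x `^ m by rewrite powR_gt0.
have := powR_div_Gamma_le X0 n0 t01.
rewrite {2}/t [n.+1%:R + _]addrC subrK => h.
have -> : mlc k * x ^+ k = x `^ (m - 1) * ((x `^ m) `^ (n%:R + t) / Gamma (k.+1%:R / m)).
  rewrite /mlc mulrA [RHS]mulrC; congr (_ * _).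
  rewrite -powRrM -powRD ?(gt_eqF x0) ?implybT// -powR_mulrn ?(ltW x0)//; congr (_ `^ _).
  by rewrite /t -!natr1; field; rewrite gt_eqF.
by rewrite ler_wpM2l ?powR_ge0.
Qed.

Lemma exp_partial_le x n : 0 <= x -> \sum_(k < n) x ^+ k / k`!%:R <= expR x.
Proof.
move=> x0; have h := @is_cvg_series_exp_coeff R x.
have nd : {homo series (exp_coeff x) : n m / (n <= m)%N >-> n <= m}.
  apply/nondecreasing_seqP => i; rewrite seriesSr lerDl /exp_coeff /=.
  by rewrite divr_ge0 ?exprn_ge0.
have <- : series (exp_coeff x) n = \sum_(k < n) x ^+ k / k`!%:R by rewrite /series /= big_mkord.
exact: nondecreasing_cvgn_le.
Qed.

(* The sum is cut into blocks of at most [m + 1] indices on which [(k + 1) / m] stays in a unit interval. *)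
Lemma ml_bound_ge1 : exists2 C : R, 0 < C & forall x n, 1 <= x ->
  \sum_(k < n) mlc k * x ^+ k <= C * (x `^ (m - 1) * expR (x `^ m)).
Proof.
pose S0 := \sum_(k < kap 1) mlc k.
have S00 : 0 <= S0 by apply: sumr_ge0 => k _; rewrite ltW// mlc_gt0.
have c00 : 0 <= (m + 1) * 3 by rewrite mulr_ge0// addr_ge0// ltW.
exists (S0 + (m + 1) * 3 + 1); first by rewrite ltr_wpDl// addr_ge0.
move=> x n x1; have x0 : 0 < x by apply: lt_le_trans x1.
pose X := x `^ m; pose W := x `^ (m - 1).
have X0 : 0 < X by rewrite powR_gt0.
have W0 : 0 < W by rewrite powR_gt0.
have t0 k : 0 <= mlc k * x ^+ k by rewrite mulr_ge0 ?exprn_ge0 ?(ltW x0) ?(ltW (mlc_gt0 _)).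
have base : \sum_(k < kap 1) mlc k * x ^+ k <= S0 * (W * expR X).
  rewrite /S0 mulr_suml; apply: ler_sum => k _; rewrite ler_wpM2l ?(ltW (mlc_gt0 _))//.
  (* Below the first block k + 1 <= 2 m, hence x^k <= x^(m - 1) x^m, which the exponential
     absorbs. *)
  have kk : k%:R <= 2 * m - 1.
    have /andP[h _] := kap_itv 1; have := ltn_ord k; rewrite -(ler_nat R) -natr1 => h2.
    by have := le_trans h2 h; lra.
  rewrite -powR_mulrn ?(ltW x0)//; apply: (@le_trans _ _ (x `^ (2 * m - 1))); first by rewrite ler_powR.
  have -> : x `^ (2 * m - 1) = W * X.
    by rewrite /W /X -powRD ?(gt_eqF x0) ?implybT//; congr (_ `^ _); ring.
  rewrite ler_wpM2l ?(ltW W0)//; apply: le_trans (expR_ge1Dx X); by rewrite lerDr.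
have blocks N : \sum_(k < kap N.+1) mlc k * x ^+ k <= S0 * (W * expR X) +
    (m + 1) * (W * (\sum_(1 <= n < N.+1) (X ^+ n / n`!%:R + 2 * (X ^+ n.+1 / n.+1`!%:R)))).
  elim: N => [|N IH]; first by rewrite big_nil !mulr0 addr0.
  rewrite -(big_mkord xpredT (fun k => mlc k * x ^+ k)) (big_cat_nat _ (kap_le N.+1))//= big_mkord.
  rewrite big_nat_recr//=; set A := \sum_(1 <= i < N.+1) _ in IH *; set B := _ + 2 * _.
  have -> : S0 * (W * expR X) + (m + 1) * (W * (A + B)) =
    (S0 * (W * expR X) + (m + 1) * (W * A)) + (m + 1) * (W * B) by ring.
  apply: lerD => //; rewrite /B.
  apply: (@le_trans _ _ (\sum_(kap N.+1 <= k < kap N.+2) (W * (X ^+ N.+1 / N.+1`!%:R + 2 * (X ^+ N.+2 / N.+2`!%:R))))).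
    rewrite big_nat [leRHS]big_nat; apply: ler_sum => k hk; exact: mlc_term_le.
  rewrite sumr_const_nat -[leLHS]mulr_natl ler_wpM2r ?kap_diff//.
  have p0 i : 0 <= X ^+ i / i`!%:R by rewrite divr_ge0// exprn_ge0// ltW.
  by rewrite mulr_ge0 ?(ltW W0)// addr_ge0// mulr_ge0.
have : \sum_(k < n) mlc k * x ^+ k <= \sum_(k < kap n.+1) mlc k * x ^+ k.
  have nk : (n <= kap n.+1)%N by apply: leq_trans (ltnW (kap_ge _)).
  rewrite -!(big_mkord xpredT (fun k => mlc k * x ^+ k)) (big_cat_nat _ nk)//= lerDl.
  by apply: sumr_ge0 => *; exact: t0.
move=> /le_trans; apply; apply: le_trans (blocks n) _.
have E0 : 0 <= expR X by exact: expR_ge0.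
have key : \sum_(1 <= i < n.+1) (X ^+ i / i`!%:R + 2 * (X ^+ i.+1 / i.+1`!%:R)) <= 3 * expR X.
  have p0 i : 0 <= X ^+ i / i`!%:R by rewrite divr_ge0// exprn_ge0// ltW.
  have -> : 3 * expR X = expR X + 2 * expR X by ring.
  rewrite big_split /= -mulr_sumr; apply: lerD.
    apply: le_trans (exp_partial_le n.+1 (ltW X0)).
    by rewrite big_add1 /= big_mkord big_ord_recl lerDr.
  rewrite ler_wpM2l//; apply: le_trans (exp_partial_le n.+2 (ltW X0)).
  by rewrite big_add1 /= big_mkord !big_ord_recl addrA lerDr addr_ge0.
have WE : 0 <= W * expR X by rewrite mulr_ge0// ltW.
have m10 : 0 <= m + 1 by rewrite addr_ge0// ltW.
have := ler_wpM2l (ltW W0) key => /(ler_wpM2l m10) h.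
have -> : (S0 + (m + 1) * 3 + 1) * (W * expR X) = S0 * (W * expR X) + (m + 1) * (W * (3 * expR X)) + W * expR X.
  by ring.
by rewrite -addrA lerD2l (le_trans h)// lerDl.
Qed.

Lemma ml_bound : exists2 C : R, 0 < C & forall x n, 0 <= x ->
  \sum_(k < n) mlc k * x ^+ k <= C * ((1 + x) `^ (m - 1) * expR (x `^ m)).
Proof.
have [C C0 hC] := ml_bound_ge1; exists (C * expR 1); first by rewrite mulr_gt0// expR_gt0.
move=> x n x0; have m10 : 0 <= m - 1 by rewrite subr_ge0.
have [x1|x1] := leP 1 x.
  apply: le_trans (hC x n x1) _; rewrite -mulrA ler_wpM2l ?(ltW C0)//.
  rewrite -[leLHS]mul1r; apply: ler_pM; rewrite ?mulr_ge0 ?powR_ge0 ?expR_ge0//.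
    by rewrite -{1}(@expR0 R) ler_expR.
  rewrite ler_wpM2r ?expR_ge0//; apply: ge0_ler_powR => //; rewrite ?nnegrE ?addr_ge0//.
  by rewrite lerDr.
apply: (@le_trans _ _ (\sum_(k < n) mlc k * 1 ^+ k)).
  apply: ler_sum => k _; rewrite ler_wpM2l ?(ltW (mlc_gt0 _))// lerXn2r ?nnegrE// ltW//.
apply: le_trans (hC 1 n (lexx 1)) _; rewrite !powR1 mul1r -mulrA ler_wpM2l ?(ltW C0)//.
rewrite ler_peMr ?expR_ge0//.
have h1 : 1 <= (1 + x) `^ (m - 1).
  by rewrite -{1}(powRr0 (1 + x)) ler_powR// lerDl.
have h2 : 1 <= expR (x `^ m) by rewrite -{1}(@expR0 R) ler_expR powR_ge0.
by rewrite -[leLHS]mulr1; apply: ler_pM.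
Qed.

Definition mlC (k : nat) : R[i] := (mlc k)%:C%C.

Lemma pscoef_ml : pscoef mlC.
Proof.
have [C C0 hC] := ml_bound; move=> r r0.
exists (C * ((1 + r) `^ (m - 1) * expR (r `^ m))) => k.
apply: le_trans (hC r k.+1 r0); rewrite big_ord_recr /= cmodR ger0_norm ?(ltW (mlc_gt0 _))// lerDr.
by apply: sumr_ge0 => i _; rewrite mulr_ge0 ?exprn_ge0 ?(ltW (mlc_gt0 _)).
Qed.

Lemma Kern_PS (z w : R[i]) : Kern m z w = (m / pi)%:C%C * PS mlC (z * (w^*)%C).
Proof.
rewrite /Kern /PS; congr (_ * csum _); apply/funext => k.
by rewrite mulrC /mlC /mlc fmorphV.
Qed.

End MittagLeffler.

(** * Positivity of the kernel series *)

Section Positivity.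
Context {R : realType}.
Local Notation Re := complex.Re.
Local Notation Im := complex.Im.
Implicit Types (c d : nat -> R) (z : R[i]) (x y : R).

Definition egf c : nat -> R[i] := fun k => (c k / k`!%:R)%:C%C.
Definition rpos z : R := Num.max (Re z) 0.

(* Exponential generating functions with [|f z| <= f (Re z)^+]; transforms of positive measures on
   the half line have this property. *)
Definition posdef c := [/\ forall k, 0 <= c k, pscoef (egf c) &
  forall z, cmod (PS (egf c) z) <= Re (PS (egf c) (rpos z)%:C%C)].

Lemma rpos_ge0 z : 0 <= rpos z. Proof. by rewrite /rpos le_max lexx orbT. Qed.
Lemma rpos_ge z : Re z <= rpos z. Proof. by rewrite /rpos le_max lexx. Qed.
Lemma real_complexM x y : (x * y)%:C%C = x%:C%C * y%:C%C. Proof. exact: rmorphM. Qed.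
Lemma rposZ x z : 0 <= x -> rpos (x%:C%C * z) = x * rpos z.
Proof. by move=> x0; rewrite /rpos ReZl maxr_pMr// mulr0. Qed.

Lemma egfD c d : egf (fun k => c k + d k) = fun k => egf c k + egf d k.
Proof. by apply/funext => k; rewrite /egf mulrDl rmorphD. Qed.
Lemma egfZ x c : egf (fun k => x * c k) = fun k => x%:C%C * egf c k.
Proof. by apply/funext => k; rewrite /egf -mulrA rmorphM. Qed.

Lemma pscoef_dom c d : (forall k, 0 <= c k <= d k) -> pscoef (egf d) -> pscoef (egf c).
Proof.
move=> cd hd r r0; have [M hM] := hd r r0; exists M => k; apply: le_trans (hM k).
have /andP[c0 ck] := cd k.
rewrite ler_wpM2r ?exprn_ge0// /egf !cmodR !ger0_norm ?divr_ge0 ?(le_trans c0 ck)//.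
by rewrite ler_wpM2r// invr_ge0.
Qed.

Lemma posdef_exp x : 0 <= x -> posdef (fun k => x ^+ k).
Proof.
move=> x0.
have e z : PS (egf (fun k => x ^+ k)) z = cexp (x%:C%C * z).
  rewrite -PS_exp /PS; congr csum; apply/funext => k.
  by rewrite /egf /expcoef exprMn real_complexX mulrA -rmorphM [_^-1 * _]mulrC.
split => [k| |z]; first by rewrite exprn_ge0.
  move=> r r0; have [M hM] := pscoef_exp (mulr_ge0 x0 r0); exists M => k.
  apply: le_trans (hM k); rewrite !cmodR !ger0_norm ?divr_ge0 ?invr_ge0 ?exprn_ge0//.
  by rewrite exprMn mulrAC mulrC mulrA.
rewrite !e cmod_cexp -rmorphM /cexp /= cos0 mulr1 ler_expR ReZl.
by rewrite ler_wpM2l// rpos_ge.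
Qed.

Lemma posdef_scale c x : 0 <= x -> posdef c -> posdef (fun k => c k * x ^+ k).
Proof.
move=> x0 [c0 pc hc].
have e z : PS (egf (fun k => c k * x ^+ k)) z = PS (egf c) (x%:C%C * z).
  rewrite /PS; congr csum; apply/funext => k.
  by rewrite /egf exprMn real_complexX mulrA -rmorphM; congr (_%:C%C * _); rewrite mulrAC.
split => [k| |z]; first by rewrite mulr_ge0 ?exprn_ge0.
  move=> r r0; have [M hM] := pc (x * r) (mulr_ge0 x0 r0); exists M => k.
  apply: le_trans (hM k); rewrite !cmodR !ger0_norm ?divr_ge0 ?mulr_ge0 ?exprn_ge0//.
  by rewrite exprMn !mulrA le_eqVlt; apply/orP; left; apply/eqP; ring.
have q : x%:C%C * (rpos z)%:C%C = (rpos (x%:C%C * z))%:C%C by rewrite (rposZ _ x0) real_complexM.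
have h2 := e (rpos z)%:C%C; rewrite q in h2.
have aux (a1 a2 b1 b2 : R[i]) : a1 = b1 -> a2 = b2 -> cmod b1 <= Re b2 -> cmod a1 <= Re a2 by move=> -> ->.
exact: (aux _ _ _ _ (e z) h2 (hc (x%:C%C * z))).
Qed.

Lemma posdefD c d : posdef c -> posdef d -> posdef (fun k => c k + d k).
Proof.
move=> [c0 pc hc] [d0 pd hd]; split => [k| |z]; first exact: addr_ge0.
  by rewrite egfD; exact: pscoefD.
rewrite egfD !PSD// ReD; apply: le_trans (cmodD _ _) _; exact: lerD.
Qed.

Lemma posdefZ x c : 0 <= x -> posdef c -> posdef (fun k => x * c k).
Proof.
move=> x0 [c0 pc hc]; split => [k| |z]; first exact: mulr_ge0.
  by rewrite egfZ; exact: pscoefZ.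
by rewrite egfZ !PSZ// cmodM cmodR ger0_norm// ReZl ler_wpM2l.
Qed.

Lemma posdef0 : posdef (fun=> 0).
Proof.
have := posdefZ (lexx (0 : R)) (posdef_exp (lexx (0 : R))).
by congr posdef; apply/funext => k; rewrite mul0r.
Qed.

Lemma posdef_sum (n : nat) (c : nat -> nat -> R) : (forall i, posdef (c i)) ->
  posdef (fun k => \sum_(i < n) c i k).
Proof.
move=> hc; elim: n => [|n IH].
  by have := posdef0; congr posdef; apply/funext => k; rewrite big_ord0.
by have := posdefD IH (hc n); congr posdef; apply/funext => k; rewrite big_ord_recr.
Qed.

(** The majorant [d] lets Tannery's theorem carry both sides of the inequality to the limit. *)
Lemma posdef_lim (c : nat -> nat -> R) d l : (forall n, posdef (c n)) ->
  (forall n k, c n k <= d k) -> pscoef (egf d) ->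
  (forall k, c ^~ k @ \oo --> l k) -> posdef l.
Proof.
move=> hc cd pd cl.
have l0 k : 0 <= l k.
  rewrite -(cvg_lim _ (cl k))//; apply: limr_ge; first exact: cvgP (cl k).
  by apply: nearW => n; have [] := hc n.
have ld k : l k <= d k.
  by rewrite -(cvg_lim _ (cl k))//; apply: limr_le; [exact: cvgP (cl k)|exact: nearW].
have pl : pscoef (egf l) by apply: pscoef_dom pd => k; rewrite l0 ld.
have lim z : ccvg (fun n => PS (egf (c n)) z) (PS (egf l) z).
  have H2 n k : cmod (egf (c n) k * z ^+ k) <= cmod (egf d k) * cmod z ^+ k.
    rewrite cmodM cmodX ler_wpM2r ?exprn_ge0 ?cmod_ge0// /egf !cmodR.
    have [c0 _ _] := hc n; rewrite !ger0_norm ?divr_ge0 ?(le_trans (c0 k) (cd n k))//.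
    by rewrite ler_wpM2r// invr_ge0.
  have H3 k : ccvg (fun n => egf (c n) k * z ^+ k) (egf l k * z ^+ k).
    apply: ccvgM; last exact: ccvg_cst.
    by apply: ccvgR; apply: cvgM; [exact: cl|exact: cvg_cst].
  by have [_] := tannery (pscoef_sum pd (cmod_ge0 z)) H2 H3.
split => // z.
apply: (ler_cvg_to (ccvg_cmod (lim z)) (lim _).1).
by apply: nearW => n; have [_ _] := hc n.
Qed.

Lemma diff_pow_bounds (a : R) (p : nat) : 0 <= a ->
  p.+1%:R * a ^+ p <= (a + 1) ^+ p.+1 - a ^+ p.+1 <= p.+1%:R * (a + 1) ^+ p.
Proof.
move=> a0; elim: p => [|p /andP[IH1 IH2]].
  by rewrite !expr0 !expr1 addrAC subrr add0r mulr1 lexx.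
have -> : (a + 1) ^+ p.+2 - a ^+ p.+2 = (a + 1) * ((a + 1) ^+ p.+1 - a ^+ p.+1) + a ^+ p.+1.
  by rewrite [(a + 1) ^+ p.+2]exprS [a ^+ p.+2]exprS; ring.
move: IH1 IH2; set D := (a + 1) ^+ p.+1 - a ^+ p.+1 => IH1 IH2.
have ap : 0 <= a ^+ p by rewrite exprn_ge0.
have a1 : 0 <= a + 1 by rewrite addr_ge0.
have D0 : 0 <= D by apply: le_trans IH1; rewrite mulr_ge0.
have i1 := ler_wpM2l a0 IH1; have i2 := ler_wpM2l a1 IH2.
have i3 : a ^+ p.+1 <= (a + 1) ^+ p.+1 by rewrite lerXn2r ?nnegrE// lerDl.
have e1 : a * (p.+1%:R * a ^+ p) = p.+1%:R * a ^+ p.+1 by rewrite exprS mulrCA.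
have e2 : (a + 1) * (p.+1%:R * (a + 1) ^+ p) = p.+1%:R * (a + 1) ^+ p.+1.
  by rewrite [(a + 1) ^+ p.+1]exprS mulrCA.
rewrite e1 in i1; rewrite e2 in i2; rewrite -[p.+2%:R]natr1.
by apply/andP; split; lra.
Qed.

(** Riemann sums of t^p on [0, 1]; the power sums are squeezed by telescoping [diff_pow_bounds]. *)
Lemma riemann_pow (p : nat) :
  (fun n : nat => n.+1%:R^-1 * \sum_(i < n.+1) (i.+1%:R / n.+1%:R) ^+ p) @ \oo --> (p.+1%:R^-1 : R).
Proof.
pose S n : R := \sum_(i < n) i.+1%:R ^+ p.
have S1 n : n%:R ^+ p.+1 <= p.+1%:R * S n.
  elim: n => [|n IH]; first by rewrite /S big_ord0 mulr0 expr0n.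
  rewrite /S big_ord_recr /= mulrDr.
  have /andP[_ h] := diff_pow_bounds p (ler0n R n); rewrite natr1 in h.
  by move: IH h; rewrite /S; lra.
have S2 n : p.+1%:R * S n <= n.+1%:R ^+ p.+1.
  elim: n => [|n IH]; first by rewrite /S big_ord0 mulr0 exprn_ge0.
  rewrite /S big_ord_recr /= mulrDr.
  have /andP[h _] := diff_pow_bounds p (ler0n R n.+1); rewrite natr1 in h.
  by move: IH h; rewrite /S; lra.
have p0 : (0 : R) < p.+1%:R by [].
have e n : n.+1%:R^-1 * \sum_(i < n.+1) (i.+1%:R / n.+1%:R) ^+ p = S n.+1 / n.+1%:R ^+ p.+1 :> R.
  rewrite /S exprS invfM mulrA [S _ * _]mulrC -mulrA; congr (_ * _).
  by rewrite mulr_suml; apply: eq_bigr => i _; rewrite exprMn exprVn.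
have u : (fun n : nat => (1 + n.+1%:R^-1) ^+ p.+1 / p.+1%:R) @ \oo --> (p.+1%:R^-1 : R).
  rewrite -[X in _ --> X]mul1r.
  apply: cvgM; last exact: cvg_cst.
  have c1 : (fun n : nat => 1 + n.+1%:R^-1) @ \oo --> (1 : R).
    by rewrite -[X in _ --> X]addr0; apply: cvgD; [exact: cvg_cst|exact: cvg_harmonic].
  elim: (p.+1) => [|q IH]; first by under eq_fun do rewrite expr0; exact: cvg_cst.
  rewrite -[X in _ --> X]mul1r; under eq_fun do rewrite exprS; exact: cvgM.
apply: (squeeze_cvgr _ (@cvg_cst _ (p.+1%:R^-1 : R) _ _ _) u).
apply: nearW => n; rewrite e.
have n0 : (0 : R) < n.+1%:R by [].
have nn : 0 < (n.+1%:R : R) ^+ p.+1 by rewrite exprn_gt0.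
apply/andP; split.
  rewrite -[leLHS]mul1r ler_pdivrMr// mulrAC ler_pdivlMr// mul1r mulrC; exact: S1.
rewrite ler_pdivrMr// mulrAC ler_pdivlMr// mulrC -exprMn mulrDl mul1r mulVf ?gt_eqF// natr1.
exact: S2.
Qed.

(** Since 1 / (k + p + 1) is the integral of t^(k + p) over [0, 1], the new sequence is a limit of
    positive combinations of the scaled sequences c_k t^k. *)
Lemma posdef_div c (p : nat) : posdef c -> posdef (fun k => c k / (k + p).+1%:R).
Proof.
move=> hc; have [c0 pc _] := hc.
pose w (n i : nat) : R := i.+1%:R / n.+1%:R.
have w0 n i : 0 <= w n i by rewrite divr_ge0.
apply: (@posdef_lim (fun n k => n.+1%:R^-1 * \sum_(i < n.+1) w n i ^+ p * (c k * w n i ^+ k)) c) => //.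
- move=> n; apply: posdefZ; first by rewrite invr_ge0.
  by apply: (@posdef_sum n.+1 (fun i k => w n i ^+ p * (c k * w n i ^+ k))) => i; apply: posdefZ; [rewrite exprn_ge0|exact: posdef_scale].
- move=> n k; have n0 : (0 : R) < n.+1%:R by [].
  rewrite mulrC ler_pdivrMr// mulr_natr -[X in c k *+ X](card_ord n.+1) -sumr_const.
  apply: ler_sum => i _; have w1 : w n i <= 1 by rewrite ler_pdivrMr// mul1r ler_nat.
  rewrite mulrCA ler_piMr// -exprD exprn_ile1//.
- move=> k.
  suff h : (fun n : nat => c k * (n.+1%:R^-1 * \sum_(i < n.+1) (i.+1%:R / n.+1%:R) ^+ (k + p))) @ \oo -->
      c k * ((k + p).+1%:R^-1 : R).
    apply: cvg_trans h; apply: near_eq_cvg; apply: nearW => n.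
    rewrite mulrCA; congr (_ * _); rewrite mulr_sumr.
    by apply: eq_bigr => i _; rewrite exprD /w; ring.
  by apply: cvgM; [exact: cvg_cst|exact: riemann_pow].
Qed.

Lemma posdef_step c (p : nat) (b : R) : 0 <= b -> posdef c ->
  posdef (fun k => c k * (1 + b / (k + p).+1%:R)).
Proof.
move=> b0 hc; have := posdefD hc (posdefZ b0 (posdef_div p hc)).
by congr posdef; apply/funext => k; ring.
Qed.

Lemma rising_Gamma (a : R) n : 0 < a -> \prod_(j < n) (a + j%:R) = Gamma (a + n%:R) / Gamma a.
Proof.
move=> a0; have g := Gamma_gt0 a0; elim: n => [|n IH].
  by rewrite big_ord0 addr0 divff// gt_eqF.
rewrite big_ord_recr /= IH -natr1 addrA GammaS ?ltr_wpDr//; ring.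
Qed.

Lemma powR_ratio_cvg (q d : R) : 0 <= q ->
  (fun n : nat => (n.+1%:R / (n.+1%:R + q)) `^ d) @ \oo --> (1 : R).
Proof.
move=> q0.
have c : (fun n : nat => n.+1%:R / (n.+1%:R + q)) @ \oo --> (1 : R).
  have h : (fun n : nat => (1 + q * n.+1%:R^-1)^-1) @ \oo --> (1 : R).
    rewrite -[X in _ --> X]invr1; apply: cvgV; first exact: oner_neq0.
    rewrite -[X in _ --> X]addr0; apply: cvgD; first exact: cvg_cst.
    by rewrite -(mulr0 q); apply: cvgM; [exact: cvg_cst|exact: cvg_harmonic].
  apply: cvg_trans h; apply: near_eq_cvg; apply: nearW => n.
  have n0 : (0 : R) < n.+1%:R by [].
  have e (N : R) : 0 < N -> (1 + q * N^-1)^-1 = N / (N + q).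
    move=> N0; have Nq : 0 < N + q by rewrite ltr_wpDr.
    have -> : 1 + q * N^-1 = (N + q) / N by field; rewrite gt_eqF.
    by rewrite invf_div.
  exact: e.
have cp : {for (1 : R), continuous (fun x => x `^ d)}.
  apply: differentiable_continuous; apply/derivable1_diffP.
  by have [] := is_derive1_powR d (ltr01 : 0 < (1 : R)).
by have := cvg_comp _ _ c cp; rewrite powR1.
Qed.

(** * Gauss' product and the positivity of the kernel series *)

Section ml.
Variable m : R.
Hypothesis m1 : 1 <= m.
Let m0 : 0 < m. Proof. exact: lt_le_trans m1. Qed.

(* Gauss' limit for the quotient [Gamma s / Gamma (s / m)] at [s = k + 1]. *)
Let app (n k : nat) : R := m ^- n.+2 * (n.+1%:R `^ (1 - m^-1)) *
  (\prod_(j < n.+2) (1 + (m - 1) * j%:R / (k + j).+1%:R) * (n.+1%:R `^ (1 - m^-1)) ^+ k).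

Let app_posdef n : posdef (app n).
Proof.
apply: posdefZ; first by rewrite mulr_ge0 ?powR_ge0// invr_ge0 exprn_ge0// ltW.
apply: posdef_scale; first exact: powR_ge0.
elim: (n.+2) => [|q IH].
  have := posdef_exp (ler01 : 0 <= (1 : R)); congr posdef; apply/funext => k.
  by rewrite big_ord0 expr1n.
(* The place where m >= 1 gives the product factors the sign that [posdef_step] requires. *)
have b0 : 0 <= (m - 1) * q%:R by rewrite mulr_ge0// subr_ge0.
by have := posdef_step q b0 IH; congr posdef; apply/funext => k; rewrite big_ord_recr.
Qed.

Let sk (k : nat) : R := k.+1%:R.
Let del k := sk k - sk k / m.

(** Quotient of the approximation by its limit. That it is at most 1 provides the majorant for
    [posdef_lim]; that it tends to 1 identifies the limit. *)
Let rho n k := n.+1%:R `^ del k * Gamma (sk k / m + n.+2%:R) / Gamma (sk k / m + n.+2%:R + del k).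

Let appE n k : app n k = rho n k * (k`!%:R * mlc m k).
Proof.
have s0 : 0 < sk k by [].
have sm0 : 0 < sk k / m by rewrite divr_gt0.
have e1 : \prod_(j < n.+2) (1 + (m - 1) * j%:R / (k + j).+1%:R) =
   \prod_(j < n.+2) (m * (sk k / m + j%:R)) / \prod_(j < n.+2) (sk k + j%:R).
  rewrite -prodf_div; apply: eq_bigr => j _.
  have -> : (k + j).+1%:R = sk k + j%:R :> R by rewrite /sk -natrD addSn.
  have : 0 < sk k + j%:R by rewrite ltr_wpDr.
  by move=> h; field; rewrite !gt_eqF.
rewrite /app e1 big_split /= prodr_const card_ord !rising_Gamma//.
have -> : Gamma (sk k) = k`!%:R by rewrite /sk Gamma_nat.
have -> : sk k + n.+2%:R = sk k / m + n.+2%:R + del k by rewrite /del; ring.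
rewrite /rho.
have -> : n.+1%:R `^ del k = n.+1%:R `^ (1 - m^-1) * (n.+1%:R `^ (1 - m^-1)) ^+ k.
  rewrite -exprS -powR_mulrn ?powR_ge0// -powRrM; congr (_ `^ _).
  by rewrite /del /sk; field; rewrite gt_eqF.
rewrite /mlc -/(sk k).
have f0 : (k`!%:R : R) != 0 by rewrite pnatr_eq0 -lt0n fact_gt0.
have g1 := Gamma_gt0 sm0.
have d0 : 0 <= del k by rewrite /del subr_ge0 ler_pdivrMr// ler_peMr.
have g2 : 0 < Gamma (sk k / m + n.+2%:R + del k).
  by apply: Gamma_gt0; rewrite ltr_wpDr// ltr_wpDr.
have mn : m ^+ n.+2 != 0 by rewrite expf_neq0// gt_eqF.
have alg (A B C M D E K : R) : C != 0 -> B != 0 -> M != 0 -> K != 0 ->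
  M^-1 * D * (M * (A / C) / (B / K) * E) = D * E * A / B * (K / C) by move=> *; field; apply/and4P.
by apply: alg => //; rewrite gt_eqF.
Qed.

Let rho_bounds n k : (n.+1%:R / (n.+1%:R + (sk k / m + 1 + (Num.Def.truncn (del k))%:R))) `^ del k <= rho n k <= 1.
Proof.
have s0 : 0 < sk k by [].
have sm0 : 0 < sk k / m by rewrite divr_gt0.
have d0 : 0 <= del k by rewrite /del subr_ge0 ler_pdivrMr// ler_peMr.
pose b := sk k / m + n.+2%:R.
have b1 : 1 < b by rewrite /b ltr_wpDl ?(ltW sm0)// ltr1n.
have b0 : 0 < b by apply: lt_trans b1.
have gb := Gamma_gt0 b0; have gbd : 0 < Gamma (b + del k) by apply: Gamma_gt0; rewrite ltr_wpDr.
have n0 : (0 : R) < n.+1%:R by [].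
rewrite /rho -/b; apply/andP; split; last first.
  rewrite ler_pdivrMr// mul1r; apply: le_trans (Gamma_ratio_ge b1 d0).
  rewrite ler_wpM2r ?(ltW gb)//; apply: ge0_ler_powR; rewrite ?nnegrE// ?subr_ge0 ?(ltW b1)//.
  by rewrite lerBrDr natr1 /b lerDr ltW.
rewrite ler_pdivlMr//.
have := Gamma_ratio_le b0 d0.
have -> : n.+1%:R + (sk k / m + 1 + (Num.Def.truncn (del k))%:R) = b + (Num.Def.truncn (del k))%:R.
  by rewrite /b -[n.+2%:R]natr1; ring.
set B := b + _ => h; have B0 : 0 < B by rewrite ltr_wpDr.
apply: le_trans (ler_wpM2l (powR_ge0 _ _) h) _.
rewrite mulrA -powRM ?divr_ge0 ?(ltW B0)// divfK// gt_eqF//.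
Qed.

Lemma posdef_ml : posdef (fun k => k`!%:R * mlc m k).
Proof.
apply: (@posdef_lim app (fun k => k`!%:R * mlc m k)).
- exact: app_posdef.
- move=> n k; rewrite appE; have /andP[_ h] := rho_bounds n k.
  by rewrite ler_piMl// mulr_ge0// ltW// mlc_gt0.
- have := pscoef_ml m1; congr pscoef; apply/funext => k.
  by rewrite /egf /mlC mulrAC divff ?mul1r// pnatr_eq0 -lt0n fact_gt0.
move=> k.
suff h : (fun n => rho n k * (k`!%:R * mlc m k)) @ \oo --> 1 * (k`!%:R * mlc m k).
  rewrite mul1r in h; apply: cvg_trans h; apply: near_eq_cvg; apply: nearW => n.
  by rewrite appE.
apply: cvgM; last exact: cvg_cst.
have q0 : 0 <= sk k / m + 1 + (Num.Def.truncn (del k))%:R.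
  by rewrite !addr_ge0// divr_ge0// ltW.
apply: (squeeze_cvgr _ (powR_ratio_cvg (del k) q0) (@cvg_cst _ (1 : R) _ _ _)).
by apply: nearW => n; exact: rho_bounds.
Qed.

Theorem ml_positivity z : cmod (PS (mlC m) z) <= Re (PS (mlC m) (rpos z)%:C%C).
Proof.
have [_ _] := posdef_ml => /(_ z).
suff -> : egf (fun k => k`!%:R * mlc m k) = mlC m by [].
apply/funext => k.
by rewrite /egf /mlC mulrAC divff ?mul1r// pnatr_eq0 -lt0n fact_gt0.
Qed.

End ml.
End Positivity.

(** * Area measure and radial moments *)

Section PlaneMeasure.
Context {R : realType}.
Local Notation mu := (@lebesgue_measure R).
Local Notation TR := (measurableTypeR R).

Let dA0 : @dA R set0 = 0%E.
Proof. exact: (@measure0 _ _ _ (@lebesgue_measure R \x @lebesgue_measure R)%E). Qed.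
Let dA_ge0 X : (0 <= @dA R X)%E.
Proof. exact: (@measure_ge0 _ _ _ (@lebesgue_measure R \x @lebesgue_measure R)%E). Qed.
Let dA_add : semi_sigma_additive (@dA R).
Proof. exact: (@measure_semi_sigma_additive _ _ _ (@lebesgue_measure R \x @lebesgue_measure R)%E). Qed.
HB.instance Definition _ := isMeasure.Build _ (R * R)%type R (@dA R) dA0 dA_ge0 dA_add.

(* [dA] lives on the product of the canonical measurable structures of [R], the library's product
   measure on the copy [measurableTypeR R]; the two differ only in their displays. *)
Lemma dA_int (f : R * R -> \bar R) : measurable_fun setT f -> (forall x, (0 <= f x)%E) ->
  (\int[@dA R]_x f x = \int[mu \x mu]_x f x)%E.
Proof.
move=> mf f0.
have mid : @measurable_fun _ _ (TR * TR)%type (R * R)%type setT idfun.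
  by move=> _ X mX; rewrite setTI; exact: mX.
have <- := ge0_integral_pushforward mid (mu \x mu)%E measurableT mf (fun y _ => f0 y).
by apply: eq_measure_integral => A mA _.
Qed.

(** Uniqueness of Lebesgue measure: a times the image measure under x -> a x + b has the right mass
    on half-open intervals. *)
Lemma affine_integral (h : R -> \bar R) (a b : R) : 0 < a -> measurable_fun setT h ->
  (forall x, (0 <= h x)%E) ->
  (a%:E * \int[mu]_x h (a * x + b)%R = \int[mu]_x h x)%E.
Proof.
move=> a0 mh h0.
pose f (x : TR) : TR := a * x + b.
have mf : measurable_fun setT f.
  by apply: measurable_funD => //; apply: measurable_funM.
pose P : {measure set TR -> \bar R} := ltac:(unshelve refine (pushforward mu f : {measure set TR -> \bar R}); exact: mf).
pose k := NngNum (ltW a0).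
have E A : measurable A -> mu A = mscale k P A.
  apply: lebesgue_measure_unique => _ [[p q]] _ <-.
  change (mu `]p, q]%classic = a%:E * mu (f @^-1` `]p, q]%classic))%E.
  have -> : f @^-1` `]p, q]%classic = `](p - b) / a, (q - b) / a]%classic.
    apply/seteqP; split => x /=; rewrite !in_itv /= /f ltr_pdivrMr// ler_pdivlMr// ltrBlDr lerBrDr.
      by rewrite mulrC.
    by rewrite [x * a]mulrC.
  rewrite !lebesgue_measure_itv /= !lte_fin ltr_pM2r ?invr_gt0// ltrD2r.
  case: ifP => _; last by rewrite mule0.
  by rewrite -!EFinB -EFinM; congr EFin; field; rewrite gt_eqF.
have <- : (\int[mscale k P]_x h x = \int[mu]_x h x)%E.
  by apply: eq_measure_integral => A mA _; exact/esym/E.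
rewrite ge0_integral_mscale//=; congr (_ * _)%E.
by rewrite (ge0_integral_pushforward mf)//; exact: (fun y _ => h0 y).
Qed.

Lemma dA_xy (f : R * R -> \bar R) : measurable_fun setT f -> (forall x, (0 <= f x)%E) ->
  (\int[@dA R]_x f x = \int[mu]_x \int[mu]_y f (x, y))%E.
Proof. by move=> mf f0; rewrite dA_int// fubini_tonelli1. Qed.

Lemma dA_yx (f : R * R -> \bar R) : measurable_fun setT f -> (forall x, (0 <= f x)%E) ->
  (\int[@dA R]_x f x = \int[mu]_y \int[mu]_x f (x, y))%E.
Proof. by move=> mf f0; rewrite dA_int// fubini_tonelli2. Qed.

Let measurable_sec1 (f : R * R -> \bar R) x : measurable_fun setT f ->
  measurable_fun setT (fun y => f (x, y)).
Proof. by move=> mf; apply: (measurableT_comp mf); exact: measurable_pair1. Qed.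

Let measurable_sec2 (f : R * R -> \bar R) y : measurable_fun setT f ->
  measurable_fun setT (fun x => f (x, y)).
Proof. by move=> mf; apply: (measurableT_comp mf); exact: measurable_pair2. Qed.

Lemma measurable_shear_x (f : R * R -> \bar R) a c b : measurable_fun setT f ->
  measurable_fun setT (fun p : R * R => f (a * p.1 + (c * p.2 + b), p.2)).
Proof.
move=> mf; apply: (measurableT_comp mf); apply/measurable_fun_pairP; split => /=; last exact: measurable_snd.
apply: measurable_funD; first by apply: measurable_funM => //; exact: measurable_fst.
by apply: measurable_funD => //; apply: measurable_funM => //; exact: measurable_snd.
Qed.

Lemma measurable_shear_y (f : R * R -> \bar R) a c b : measurable_fun setT f ->
  measurable_fun setT (fun p : R * R => f (p.1, a * p.2 + (c * p.1 + b))).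
Proof.
move=> mf; apply: (measurableT_comp mf); apply/measurable_fun_pairP; split => /=; first exact: measurable_fst.
apply: measurable_funD; first by apply: measurable_funM => //; exact: measurable_snd.
by apply: measurable_funD => //; apply: measurable_funM => //; exact: measurable_fst.
Qed.

(** Tonelli reduces this to [affine_integral] in one variable. Compositions of such maps yield the
    scalings and the rotations of the plane. *)
Lemma dA_shear_x (f : R * R -> \bar R) (a c b : R) : 0 < a -> measurable_fun setT f ->
  (forall x, (0 <= f x)%E) ->
  (a%:E * \int[@dA R]_p f (a * p.1 + (c * p.2 + b), p.2)%R = \int[@dA R]_p f p)%E.
Proof.
move=> a0 mf f0; have ms := measurable_shear_x a c b mf.
rewrite (dA_yx ms)//= (dA_yx mf)// -ge0_integralZl//=.
- apply: eq_integral => y _.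
  exact: (@affine_integral (fun x => f (x, y)) a (c * y + b) a0 (measurable_sec2 y mf)).
- exact: (@measurable_fun_fubini_tonelli_G _ _ TR TR R mu _ ms (fun x => f0 _)).
- by move=> y _; apply: integral_ge0.
- by rewrite lee_fin ltW.
Qed.

Lemma dA_shear_y (f : R * R -> \bar R) (a c b : R) : 0 < a -> measurable_fun setT f ->
  (forall x, (0 <= f x)%E) ->
  (a%:E * \int[@dA R]_p f (p.1, a * p.2 + (c * p.1 + b))%R = \int[@dA R]_p f p)%E.
Proof.
move=> a0 mf f0; have ms := measurable_shear_y a c b mf.
rewrite (dA_xy ms)//= (dA_xy mf)// -ge0_integralZl//=.
- apply: eq_integral => x _.
  exact: (@affine_integral (fun y => f (x, y)) a (c * x + b) a0 (measurable_sec1 x mf)).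
- exact: (@measurable_fun_fubini_tonelli_F _ _ TR TR R mu _ ms (fun x => f0 _)).
- by move=> y _; apply: integral_ge0.
- by rewrite lee_fin ltW.
Qed.

Definition cmeasE (f : R[i] -> \bar R) := measurable_fun setT (f \o @toC R : R * R -> \bar R).

Lemma cmeasE_affine (f : R[i] -> \bar R) (a b : R[i]) : cmeasE f -> cmeasE (fun z => f (a * z + b)).
Proof.
move=> mf.
rewrite /cmeasE.
have -> : (fun z => f (a * z + b)) \o @toC R = (f \o @toC R) \o (fun p : R * R =>
   (complex.Re a * p.1 - complex.Im a * p.2 + complex.Re b,
    complex.Re a * p.2 + complex.Im a * p.1 + complex.Im b)).
  apply/funext => p /=; congr f; case: a b => [a1 a2] [b1 b2]; case: p => x y.
  by apply/eqP; rewrite eq_complex /=; apply/andP; split; apply/eqP; simpc.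
apply: (measurableT_comp mf); apply/measurable_fun_pairP; split => /=.
  by apply: measurable_funD => //; apply: measurable_funB; apply: measurable_funM => //;
    (exact: measurable_fst || exact: measurable_snd).
by apply: measurable_funD => //; apply: measurable_funD; apply: measurable_funM => //;
  (exact: measurable_fst || exact: measurable_snd).
Qed.

Lemma dA_scale (f : R[i] -> \bar R) (a : R) (b : R[i]) : 0 < a -> cmeasE f -> (forall z, (0 <= f z)%E) ->
  ((a ^+ 2)%:E * \int[@dA R]_p f (a%:C%C * toC p + b)%R = \int[@dA R]_p f (toC p))%E.
Proof.
move=> a0 mf f0.
rewrite -(@dA_shear_x (f \o @toC R) a 0 (complex.Re b) a0 mf)//=.
rewrite -(@dA_shear_y _ a 0 (complex.Im b) a0 (measurable_shear_x a 0 (complex.Re b) mf))//=.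
rewrite muleA -EFinM -expr2; congr (_ * _)%E; apply: eq_integral => p _; congr f.
case: {f0 mf} b p => b1 b2 [x y].
have alg (u v : R) : a%:C%C * toC (u, v) + (b1 +i* b2)%C =
    toC (a * u + (0 * (a * v + (0 * u + b2)) + b1), a * v + (0 * u + b2)).
  by apply/eqP; rewrite eq_complex /=; apply/andP; split; apply/eqP; ring.
exact: alg.
Qed.

(** A rotation by theta is a product of three shears with slopes - tan (theta / 2), sin theta, - tan
    (theta / 2); the half-turn has to be left out. *)
Let dA_rot0 (f : R[i] -> \bar R) (c s : R) : c ^+ 2 + s ^+ 2 = 1 -> c != -1 -> cmeasE f ->
  (forall z, (0 <= f z)%E) ->
  (\int[@dA R]_p f ((c +i* s)%C * toC p)%R = \int[@dA R]_p f (toC p))%E.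
Proof.
move=> cs c1 mf f0.
have c1' : 1 + c != 0 by rewrite addrC addr_eq0.
pose t := s / (1 + c).
have st : s * t = 1 - c.
  have -> : 1 - c = (1 - c) * (1 + c) / (1 + c) by rewrite mulfK.
  by rewrite /t mulrA; congr (_ / _); move: cs; rewrite !expr2 => cs; lra.
have i1 := @dA_shear_x (f \o @toC R) 1 (- t) 0 ltr01 mf (fun x => f0 _).
have m1 := measurable_shear_x 1 (- t) 0 mf.
have i2 := @dA_shear_y _ 1 s 0 ltr01 m1 (fun x => f0 _).
have m2 := measurable_shear_y 1 s 0 m1.
have i3 := @dA_shear_x _ 1 (- t) 0 ltr01 m2 (fun x => f0 _).
rewrite !mul1e in i1 i2 i3.
rewrite -[RHS]i1 -[RHS]i2 -[RHS]i3; apply: eq_integral => -[x y] _ /=; congr f.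
have tc : t * (1 + c) = s by rewrite /t divfK.
have alg (u v : R) : (c +i* s)%C * toC (u, v) =
   toC (1 * u + (- t * v + 0) + (- t * (1 * v + (s * (1 * u + (- t * v + 0)) + 0)) + 0),
        1 * v + (s * (1 * u + (- t * v + 0)) + 0)).
  apply/eqP; rewrite eq_complex /=; apply/andP; split; rewrite -subr_eq0; apply/eqP.
    transitivity (u * (s * t - (1 - c)) + v * (t * (1 + c) - s) - v * t * (s * t - (1 - c))).
      by ring.
    by rewrite st tc !subrr !mulr0 addr0 subr0.
  transitivity (v * (s * t - (1 - c))); first by ring.
  by rewrite st subrr mulr0.
by rewrite alg; congr toC; congr pair; ring.
Qed.

Lemma dA_rot (f : R[i] -> \bar R) (w : R[i]) : cmod w = 1 -> cmeasE f -> (forall z, (0 <= f z)%E) ->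
  (\int[@dA R]_p f (w * toC p)%R = \int[@dA R]_p f (toC p))%E.
Proof.
case: w => c s w1 mf f0.
have cs : c ^+ 2 + s ^+ 2 = 1 by rewrite -(@cmod_sqr R (c +i* s)%C) w1 expr1n.
have [c1|c1] := eqVneq c (-1); last exact: dA_rot0.
(* What remains is the half-turn, which is the quarter-turn applied twice. *)
have s0 : s = 0.
  by move: cs; rewrite c1 sqrrN expr1n => /eqP; rewrite addrC -subr_eq0 addrK sqrf_eq0 => /eqP.
have i2 : (0 : R) ^+ 2 + 1 ^+ 2 = 1 by rewrite expr0n /= add0r expr1n.
have n0 : (0 : R) != -1 by rewrite eq_sym oppr_eq0 oner_eq0.
have m2 : cmeasE (fun z => f ((0 +i* 1)%C * z)).
  by have := cmeasE_affine (0 +i* 1)%C 0 mf; congr cmeasE; apply/funext => z; rewrite addr0.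
rewrite -(dA_rot0 i2 n0 mf f0) -(dA_rot0 i2 n0 m2 (fun z => f0 _)).
apply: eq_integral => p _; rewrite mulrA; congr (f (_ * _)).
by rewrite c1 s0; simpc.
Qed.

Lemma dA_gauss (a : R) (z : R[i]) : 0 < a ->
  (\int[@dA R]_p (expR (- (a * cmod (toC p - z) ^+ 2)))%:E = (pi / a)%:E)%E.
Proof.
move=> a0.
have mg : cmeasE (fun w => (expR (- (cmod w ^+ 2)))%:E).
  apply/measurable_EFinP; apply: measurableT_comp; first exact: measurable_expR.
  have -> : (fun p : R * R => - cmod (toC p) ^+ 2) = (fun p => - (p.1 ^+ 2 + p.2 ^+ 2)).
    by apply/funext => p; rewrite cmod_sqr.
  apply: measurableT_comp; first exact: oppr_measurable.
  by apply: measurable_funD; apply: measurable_funX; [exact: measurable_fst|exact: measurable_snd].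
have g1 : (\int[@dA R]_p (expR (- (cmod (toC p) ^+ 2)))%:E = pi%:E)%E.
  rewrite (dA_xy mg)/=; last by move=> x; rewrite lee_fin expR_ge0.
  transitivity (\int[mu]_x ((gauss_fun x)%:E * (Num.sqrt pi)%:E))%E.
    apply: eq_integral => x _; rewrite -integralT_gauss -ge0_integralZl//=.
    - apply: eq_integral => y _; rewrite cmod_sqr /= /gauss_fun -EFinM -expRD; congr (expR _)%:E; ring.
    - by apply/measurable_EFinP; exact: measurable_gauss_fun.
    - by move=> y _; rewrite lee_fin expR_ge0.
    - by rewrite lee_fin expR_ge0.
  rewrite ge0_integralZr//=; last 2 first.
  - by apply/measurable_EFinP; exact: measurable_gauss_fun.
  - by move=> y _; rewrite lee_fin expR_ge0.
  by rewrite integralT_gauss -EFinM -expr2 sqr_sqrtr// pi_ge0.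
have s0 : 0 < Num.sqrt a by rewrite sqrtr_gt0.
have := dA_scale (- ((Num.sqrt a)%:C%C * z)) s0 mg (fun x => _).
rewrite g1 sqr_sqrtr ?(ltW a0)// => /(_ (fun=> _))/wrap[|h].
  by move=> x; rewrite lee_fin expR_ge0.
have -> : pi / a = a^-1 * pi by rewrite mulrC.
rewrite EFinM -h muleA -EFinM mulVf ?gt_eqF// mul1e.
apply: eq_integral => p _; congr (expR (- _))%:E.
rewrite -mulrBr cmodM cmodR exprMn (ger0_norm (sqrtr_ge0 a)) (sqr_sqrtr (ltW a0)).
by [].
Qed.

End PlaneMeasure.

(** * Integration of radial functions *)

Section Radial.
Context {R : realType}.
Local Notation mu := (@lebesgue_measure R).
Local Notation TR := (measurableTypeR R).

Let q2 (p : R * R) : R := cmod (toC p) ^+ 2.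

Lemma measurable_cmod2 : measurable_fun setT q2.
Proof.
have -> : q2 = (fun p => p.1 ^+ 2 + p.2 ^+ 2) by apply/funext => p; rewrite /q2 cmod_sqr.
by apply: measurable_funD; apply: measurable_funX; [exact: measurable_fst|exact: measurable_snd].
Qed.

Let mq : @measurable_fun _ _ (R * R)%type TR setT q2.
Proof. exact: measurable_cmod2. Qed.

Let P : {measure set TR -> \bar R} :=
  ltac:(unshelve refine (pushforward (@dA R) (q2 : R * R -> TR) : {measure set TR -> \bar R}); exact: mq).

Let PE A : P A = @dA R (q2 @^-1` A). Proof. by []. Qed.

Let m2le (t : R) : measurable [set p | q2 p <= t].
Proof.
rewrite -[X in measurable X]setTI.
have -> : [set p | q2 p <= t] = q2 @^-1` `]-oo, t]%classic by apply/seteqP; split => p /=; rewrite in_itv.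
exact: (measurable_cmod2 measurableT).
Qed.

(** Area of the unit disc. By scaling, the disc |z|^2 <= t has area t V, so the image of dA under
    |z|^2 is V times Lebesgue measure on the half line; the value of V is found only afterwards. *)
Let V := @dA R [set p | q2 p <= 1].

Let V_gt0 : (0 < V)%E.
Proof.
pose I := `[0, 2^-1]%classic : set TR.
have m1 : measurable I by exact: measurable_itv.
have : ((mu \x mu) (I `*` I) <= V)%E.
  rewrite /V /dA; apply: le_measure; rewrite ?inE; first exact: measurableX.
    exact: (m2le 1).
  move=> [x y] [/=]; rewrite /I /= !in_itv /= => /andP[x0 x1] /andP[y0 y1].
  by rewrite /q2 cmod_sqr /= !expr2; nra.
apply: lt_le_trans.
have -> : ((mu \x mu) (I `*` I) = mu I * mu I)%E by exact: product_measure1E.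
rewrite /I lebesgue_measure_itv /= lte_fin invr_gt0 ltr0n /=.
by rewrite oppr0 addr0 -EFinM lte_fin mulr_gt0// invr_gt0.
Qed.

Let V_fin : (V < +oo)%E.
Proof.
pose I := `[-1, 1]%classic : set TR.
have m1 : measurable I by exact: measurable_itv.
have : (V <= (mu \x mu) (I `*` I))%E.
  rewrite /V /dA; apply: le_measure; rewrite ?inE; last 2 first.
  - exact: measurableX.
  - move=> [x y] /=; rewrite /q2 cmod_sqr /I /= !in_itv /= => h.
    have hx : x ^+ 2 <= 1 by apply: le_trans h; rewrite lerDl sqr_ge0.
    have hy : y ^+ 2 <= 1 by apply: le_trans h; rewrite lerDr sqr_ge0.
    by split; rewrite -ler_norml -(ler_pXn2r (ltn0Sn 1)) ?nnegrE// real_normK ?num_real// expr1n.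
  exact: (m2le 1).
move=> h; apply: le_lt_trans h _.
have -> : ((mu \x mu) (I `*` I) = mu I * mu I)%E by exact: product_measure1E.
rewrite /I lebesgue_measure_itv /= lte_fin.
by rewrite (lt_trans (ltrN10 R) ltr01) /= -EFinM ltry.
Qed.

Let scaleV (t : R) : 0 < t -> @dA R [set p | q2 p <= t] = (t%:E * V)%E.
Proof.
move=> t0; have s0 : 0 < Num.sqrt t by rewrite sqrtr_gt0.
pose f (z : R[i]) : \bar R := (\1_[set z | cmod z ^+ 2 <= t] z)%:E.
have fe : f \o @toC R = EFin \o \1_[set p | q2 p <= t].
  apply/funext => p; rewrite /f /= !indicE; congr EFin; congr (nat_of_bool _)%:R; apply/idP/idP; rewrite !inE.
have mf : cmeasE f by rewrite /cmeasE fe; apply/measurable_EFinP; exact: measurable_indic.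
have f0 z : (0 <= f z)%E by rewrite lee_fin.
have := dA_scale 0 s0 mf f0; rewrite (sqr_sqrtr (ltW t0)).
have -> : (\int[@dA R]_p f (toC p) = @dA R [set p | (q2 p <= t)%R])%E.
  by rewrite -[in RHS](setIT [set p | q2 p <= t]) -integral_indic//; apply: eq_integral => p _; rewrite -[LHS]/((f \o @toC R) p) fe.
move=> <-; congr (_ * _)%E.
rewrite /V -[in RHS](setIT [set p | q2 p <= 1]) -integral_indic//; apply: eq_integral => p _.
rewrite /f !indicE; congr EFin; congr (nat_of_bool _)%:R.
have e : cmod ((Num.sqrt t)%:C%C * toC p + 0) ^+ 2 = t * q2 p.
  by rewrite addr0 cmodM cmodR exprMn (ger0_norm (sqrtr_ge0 t)) (sqr_sqrtr (ltW t0)).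
have q : (t * q2 p <= t) = (q2 p <= 1) by rewrite -[X in _ <= X]mulr1 ler_pM2l.
by apply/idP/idP; rewrite !inE /= e q.
Qed.

Let Vr := fine V.
Let VrE : V = Vr%:E. Proof. by rewrite /Vr fineK// ge0_fin_numE ?V_fin// (ltW V_gt0). Qed.
Let Vr_gt0 : 0 < Vr. Proof. by rewrite -lte_fin -VrE V_gt0. Qed.

Let scale0 (t : R) : t <= 0 -> @dA R [set p | q2 p <= t] = 0%E.
Proof.
move=> t0; apply/eqP; rewrite eq_le measure_ge0 andbT.
apply/lee_addgt0Pr => e e0; rewrite add0e.
apply: (@le_trans _ _ (@dA R [set p | q2 p <= e / Vr])).
  apply: le_measure; rewrite ?inE; [exact: m2le|exact: m2le|].
  by move=> p /= h; rewrite (le_trans h)// (le_trans t0)// divr_ge0 ?(ltW e0) ?(ltW Vr_gt0).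
by rewrite scaleV ?divr_gt0 ?Vr_gt0// VrE -EFinM divfK// gt_eqF ?Vr_gt0.
Qed.

Let cum (t : R) : @dA R [set p | q2 p <= t] = (Vr * Num.max t 0)%:E.
Proof.
case: (leP t 0) => t0; first by rewrite scale0// mulr0.
by rewrite scaleV// VrE -EFinM mulrC.
Qed.

Let Pitv a b : a <= b -> P `]a, b]%classic = (Vr * (Num.max b 0 - Num.max a 0))%:E.
Proof.
move=> ab; rewrite PE.
have -> : q2 @^-1` `]a, b]%classic = [set p | q2 p <= b] `\` [set p | q2 p <= a].
  apply/seteqP; split => p /=; rewrite in_itv /=.
    by move=> /andP[h1 h2]; split => //; apply/negP; rewrite -ltNge.
  by move=> [h1 /negP]; rewrite -ltNge => h2; apply/andP.
rewrite measureD; [|exact: m2le|exact: m2le|by have := ltry (Vr * Num.max b 0); rewrite -cum].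
rewrite setIidr; last by move=> p /= h; apply: le_trans ab.
transitivity (@dA R [set p | (q2 p <= b)%R] - @dA R [set p | (q2 p <= a)%R])%E; first by [].
by rewrite !cum -EFinB -mulrBr.
Qed.

Let neg0 : measurable (`]-oo, 0%R]%classic : set TR). Proof. exact: measurable_itv. Qed.
Let Vi_ge0 : 0 <= Vr^-1. Proof. by rewrite invr_ge0 (ltW Vr_gt0). Qed.

(** The normalised image measure, completed by Lebesgue measure on the negative half line so that
    uniqueness on the whole line applies. *)
Let Q : {measure set TR -> \bar R} := measure_add (mscale (NngNum Vi_ge0) P) (mrestr mu neg0).

Let QE A : measurable A -> mu A = Q A.
Proof.
apply: lebesgue_measure_unique => _ [[a b] _ <-].
transitivity ((Vr^-1)%:E * P `]a, b]%classic + mu (`]a, b]%classic `&` `]-oo, 0%R]%classic))%E; last first.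
  exact/esym/(measure_addE (mscale (NngNum Vi_ge0) P) (mrestr mu neg0)).
rewrite /=.
case: (leP a b) => ab; last first.
  by rewrite set_itv_ge ?set0I ?measure0 ?mule0 ?adde0// bnd_simp -leNgt ltW.
rewrite (Pitv ab) -EFinM mulrA mulVf ?gt_eqF ?Vr_gt0// mul1r.
have -> : `]a, b]%classic `&` `]-oo, 0%R]%classic = `]a, Num.min b 0]%classic :> set R.
  apply/seteqP; split => x /=; rewrite !in_itv /= le_min.
    by move=> [/andP[-> ->] ->].
  by move=> /and3P[-> -> ->].
rewrite !lebesgue_measure_itv /= !lte_fin lt_min.
have [ab'|] := ltP a b; last first.
  move=> ba; have -> : a = b by (apply/eqP; rewrite eq_le ab ba).
  by rewrite subrr adde0.
case: (ltP a 0) => a0 /=.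
  rewrite -!EFinB -EFinD; congr EFin.
  by case: (leP b 0) => b0; lra.
rewrite max_l ?(le_trans a0)//.
by rewrite adde0 -!EFinB.
Qed.

Let radialV (h : R -> \bar R) : measurable_fun setT h -> (forall x, (0 <= h x)%E) ->
  (\int[@dA R]_p h (cmod (toC p) ^+ 2)%R = Vr%:E * \int[mu]_(t in `]0%R, +oo[) h t)%E.
Proof.
move=> mh h0.
pose D := (`]0, +oo[%classic : set TR).
have mD : measurable D by exact: measurable_itv.
have mhD : @measurable_fun _ _ TR _ D h by apply: measurable_funS mh.
have -> : (\int[mu]_(t in `]0%R, +oo[) h t = \int[mscale (NngNum Vi_ge0) P]_(t in D) h t)%E.
  apply: eq_measure_integral => A mA AD; apply: (eq_trans (QE mA)).
  transitivity (mscale (NngNum Vi_ge0) P A + mu (A `&` `]-oo, 0%R]%classic))%E.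
    exact: (measure_addE (mscale (NngNum Vi_ge0) P) (mrestr mu neg0)).
  rewrite (_ : A `&` `]-oo, 0%R]%classic = set0) ?measure0 ?adde0//.
  apply/seteqP; split => // x [/AD]; rewrite /D /= !in_itv /= andbT => x0.
  by rewrite leNgt x0.
rewrite ge0_integral_mscale//= muleA -EFinM mulfV ?gt_eqF ?Vr_gt0// mul1e.
have -> : (\int[P]_(t in D) h t = \int[@dA R]_(p in q2 @^-1` D) (h \o q2) p)%E.
  exact: (ge0_integral_pushforward mq (@dA R) mD mhD (fun y _ => h0 y)).
have mN : measurable [set p | q2 p <= 0] by exact: m2le.
have mhq : measurable_fun setT (h \o q2) by apply: (measurableT_comp mh); exact: measurable_cmod2.
transitivity (\int[@dA R]_p (h \o q2) p)%E; first by [].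
rewrite (@ge0_negligible_integral _ _ _ (@dA R) _ _ _ mN measurableT mhq (fun x _ => h0 _) (scale0 (lexx 0))).
congr (integral _ _ _); apply/seteqP; split => p /=; rewrite /D /= in_itv /= andbT ltNge.
  by move=> [_ /negP].
by move=> /negP.
Qed.

(** The unknown constant is identified as pi by testing on exp (- t): one side is the plane gaussian
    integral, the other is Gamma 1. *)
Lemma radial_integral (h : R -> \bar R) : measurable_fun setT h -> (forall x, (0 <= h x)%E) ->
  (\int[@dA R]_p h (cmod (toC p) ^+ 2)%R = pi%:E * \int[mu]_(t in `]0%R, +oo[) h t)%E.
Proof.
move=> mh h0; rewrite radialV//; congr (_ * _)%E.
have := @radialV (fun t => (expR (- t))%:E).
have -> : (\int[mu]_(t in `]0%R, +oo[) (expR (- t))%:E = 1)%E.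
  rewrite -Gammae1 /Gammae; apply: eq_integral => t _.
  by rewrite /gfun subrr powRr0 mul1r.
move=> /(_ _ _)/wrap[||].
- by apply/measurable_EFinP; apply: measurableT_comp; [exact: measurable_expR|exact: oppr_measurable].
- by move=> x; rewrite lee_fin expR_ge0.
rewrite mule1 => <-.
have -> : pi%:E = (pi / 1)%:E :> \bar R by rewrite divr1.
rewrite -(dA_gauss 0 ltr01).
by apply: eq_integral => p _; rewrite subr0 mul1r.
Qed.

End Radial.

(** * Norms of the monomials *)

Section Moments.
Context {R : realType}.
Local Notation mu := (@lebesgue_measure R).
Variable m : R.
Hypothesis m1 : 1 <= m.
Let m0 : 0 < m. Proof. exact: lt_le_trans m1. Qed.

Let h k (t : R) : R := t ^+ k * expR (- (t `^ m)).

Let h_ge0 k t : 0 <= t -> 0 <= h k t.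
Proof. by move=> t0; rewrite mulr_ge0 ?exprn_ge0 ?expR_ge0. Qed.

Let mh k : measurable_fun setT (h k).
Proof.
apply: measurable_funM; first exact: exprn_measurable.
apply: measurableT_comp; first exact: measurable_expR.
by apply: measurableT_comp; [exact: oppr_measurable|exact: measurable_powR].
Qed.

(** With [hi], the preimages under t -> t^m of the end points of [gset n], so that the substitution
    lands exactly on [Gpart]. *)
Let lo n : R := (n.+2%:R^-1) `^ m^-1.
Let hi n : R := n.+2%:R `^ m^-1.

Let lo_gt0 n : 0 < lo n. Proof. by rewrite powR_gt0// invr_gt0. Qed.
Let mi_gt0 : 0 < m^-1. Proof. by rewrite invr_gt0. Qed.

Let lohi n : lo n < hi n.
Proof. by apply: gt0_ltr_powR; rewrite ?nnegrE ?invr_ge0//; exact: gset_lt. Qed.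

Let powK (x : R) : 0 <= x -> (x `^ m^-1) `^ m = x.
Proof. by move=> x0; rewrite -powRrM mulVf ?gt_eqF// powRr1. Qed.

Let cont (x a : R) : 0 < x -> {for x, continuous (fun t => t `^ a)}.
Proof.
move=> x0; apply: differentiable_continuous; apply/derivable1_diffP.
by have [] := is_derive1_powR a x0.
Qed.

Let h_int k n : mu.-integrable `[lo n, hi n] (EFin \o h k).
Proof.
apply: continuous_compact_integrable; first exact: segment_compact.
apply: continuous_in_subspaceT => x /[!inE] /=; rewrite in_itv /= => /andP[x0 _].
have {}x0 : 0 < x by apply: lt_le_trans x0.
apply: cvgM; first exact: exprn_continuous.
have cc : (fun t => - (t `^ m)) @ x --> - (x `^ m) by apply: cvgN; exact: cont.
exact: (cvg_comp _ _ cc (@continuous_expR R _)).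
Qed.

Let subst k n : Gpart (k.+1%:R / m) n = m * \int[mu]_(t in `[lo n, hi n]) h k t.
Proof.
have eF : Gpart (k.+1%:R / m) n = \int[mu]_(t in `[lo n `^ m, hi n `^ m]) gfun (k.+1%:R / m) t.
  by rewrite /Gpart /gset /lo /hi !powK// invr_ge0.
have der (x : R) : 0 < x -> is_derive x 1 (fun t => t `^ m) (m * x `^ (m - 1)).
  by move=> x0; exact: is_derive1_powR.
have dE (x : R) : 0 < x -> (fun t => t `^ m)^`() x = m * x `^ (m - 1).
  by move=> x0; rewrite derive1E; have [_ ->] := der x x0.
have cd (x : R) : 0 < x -> {for x, continuous (fun t => t `^ m)^`()}.
  move=> x0; suff : (fun t => t `^ m)^`() @ x --> (fun t => t `^ m)^`() x by [].
  rewrite dE//.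
  have hh : (fun t => m * t `^ (m - 1)) @ x --> m * x `^ (m - 1).
    by apply: cvgM; [exact: cvg_cst|exact: cont].
  apply: cvg_trans hh; apply: near_eq_cvg; near=> t; rewrite dE//.
  near: t; exact: lt_nbhsr.
have hi0 : 0 < hi n by apply: lt_trans (lohi n).
have ih := h_int k n.
rewrite eF -RintegralZl//.
rewrite /Rintegral (@integration_by_substitution_increasing _ (fun t => t `^ m)).
- congr fine; apply: eq_integral => x /[!inE] /=; rewrite in_itv /= => /andP[x0 _].
  have {}x0 : 0 < x by apply: lt_le_trans x0.
  transitivity (gfun (k.+1%:R / m) (x `^ m) * (fun t => t `^ m)^`()%classic x)%:E; first by [].
  rewrite dE// /gfun /h; congr EFin.
  have -> : (x `^ m) `^ (k.+1%:R / m - 1) = x `^ (k.+1%:R - m).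
    by rewrite -powRrM; congr (_ `^ _); field; rewrite gt_eqF.
  rewrite -[x ^+ k](powR_mulrn k (ltW x0)).
  have -> : x `^ k%:R = x `^ (k.+1%:R - m) * x `^ (m - 1).
    rewrite -powRD ?(gt_eqF x0) ?implybT//; congr (_ `^ _); rewrite -natr1; ring.
  ring.
- exact: ltW.
- move=> x y; rewrite !in_itv /= => /andP[x0 _] /andP[y0 _] xy.
  by apply: gt0_ltr_powR; rewrite ?nnegrE ?(le_trans (ltW (lo_gt0 n)))//.
- by move=> x; rewrite in_itv /= => /andP[x0 _]; apply: cd; exact: lt_trans x0.
- by apply/cvg_ex; exists ((fun t => t `^ m)^`() (lo n)); apply: cvg_at_right_filter; exact: cd.
- by apply/cvg_ex; exists ((fun t => t `^ m)^`() (hi n)); apply: cvg_at_left_filter; exact: cd.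
- split.
  + move=> x; rewrite in_itv /= => /andP[x0 _].
    by have [] := der x (lt_trans (lo_gt0 n) x0).
  + by apply: cvg_at_right_filter; exact: cont.
  + by apply: cvg_at_left_filter; exact: cont.
apply: continuous_in_subspaceT => x /[!inE] /=; rewrite in_itv /= => /andP[x0 _].
apply: gprim_cont; apply: lt_le_trans x0; exact: powR_gt0.
Unshelve. all: end_near.
Qed.

Lemma Gamma_powR k :
  (\int[mu]_(t in `]0%R, +oo[) (t ^+ k * expR (- (t `^ m)))%:E = (Gamma (k.+1%:R / m) / m)%:E)%E.
Proof.
have s0 : 0 < k.+1%:R / m :> R by rewrite divr_gt0.
have U : `]0%R, +oo[%classic = \bigcup_n `[lo n, hi n]%classic.
  apply/seteqP; split=> t /=; rewrite ?in_itv /= ?andbT; last first.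
    by move=> [n _] /=; rewrite in_itv /= => /andP[h1 _]; exact: lt_le_trans h1.
  move=> t0; have tm : 0 < t `^ m by exact: powR_gt0.
  have tK : t = (t `^ m) `^ m^-1 by rewrite -powRrM mulfV ?gt_eqF// powRr1 ?ltW.
  pose n := Num.bound (t `^ m + (t `^ m)^-1); exists n => //=; rewrite in_itv /=.
  have ti : 0 < (t `^ m)^-1 by rewrite invr_gt0.
  have hn : t `^ m + (t `^ m)^-1 < n%:R by apply: archi_boundP; rewrite addr_ge0 ?(ltW ti) ?(ltW tm).
  have nn : n%:R <= (n.+2%:R : R) by rewrite ler_nat; lia.
  rewrite tK /lo /hi; apply/andP; split; apply: ge0_ler_powR; rewrite ?nnegrE ?invr_ge0 ?(ltW mi_gt0) ?(ltW m0) ?(ltW tm)//.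
    by rewrite -[t `^ m]invrK lef_pV2 ?posrE//; lra.
  by lra.
have c1 : (\int[mu]_(t in `[lo n, hi n]) (h k t)%:E)%E @[n --> \oo] -->
    (\int[mu]_(t in `]0%R, +oo[) (h k t)%:E)%E.
  rewrite U; apply: ge0_nondecreasing_set_cvg_integral.
  - apply/nondecreasing_seqP => n; apply/subsetPset => t; rewrite /= !in_itv /= => /andP[h1 h2].
    have nn : n.+2%:R <= (n.+3%:R : R) by rewrite ler_nat.
    apply/andP; split; [apply: le_trans h1|apply: (le_trans h2)]; apply: ge0_ler_powR;
      rewrite ?nnegrE ?invr_ge0 ?(ltW mi_gt0) ?(ltW m0)//.
    by rewrite lef_pV2 ?posrE.
  - by move=> n; exact: measurable_itv.
  - by move=> n; apply/measurable_EFinP; apply: measurable_funS (mh k).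
  - move=> n t; rewrite /= in_itv /= => /andP[h1 _]; rewrite lee_fin h_ge0//.
    by apply: le_trans h1; rewrite ltW.
have c2 : (\int[mu]_(t in `[lo n, hi n]) (h k t)%:E)%E @[n --> \oo] --> (Gamma (k.+1%:R / m) / m)%:E.
  have c3 : (fun n => (Gpart (k.+1%:R / m) n / m)%:E) @ \oo --> (Gamma (k.+1%:R / m) / m)%:E.
    apply: cvg_EFin; first exact: nearW.
    by apply: cvgM; [exact: Gpart_cvgR|exact: cvg_cst].
  apply: cvg_trans c3; apply: near_eq_cvg; apply: nearW => n.
  rewrite subst mulrAC mulfV ?gt_eqF// mul1r /Rintegral fineK//.
  apply: integrable_fin_num; first exact: measurable_itv.
  exact: h_int.
exact: (cvg_unique _ c1 c2).
Qed.

Lemma wtE (z : R[i]) : wt m z = expR (- ((cmod z ^+ 2) `^ m)).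
Proof. by rewrite /wt powRrM (powR_mulrn 2 (cmod_ge0 z)). Qed.

Lemma moment k : (\int[@dA R]_p (cmod (toC p) ^+ (2 * k) * wt m (toC p))%:E =
   ((pi / m) * Gamma (k.+1%:R / m))%:E)%E.
Proof.
(* The absolute value makes the integrand nonnegative on the whole line, as [radial_integral]
   requires. *)
pose g (t : R) : R := `|t| ^+ k * expR (- (t `^ m)).
have mg : measurable_fun setT (EFin \o g).
  apply/measurable_EFinP; apply: measurable_funM.
    by apply: measurable_funX; exact: normr_measurable.
  apply: measurableT_comp; first exact: measurable_expR.
  by apply: measurableT_comp; [exact: oppr_measurable|exact: measurable_powR].
have g0 x : (0 <= (EFin \o g) x)%E by rewrite lee_fin mulr_ge0 ?expR_ge0// exprn_ge0.
have e := radial_integral mg g0.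
transitivity (pi%:E * (Gamma (k.+1%:R / m) / m)%:E : \bar R)%E; last first.
  by rewrite -EFinM; congr EFin; ring.
rewrite -Gamma_powR.
have <- : (\int[mu]_(t in `]0%R, +oo[) (EFin \o g) t =
  \int[mu]_(t in `]0%R, +oo[) (t ^+ k * expR (- (t `^ m)))%:E)%E.
  apply: eq_integral => x /[!inE] /=; rewrite in_itv /= andbT => x0.
  by rewrite /g ger0_norm// ltW.
rewrite -e; apply: eq_integral => p _ /=; rewrite wtE exprM /g.
by rewrite ger0_norm// exprn_ge0// cmod_ge0.
Qed.

End Moments.

(** * Reproducing kernel *)

Section Meas.
Context {R : realType}.
Local Notation Re := complex.Re.
Local Notation Im := complex.Im.
Implicit Types (f g : R[i] -> R[i]) (h : R[i] -> R).

Definition rmeas h := measurable_fun setT (h \o @toC R).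
Definition cmeas f := rmeas (fun z => Re (f z)) /\ rmeas (fun z => Im (f z)).

Lemma ccvgJ (s : nat -> R[i]) l : ccvg s l -> ccvg (fun n => ((s n)^*)%C) (l^*)%C.
Proof.
move=> [h1 h2]; split; first by rewrite ReJ; under eq_fun do rewrite ReJ.
by rewrite ImJ; under eq_fun do rewrite ImJ; exact: cvgN.
Qed.

Lemma rmeasD h k : rmeas h -> rmeas k -> rmeas (fun z => h z + k z).
Proof. exact: measurable_funD. Qed.
Lemma rmeasM h k : rmeas h -> rmeas k -> rmeas (fun z => h z * k z).
Proof. exact: measurable_funM. Qed.
Lemma rmeasB h k : rmeas h -> rmeas k -> rmeas (fun z => h z - k z).
Proof. exact: measurable_funB. Qed.
Lemma rmeas_cst c : rmeas (fun=> c).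
Proof. exact: measurable_cst. Qed.
Lemma rmeasX h n : rmeas h -> rmeas (fun z => h z ^+ n).
Proof. exact: measurable_funX. Qed.
Lemma rmeas_comp h (k : R -> R) : measurable_fun setT k -> rmeas h -> rmeas (fun z => k (h z)).
Proof. by move=> mk mh; apply: (measurableT_comp mk mh). Qed.

Lemma cmeas_cst c : cmeas (fun=> c).
Proof. by split; exact: rmeas_cst. Qed.
Lemma cmeas_id : cmeas id.
Proof. by split; [exact: measurable_fst|exact: measurable_snd]. Qed.

Lemma cmeasD f g : cmeas f -> cmeas g -> cmeas (fun z => f z + g z).
Proof.
move=> [f1 f2] [g1 g2]; split.
  by have := rmeasD f1 g1; congr rmeas; apply/funext => z; rewrite ReD.
by have := rmeasD f2 g2; congr rmeas; apply/funext => z; rewrite ImD.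
Qed.

Lemma cmeasM f g : cmeas f -> cmeas g -> cmeas (fun z => f z * g z).
Proof.
move=> [f1 f2] [g1 g2]; split.
  by have := rmeasB (rmeasM f1 g1) (rmeasM f2 g2); congr rmeas; apply/funext => z; rewrite ReM.
by have := rmeasD (rmeasM f1 g2) (rmeasM f2 g1); congr rmeas; apply/funext => z; rewrite ImM.
Qed.

Lemma cmeasJ f : cmeas f -> cmeas (fun z => ((f z)^*)%C).
Proof.
move=> [f1 f2]; split.
  by have := f1; congr rmeas; apply/funext => z; rewrite ReJ.
have := rmeas_comp (@oppr_measurable R setT) f2.
by congr rmeas; apply/funext => z; rewrite ImJ.
Qed.

Lemma cmeasX f n : cmeas f -> cmeas (fun z => f z ^+ n).
Proof.
move=> mf; elim: n => [|n IH].
  by have := cmeas_cst 1; congr cmeas; apply/funext => z; rewrite expr0.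
by have := cmeasM mf IH; congr cmeas; apply/funext => z; rewrite exprS.
Qed.

Lemma cmeas_sum (n : nat) (F : nat -> R[i] -> R[i]) : (forall k, cmeas (F k)) ->
  cmeas (fun z => \sum_(k < n) F k z).
Proof.
move=> mF; elim: n => [|n IH].
  by have := cmeas_cst 0; congr cmeas; apply/funext => z; rewrite big_ord0.
by have := cmeasD IH (mF n); congr cmeas; apply/funext => z; rewrite big_ord_recr.
Qed.

Lemma rmeas_cmod2 f : cmeas f -> rmeas (fun z => cmod (f z) ^+ 2).
Proof.
move=> [f1 f2]; have := rmeasD (rmeasX 2 f1) (rmeasX 2 f2).
by congr rmeas; apply/funext => z; rewrite cmod_sqr.
Qed.

Lemma rmeas_cmod f : cmeas f -> rmeas (fun z => cmod (f z)).
Proof.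
move=> /rmeas_cmod2 /(rmeas_comp (@measurable_powR R (2^-1))).
by congr rmeas; apply/funext => z; rewrite powR12_sqrt ?sqr_ge0// sqrtr_sqr ger0_norm// cmod_ge0.
Qed.

Lemma cmeas_lim (F : nat -> R[i] -> R[i]) g : (forall n, cmeas (F n)) ->
  (forall z, ccvg (fun n => F n z) (g z)) -> cmeas g.
Proof.
move=> mF Fg; split.
  apply: (@measurable_fun_cvg _ _ _ _ (fun n => (fun z => Re (F n z)) \o @toC R)).
    by move=> n; exact: (mF n).1.
  by move=> p _; exact: (Fg (toC p)).1.
apply: (@measurable_fun_cvg _ _ _ _ (fun n => (fun z => Im (F n z)) \o @toC R)).
  by move=> n; exact: (mF n).2.
by move=> p _; exact: (Fg (toC p)).2.
Qed.

Lemma PS_cvg (a : nat -> R[i]) z : pscoef a -> ccvg (fun n => \sum_(k < n) a k * z ^+ k) (PS a z).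
Proof. by move=> pa; apply: asum_cvg; exact: asum_ps. Qed.

Lemma cmeas_PS (a : nat -> R[i]) : pscoef a -> cmeas (PS a).
Proof.
move=> pa; apply: (@cmeas_lim (fun n z => \sum_(k < n) a k * z ^+ k)) => [n|z]; last exact: PS_cvg.
apply: (@cmeas_sum n (fun k z => a k * z ^+ k)) => k.
by apply: cmeasM; [exact: cmeas_cst|apply: cmeasX; exact: cmeas_id].
Qed.

Lemma rmeas_wt (m : R) : rmeas (wt m).
Proof.
apply: rmeas_comp; first exact: measurable_expR.
apply: rmeas_comp; first exact: oppr_measurable.
exact: (@rmeas_comp _ (fun x => x `^ (2 * m)) (measurable_powR _) (rmeas_cmod cmeas_id)).
Qed.

Definition disc (r : R) : set (R * R) := [set p | cmod (toC p) <= r].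

Lemma measurable_disc r : measurable (disc r).
Proof.
have := @rmeas_cmod id cmeas_id => /(_ measurableT `]-oo, r]%classic (measurable_itv _)).
by rewrite setTI; congr measurable; apply/seteqP; split => p /=; rewrite in_itv.
Qed.

End Meas.

(** * Integrals over discs and orthogonality of monomials *)

Section Disc.
Context {R : realType}.
Local Notation Re := complex.Re.
Local Notation Im := complex.Im.
Implicit Types (h : R[i] -> R).
Variable m : R.
Hypothesis m1 : 1 <= m.

(** The squared norm of z^k, by [moment]. *)
Definition gam k : R := (pi / m) * Gamma (k.+1%:R / m).

Lemma gam_gt0 k : 0 < gam k.
Proof.
have m0 : 0 < m by exact: lt_le_trans m1.
by rewrite mulr_gt0 ?divr_gt0 ?pi_gt0// Gamma_gt0 ?divr_gt0.
Qed.

Lemma wt_ge0 z : 0 <= wt m z. Proof. exact: expR_ge0. Qed.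

Lemma wt_integrable : (@dA R).-integrable setT (fun p => (wt m (toC p))%:E).
Proof.
apply/integrableP; split; first by apply/measurable_EFinP; exact: rmeas_wt.
have := moment m1 0 => e.
under eq_integral => p _ do rewrite abse_EFin ger0_norm ?wt_ge0//.
rewrite [X in (X < _)%E](_ : _ = (pi / m * Gamma (1%:R / m))%:E)%E ?ltry// -e.
by apply: eq_integral => p _; rewrite muln0 expr0 mul1r.
Qed.

(** On a disc the partial sums of a power series are uniformly bounded, so limits and integrals can
    be exchanged even for functions that are not integrable on the plane. *)
Definition dint (r : R) h : R := \int[@dA R]_(p in disc r) (h (toC p) * wt m (toC p)).

Definition dbound r h := rmeas h /\ exists B : R, forall z, cmod z <= r -> `|h z| <= B.

Lemma disc_integrable r h : dbound r h ->
  (@dA R).-integrable (disc r) (fun p => (h (toC p) * wt m (toC p))%:E).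
Proof.
move=> [mh [B hB]].
have iw : (@dA R).-integrable (disc r) (fun p => (`|B| * wt m (toC p))%:E).
  have i1 : (@dA R).-integrable (disc r) (fun p => (wt m (toC p))%:E).
    by apply: integrableS wt_integrable => //; exact: measurable_disc.
  by have := integrableZl (measurable_disc r) `|B| i1; apply: eq_integrable; [exact: measurable_disc|].
apply: (le_integrable (measurable_disc r) _ _ iw).
  apply/measurable_EFinP; apply: measurable_funS (rmeasM mh (rmeas_wt m)) => //.
move=> p /= hp; rewrite lee_fin !normrM ler_wpM2r//.
by rewrite normr_id (le_trans (hB _ hp))// ler_norm.
Qed.

Lemma dintD r h k : dbound r h -> dbound r k -> dint r (fun z => h z + k z) = dint r h + dint r k.
Proof.
move=> bh bk; rewrite /dint -RintegralD//; [|exact: measurable_disc|exact: disc_integrable..].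
by apply: eq_Rintegral => p _; rewrite mulrDl.
Qed.

Lemma dintZ r c h : dbound r h -> dint r (fun z => c * h z) = c * dint r h.
Proof.
move=> bh; rewrite /dint -RintegralZl//; [|exact: measurable_disc|exact: disc_integrable].
by apply: eq_Rintegral => p _; rewrite mulrA.
Qed.

Lemma eq_dint r h k : (forall z, cmod z <= r -> h z = k z) -> dint r h = dint r k.
Proof. by move=> e; apply: eq_Rintegral => p; rewrite inE /disc /= => hp; rewrite e. Qed.

Lemma dbound_cst r c : dbound r (fun=> c).
Proof. by split; [exact: rmeas_cst|exists `|c|]. Qed.

Lemma dboundD r h k : dbound r h -> dbound r k -> dbound r (fun z => h z + k z).
Proof.
move=> [mh [B hB]] [mk [C hC]]; split; first exact: rmeasD.
by exists (B + C) => z zr; apply: le_trans (ler_normD _ _) _; apply: lerD; [exact: hB|exact: hC].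
Qed.

Lemma dint_sum r (n : nat) (H : nat -> R[i] -> R) : (forall k, dbound r (H k)) ->
  dbound r (fun z => \sum_(k < n) H k z) /\ dint r (fun z => \sum_(k < n) H k z) = \sum_(k < n) dint r (H k).
Proof.
move=> bH; elim: n => [|n [IH1 IH2]].
  split; first by have := dbound_cst r 0; congr dbound; apply/funext => z; rewrite big_ord0.
  have -> : (fun z => \sum_(k < 0) H k z) = (fun z => 0 * 0) by apply/funext => z; rewrite big_ord0 mul0r.
  by rewrite (dintZ 0 (dbound_cst r 0)) mul0r big_ord0.
have e : (fun z => \sum_(k < n.+1) H k z) = (fun z => \sum_(k < n) H k z + H n z).
  by apply/funext => z; rewrite big_ord_recr.
by rewrite e big_ord_recr /= -IH2; split; [exact: dboundD|exact: dintD].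
Qed.

Lemma dint_ge0 r h : (forall z, cmod z <= r -> 0 <= h z) -> 0 <= dint r h.
Proof. by move=> h0; apply: Rintegral_ge0 => p hp; rewrite mulr_ge0 ?wt_ge0// h0. Qed.

Let dint_rot0 r h w : dbound r h -> (forall z, cmod z <= r -> 0 <= h z) -> cmod w = 1 ->
  dint r (fun z => h (w * z)) = dint r h.
Proof.
move=> [mh _] h0 w1.
pose f (z : R[i]) : \bar R := if cmod z <= r then (h z * wt m z)%:E else 0%E.
have f0 z : (0 <= f z)%E by rewrite /f; case: ifP => // hz; rewrite lee_fin mulr_ge0 ?wt_ge0// h0.
have fp k : (fun p => (k (toC p) * wt m (toC p))%:E) \_ (disc r) =
    (fun p => if cmod (toC p) <= r then (k (toC p) * wt m (toC p))%:E else 0%E).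
  apply/funext => p; rewrite /patch; case: ifP => [/[!inE] hp|hp]; first by rewrite ifT.
  by rewrite ifF//; apply/negP => h1; move/negP: hp; apply; rewrite inE.
have mf : cmeasE f.
  rewrite /cmeasE (_ : f \o @toC R = (fun p => (h (toC p) * wt m (toC p))%:E) \_ (disc r)); last by rewrite fp.
  apply/(measurable_restrictT _ (measurable_disc r)); apply/measurable_EFinP.
  by apply: measurable_funS (rmeasM mh (rmeas_wt m)).
rewrite /dint /Rintegral; congr fine.
rewrite [LHS]integral_mkcond [RHS]integral_mkcond (fp h) (fp (fun z => h (w * z))).
rewrite -[RHS](dA_rot w1 mf f0); apply: eq_integral => p _.
by rewrite /f cmodM w1 mul1r /wt cmodM w1 mul1r.
Qed.

Lemma rmeas_rot h w : rmeas h -> rmeas (fun z => h (w * z)).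
Proof.
move=> mh; have mE : cmeasE (EFin \o h) by apply/measurable_EFinP.
have := cmeasE_affine w 0 mE; rewrite /cmeasE => /measurable_EFinP.
by apply: eq_measurable_fun => p _ /=; rewrite addr0.
Qed.

Lemma dbound_rot r h w : cmod w = 1 -> dbound r h -> dbound r (fun z => h (w * z)).
Proof.
move=> w1 [mh [B hB]]; split; first exact: rmeas_rot.
by exists B => z zr; apply: hB; rewrite cmodM w1 mul1r.
Qed.

Lemma dint_rot r h w : dbound r h -> cmod w = 1 -> dint r (fun z => h (w * z)) = dint r h.
Proof.
move=> bh w1; have [mh [B hB]] := bh.
(* Adding the bound [B] reduces to a nonnegative integrand; its own contribution is the same on both
   sides. *)
have bB := dbound_cst r B.
have e := dint_rot0 (dboundD bh bB) _ w1.
have := e; rewrite (dintD (dbound_rot w1 bh) bB) (dintD bh bB) => /(_ _)/wrap[|/addIr//].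
by move=> z zr; have := hB _ zr; rewrite ler_norml => /andP[h1 _]; rewrite -lerBlDr sub0r.
Qed.

Lemma dbound_re r (f : R[i] -> R[i]) : cmeas f ->
  (exists B : R, forall z, cmod z <= r -> cmod (f z) <= B) -> dbound r (fun z => Re (f z)).
Proof.
move=> [mf _] [B hB]; split => //; exists B => z zr.
by apply: le_trans (normRe_le _) _; exact: hB.
Qed.

Lemma dbound_mono r c j k : dbound r (fun z => Re (c * (z ^+ j * ((z^*)%C) ^+ k))).
Proof.
apply: (@dbound_re r (fun z => c * (z ^+ j * ((z^*)%C) ^+ k))).
  apply: cmeasM; first exact: cmeas_cst.
  by apply: cmeasM; apply: cmeasX; [exact: cmeas_id|apply: cmeasJ; exact: cmeas_id].
exists (cmod c * (r ^+ j * r ^+ k)) => z zr.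
rewrite !cmodM !cmodX cmodJ ler_wpM2l ?cmod_ge0//.
have r0 : 0 <= r by apply: le_trans zr; exact: cmod_ge0.
by apply: ler_pM; rewrite ?exprn_ge0 ?cmod_ge0// lerXn2r ?nnegrE ?cmod_ge0.
Qed.

(* Rotating by [w] with [w ^+ j * (w^* ) ^+ k = -1] changes the sign of the integrand. *)
Lemma dint_orth r c j k : j != k -> dint r (fun z => Re (c * (z ^+ j * ((z^*)%C) ^+ k))) = 0.
Proof.
move=> jk; pose d := (maxn j k - minn j k)%N.
have d0 : (0 < d)%N by rewrite /d; lia.
have dr : (d%:R : R) != 0 by rewrite pnatr_eq0 -lt0n.
pose w : R[i] := cexp (0 +i* (pi / d%:R))%C.
have w1 : cmod w = 1 by rewrite cmod_cexp /= expR0.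
have wd : w ^+ d = -1.
  rewrite -cexpX.
  have -> : d%:R * (0 +i* (pi / d%:R))%C = (0 +i* pi)%C :> R[i].
    rewrite -(rmorph_nat (@real_complex R)); apply: complex_eq; rewrite ?ReZl ?ImZl /= ?mulr0//.
    by rewrite mulrC divfK.
  by rewrite /cexp /= expR0 cospi sinpi mulr0 mul1r; apply: complex_eq; rewrite /= ?oppr0.
have wJ : w * (w^*)%C = 1 by rewrite mulcJ w1 expr1n.
have wdJ : ((w^*)%C) ^+ d = -1 by rewrite -conjcX wd; apply: complex_eq; rewrite ?ReJ ?ImJ /= ?oppr0.
have wjk : w ^+ j * ((w^*)%C) ^+ k = -1.
  case: (ltngtP j k) => [lt|gt|e]; last by rewrite e eqxx in jk.
    have -> : k = (j + d)%N by rewrite /d; lia.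
    by rewrite exprD mulrA -exprMn wJ expr1n mul1r.
  have -> : j = (k + d)%N by rewrite /d; lia.
  by rewrite exprD mulrAC -exprMn wJ expr1n mul1r.
have := dint_rot (dbound_mono r c j k) w1.
have e z : Re (c * ((w * z) ^+ j * (((w * z)^*)%C) ^+ k)) = -1 * Re (c * (z ^+ j * ((z^*)%C) ^+ k)).
  have -> : c * ((w * z) ^+ j * (((w * z)^*)%C) ^+ k) = (w ^+ j * ((w^*)%C) ^+ k) * (c * (z ^+ j * ((z^*)%C) ^+ k)).
    by rewrite conjcM !exprMn; ring.
  have g (x : R[i]) : Re (-1 * x) = -1 * Re x by rewrite !mulN1r ReN.
  by rewrite wjk g.
rewrite (eq_dint (fun z _ => e z)) (dintZ _ (dbound_mono r c j k)) => /eqP.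
by rewrite mulN1r -subr_eq0 -opprD oppr_eq0 -mulr2n mulrn_eq0 /= => /eqP.
Qed.

Definition gamr r k : R := dint r (fun z => cmod z ^+ (2 * k)).

Lemma dint_diag r c k : dint r (fun z => Re (c * (z ^+ k * ((z^*)%C) ^+ k))) = Re c * gamr r k.
Proof.
have e z : Re (c * (z ^+ k * ((z^*)%C) ^+ k)) = Re c * cmod z ^+ (2 * k).
  by rewrite -exprMn mulcJ real_complexX mulrC ReZl exprM mulrC.
rewrite (eq_dint (fun z _ => e z)) dintZ//; split.
  by apply: rmeasX; exact: rmeas_cmod cmeas_id.
exists (r ^+ (2 * k)) => z zr; have r0 : 0 <= r by apply: le_trans zr; exact: cmod_ge0.
by rewrite ger0_norm ?exprn_ge0 ?cmod_ge0// lerXn2r ?nnegrE ?cmod_ge0.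
Qed.

Lemma dint_lim r (H : nat -> R[i] -> R) h (B : R) : (forall n, rmeas (H n)) -> rmeas h ->
  (forall n z, cmod z <= r -> `|H n z| <= B) -> (forall z, cmod z <= r -> H ^~ z @ \oo --> h z) ->
  (fun n => dint r (H n)) @ \oo --> dint r h.
Proof.
move=> mH mh HB Hh.
have bh : dbound r h.
  split => //; exists B => z zr.
  have c : (fun n => `|H n z|) @ \oo --> `|h z| by exact: cvg_norm (Hh z zr).
  rewrite -(cvg_lim _ c)//.
  by apply: limr_le; [exact: cvgP c|apply: nearW => n; exact: HB].
apply: fine_cvg; rewrite /dint /Rintegral fineK; last first.
  by apply: integrable_fin_num; [exact: measurable_disc|exact: disc_integrable].
apply: (@dominated_cvg _ _ _ _ _ (measurable_disc r) _ _ (fun p => (B * wt m (toC p))%:E)) => //.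
- by move=> n; apply/measurable_EFinP; apply: measurable_funS (rmeasM (mH n) (rmeas_wt m)).
- move=> p hp; apply: cvg_EFin; first exact: nearW.
  by apply: cvgM; [exact: Hh|exact: cvg_cst].
- exact: (disc_integrable (dbound_cst r B)).
- move=> n p hp; rewrite lee_fin normrM [`|wt _ _|]ger0_norm ?wt_ge0// ler_wpM2r ?wt_ge0//.
  exact: HB.
Qed.

(** Parseval on a disc: partial sums pass to the limit by dominated convergence, and the mixed terms
    vanish by [dint_orth]. *)
Lemma disc_lemma r a b : pscoef a -> pscoef b ->
  (fun n => \sum_(k < n) Re (a k * ((b k)^*)%C) * gamr r k) @ \oo -->
  dint r (fun z => Re (PS a z * ((PS b z)^*)%C)).
Proof.
move=> pa pb.
pose S (c : nat -> R[i]) n z := \sum_(k < n) c k * z ^+ k.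
have mS c n : cmeas (S c n).
  apply: (@cmeas_sum _ n (fun k z => c k * z ^+ k)) => k.
  by apply: cmeasM; [exact: cmeas_cst|apply: cmeasX; exact: cmeas_id].
have bS c : pscoef c -> exists2 B : R, 0 <= B & forall n z, cmod z <= r -> cmod (S c n z) <= B.
  move=> pc; have [r0|r0] := leP 0 r; last first.
    by exists 0 => // n z zr; have := le_lt_trans zr r0; rewrite ltNge cmod_ge0.
  have [M hM] := pscoef_sum pc r0; exists M => [|n z zr].
    by have := hM 0%N; rewrite big_ord0.
  apply: le_trans (cmod_sum _ _ _) _; apply: le_trans (hM n); apply: ler_sum => k _.
  by rewrite cmodM cmodX ler_wpM2l ?cmod_ge0// lerXn2r ?nnegrE ?cmod_ge0.
have [A A0 hA] := bS _ pa; have [B B0 hB] := bS _ pb.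
have lim : (fun n => dint r (fun z => Re (S a n z * ((S b n z)^*)%C))) @ \oo -->
  dint r (fun z => Re (PS a z * ((PS b z)^*)%C)).
  apply: (@dint_lim r _ _ (A * B)) => [n||n z zr|z zr].
  - by case: (cmeasM (mS a n) (cmeasJ (mS b n))).
  - by case: (cmeasM (cmeas_PS pa) (cmeasJ (cmeas_PS pb))).
  - apply: le_trans (normRe_le _) _; rewrite cmodM cmodJ.
    by apply: ler_pM; rewrite ?cmod_ge0//; [exact: hA|exact: hB].
  - apply: (proj1 (ccvgM (PS_cvg z pa) (ccvgJ (PS_cvg z pb)))).
apply: cvg_trans lim; apply: near_eq_cvg; apply: nearW => n /=.
pose T j k z : R := Re (a j * ((b k)^*)%C * (z ^+ j * ((z^*)%C) ^+ k)).
have e z : Re (S a n z * ((S b n z)^*)%C) = \sum_(j < n) \sum_(k < n) T j k z.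
  rewrite /S conjc_sum mulr_suml Re_sum; apply: eq_bigr => j _.
  rewrite mulr_sumr Re_sum; apply: eq_bigr => k _.
  by rewrite /T conjcM conjcX; congr Re; ring.
rewrite (eq_dint (fun z _ => e z)).
have bT j k : dbound r (T j k) by exact: dbound_mono.
have s1 j := @dint_sum r n (T j) (bT j).
have [_ ->] := @dint_sum r n (fun j z => \sum_(k < n) T j k z) (fun j => (s1 j).1).
apply: eq_bigr => j _; rewrite (s1 j).2 (bigD1 j)//= dint_diag big1 ?addr0// => k kj.
by apply: dint_orth; rewrite eq_sym.
Qed.

End Disc.

Lemma cauchy_schwarz {R : realType} (x y : nat -> R) n :
  (\sum_(k < n) x k * y k) ^+ 2 <= (\sum_(k < n) x k ^+ 2) * (\sum_(k < n) y k ^+ 2).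
Proof.
elim: n => [|n IH]; first by rewrite !big_ord0 expr0n /= mul0r.
rewrite !big_ord_recr /=.
set S := \sum_(k < n) x k * y k in IH *; set A := \sum_(k < n) x k ^+ 2 in IH *.
set B := \sum_(k < n) y k ^+ 2 in IH *.
have A0 : 0 <= A by apply: sumr_ge0 => k _; exact: sqr_ge0.
have B0 : 0 <= B by apply: sumr_ge0 => k _; exact: sqr_ge0.
clearbody S A B; move: (x n) (y n) => a b.
have C0 : 0 <= A * b ^+ 2 + B * a ^+ 2 by rewrite addr_ge0// mulr_ge0// sqr_ge0.
have h : 2 * S * (a * b) <= A * b ^+ 2 + B * a ^+ 2.
  apply: le_trans (ler_norm _) _; rewrite -(@ler_pXn2r _ 2)// ?nnegrE// real_normK ?num_real//.
  have i1 : 4 * (S ^+ 2 * (a * b) ^+ 2) <= 4 * (A * B * (a * b) ^+ 2).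
    by rewrite ler_pM2l// ler_wpM2r// sqr_ge0.
  have i2 : 0 <= (A * b ^+ 2 - B * a ^+ 2) ^+ 2 by exact: sqr_ge0.
  have e1 : (2 * S * (a * b)) ^+ 2 = 4 * (S ^+ 2 * (a * b) ^+ 2) by ring.
  have e2 : (A * b ^+ 2 + B * a ^+ 2) ^+ 2 = (A * b ^+ 2 - B * a ^+ 2) ^+ 2 + 4 * (A * B * (a * b) ^+ 2) by ring.
  by rewrite e1 e2; lra.
have e1 : (S + a * b) ^+ 2 = S ^+ 2 + 2 * S * (a * b) + a ^+ 2 * b ^+ 2 by ring.
have e2 : (A + a ^+ 2) * (B + b ^+ 2) = A * B + (A * b ^+ 2 + B * a ^+ 2) + a ^+ 2 * b ^+ 2 by ring.
by rewrite e1 e2; lra.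
Qed.

Lemma dA_Rint {R : realType} (f : R * R -> R) : measurable_fun setT f ->
  Rintegral (@lebesgue_measure R \x @lebesgue_measure R)%E setT f = Rintegral (@dA R) setT f.
Proof.
move=> mf; have mE : measurable_fun setT (EFin \o f) by apply/measurable_EFinP.
rewrite /Rintegral; congr fine; rewrite [LHS]integralE [RHS]integralE; congr (_ - _)%E; apply/esym/dA_int => //.
  exact: measurable_funepos.
exact: measurable_funeneg.
Qed.

(** * Bessel's inequality and the reproducing property *)

Section Fock.
Context {R : realType}.
Local Notation Re := complex.Re.
Local Notation Im := complex.Im.
Implicit Types (h : R[i] -> R).
Variable m : R.
Hypothesis m1 : 1 <= m.

Let Pf (h : R[i] -> R) (p : R * R) : \bar R := (h (toC p) * wt m (toC p))%:E.

Lemma disc_cover (p : R * R) : exists n : nat, forall k, (n <= k)%N -> disc k%:R p.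
Proof.
exists (Num.bound (cmod (toC p))) => k hk; rewrite /disc /=.
apply: (@le_trans _ _ (Num.bound (cmod (toC p)))%:R); last by rewrite ler_nat.
by apply: ltW; apply: archi_boundP; exact: cmod_ge0.
Qed.

Lemma dint_full h : (@dA R).-integrable setT (Pf h) ->
  (fun n : nat => dint m n%:R h) @ \oo --> \int[@dA R]_p (h (toC p) * wt m (toC p)).
Proof.
move=> ih; apply: fine_cvg; rewrite /Rintegral fineK; last first.
  exact: integrable_fin_num.
under eq_fun do rewrite [integral _ _ _]integral_mkcond.
have mf : measurable_fun setT (Pf h) by exact: measurable_int ih.
apply: (@dominated_cvg _ _ _ _ _ measurableT _ _ (abse \o Pf h)) => //.
- by move=> n; apply/(measurable_restrictT _ (measurable_disc _)); apply: measurable_funS mf.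
- move=> p _; have [n hn] := disc_cover p.
  apply: cvg_near_cst; exists n => // k hk; rewrite /patch ifT// inE; exact: hn.
- exact: integrable_abse.
- move=> n p _; rewrite /patch; case: ifP => // _.
  by rewrite abse0 abse_ge0.
Qed.

Lemma int_full h : rmeas h -> (forall z, 0 <= h z) ->
  (fun n : nat => \int[@dA R]_(p in disc n%:R) Pf h p)%E @ \oo --> (\int[@dA R]_p Pf h p)%E.
Proof.
move=> mh h0.
have -> : [set: R * R] = \bigcup_n disc n%:R.
  by apply/seteqP; split => // p _; have [n hn] := disc_cover p; exists n => //; exact: hn.
apply: ge0_nondecreasing_set_cvg_integral.
- apply/nondecreasing_seqP => n; apply/subsetPset => p; rewrite /disc /= => /le_trans; apply.
  by rewrite ler_nat.
- by move=> n; exact: measurable_disc.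
- by move=> n; apply/measurable_EFinP; apply: measurable_funS (rmeasM mh (rmeas_wt m)).
- by move=> n p _; rewrite lee_fin mulr_ge0 ?wt_ge0.
Qed.

Lemma dintE r h : dbound r h -> (dint m r h)%:E = (\int[@dA R]_(p in disc r) Pf h p)%E.
Proof.
move=> bh; rewrite /dint /Rintegral fineK//.
by apply: integrable_fin_num; [exact: measurable_disc|exact: disc_integrable].
Qed.

Lemma dint_le_full r h : dbound r h -> (forall z, 0 <= h z) ->
  ((dint m r h)%:E <= \int[@dA R]_p Pf h p)%E.
Proof.
move=> bh h0; rewrite dintE//; apply: ge0_subset_integral => //; first exact: measurable_disc.
  by apply/measurable_EFinP; exact: (rmeasM bh.1 (rmeas_wt m)).
by move=> p _; rewrite lee_fin mulr_ge0 ?wt_ge0.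
Qed.

Let dbX r k : dbound r (fun z : R[i] => cmod z ^+ (2 * k)).
Proof.
split; first by apply: rmeasX; exact: rmeas_cmod cmeas_id.
exists (r ^+ (2 * k)) => z zr; have r0 : 0 <= r by apply: le_trans zr; exact: cmod_ge0.
by rewrite ger0_norm ?exprn_ge0 ?cmod_ge0// lerXn2r ?nnegrE ?cmod_ge0.
Qed.

Lemma gamr_ge0 r k : 0 <= gamr m r k.
Proof. by apply: dint_ge0 => z _; rewrite exprn_ge0 ?cmod_ge0. Qed.

Lemma gamr_le r k : gamr m r k <= gam m k.
Proof.
rewrite -lee_fin -(moment m1 k); apply: dint_le_full; first exact: dbX.
by move=> z; rewrite exprn_ge0 ?cmod_ge0.
Qed.

Lemma gamr_cvg k : (fun n : nat => gamr m n%:R k) @ \oo --> gam m k.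
Proof.
apply: fine_cvg; rewrite -(moment m1 k).
have h := @int_full (fun z => cmod z ^+ (2 * k)) (dbX 0 k).1 (fun z => exprn_ge0 _ (cmod_ge0 z)).
by apply: cvg_trans h; apply: near_eq_cvg; apply: nearW => n; rewrite -dintE.
Qed.

Let db_l2 r (a : nat -> R[i]) : pscoef a -> dbound r (fun z => cmod (PS a z) ^+ 2).
Proof.
move=> pa; split; first exact: rmeas_cmod2 (cmeas_PS pa).
have [B hB] := PS_bound r pa; exists (B ^+ 2) => z zr.
have B0 : 0 <= B by apply: le_trans (hB z zr); exact: cmod_ge0.
by rewrite ger0_norm ?sqr_ge0// lerXn2r ?nnegrE ?cmod_ge0// hB.
Qed.

Lemma disc_parseval r (a : nat -> R[i]) : pscoef a ->
  (fun n => \sum_(k < n) cmod (a k) ^+ 2 * gamr m r k) @ \oo --> dint m r (fun z => cmod (PS a z) ^+ 2).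
Proof.
move=> pa; have := disc_lemma m1 (r := r) pa pa.
have -> : (fun z => Re (PS a z * ((PS a z)^*)%C)) = (fun z => cmod (PS a z) ^+ 2).
  by apply/funext => z; rewrite mulcJ.
by apply: cvg_trans; apply: near_eq_cvg; apply: nearW => n; apply: eq_bigr => k _; rewrite mulcJ.
Qed.

(** For a fixed number of terms Parseval on a disc gives the bound with [gamr]; then the radius
    tends to infinity. *)
Lemma bessel (a : nat -> R[i]) (E : R) : pscoef a -> (l2sq m (PS a) <= E%:E)%E ->
  forall n, \sum_(k < n) cmod (a k) ^+ 2 * gam m k <= E.
Proof.
move=> pa hE n.
have c : (fun j : nat => \sum_(k < n) cmod (a k) ^+ 2 * gamr m j%:R k) @ \oo -->
    \sum_(k < n) cmod (a k) ^+ 2 * gam m k.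
  elim: n => [|n IH].
    by rewrite big_ord0; under eq_fun do rewrite big_ord0; exact: cvg_cst.
  rewrite big_ord_recr /=; under eq_fun do rewrite big_ord_recr /=.
  by apply: cvgD; [exact: IH|apply: cvgM; [exact: cvg_cst|exact: gamr_cvg]].
rewrite -(cvg_lim _ c)//; apply: limr_le; first exact: cvgP c.
apply: nearW => j.
apply: (@le_trans _ _ (dint m j%:R (fun z => cmod (PS a z) ^+ 2))); last first.
  rewrite -lee_fin; apply: le_trans hE; apply: dint_le_full; first exact: db_l2.
  by move=> z; exact: sqr_ge0.
have d := disc_parseval (r := j%:R) pa; rewrite -(cvg_lim _ d)//.
apply: nondecreasing_cvgn_le; last exact: cvgP d.
apply/nondecreasing_seqP => i; rewrite big_ord_recr /= lerDl mulr_ge0 ?sqr_ge0//.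
exact: gamr_ge0.
Qed.

Lemma l2_le (b : nat -> R[i]) (E : R) : pscoef b ->
  (forall n, \sum_(k < n) cmod (b k) ^+ 2 * gam m k <= E) -> (l2sq m (PS b) <= E%:E)%E.
Proof.
move=> pb hE.
have h := @int_full (fun z => cmod (PS b z) ^+ 2) (rmeas_cmod2 (cmeas_PS pb)) (fun z => sqr_ge0 _).
rewrite /l2sq -(cvg_lim _ h)//; apply: lime_le; first exact: cvgP h.
apply: nearW => n; rewrite -dintE; last exact: db_l2.
rewrite lee_fin.
have d := disc_parseval (r := n%:R) pb; rewrite -(cvg_lim _ d)//; apply: limr_le; first exact: cvgP d.
apply: nearW => j; apply: le_trans (hE j); apply: ler_sum => k _.
by rewrite ler_wpM2l ?sqr_ge0// gamr_le.
Qed.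

(** Taylor coefficients of K(., z), in the normalisation by the norms of the monomials. *)
Definition kcoef (z : R[i]) (k : nat) : R[i] := ((z^*)%C) ^+ k * ((gam m k)^-1)%:C%C.

Lemma gamV k : (gam m k)^-1 = m / pi * mlc m k.
Proof. by rewrite /gam invfM invf_div. Qed.

Lemma kcoef_ml z k : kcoef z k = (m / pi)%:C%C * (mlC m k * ((z^*)%C) ^+ k).
Proof. by rewrite /kcoef gamV real_complexM /mlC; ring. Qed.

Lemma Kern_kcoef w z : Kern m w z = PS (kcoef z) w.
Proof.
rewrite Kern_PS /PS -csumZ; last exact: (asum_ps _ (pscoef_ml m1)).
congr csum; apply/funext => k; rewrite kcoef_ml exprMn; ring.
Qed.

Lemma pscoef_kcoef z : pscoef (kcoef z).
Proof.
have e : kcoef z = fun k => (m / pi)%:C%C * (mlC m k * ((z^*)%C) ^+ k) by apply/funext => k; exact: kcoef_ml.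
rewrite e; apply: pscoefZ => r r0.
have [M hM] := pscoef_ml m1 (mulr_ge0 (cmod_ge0 z) r0); exists M => k.
by rewrite cmodM cmodX cmodJ -mulrA -exprMn.
Qed.

Lemma csumJ (a : nat -> R[i]) : asum a -> ((csum a)^*)%C = csum (fun k => ((a k)^*)%C).
Proof.
move=> /asum_cvg /ccvgJ h; apply/esym/csum_eq.
have -> : (fun n => \sum_(k < n) ((a k)^*)%C) = (fun n => ((\sum_(k < n) a k)^*)%C).
  by apply/funext => n; rewrite conjc_sum.
exact: h.
Qed.

Lemma KernJ z w : ((Kern m z w)^*)%C = Kern m w z.
Proof.
rewrite !Kern_PS conjcM; congr (_ * _); first by apply: complex_eq; rewrite ?ReJ ?ImJ /= ?oppr0.
rewrite /PS csumJ; last exact: (asum_ps _ (pscoef_ml m1)).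
congr csum; apply/funext => k; rewrite conjcM conjcX conjcM conjcK [w * _]mulrC; congr (_ * _).
by apply: complex_eq; rewrite ?ReJ ?ImJ /= ?oppr0.
Qed.

Definition Kd z : R := Re (Kern m z z).

Lemma Kern_diag z : Kern m z z = (Kd z)%:C%C.
Proof.
apply: complex_eq; rewrite //=.
have := KernJ z z => /(congr1 (@complex.Im R)); rewrite ImJ => /eqP.
by rewrite eq_sym -subr_eq0 opprK -mulr2n mulrn_eq0 /= => /eqP.
Qed.

Lemma Kd_sum z n : \sum_(k < n) cmod z ^+ (2 * k) / gam m k <= Kd z.
Proof.
rewrite /Kd Kern_kcoef.
have e k : Re (kcoef z k * z ^+ k) = cmod z ^+ (2 * k) / gam m k.
  rewrite /kcoef mulrAC -exprMn [_ * z]mulrC mulcJ real_complexX -real_complexM -exprM mulrC.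
  by [].
under eq_bigr do rewrite -e.
apply: Re_csum_ge; first exact: (asum_ps _ (pscoef_kcoef z)).
by move=> k; rewrite e divr_ge0 ?exprn_ge0 ?cmod_ge0// ltW ?gam_gt0.
Qed.

Lemma Kd_gt0 z : 0 < Kd z.
Proof.
apply: lt_le_trans (Kd_sum z 1); rewrite big_ord1 muln0 expr0 mul1r invr_gt0.
exact: gam_gt0.
Qed.

Lemma cmod_kcoef z k : cmod (kcoef z k) ^+ 2 * gam m k = cmod z ^+ (2 * k) / gam m k.
Proof.
have g := gam_gt0 m1 k.
rewrite /kcoef cmodM cmodX cmodJ cmodR ger0_norm ?invr_ge0 ?(ltW g)// exprMn -exprM mulnC.
by field; rewrite gt_eqF.
Qed.

Lemma l2_Kern z : (l2sq m (fun w => Kern m w z) <= (Kd z)%:E)%E.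
Proof.
have -> : (fun w => Kern m w z) = PS (kcoef z) by apply/funext => w; exact: Kern_kcoef.
apply: l2_le; first exact: pscoef_kcoef.
by move=> n; under eq_bigr do rewrite cmod_kcoef; exact: Kd_sum.
Qed.

(** Weighted Cauchy-Schwarz: [V] bounds the squared norm of the functional with coefficients [c] on
    the Fock space. It serves for point evaluation and for the derivative functional. *)
Lemma functional_bound (a c : nat -> R[i]) (E V : R) :
  (forall n, \sum_(k < n) cmod (a k) ^+ 2 * gam m k <= E) ->
  (forall n, \sum_(k < n) cmod (c k) ^+ 2 / gam m k <= V) ->
  cmod (csum (fun k => a k * c k)) ^+ 2 <= E * V.
Proof.
move=> hE hV.
have E0 : 0 <= E by have := hE 0%N; rewrite big_ord0.
have V0 : 0 <= V by have := hV 0%N; rewrite big_ord0.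
rewrite -(sqr_sqrtr (mulr_ge0 E0 V0)) lerXn2r ?nnegrE ?cmod_ge0 ?sqrtr_ge0//.
apply: (@cmod_csum_le _ _ (fun k => cmod (a k) * cmod (c k))) => [k|n]; first by rewrite cmodM.
rewrite -[leLHS]ger0_norm; last by apply: sumr_ge0 => k _; rewrite mulr_ge0 ?cmod_ge0.
rewrite -sqrtr_sqr ler_wsqrtr//.
pose s k := Num.sqrt (gam m k).
have s0 k : 0 < s k by rewrite sqrtr_gt0 gam_gt0.
have ss k : s k ^+ 2 = gam m k by rewrite sqr_sqrtr// ltW// gam_gt0.
have := cauchy_schwarz (fun k => cmod (a k) * s k) (fun k => cmod (c k) / s k) n.
have -> : \sum_(k < n) cmod (a k) * s k * (cmod (c k) / s k) = \sum_(k < n) cmod (a k) * cmod (c k).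
  by apply: eq_bigr => k _; rewrite mulrACA divff ?mulr1// gt_eqF.
move=> h; apply: le_trans h _; apply: ler_pM.
- by apply: sumr_ge0 => k _; exact: sqr_ge0.
- by apply: sumr_ge0 => k _; exact: sqr_ge0.
- by apply: le_trans (hE n); apply: ler_sum => k _; rewrite exprMn ss.
- by apply: le_trans (hV n); apply: ler_sum => k _; rewrite exprMn exprVn ss.
Qed.

Lemma point_bound (a : nat -> R[i]) (E : R) z : pscoef a -> (l2sq m (PS a) <= E%:E)%E ->
  cmod (PS a z) ^+ 2 <= E * Kd z.
Proof.
move=> pa hE; apply: functional_bound; first exact: bessel.
by move=> n; apply: le_trans (Kd_sum z n); apply: ler_sum => k _; rewrite cmodX -exprM mulnC.
Qed.

(** Over the disc of radius n the integral is the real part of sum a_k z^k gamr_k / gam_k; the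
    quotients lie in [0, 1] and tend to 1, so Tannery's theorem applies. *)
Let repro_re (a : nat -> R[i]) z : pscoef a ->
  (@dA R).-integrable setT (Pf (fun w => Re (PS a w * ((PS (kcoef z) w)^*)%C))) ->
  \int[@dA R]_p (Re (PS a (toC p) * ((PS (kcoef z) (toC p))^*)%C) * wt m (toC p)) = Re (PS a z).
Proof.
move=> pa ih.
pose F (n k : nat) : R[i] := a k * z ^+ k * (gamr m n%:R k / gam m k)%:C%C.
have r01 n k : 0 <= gamr m n%:R k / gam m k <= 1.
  rewrite divr_ge0 ?gamr_ge0 ?(ltW (gam_gt0 m1 k))//= ler_pdivrMr ?gam_gt0// mul1r.
  exact: gamr_le.
have F1 n k : cmod (F n k) <= cmod (a k) * cmod z ^+ k.
  have /andP[h1 h2] := r01 n k.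
  by rewrite /F !cmodM cmodX cmodR ger0_norm// ler_piMr// mulr_ge0 ?exprn_ge0 ?cmod_ge0.
have F2 k : ccvg (F ^~ k) (a k * z ^+ k).
  rewrite -[X in ccvg _ X]mulr1; apply: ccvgM; first exact: ccvg_cst.
  have h : (fun n : nat => gamr m n%:R k / gam m k) @ \oo --> gam m k / gam m k.
    by apply: cvgM; [exact: gamr_cvg|exact: cvg_cst].
  by rewrite divff ?gt_eqF ?gam_gt0// in h; exact: ccvgR h.
have [_ [lim _]] := tannery (pscoef_sum pa (cmod_ge0 z)) F1 F2.
have lim2 := dint_full ih.
apply: (cvg_unique (@Rhausdorff R) lim2).
apply: cvg_trans lim; apply: near_eq_cvg; apply: nearW => n.
have d := disc_lemma m1 (r := n%:R) pa (pscoef_kcoef z).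
have sF : asum (F n) by apply: asumW (F1 n) (pscoef_sum pa (cmod_ge0 z)).
have [e _] := asum_cvg sF.
apply: (cvg_unique (@Rhausdorff R) e); apply: cvg_trans d.
apply: near_eq_cvg; apply: nearW => N; rewrite Re_sum; apply: eq_bigr => k _.
rewrite /F /kcoef conjcM conjcX conjcK.
have -> : (((gam m k)^-1)%:C%C^*)%C = ((gam m k)^-1)%:C%C :> R[i].
  by apply: complex_eq; rewrite ?ReJ ?ImJ /= ?oppr0.
by rewrite mulrA ![_ * _%:C%C]mulrC !ReZl; ring.
Qed.

(** Only the integrability of the product is assumed, not that the function is square integrable:
    this is exactly what the definedness of a Toeplitz operator provides. *)
Theorem reproducing (a : nat -> R[i]) z : pscoef a ->
  lam_integrable m (fun w => Kern m z w * PS a w) ->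
  lam_int m (fun w => Kern m z w * PS a w) = PS a z.
Proof.
have e (b : nat -> R[i]) w : Kern m z w * PS b w = PS b w * ((PS (kcoef z) w)^*)%C.
  by rewrite -Kern_kcoef KernJ mulrC.
move=> pa [i1 i2]; apply: complex_eq; rewrite /lam_int /=.
  transitivity (\int[@dA R]_p (Re (PS a (toC p) * ((PS (kcoef z) (toC p))^*)%C) * wt m (toC p))).
    transitivity (\int[@dA R]_p (Re (Kern m z (toC p) * PS a (toC p)) * wt m (toC p))).
      by apply: dA_Rint; apply/measurable_EFinP; exact: measurable_int i1.
    by apply: eq_Rintegral => p _; rewrite e.
  by apply: (repro_re pa); apply: eq_integrable i1 => // p _; rewrite e.
(* The imaginary part is the real part after multiplication of the series by - i. *)
have pb : pscoef (fun k => - 'i%C * a k) by exact: pscoefZ.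
have ReI (x : R[i]) : Re (- 'i%C * x) = Im x by case: x => x y; rewrite /=; ring.
have eb w : Re (PS (fun k => - 'i%C * a k) w * ((PS (kcoef z) w)^*)%C) =
   Im (Kern m z w * PS a w) by rewrite PSZ// -mulrA -e ReI.
have pz : Im (PS a z) = Re (PS (fun k => - 'i%C * a k) z) by rewrite PSZ// ReI.
rewrite pz; apply: (etrans _ (repro_re pb _)); last by apply: eq_integrable i2 => // p _; rewrite /Pf (eb (toC p)).
transitivity (\int[@dA R]_p (Im (Kern m z (toC p) * PS a (toC p)) * wt m (toC p))).
  by apply: dA_Rint; apply/measurable_EFinP; exact: measurable_int i2.
by apply: eq_Rintegral => p _; rewrite (eb (toC p)).
Qed.

End Fock.

(** * Schur test for exponential symbols *)

Section KernelBound.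
Context {R : realType}.
Local Notation Re := complex.Re.
Local Notation Im := complex.Im.
Implicit Types (z w : R[i]) (g : {poly R[i]}).
Variable m : R.
Hypothesis m1 : 1 <= m.
Let m0 : 0 < m. Proof. exact: lt_le_trans m1. Qed.
Let mm1 : 0 <= m - 1. Proof. by rewrite subr_ge0. Qed.

Lemma powR_mid (x y : R) : 0 <= x -> 0 <= y -> ((x + y) / 2) `^ m <= (x `^ m + y `^ m) / 2.
Proof.
move=> x0 y0.
have -> : (x + y) / 2 = 2^-1 * x + 2^-1 * y by ring.
have -> : (x `^ m + y `^ m) / 2 = 2^-1 * x `^ m + 2^-1 * y `^ m by ring.
rewrite {2 4}(_ : 2^-1 = 1 - 2^-1); last by rewrite {2}(splitr 1) div1r addrK.
by apply: (convex_powR m1 (Itv01 _ _)) => //=;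
  rewrite ?inE/= ?in_itv/= ?x0 ?y0// ?invr_ge0// invf_le1 ?ler1n.
Qed.

(** If Re (z conj w) >= 0, the right-hand side is |z - w|^2 / 2; otherwise the claim amounts to |z +
    w|^2 >= 0. *)
Lemma rpos_gap z w : cmod (z - w) ^+ 2 / 4 <= (cmod z ^+ 2 + cmod w ^+ 2) / 2 - rpos (z * (w^*)%C).
Proof.
have e : cmod (z - w) ^+ 2 = cmod z ^+ 2 + cmod w ^+ 2 - 2 * Re (z * (w^*)%C).
  by case: z w => a b [c d]; rewrite !cmod_sqr /=; ring.
have s : 0 <= cmod z ^+ 2 + cmod w ^+ 2 + 2 * Re (z * (w^*)%C).
  have -> : cmod z ^+ 2 + cmod w ^+ 2 + 2 * Re (z * (w^*)%C) = cmod (z + w) ^+ 2.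
    by case: z w {e} => a b [c d]; rewrite !cmod_sqr /=; ring.
  exact: sqr_ge0.
have p := sqr_ge0 (cmod (z - w)).
rewrite /rpos; case: (leP (Re (z * (w^*)%C)) 0) => h; lra.
Qed.

Definition kR z w : R := Num.max 1 (Num.max (cmod z) (cmod w)).
Definition kT z w : R := kR z w `^ (2 * m - 2).
(** Equals 2^-(m - 1) / 4: the first factor comes from q >= R^2 / 2 raised to the power m - 1, the
    quarter from [rpos_gap]. *)
Definition kdel : R := 2^-1 `^ (m + 1).

Lemma kR_ge1 z w : 1 <= kR z w. Proof. by rewrite /kR le_max lexx. Qed.
Lemma kR_gel z w : cmod z <= kR z w. Proof. by rewrite /kR !le_max lexx orbT. Qed.
Lemma kR_ger z w : cmod w <= kR z w. Proof. by rewrite /kR !le_max lexx !orbT. Qed.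
Lemma kdel_gt0 : 0 < kdel. Proof. by rewrite powR_gt0// invr_gt0. Qed.
Lemma kR_gt0 z w : 0 < kR z w. Proof. exact: lt_le_trans ltr01 (kR_ge1 z w). Qed.
Lemma kTE z w : kT z w = (kR z w `^ (m - 1)) ^+ 2.
Proof. by rewrite /kT -powR_mulrn ?powR_ge0// -powRrM; congr (_ `^ _); ring. Qed.

(** Convexity gives q^m below the mean of the two powers, and q^m - P^m >= q^(m - 1) (q - P), to
    which [rpos_gap] applies. *)
Lemma kern_gap z w : kdel * (kT z w * cmod (z - w) ^+ 2) - 4 * kdel <=
  (cmod z ^+ 2) `^ m / 2 + (cmod w ^+ 2) `^ m / 2 - rpos (z * (w^*)%C) `^ m.
Proof.
set P := rpos _; set q := (cmod z ^+ 2 + cmod w ^+ 2) / 2.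
have P0 : 0 <= P by exact: rpos_ge0.
have gap : cmod (z - w) ^+ 2 / 4 <= q - P by exact: rpos_gap.
have d0 : 0 <= cmod (z - w) ^+ 2 by exact: sqr_ge0.
have Pq : P <= q by rewrite -subr_ge0; apply: le_trans gap; rewrite divr_ge0.
have q0 : 0 <= q by apply: le_trans Pq.
have h1 : q `^ m <= (cmod z ^+ 2) `^ m / 2 + (cmod w ^+ 2) `^ m / 2.
  by rewrite -mulrDl; apply: powR_mid; exact: sqr_ge0.
have pw (x : R) : 0 <= x -> x `^ m = x `^ (m - 1) * x.
  move=> x0; rewrite -{3}(powRr1 x0) -powRD ?subrK// (gt_eqF m0) //.
have h2 : q `^ (m - 1) * (q - P) <= q `^ m - P `^ m.
  rewrite (pw q q0) (pw P P0) mulrBr lerB// ler_wpM2r//.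
  by apply: ge0_ler_powR; rewrite ?nnegrE.
have h3 : q `^ (m - 1) * (cmod (z - w) ^+ 2 / 4) <= q `^ (m - 1) * (q - P).
  by rewrite ler_wpM2l// powR_ge0.
suff h4 : kdel * (kT z w * cmod (z - w) ^+ 2) - 4 * kdel <= q `^ (m - 1) * (cmod (z - w) ^+ 2 / 4).
  lra.
(* When |z| and |w| are at most 1, q may vanish, but then kT = 1 and |z - w|^2 <= 4: the subtracted
   4 kdel covers this case. Otherwise q >= R^2 / 2. *)
have [M1|M1] := leP (Num.max (cmod z) (cmod w)) 1.
  have R1 : kR z w = 1 by rewrite /kR; apply/eqP; rewrite eq_le ge_max lexx M1 le_max lexx.
  have -> : kT z w = 1 by rewrite /kT R1 powR1.
  have dz : cmod (z - w) <= 2.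
    move: M1; rewrite ge_max => /andP[a b]; apply: le_trans (cmodBD _ _) _.
    by rewrite -[2]/(1 + 1 : R) lerD.
  have d4 : cmod (z - w) ^+ 2 <= 4.
    by rewrite (_ : 4 = 2 ^+ 2 :> R) ?lerXn2r ?nnegrE ?cmod_ge0//; rewrite -natrX.
  have k0 := kdel_gt0.
  have h5 : 0 <= q `^ (m - 1) * (cmod (z - w) ^+ 2 / 4) by rewrite mulr_ge0 ?powR_ge0// divr_ge0.
  apply: le_trans h5; rewrite mul1r subr_le0 mulrC ler_wpM2r// ltW//.
have RM : kR z w = Num.max (cmod z) (cmod w) by rewrite /kR max_r// ltW.
have R0 := kR_gt0 z w.
have qR : kR z w ^+ 2 / 2 <= q.
  rewrite /q ler_pM2r ?invr_gt0// RM; case: (leP (cmod z) (cmod w)) => _.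
    by rewrite lerDr sqr_ge0.
  by rewrite lerDl sqr_ge0.
have h5 : 4 * kdel * kT z w <= q `^ (m - 1).
  apply: (@le_trans _ _ ((kR z w ^+ 2 / 2) `^ (m - 1))); last first.
    by apply: (ge0_ler_powR mm1 _ _ qR); rewrite nnegrE//; apply: divr_ge0 => //; exact: sqr_ge0.
  rewrite powRM ?sqr_ge0 ?invr_ge0//.
  have -> : (kR z w ^+ 2) `^ (m - 1) = kT z w.
    rewrite /kT -(powR_mulrn 2 (ltW R0)) -powRrM; congr (_ `^ _); ring.
  rewrite mulrC ler_wpM2l ?powR_ge0//.
  have -> : kdel = 2^-1 `^ (m - 1) * 4^-1.
    have h20 : (2^-1 : R) != 0 by rewrite invr_eq0.
    rewrite /kdel (_ : m + 1 = m - 1 + 2%:R); last by ring.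
    rewrite powRD ?h20 ?implybT// powR_mulrn ?invr_ge0// exprVn; congr (_ * _^-1).
    by rewrite -natrX.
  by rewrite mulrCA mulfV ?mulr1.
have h6 : (4 * kdel * kT z w) * (cmod (z - w) ^+ 2 / 4) <= q `^ (m - 1) * (cmod (z - w) ^+ 2 / 4).
  by rewrite ler_wpM2r// divr_ge0.
have k0 := kdel_gt0.
have e : (4 * kdel * kT z w) * (cmod (z - w) ^+ 2 / 4) = kdel * (kT z w * cmod (z - w) ^+ 2) by field.
rewrite e in h6; apply: le_trans h6; rewrite gerBl mulr_ge0// ltW//.
Qed.

Lemma cmod_Kern_le : exists2 C : R, 0 < C & forall z w,
  cmod (Kern m z w) <= C * ((1 + rpos (z * (w^*)%C)) `^ (m - 1) * expR (rpos (z * (w^*)%C) `^ m)).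
Proof.
have [C C0 hC] := ml_bound m1; have p0 := pi_gt0 R.
have mp : 0 < m / pi by rewrite divr_gt0.
exists (m / pi * C) => [|z w]; first exact: mulr_gt0.
rewrite Kern_PS cmodM cmodR (ger0_norm (ltW mp)) -[m / pi * C * _]mulrA ler_wpM2l ?(ltW mp)//.
apply: le_trans (ml_positivity m1 _) _.
apply: Re_csum_le; first exact: (asum_ps _ (pscoef_ml m1)).
move=> n; apply: le_trans (hC _ n (rpos_ge0 _)); apply: ler_sum => k _.
by rewrite /mlC real_complexX ReZl.
Qed.

Lemma cmod_powB z w (B : R) k : cmod z <= B -> cmod w <= B ->
  cmod (z ^+ k.+1 - w ^+ k.+1) <= k.+1%:R * (B ^+ k * cmod (z - w)).
Proof.
move=> zB wB; have B0 : 0 <= B by apply: le_trans zB; exact: cmod_ge0.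
elim: k => [|k IH]; first by rewrite !expr1 expr0 !mul1r.
have -> : z ^+ k.+2 - w ^+ k.+2 = z * (z ^+ k.+1 - w ^+ k.+1) + (z - w) * w ^+ k.+1.
  by rewrite [z ^+ k.+2]exprS [w ^+ k.+2]exprS; ring.
apply: le_trans (cmodD _ _) _; rewrite !cmodM cmodX.
have i1 : cmod z * cmod (z ^+ k.+1 - w ^+ k.+1) <= B * (k.+1%:R * (B ^+ k * cmod (z - w))).
  by apply: ler_pM; rewrite ?cmod_ge0.
have i2 : cmod (z - w) * cmod w ^+ k.+1 <= cmod (z - w) * B ^+ k.+1.
  by rewrite ler_wpM2l ?cmod_ge0// lerXn2r ?nnegrE ?cmod_ge0.
have e : B * (k.+1%:R * (B ^+ k * cmod (z - w))) + cmod (z - w) * B ^+ k.+1 =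
  k.+2%:R * (B ^+ k.+1 * cmod (z - w)) by rewrite -[k.+2%:R]natr1 exprS; ring.
by rewrite -e; exact: lerD.
Qed.

Definition plip g : R := \sum_(k < size g) k%:R * cmod g`_k.

Lemma deg_le_idx g k : deg_le g m -> (k < size g)%N -> k%:R <= m.
Proof. by move=> d ks; apply: le_trans d; rewrite ler_nat; lia. Qed.

(** The degree condition enters here: exponents k - 1 <= m - 1 make the Lipschitz scale the square
    root of [kT], the scale of the gaussian. *)
Lemma poly_lip g z w : deg_le g m ->
  cmod (g.[z] - g.[w]) <= plip g * (kR z w `^ (m - 1) * cmod (z - w)).
Proof.
move=> dg; rewrite !horner_coef -sumrB; apply: le_trans (cmod_sum _ _ _) _.
rewrite /plip mulr_suml; apply: ler_sum => -[k ks] _ /=.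
rewrite -mulrBr cmodM; case: k ks => [|k] ks.
  by rewrite !expr0 subrr cmod0 mulr0 !mul0r.
rewrite mulrAC [leRHS]mulrC ler_wpM2l ?cmod_ge0//.
apply: le_trans (cmod_powB k (kR_gel z w) (kR_ger z w)) _.
rewrite ler_wpM2l// ler_wpM2r ?cmod_ge0// -powR_mulrn ?(ltW (kR_gt0 z w))//.
apply: ler_powR; first exact: kR_ge1.
by rewrite lerBrDr natr1; exact: deg_le_idx dg ks.
Qed.

(** Cauchy-Schwarz, with at most m + 1 indices whose squares are at most (m + 1)^2; it brings in the
    Hardy norm. *)
Lemma plip_sqr g : deg_le g m -> plip g ^+ 2 <= (m + 1) ^+ 3 * h2sq g.
Proof.
move=> dg; apply: le_trans (cauchy_schwarz (fun k => k%:R) (fun k => cmod g`_k) (size g)) _.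
rewrite ler_wpM2r//; first by apply: sumr_ge0 => k _; exact: sqr_ge0.
have sm : (size g)%:R <= m + 1.
  have [->|s0] := posnP (size g); first by rewrite addr_ge0// ltW.
  by rewrite -(prednK s0) -natr1 lerD2r.
apply: (@le_trans _ _ (\sum_(k < size g) (m + 1) ^+ 2)).
  apply: ler_sum => k _; rewrite lerXn2r ?nnegrE ?addr_ge0 ?(ltW m0)//.
  by apply: le_trans sm; rewrite ler_nat ltnW.
by rewrite sumr_const card_ord -mulr_natr [leRHS]exprSr ler_wpM2l// sqr_ge0.
Qed.

(* By [kern_gap], [|K(z,w)|] times the square roots of the two weights is dominated by this kernel; the
   factor [kT] normalises the gaussian, whose width shrinks at infinity. *)
Definition kap (a : R) z w : R := kT z w * expR (- (a * (kT z w * cmod (z - w) ^+ 2))).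

(** Half of the exponent kdel D^2 pays for plip g * D by completing the square, which leaves the
    gaussian parameter kdel / 2 and the factor exp (plip^2 / (2 kdel)). *)
Lemma weighted_kernel_bound : exists2 N : R, 0 < N & forall g z w, deg_le g m ->
  cmod (cexp g.[z]) * cmod (Kern m z w) * cmod (cexp (- g.[w])) *
    expR (- ((cmod z ^+ 2) `^ m / 2)) * expR (- ((cmod w ^+ 2) `^ m / 2)) <=
  N * expR (plip g ^+ 2 / (2 * kdel)) * kap (kdel / 2) z w.
Proof.
have [C C0 hC] := cmod_Kern_le; have k0 := kdel_gt0.
exists (C * 2 `^ (m - 1) * expR (4 * kdel)) => [|g z w dg].
  by rewrite !mulr_gt0 ?powR_gt0 ?expR_gt0.
set P := rpos (z * (w^*)%C); set D := kR z w `^ (m - 1) * cmod (z - w).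
have P0 : 0 <= P by exact: rpos_ge0.
have D0 : 0 <= D by rewrite mulr_ge0 ?powR_ge0 ?cmod_ge0.
have D2 : kT z w * cmod (z - w) ^+ 2 = D ^+ 2 by rewrite kTE /D exprMn.
have K1 : cmod (Kern m z w) <= C * (2 `^ (m - 1) * kT z w * expR (P `^ m)).
  apply: le_trans (hC z w) _; rewrite ler_wpM2l ?(ltW C0)// ler_wpM2r ?expR_ge0//.
  have R1 := kR_ge1 z w; have R0 := kR_gt0 z w.
  have PR : 1 + P <= 2 * kR z w ^+ 2.
    have : P <= kR z w ^+ 2.
      rewrite /P /rpos ge_max sqr_ge0 andbT; apply: le_trans (Re_le _) _.
      by rewrite cmodM cmodJ expr2; apply: ler_pM; rewrite ?cmod_ge0 ?kR_gel ?kR_ger.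
    have : 1 <= kR z w ^+ 2 by rewrite exprn_ege1.
    lra.
  apply: (@le_trans _ _ ((2 * kR z w ^+ 2) `^ (m - 1))).
    apply: (ge0_ler_powR mm1 _ _ PR); rewrite nnegrE; first exact: addr_ge0.
    by apply: mulr_ge0 => //; exact: sqr_ge0.
  rewrite powRM ?sqr_ge0// ler_wpM2l ?powR_ge0// kTE.
  by rewrite -(powR_mulrn 2 (ltW R0)) -(powR_mulrn 2 (powR_ge0 _ _)) -!powRrM mulrC.
have g1 : Re g.[z] - Re g.[w] <= plip g * D.
  by rewrite -ReB; apply: le_trans (Re_le _) _; exact: poly_lip.
have amgm : plip g * D <= plip g ^+ 2 / (2 * kdel) + kdel / 2 * D ^+ 2.
  have : 0 <= kdel / 2 * (D - plip g / kdel) ^+ 2 by rewrite mulr_ge0 ?sqr_ge0// divr_ge0// ltW.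
  have -> : kdel / 2 * (D - plip g / kdel) ^+ 2 =
    plip g ^+ 2 / (2 * kdel) + kdel / 2 * D ^+ 2 - plip g * D by field; rewrite gt_eqF.
  by rewrite subr_ge0.
have gap := kern_gap z w; rewrite D2 -/P in gap.
rewrite !cmod_cexp ReN /kap D2.
set A := (cmod z ^+ 2) `^ m / 2 in gap *; set B := (cmod w ^+ 2) `^ m / 2 in gap *.
apply: (@le_trans _ _ (expR (Re g.[z]) * (C * (2 `^ (m - 1) * kT z w * expR (P `^ m))) *
   expR (- Re g.[w]) * expR (- A) * expR (- B))).
  by rewrite !(ler_wpM2r (expR_ge0 _))// ler_wpM2l ?expR_ge0.
have alg1 (C' k T eP x y x' y' : R) :
  x * (C' * (k * T * eP)) * y * x' * y' = C' * k * T * (x * y * eP * x' * y') by ring.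
have alg2 (C' k T x y x' : R) : C' * k * x * y * (T * x') = C' * k * T * (x * y * x') by ring.
rewrite alg1 alg2 -!expRD.
have e2 : kdel / 2 * D ^+ 2 + kdel / 2 * D ^+ 2 = kdel * D ^+ 2 by field.
apply: ler_wpM2l; last by rewrite ler_expR; lra.
by apply: mulr_ge0; [apply: mulr_ge0; [exact: ltW|exact: powR_ge0]|exact: powR_ge0].
Qed.

Lemma rmeas_kap a z : rmeas (kap a z).
Proof.
have mT : rmeas (kT z).
  apply: (@rmeas_comp _ _ (fun x => x `^ (2 * m - 2))); first exact: measurable_powR.
  apply: measurable_maxr; first exact: rmeas_cst.
  by apply: measurable_maxr; [exact: rmeas_cst|exact: rmeas_cmod cmeas_id].
apply: rmeasM => //; apply: (@rmeas_comp _ _ expR); first exact: measurable_expR.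
apply: (@rmeas_comp _ _ -%R); first exact: oppr_measurable.
apply: rmeasM; first exact: rmeas_cst; apply: rmeasM => //.
apply: (@rmeas_cmod2 _ (fun w => z - w)).
have := cmeasD (cmeas_cst z) (cmeasM (cmeas_cst (-1)) cmeas_id).
by congr cmeas; apply/funext => w; rewrite mulN1r.
Qed.

Lemma kap_ge0 a z w : 0 <= kap a z w.
Proof. by rewrite mulr_ge0 ?powR_ge0 ?expR_ge0. Qed.

Lemma kap_sym a z w : kap a z w = kap a w z.
Proof. by rewrite /kap /kT /kR [Num.max (cmod w) _]maxC cmodB. Qed.

(** Freezes the scale at z: kT z w <= kT z z (1 + d)^p <= kT z z exp (p d) with p = 2 m - 2, and
    half of the gaussian absorbs exp (p d). *)
Lemma kap_le (a : R) z w : 0 < a ->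
  kap a z w <= expR ((2 * m - 2) ^+ 2 / (2 * a)) *
    (kT z z * expR (- (a / 2 * kT z z * cmod (w - z) ^+ 2))).
Proof.
move=> a0; set p := 2 * m - 2; set d := cmod (z - w).
have p0 : 0 <= p by rewrite /p (_ : 2 * m - 2 = 2 * (m - 1)) ?mulr_ge0//; ring.
have d0 : 0 <= d by exact: cmod_ge0.
have kzz : kR z z = Num.max 1 (cmod z) by rewrite /kR maxxx.
have R1 : 1 <= kR z z by exact: kR_ge1.
have R2 : kR z z <= kR z w.
  by rewrite kzz ge_max kR_ge1 kR_gel.
have R3 : kR z w <= kR z z * (1 + d).
  have d1 : d <= kR z z * d by rewrite ler_peMl.
  have zz := kR_gel z z.
  rewrite mulrDr mulr1 /kR !ge_max -/(kR z z); apply/and3P; split.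
  - by apply: (le_trans R1); rewrite lerDl mulr_ge0// (le_trans ler01).
  - by apply: (le_trans zz); rewrite lerDl mulr_ge0// (le_trans ler01).
  - have : cmod w - cmod z <= d by rewrite /d cmodB; exact: cmod_dist.
    lra.
have T1 : 1 <= kT z z by have := @ler_powR R _ R1 _ _ p0; rewrite powRr0.
have T2 : kT z z <= kT z w.
  by apply: ge0_ler_powR => //; rewrite ?nnegrE ?(ltW (kR_gt0 _ _)).
have T3 : kT z w <= kT z z * expR (p * d).
  apply: (@le_trans _ _ ((kR z z * (1 + d)) `^ p)).
    by apply: ge0_ler_powR => //; rewrite nnegrE ?mulr_ge0 ?addr_ge0 ?(ltW (kR_gt0 _ _)).
  rewrite powRM ?addr_ge0 ?(ltW (kR_gt0 _ _))// ler_wpM2l ?powR_ge0//.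
  apply: (@le_trans _ _ (expR d `^ p)).
    by apply: (ge0_ler_powR p0); rewrite ?nnegrE; [exact: addr_ge0|exact: expR_ge0|exact: expR_ge1Dx].
  by rewrite -expRM mulrC.
have T0 : 0 <= kT z z by exact: powR_ge0.
have d20 : 0 <= d ^+ 2 by exact: sqr_ge0.
apply: (@le_trans _ _ (kT z z * expR (p * d) * expR (- (a * (kT z z * d ^+ 2))))).
  rewrite /kap -/d; apply: ler_pM; [exact: powR_ge0|exact: expR_ge0|exact: T3|].
  rewrite ler_expR lerN2; apply: ler_wpM2l; first exact: ltW.
  exact: ler_wpM2r.
rewrite [cmod (w - z)]cmodB -/d.
have -> : expR (p ^+ 2 / (2 * a)) * (kT z z * expR (- (a / 2 * kT z z * d ^+ 2))) =
  kT z z * expR (p ^+ 2 / (2 * a) - a / 2 * kT z z * d ^+ 2) by rewrite expRD; ring.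
rewrite -mulrA -expRD ler_wpM2l// ler_expR.
have h : 0 <= a / 2 * (d - p / a) ^+ 2 by rewrite mulr_ge0 ?sqr_ge0// divr_ge0// ltW.
have e : a / 2 * (d - p / a) ^+ 2 = a / 2 * d ^+ 2 - p * d + p ^+ 2 / (2 * a) by field; rewrite gt_eqF.
have h2 : a / 2 * d ^+ 2 <= a / 2 * (kT z z * d ^+ 2).
  by rewrite ler_wpM2l ?divr_ge0 ?(ltW a0)// ler_peMl.
have e3 : a * (kT z z * d ^+ 2) = a / 2 * (kT z z * d ^+ 2) + a / 2 * (kT z z * d ^+ 2) by field.
have e4 : a / 2 * kT z z * d ^+ 2 = a / 2 * (kT z z * d ^+ 2) by ring.
by rewrite e3 e4; lra.
Qed.

(** The prefactor [kT z z] cancels against the mass of the gaussian, so the bound is uniform in z,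
    as Schur's test demands. *)
Lemma kap_integral (a : R) z : 0 < a ->
  (\int[@dA R]_p (kap a z (toC p))%:E <= (expR ((2 * m - 2) ^+ 2 / (2 * a)) * (2 * pi / a))%:E)%E.
Proof.
move=> a0; set L := expR _.
have T0 : 0 < kT z z by rewrite powR_gt0// kR_gt0.
have b0 : 0 < a / 2 * kT z z by rewrite !mulr_gt0.
have mg : measurable_fun setT (fun p : R * R => expR (- (a / 2 * kT z z * cmod (toC p - z) ^+ 2))).
  apply: (@rmeas_comp _ (fun w => - (a / 2 * kT z z * cmod (w - z) ^+ 2)) expR).
    exact: measurable_expR.
  apply: (@rmeas_comp _ _ -%R); first exact: oppr_measurable.
  apply: rmeasM; first exact: rmeas_cst.
  apply: (@rmeas_cmod2 _ (fun w => w - z)); exact: cmeasD cmeas_id (cmeas_cst (- z)).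
apply: (@le_trans _ _ (\int[@dA R]_p ((L * kT z z)%:E *
    (expR (- (a / 2 * kT z z * cmod (toC p - z) ^+ 2)))%:E))%E).
  apply: ge0_le_integral => //.
  - by move=> p _; rewrite lee_fin kap_ge0.
  - by apply/measurable_EFinP; exact: rmeas_kap.
  - by apply/measurable_EFinP; apply: measurable_funM => //; exact: measurable_cst.
  - by move=> p _; rewrite -EFinM lee_fin -[leRHS]mulrA; exact: kap_le.
rewrite ge0_integralZl//; last 2 first.
- by apply/measurable_EFinP.
- by rewrite lee_fin mulr_ge0 ?expR_ge0 ?powR_ge0.
rewrite dA_gauss// -EFinM lee_fin.
have -> : L * kT z z * (pi / (a / 2 * kT z z)) = L * (2 * pi / a).
  by field; rewrite !gt_eqF.
exact: lexx.
Qed.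

End KernelBound.

Opaque Kern.

(** * A class of functions with absolutely convergent integrals *)

Section Tame.
Context {R : realType}.
Local Notation Re := complex.Re.
Local Notation Im := complex.Im.
Implicit Types (z w : R[i]) (f h : R[i] -> R[i]).
Variable m : R.
Hypothesis m1 : 1 <= m.
Let m0 : 0 < m. Proof. exact: lt_le_trans m1. Qed.

(** Growth exp (B (1 + |z|)^m) is beaten by the weight exp (- |z|^(2 m)). The class is closed under
    products and contains the kernel functions and exp g for deg g <= m, so all integrals of the
    sufficiency part converge. *)
Definition tame f := cmeas f /\ exists A B : R, [/\ 0 <= A, 0 <= B &
  forall z, cmod (f z) <= A * expR (B * (1 + cmod z) `^ m)].

Let pw0 z : 0 <= (1 + cmod z) `^ m. Proof. exact: powR_ge0. Qed.

Lemma tameM f h : tame f -> tame h -> tame (fun z => f z * h z).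
Proof.
move=> [mf [A [B [A0 B0 hA]]]] [mh [A' [B' [A0' B0' hA']]]].
split; first exact: cmeasM; exists (A * A'), (B + B'); split; rewrite ?mulr_ge0 ?addr_ge0//.
move=> z; rewrite cmodM mulrDl expRD mulrACA.
by apply: ler_pM; rewrite ?cmod_ge0.
Qed.

Lemma tameJ f : tame f -> tame (fun z => ((f z)^*)%C).
Proof.
move=> [mf [A [B [A0 B0 hA]]]]; split; first exact: cmeasJ.
by exists A, B; split => // z; rewrite cmodJ.
Qed.

Lemma tameD f h : tame f -> tame h -> tame (fun z => f z + h z).
Proof.
move=> [mf [A [B [A0 B0 hA]]]] [mh [A' [B' [A0' B0' hA']]]].
split; first exact: cmeasD; exists (A + A'), (B + B'); split; rewrite ?addr_ge0//.
move=> z; apply: le_trans (cmodD _ _) _; rewrite mulrDl; apply: lerD.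
  apply: le_trans (hA z) _; rewrite ler_wpM2l// ler_expR mulrDl lerDl mulr_ge0//.
apply: le_trans (hA' z) _; rewrite ler_wpM2l// ler_expR mulrDl lerDr mulr_ge0//.
Qed.

Lemma tame_cst c : tame (fun=> c).
Proof.
split; first exact: cmeas_cst; exists (cmod c), 0; split; rewrite ?cmod_ge0// => z.
by rewrite mul0r expR0 mulr1.
Qed.

Lemma tame_sum (n : nat) (F : nat -> R[i] -> R[i]) : (forall k, tame (F k)) ->
  tame (fun z => \sum_(k < n) F k z).
Proof.
move=> mF; elim: n => [|n IH].
  by have := tame_cst 0; congr tame; apply/funext => z; rewrite big_ord0.
by have := tameD IH (mF n); congr tame; apply/funext => z; rewrite big_ord_recr.
Qed.

Lemma tame_Kern x : tame (fun w => Kern m w x).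
Proof.
split.
  have -> : (fun w => Kern m w x) = PS (kcoef m x) by apply/funext => w; exact: Kern_kcoef.
  by apply: cmeas_PS; exact: pscoef_kcoef.
have [C C0 hC] := cmod_Kern_le m1.
exists C, (2 * (1 + cmod x) `^ m); split; rewrite ?mulr_ge0 ?powR_ge0 ?(ltW C0)// => w.
apply: le_trans (hC w x) _; rewrite ler_wpM2l ?(ltW C0)//.
set P := rpos _; have P0 : 0 <= P by exact: rpos_ge0.
(* A majorant of 1 + P in product form: Y^m factors, and the part depending on x goes into the
   constant B. *)
pose Y := (1 + cmod x) * (1 + cmod w).
have x0 := cmod_ge0 x; have w0 := cmod_ge0 w.
have PY : 1 + P <= Y.
  have : P <= cmod x * cmod w.
    rewrite /P /rpos ge_max mulr_ge0// andbT; apply: le_trans (Re_le _) _.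
    by rewrite cmodM cmodJ mulrC.
  by rewrite /Y mulrDl !mulrDr !mul1r mulr1; lra.
have Y1 : 1 <= Y by apply: le_trans PY; rewrite lerDl.
have YE : Y `^ m = (1 + cmod x) `^ m * (1 + cmod w) `^ m by rewrite powRM ?addr_ge0.
have i1 : (1 + P) `^ (m - 1) <= expR (Y `^ m).
  apply: (@le_trans _ _ (Y `^ m)); last by apply: le_trans (expR_ge1Dx _); rewrite lerDr.
  apply: (@le_trans _ _ (Y `^ (m - 1))).
    by apply: ge0_ler_powR; rewrite ?nnegrE ?subr_ge0 ?addr_ge0 ?(le_trans ler01 Y1).
  by apply: ler_powR => //; rewrite gerBl.
have i2 : expR (P `^ m) <= expR (Y `^ m).
  rewrite ler_expR; apply: ge0_ler_powR; rewrite ?nnegrE ?(ltW m0) ?(le_trans ler01 Y1)//.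
  by apply: le_trans PY; rewrite lerDr.
have -> : 2 * (1 + cmod x) `^ m * (1 + cmod w) `^ m = Y `^ m + Y `^ m by rewrite YE; ring.
rewrite expRD.
by apply: ler_pM; [exact: powR_ge0|exact: expR_ge0|exact: i1|exact: i2].
Qed.

Lemma tame_KernJ x : tame (fun w => Kern m x w).
Proof. by have := tameJ (tame_Kern x); congr tame; apply/funext => w; rewrite (KernJ m1). Qed.

Lemma cmeas_entire f : entire f -> cmeas f.
Proof.
move=> /entire_power_series [a [pa fa _]].
by have := cmeas_PS pa; congr cmeas; apply/funext => z; rewrite fa.
Qed.

Lemma tame_cexp (g : {poly R[i]}) : deg_le g m -> tame (fun z => cexp g.[z]).
Proof.
move=> dg; split.
  by apply: cmeas_entire; apply: entire_comp; [exact: entire_cexp|exact: entire_horner].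
have B0 : 0 <= \sum_(k < size g) cmod g`_k by apply: sumr_ge0 => k _; exact: cmod_ge0.
exists 1, (\sum_(k < size g) cmod g`_k); split => // z; rewrite mul1r cmod_cexp ler_expR.
apply: le_trans (Re_le _) _; rewrite horner_coef mulr_suml.
apply: le_trans (cmod_sum _ _ _) _; apply: ler_sum => k _.
rewrite cmodM cmodX ler_wpM2l ?cmod_ge0//.
have z1 : 0 <= 1 + cmod z by rewrite addr_ge0 ?cmod_ge0.
apply: (@le_trans _ _ ((1 + cmod z) ^+ k)).
  by rewrite lerXn2r ?nnegrE ?cmod_ge0// lerDr.
rewrite -powR_mulrn//; apply: ler_powR; first by rewrite lerDl cmod_ge0.
exact: deg_le_idx dg (ltn_ord k).
Qed.

(** With s = max (1, |z|)^m the exponent is at most b s - s^2 + 1 <= b^2 / 2 + 1 - s^2 / 2, and s^2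
    >= |z|^2 leaves a gaussian majorant. *)
Lemma tame_wt f : tame f -> exists2 A : R, 0 <= A &
  forall z, cmod (f z) * wt m z <= A * expR (- (2^-1 * cmod z ^+ 2)).
Proof.
move=> [_ [A [B [A0 B0 hA]]]]; pose b := B * 2 `^ m.
exists (A * expR (b ^+ 2 / 2 + 1)) => [|z]; first by rewrite mulr_ge0 ?expR_ge0.
rewrite wtE; apply: (@le_trans _ _ (A * expR (B * (1 + cmod z) `^ m) * expR (- ((cmod z ^+ 2) `^ m)))).
  by rewrite ler_wpM2r ?expR_ge0.
rewrite -[leLHS]mulrA -[leRHS]mulrA -!expRD ler_wpM2l// ler_expR.
set r := cmod z; have r0 : 0 <= r by exact: cmod_ge0.
pose M := Num.max 1 r; pose s := M `^ m.
have M1 : 1 <= M by rewrite /M le_max lexx.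
have rM : r <= M by rewrite /M le_max lexx orbT.
have M0 : 0 <= M by apply: le_trans M1.
have s1 : (1 + r) `^ m <= 2 `^ m * s.
  rewrite /s -powRM//; apply: ge0_ler_powR; rewrite ?nnegrE ?addr_ge0 ?mulr_ge0 ?(ltW m0)//.
  by lra.
have s2 : s ^+ 2 - 1 <= (r ^+ 2) `^ m.
  rewrite /s /M; case: (leP r 1) => r1; first by rewrite powR1 expr1n subrr powR_ge0.
  have -> : (r ^+ 2) `^ m = (r `^ m) ^+ 2.
    by rewrite -(powR_mulrn 2 r0) -(powR_mulrn 2 (powR_ge0 _ _)) -!powRrM mulrC.
  by rewrite gerBl.
have s3 : r ^+ 2 <= s ^+ 2.
  rewrite lerXn2r ?nnegrE ?powR_ge0//; apply: le_trans rM _.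
  by rewrite -{1}(powRr1 M0); apply: ler_powR.
have h1 : B * (1 + r) `^ m <= b * s by rewrite /b -mulrA ler_wpM2l.
have h2 : 0 <= (b - s) ^+ 2 by exact: sqr_ge0.
have e2 : (b - s) ^+ 2 = b ^+ 2 + s ^+ 2 - 2 * (b * s) by ring.
by clearbody s b; lra.
Qed.

Lemma gauss_integrable (A : R) :
  (@dA R).-integrable setT (fun p => (A * expR (- (2^-1 * cmod (toC p) ^+ 2)))%:E).
Proof.
have mg : rmeas (fun w : R[i] => expR (- (2^-1 * cmod w ^+ 2))).
  apply: (@rmeas_comp _ _ expR); first exact: measurable_expR.
  apply: (@rmeas_comp _ _ -%R); first exact: oppr_measurable.
  by apply: rmeasM; [exact: rmeas_cst|exact: rmeas_cmod2 cmeas_id].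
have i1 : (@dA R).-integrable setT (fun p => (expR (- (2^-1 * cmod (toC p) ^+ 2)))%:E).
  apply/integrableP; split; first by apply/measurable_EFinP.
  have h := @dA_gauss R 2^-1 0; rewrite invr_gt0 in h.
  have <- : (\int[@dA R]_p (expR (- (2^-1 * cmod (toC p - 0) ^+ 2)))%:E =
     \int[@dA R]_p `|(expR (- (2^-1 * cmod (toC p) ^+ 2)))%:E|)%E.
    by apply: eq_integral => p _; rewrite subr0 abse_EFin ger0_norm ?expR_ge0.
  by rewrite h// ltry.
by have := integrableZl measurableT A i1; apply: eq_integrable.
Qed.

Lemma tame_real_integrable (k : R[i] -> R) f : rmeas k -> tame f -> (forall z, `|k z| <= cmod (f z)) ->
  (@dA R).-integrable setT (fun p => (k (toC p) * wt m (toC p))%:E).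
Proof.
move=> mk tf kf; have [A A0 hA] := tame_wt tf.
apply: (le_integrable measurableT _ _ (gauss_integrable A)).
  by apply/measurable_EFinP; exact: rmeasM mk (rmeas_wt m).
move=> p _; rewrite lee_fin [leRHS]ger0_norm ?mulr_ge0 ?expR_ge0//.
apply: le_trans (hA _); rewrite normrM [`|wt _ _|]ger0_norm ?wt_ge0// ler_wpM2r ?wt_ge0//.
Qed.

Lemma tame_integrable f : tame f -> lam_integrable m f.
Proof.
move=> tf; have [mf1 mf2] := tf.1; split.
  by apply: (tame_real_integrable mf1 tf) => z; exact: normRe_le.
by apply: (tame_real_integrable mf2 tf) => z; exact: normIm_le.
Qed.

Let LI (k : R[i] -> R) : R := \int[@dA R]_p (k (toC p) * wt m (toC p)).

Lemma lam_intE f : cmeas f -> lam_int m f = ((LI (fun z => Re (f z))) +i* (LI (fun z => Im (f z))))%C.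
Proof.
move=> [f1 f2]; rewrite /lam_int; congr Complex; apply: dA_Rint.
  exact: rmeasM f1 (rmeas_wt m).
exact: rmeasM f2 (rmeas_wt m).
Qed.

Let LID (k l : R[i] -> R) : (@dA R).-integrable setT (fun p => (k (toC p) * wt m (toC p))%:E) ->
  (@dA R).-integrable setT (fun p => (l (toC p) * wt m (toC p))%:E) ->
  LI (fun z => k z + l z) = LI k + LI l.
Proof.
move=> ik il; rewrite /LI -RintegralD//; apply: eq_Rintegral => p _; ring.
Qed.

Let LIZ x (k : R[i] -> R) : (@dA R).-integrable setT (fun p => (k (toC p) * wt m (toC p))%:E) ->
  LI (fun z => x * k z) = x * LI k.
Proof.
move=> ik; rewrite /LI -RintegralZl//; apply: eq_Rintegral => p _; ring.
Qed.

Lemma lam_intD f h : tame f -> tame h -> lam_int m (fun z => f z + h z) = lam_int m f + lam_int m h.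
Proof.
move=> tf th; have [f1 f2] := tame_integrable tf; have [h1 h2] := tame_integrable th.
have th2 := tameD tf th.
rewrite (lam_intE th2.1) (lam_intE tf.1) (lam_intE th.1).
apply: complex_eq => /=; rewrite -LID//; congr LI; apply/funext => z; [exact: ReD|exact: ImD].
Qed.

Lemma lam_intZ c f : tame f -> lam_int m (fun z => c * f z) = c * lam_int m f.
Proof.
move=> tf; have [f1 f2] := tame_integrable tf.
have tc := tameM (tame_cst c) tf.
rewrite (lam_intE tc.1) (lam_intE tf.1).
have iz x (k : R[i] -> R) : (@dA R).-integrable setT (fun p => (k (toC p) * wt m (toC p))%:E) ->
    (@dA R).-integrable setT (fun p => (x * k (toC p) * wt m (toC p))%:E).
  move=> ik; have := integrableZl measurableT x ik.
  by apply: eq_integrable => // p _; rewrite -mulrA.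
have e1 : (fun z => Re (c * f z)) = (fun z => Re c * Re (f z) + - Im c * Im (f z)).
  by apply/funext => z; rewrite ReM mulNr.
have e2 : (fun z => Im (c * f z)) = (fun z => Re c * Im (f z) + Im c * Re (f z)).
  by apply/funext => z; rewrite ImM.
apply: complex_eq; rewrite /= ?ReM ?ImM /=.
  rewrite e1 (LID (iz (Re c) (fun z => Re (f z)) f1) (iz (- Im c) (fun z => Im (f z)) f2)).
  by rewrite (LIZ _ f1) (LIZ _ f2) mulNr.
rewrite e2 (LID (iz (Re c) (fun z => Im (f z)) f2) (iz (Im c) (fun z => Re (f z)) f1)).
by rewrite (LIZ _ f2) (LIZ _ f1).
Qed.

Lemma lam_integrableJ f : lam_integrable m f -> lam_integrable m (fun z => ((f z)^*)%C).
Proof.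
move=> [f1 f2]; split.
  by apply: eq_integrable f1 => // p _; rewrite ReJ.
have := integrableZl measurableT (-1) f2; apply: eq_integrable => // p _.
by rewrite ImJ mulNr -EFinM mulN1r.
Qed.

Lemma lam_intJ f : cmeas f -> lam_integrable m f ->
  lam_int m (fun z => ((f z)^*)%C) = ((lam_int m f)^*)%C.
Proof.
move=> mf [f1 f2].
rewrite (lam_intE (cmeasJ mf)) (lam_intE mf); apply: complex_eq; rewrite ?ReJ ?ImJ /=.
  by congr LI; apply/funext => z; rewrite ReJ.
have -> : (fun z => Im ((f z)^*)%C) = (fun z => -1 * Im (f z)).
  by apply/funext => z; rewrite ImJ mulN1r.
by rewrite LIZ// mulN1r.
Qed.

Lemma lam_int_sum (n : nat) (F : nat -> R[i] -> R[i]) : (forall k, tame (F k)) ->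
  lam_int m (fun z => \sum_(k < n) F k z) = \sum_(k < n) lam_int m (F k).
Proof.
move=> tF; elim: n => [|n IH].
  have -> : (fun z => \sum_(k < 0) F k z) = (fun z => 0 * 0) by apply/funext => z; rewrite big_ord0 mulr0.
  by rewrite (lam_intZ 0 (tame_cst 0)) mul0r big_ord0.
have -> : (fun z => \sum_(k < n.+1) F k z) = (fun z => \sum_(k < n) F k z + F n z).
  by apply/funext => z; rewrite big_ord_recr.
by rewrite lam_intD ?IH ?big_ord_recr//; exact: tame_sum.
Qed.

Lemma cmod_lam_int f : tame f ->
  ((cmod (lam_int m f))%:E <= \int[@dA R]_p (cmod (f (toC p)) * wt m (toC p))%:E)%E.
Proof.
move=> tf.
have [e|n0] := eqVneq (lam_int m f) 0.
  by rewrite e cmod0; apply: integral_ge0 => p _; rewrite lee_fin mulr_ge0 ?cmod_ge0 ?wt_ge0.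
set I := lam_int m f in n0 *; have cI : 0 < cmod I by rewrite cmod_gt0.
(* The unimodular factor that turns the integral into its modulus. *)
pose t : R[i] := (I^*)%C * ((cmod I)^-1)%:C%C.
have t1 : cmod t = 1 by rewrite /t cmodM cmodJ cmodR ger0_norm ?invr_ge0 ?(ltW cI)// divff// gt_eqF.
have tc := tameM (tame_cst t) tf.
have tI : t * I = (cmod I)%:C%C.
  by rewrite /t mulrAC [_ * I]mulrC mulcJ -real_complexM expr2 mulfK// gt_eqF.
have -> : cmod I = LI (fun z => Re (t * f z)).
  by have := lam_intZ t tf; rewrite (lam_intE tc.1) -/I tI => /(congr1 (@complex.Re R)) /= ->.
have [i1 _] := tame_integrable tc.
rewrite /LI /Rintegral fineK; last exact: integrable_fin_num.
have ic : (@dA R).-integrable setT (fun p => (cmod (f (toC p)) * wt m (toC p))%:E).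
  apply: (tame_real_integrable (rmeas_cmod tf.1) tf) => z.
  by rewrite ger0_norm ?cmod_ge0.
apply: le_integral => // p _; rewrite lee_fin ler_wpM2r ?wt_ge0//.
by apply: le_trans (Re_le _) _; rewrite cmodM t1 mul1r.
Qed.

Lemma reproducing_entire f z : entire f -> tame f -> lam_int m (fun w => Kern m z w * f w) = f z.
Proof.
move=> /entire_power_series [a [pa fa _]] tf.
have e : f = PS a by apply/funext => w; exact: fa.
have := tameM (tame_KernJ z) tf => /tame_integrable; rewrite e.
exact: reproducing.
Qed.

Lemma entire_Kern x : entire (fun w => Kern m w x).
Proof.
apply: (@entire_ext _ (PS (kcoef m x))); first by move=> w; rewrite Kern_kcoef.
by apply: entire_PS; exact: pscoef_kcoef.
Qed.

Definition kcomb (n : nat) (c w : nat -> R[i]) z := \sum_(j < n) c j * Kern m z (w j).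

Lemma tame_kcomb n (c w : nat -> R[i]) : tame (kcomb n c w).
Proof.
apply: (@tame_sum n (fun j z => c j * Kern m z (w j))) => j.
by apply: tameM; [exact: tame_cst|exact: tame_Kern].
Qed.

Lemma entire_kcomb n (c w : nat -> R[i]) : entire (kcomb n c w).
Proof.
elim: n => [|n IH].
  by apply: (entire_ext _ (entire_cst 0)) => z; rewrite /kcomb big_ord0.
apply: (entire_ext _ (entireD IH (entireM (entire_cst (c n)) (entire_Kern (w n))))) => z.
by rewrite /kcomb big_ord_recr.
Qed.

(** The adjoint acts diagonally on kernel functions: the integrand for K_w is the conjugate of K(w,
    z) v(z) K(z, x), and the reproducing property at w evaluates it. *)
Lemma toep_conj_kcomb v n (c w : nat -> R[i]) x : entire v -> tame v ->
  toep m (cconj v) (kcomb n c w) x = kcomb n (fun j => c j * ((v (w j))^*)%C) w x.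
Proof.
move=> ev tv; rewrite /toep /kcomb.
pose F j z := c j * (((Kern m (w j) z * (v z * Kern m z x)))^*)%C.
have tF j : tame (F j).
  apply: tameM; first exact: tame_cst; apply: tameJ; apply: tameM; first exact: tame_KernJ.
  by apply: tameM => //; exact: tame_Kern.
transitivity (lam_int m (fun z => \sum_(j < n) F j z)).
  have alg (a b d e : R[i]) : a * ((b * (d * e))^*)%C = ((e^*)%C * (d^*)%C) * (a * (b^*)%C).
    by rewrite !conjcM; ring.
  apply: (congr1 (lam_int m)); apply/funext => z; rewrite mulr_sumr; apply: eq_bigr => j _.
  by rewrite -(KernJ m1 z x) -(KernJ m1 (w j) z); apply/esym; exact: alg.
rewrite lam_int_sum//; apply: eq_bigr => j _.
have t2 : tame (fun z => v z * Kern m z x) by apply: tameM => //; exact: tame_Kern.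
rewrite /F lam_intZ; last by apply: tameJ; apply: tameM => //; exact: tame_KernJ.
have t3 : tame (fun z => Kern m (w j) z * (v z * Kern m z x)) by apply: tameM => //; exact: tame_KernJ.
rewrite (lam_intJ t3.1 (tame_integrable t3)).
rewrite reproducing_entire//; last by apply: entireM => //; exact: entire_Kern.
by rewrite (conjcM (v (w j))) (KernJ m1) mulrA.
Qed.

(** After the conjugate symbol the function is again a kernel combination, and on holomorphic
    functions the symbol u acts by plain multiplication. *)
Lemma TT_kcomb u v n (c w : nat -> R[i]) z : entire u -> entire v -> tame u -> tame v ->
  TT_defined m u v (kcomb n c w) /\
  TT m u v (kcomb n c w) z = u z * toep m (cconj v) (kcomb n c w) z.
Proof.
move=> eu ev tu tv.
have e : toep m (cconj v) (kcomb n c w) = kcomb n (fun j => c j * ((v (w j))^*)%C) w.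
  by apply/funext => x; exact: toep_conj_kcomb.
split.
  split => x; rewrite /toep_defined; last first.
    rewrite e; apply: tame_integrable; apply: tameM; last exact: tame_kcomb.
    by apply: tameM => //; exact: tame_KernJ.
  apply: tame_integrable; apply: tameM; last exact: tame_kcomb.
  by apply: tameM; [exact: tame_KernJ|exact: tameJ].
rewrite /TT e /toep.
have -> : (fun w0 => Kern m z w0 * u w0 * kcomb n (fun j => c j * ((v (w j))^*)%C) w w0) =
  (fun w0 => Kern m z w0 * (u w0 * kcomb n (fun j => c j * ((v (w j))^*)%C) w w0)).
  by apply/funext => w0; rewrite mulrA.
apply: reproducing_entire; first by apply: entireM => //; exact: entire_kcomb.
by apply: tameM => //; exact: tame_kcomb.
Qed.

End Tame.

Section SigmaFinite.
Context {R : realType}.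
(** Discs have finite area by Chebyshev's inequality for the gaussian; Tonelli for dA with itself
    relies on this. *)
Let dA_sf : sigma_finite setT (@dA R).
Proof.
have cov : [set: R * R] = \bigcup_n disc n%:R.
  by apply/seteqP; split => // p _; have [n hn] := disc_cover p; exists n => //; exact: hn.
exists (fun n => disc n%:R) => // n; split; first exact: measurable_disc.
set D := disc _; have mD : measurable D by exact: measurable_disc.
pose e (p : R * R) := (expR (- (1 * cmod (toC p - 0) ^+ 2)))%:E.
have me : measurable_fun setT e.
  apply/measurable_EFinP; apply: (@rmeas_comp _ (fun w => - (1 * cmod (w - 0) ^+ 2)) expR).
    exact: measurable_expR.
  apply: (@rmeas_comp _ _ -%R); first exact: oppr_measurable.
  apply: rmeasM; first exact: rmeas_cst.
  by apply: (@rmeas_cmod2 _ (fun w => w - 0)); exact: cmeasD cmeas_id (cmeas_cst (- 0)).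
have e0 p : (0 <= e p)%E by rewrite lee_fin expR_ge0.
have h : ((expR (- n%:R ^+ 2))%:E * @dA R D <= (pi / 1)%:E)%E.
  rewrite -(integral_cst _ mD) -(@dA_gauss R 1 0 ltr01).
  apply: (@le_trans _ _ (\int[@dA R]_(p in D) e p)%E).
    apply: ge0_le_integral => //.
    - by move=> p _; rewrite lee_fin expR_ge0.
    - exact: measurable_funS me.
    - move=> p hp; rewrite lee_fin ler_expR lerN2 mul1r subr0.
      by rewrite lerXn2r ?nnegrE ?cmod_ge0.
  by apply: ge0_subset_integral.
rewrite ltey; apply/eqP => E; move: h.
by rewrite [X in (_ * X)%E]E gt0_muley ?lte_fin ?expR_gt0.
Qed.
HB.instance Definition _ := Measure_isSigmaFinite.Build _ (R * R)%type R (@dA R) dA_sf.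
End SigmaFinite.

(** * The pointwise step of Schur's test *)

Section Schur.
Context {R : realType}.
Local Notation dA := (@dA R).

(* The pointwise Cauchy-Schwarz inequality for the measure [k dA], in AM-GM form. *)
Lemma schur_point (k phi : R * R -> R) (F S : R) :
  measurable_fun setT k -> measurable_fun setT phi -> (forall p, 0 <= k p) -> (forall p, 0 <= phi p) ->
  0 <= F -> 0 < S -> (\int[dA]_p (k p)%:E <= S%:E)%E ->
  (F%:E <= \int[dA]_p (k p * phi p)%:E)%E ->
  ((F ^+ 2)%:E <= S%:E * \int[dA]_p (k p * phi p ^+ 2)%:E)%E.
Proof.
move=> mk mphi k0 phi0 F0 S0 kS FI.
have mk2 : measurable_fun setT (fun p => (k p * phi p ^+ 2)%:E).
  by apply/measurable_EFinP; apply: measurable_funM => //; exact: measurable_funX.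
have X0 : (0 <= \int[dA]_p (k p * phi p ^+ 2)%:E)%E.
  by apply: integral_ge0 => p _; rewrite lee_fin mulr_ge0 ?sqr_ge0.
(* Integration of F phi <= F^2 / (2 S) + S phi^2 / 2 against k; the first term contributes at most
   F^2 / 2 and is absorbed on the left. *)
have h : ((F ^+ 2)%:E <= (F ^+ 2 / (2 * S))%:E * \int[dA]_p (k p)%:E +
    (S / 2)%:E * \int[dA]_p (k p * phi p ^+ 2)%:E)%E.
  have c1 : 0 <= F ^+ 2 / (2 * S) by rewrite divr_ge0 ?sqr_ge0// mulr_ge0// ltW.
  have c2 : 0 <= S / 2 by rewrite divr_ge0// ltW.
  apply: (@le_trans _ _ (F%:E * \int[dA]_p (k p * phi p)%:E)%E).
    by rewrite expr2 EFinM; apply: lee_wpmul2l.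
  have mA : measurable_fun setT (fun p => (k p * phi p)%:E).
    by apply/measurable_EFinP; exact: measurable_funM.
  have mk1 : measurable_fun setT (fun p => (k p)%:E) by apply/measurable_EFinP.
  rewrite -(ge0_integralZl dA measurableT mA); [|by move=> p _; rewrite lee_fin mulr_ge0|by rewrite lee_fin].
  rewrite -(ge0_integralZl dA measurableT mk1); [|by move=> p _; rewrite lee_fin|by rewrite lee_fin].
  rewrite -(ge0_integralZl dA measurableT mk2);
    [|by move=> p _; rewrite lee_fin mulr_ge0 ?sqr_ge0|by rewrite lee_fin].
  have n1 p : (0 <= (F ^+ 2 / (2 * S))%:E * (k p)%:E)%E by rewrite -EFinM lee_fin mulr_ge0.
  have n2 p : (0 <= (S / 2)%:E * (k p * phi p ^+ 2)%:E)%E.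
    by rewrite -EFinM lee_fin mulr_ge0// mulr_ge0 ?sqr_ge0.
  rewrite -(ge0_integralD dA measurableT (fun p _ => n1 p) (measurable_funeM _ mk1)
    (fun p _ => n2 p) (measurable_funeM _ mk2)).
  apply: ge0_le_integral => //.
  - by move=> p _; rewrite -EFinM lee_fin !mulr_ge0.
  - by apply: measurable_funeM; apply/measurable_EFinP; exact: measurable_funM.
  - by apply: emeasurable_funD; apply: measurable_funeM => //; apply/measurable_EFinP.
  move=> p _; rewrite -!EFinM -EFinD lee_fin.
  have q : 0 <= k p * ((F - S * phi p) ^+ 2 / (2 * S)).
    by rewrite mulr_ge0// divr_ge0 ?sqr_ge0// mulr_ge0// ltW.
  have e : k p * ((F - S * phi p) ^+ 2 / (2 * S)) =
     F ^+ 2 / (2 * S) * k p + S / 2 * (k p * phi p ^+ 2) - F * (k p * phi p).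
    by field; rewrite gt_eqF.
  by rewrite -subr_ge0 -e.
have h2 : ((F ^+ 2 / (2 * S))%:E * \int[dA]_p (k p)%:E <= (F ^+ 2 / 2)%:E)%E.
  have -> : F ^+ 2 / 2 = F ^+ 2 / (2 * S) * S by field; rewrite gt_eqF.
  by rewrite [leRHS]EFinM lee_wpmul2l// lee_fin divr_ge0 ?sqr_ge0// mulr_ge0// ltW.
move: X0 h; move: (\int[dA]_p (k p * phi p ^+ 2)%:E)%E => [x| |] //= X0 h; last first.
  by rewrite gt0_muley ?lte_fin// leey.
have {}h := le_trans h (leeD2r _ h2).
move: h; rewrite -!EFinM -EFinD !lee_fin => h.
have e : S / 2 * x = S * x / 2 by ring.
rewrite e in h; lra.
Qed.

End Schur.

(** * Boundedness of the product for exponential symbols *)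

Section Sufficiency.
Context {R : realType}.
Local Notation Re := complex.Re.
Local Notation Im := complex.Im.
Local Notation dA := (@dA R).
Implicit Types (z w : R[i]).
Variable m : R.
Hypothesis m1 : 1 <= m.

Lemma measurable_kap2 (a : R) :
  measurable_fun setT (fun x : (R * R) * (R * R) => kap m a (toC x.1) (toC x.2)).
Proof.
have mc : measurable_fun setT (fun p : R * R => cmod (toC p)) by exact: rmeas_cmod cmeas_id.
have mc1 : measurable_fun setT (fun x : (R * R) * (R * R) => cmod (toC x.1)).
  by apply: (measurableT_comp mc); exact: measurable_fst.
have mc2 : measurable_fun setT (fun x : (R * R) * (R * R) => cmod (toC x.2)).
  by apply: (measurableT_comp mc); exact: measurable_snd.
have mT : measurable_fun setT (fun x : (R * R) * (R * R) => kT m (toC x.1) (toC x.2)).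
  apply: (@measurableT_comp _ _ _ _ _ _ (fun x => x `^ (2 * m - 2))); first exact: measurable_powR.
  by apply: measurable_maxr => //; apply: measurable_maxr.
apply: measurable_funM => //.
apply: measurableT_comp; first exact: measurable_expR.
apply: measurableT_comp; first exact: oppr_measurable.
apply: measurable_funM => //; apply: measurable_funM => //.
have -> : (fun x : (R * R) * (R * R) => cmod (toC x.1 - toC x.2) ^+ 2) =
  (fun x => (x.1.1 - x.2.1) ^+ 2 + (x.1.2 - x.2.2) ^+ 2).
  by apply/funext => x; rewrite cmod_sqr ReB ImB.
have mf1 : measurable_fun setT (fun x : (R * R) * (R * R) => x.1.1).
  by apply: (measurableT_comp measurable_fst); exact: measurable_fst.
have mf2 : measurable_fun setT (fun x : (R * R) * (R * R) => x.1.2).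
  by apply: (measurableT_comp measurable_snd); exact: measurable_fst.
have ms1 : measurable_fun setT (fun x : (R * R) * (R * R) => x.2.1).
  by apply: (measurableT_comp measurable_fst); exact: measurable_snd.
have ms2 : measurable_fun setT (fun x : (R * R) * (R * R) => x.2.2).
  by apply: (measurableT_comp measurable_snd); exact: measurable_snd.
by apply: measurable_funD; apply: measurable_funX; apply: measurable_funB.
Qed.

(** Square root of the weight; multiplication by it transfers the problem to the unweighted L^2 of
    the plane. *)
Let om z : R := expR (- ((cmod z ^+ 2) `^ m / 2)).

Let om2 z : om z ^+ 2 = wt m z.
Proof. by rewrite /om wtE expr2 -expRD; congr expR; field. Qed.

Let om_ge0 z : 0 <= om z. Proof. exact: expR_ge0. Qed.

Let rmeas_om : rmeas om.
Proof.
have := rmeas_comp (@measurable_powR R (2^-1)) (rmeas_wt m).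
congr rmeas; apply/funext => z.
by rewrite powR12_sqrt ?wt_ge0// -om2 sqrtr_sqr ger0_norm.
Qed.

(** Schur's test with constant test function: the dominating kernel is symmetric, so one uniform
    integral bound serves for both variables. *)
Lemma schur_bound (u v f h : R[i] -> R[i]) (N a S : R) : 0 < a -> 0 < N -> 0 < S ->
  cmeas v -> cmeas f ->
  (forall z, (\int[dA]_p (N * kap m a z (toC p))%:E <= S%:E)%E) ->
  (forall z w, cmod (u z) * cmod (Kern m z w) * cmod (v w) * om z * om w <= N * kap m a z w) ->
  (forall z, ((cmod (h z))%:E <= (cmod (u z))%:E *
     \int[dA]_p (cmod (Kern m z (toC p) * ((v (toC p))^*)%C * f (toC p)) * wt m (toC p))%:E)%E) ->
  cmeas h ->
  (l2sq m h <= (S ^+ 2)%:E * l2sq m f)%E.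
Proof.
move=> a0 N0 S0 mv mf kS hH hT mh.
pose phi (p : R * R) := cmod (f (toC p)) * om (toC p).
have mphi : measurable_fun setT phi by exact: (rmeasM (rmeas_cmod mf) rmeas_om).
have phi0 p : 0 <= phi p by rewrite mulr_ge0 ?cmod_ge0.
pose k z (p : R * R) := N * kap m a z (toC p).
have mk z : measurable_fun setT (k z) by exact: (rmeasM (rmeas_cst N) (rmeas_kap m a z)).
have k0 z p : 0 <= k z p by rewrite mulr_ge0 ?kap_ge0// ltW.
have mKv z : rmeas (fun w => cmod (Kern m z w * ((v w)^*)%C * f w) * wt m w).
  apply: rmeasM (rmeas_wt m); apply: rmeas_cmod; apply: cmeasM => //; apply: cmeasM; last exact: cmeasJ.
  by have [] := tame_KernJ m1 z.
have key z : ((cmod (h z) * om z)%:E <= \int[dA]_p (k z p * phi p)%:E)%E.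
  rewrite mulrC EFinM; apply: (@le_trans _ _ ((om z)%:E * ((cmod (u z))%:E *
     \int[dA]_p (cmod (Kern m z (toC p) * ((v (toC p))^*)%C * f (toC p)) * wt m (toC p))%:E))%E).
    by apply: lee_wpmul2l; rewrite ?lee_fin.
  rewrite muleA -EFinM -ge0_integralZl//; last 3 first.
  - by apply/measurable_EFinP; exact: mKv.
  - by move=> p _; rewrite lee_fin mulr_ge0 ?cmod_ge0 ?wt_ge0.
  - by rewrite lee_fin mulr_ge0 ?cmod_ge0.
  apply: ge0_le_integral => //.
  - by move=> p _; rewrite -EFinM lee_fin; exact: (mulr_ge0 (mulr_ge0 (om_ge0 z) (cmod_ge0 _)) (mulr_ge0 (cmod_ge0 _) (wt_ge0 m _))).
  - by apply: measurable_funeM; apply/measurable_EFinP; exact: mKv.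
  - by apply/measurable_EFinP; exact: measurable_funM.
  move=> p _; rewrite -EFinM lee_fin.
  apply: le_trans (ler_wpM2r (phi0 p) (hH z (toC p))); rewrite /phi -om2 !cmodM cmodJ.
  have alg (a1 a2 a3 a4 a5 a6 : R) : a1 * a2 * (a3 * a4 * a5 * a6 ^+ 2) = a2 * a3 * a4 * a1 * a6 * (a5 * a6) by ring.
  by rewrite alg.
have pt z : ((cmod (h z) ^+ 2 * wt m z)%:E <= S%:E * \int[dA]_p (k z p * phi p ^+ 2)%:E)%E.
  rewrite -om2 -exprMn; apply: schur_point => //; last exact: kS.
  by rewrite mulr_ge0 ?cmod_ge0.
pose H (x : (R * R) * (R * R)) : \bar R := (N * kap m a (toC x.1) (toC x.2) * phi x.2 ^+ 2)%:E.
have mH : measurable_fun setT H.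
  apply/measurable_EFinP; apply: measurable_funM.
    by apply: measurable_funM => //; exact: measurable_kap2.
  by apply: measurable_funX; apply: (measurableT_comp mphi); exact: measurable_snd.
have H0 x : (0 <= H x)%E by rewrite lee_fin; apply: mulr_ge0 (sqr_ge0 _); apply: mulr_ge0 (kap_ge0 _ _ _ _); exact: ltW.
have T1 := fubini_tonelli1 (m1 := dA) (m2 := dA) H mH H0.
have T2 := fubini_tonelli2 (m1 := dA) (m2 := dA) H mH H0.
have mF : measurable_fun setT (fun p : R * R => \int[dA]_q H (p, q))%E.
  exact: (measurable_fun_fubini_tonelli_F (m2 := dA) H mH H0).
apply: (@le_trans _ _ (\int[dA]_p (S%:E * \int[dA]_q H (p, q)))%E).
  apply: ge0_le_integral => //.
  - by move=> p _; rewrite lee_fin mulr_ge0 ?sqr_ge0 ?wt_ge0.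
  - by apply/measurable_EFinP; exact: rmeasM (rmeas_cmod2 mh) (rmeas_wt m).
  - exact: measurable_funeM.
rewrite (ge0_integralZl dA measurableT mF);
  [|by move=> p _; exact: integral_ge0|by rewrite lee_fin ltW].
have -> : (\int[dA]_p \int[dA]_q H (p, q) = \int[dA]_q \int[dA]_p H (p, q))%E.
  exact: (etrans (esym T1) T2).
rewrite expr2 EFinM -muleA lee_wpmul2l ?lee_fin ?(ltW S0)//.
rewrite /l2sq -ge0_integralZl//; last 3 first.
- by apply/measurable_EFinP; exact: rmeasM (rmeas_cmod2 mf) (rmeas_wt m).
- by move=> p _; rewrite lee_fin mulr_ge0 ?sqr_ge0 ?wt_ge0.
- by rewrite lee_fin ltW.
apply: ge0_le_integral.
- exact: measurableT.
- by move=> p _; apply: integral_ge0 => q _; exact: H0.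
- exact: (measurable_fun_fubini_tonelli_G (m1 := dA) H mH H0).
- apply: measurable_funeM; apply/measurable_EFinP; exact: rmeasM (rmeas_cmod2 mf) (rmeas_wt m).
move=> q _; rewrite /H /=.
have -> : (\int[dA]_p (N * kap m a (toC p) (toC q) * phi q ^+ 2)%:E =
   (phi q ^+ 2)%:E * \int[dA]_p (k (toC q) p)%:E)%E.
  rewrite -ge0_integralZl//; last 3 first.
  - by apply/measurable_EFinP.
  - by move=> p _; rewrite lee_fin.
  - by rewrite lee_fin sqr_ge0.
  by apply: eq_integral => p _; rewrite -EFinM /k kap_sym mulrC.
rewrite muleC /phi exprMn om2; apply: lee_wpmul2r.
  by rewrite lee_fin mulr_ge0 ?sqr_ge0 ?wt_ge0.
exact: kS.
Qed.

Theorem TT_bounded_exp (c : R[i]) : c != 0 ->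
  exists C1 C2 : R, [/\ 0 < C1, 0 < C2 &
    forall g : {poly R[i]}, deg_le g m ->
      TT_bounded_by m (fun z => cexp g.[z]) (fun z => c * cexp (- g.[z]))
                    (C1 * expR (C2 * h2sq g))].
Proof.
move=> c0; have cc : 0 < cmod c by rewrite cmod_gt0.
have [N N0 hN] := weighted_kernel_bound m1.
have k0 := kdel_gt0 m; pose a := kdel m / 2.
have a0 : 0 < a by rewrite divr_gt0.
pose L := expR ((2 * m - 2) ^+ 2 / (2 * a)) * (2 * pi / a).
have L0 : 0 < L by rewrite mulr_gt0 ?expR_gt0// divr_gt0// mulr_gt0// pi_gt0.
have m11 : 0 < m + 1 by rewrite ltr_wpDl// (le_trans ler01).
(* [N] comes from [weighted_kernel_bound], [L] is the mass in [kap_integral] at a = kdel / 2, and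
   the exponent combines plip^2 / (2 kdel) with [plip_sqr]. *)
exists (cmod c * N * L), ((m + 1) ^+ 3 / (2 * kdel m)); split.
- by apply: mulr_gt0 L0; exact: mulr_gt0.
- by rewrite divr_gt0 ?exprn_gt0// mulr_gt0.
move=> g dg f [n [d [w fE]]].
have fk : f = kcomb m n d w by apply/funext => z; rewrite fE.
rewrite {}fk.
pose u z := cexp g.[z]; pose v z := c * cexp (- g.[z]).
have eu : entire u by apply: entire_comp; [exact: entire_cexp|exact: entire_horner].
have tu : tame m u by exact: tame_cexp.
have vE : (fun z => c * cexp (- g.[z])) = (fun z => c * cexp (- g).[z]).
  by apply/funext => z; rewrite hornerN.
have ev : entire v.
  rewrite /v vE; apply: entireM; first exact: entire_cst.
  by apply: entire_comp; [exact: entire_cexp|exact: entire_horner].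
have tv : tame m v.
  rewrite /v vE; apply: tameM; first exact: tame_cst.
  by apply: tame_cexp => //; rewrite /deg_le size_polyN.
have TTE z := TT_kcomb m1 n d w z eu ev tu tv.
split; first exact: (TTE 0).1.
pose e0 := expR (plip g ^+ 2 / (2 * kdel m)).
pose S := cmod c * N * L * e0.
have S0 : 0 < S by apply: mulr_gt0 (expR_gt0 _); apply: mulr_gt0 L0; exact: mulr_gt0.
have SM : S <= cmod c * N * L * expR ((m + 1) ^+ 3 / (2 * kdel m) * h2sq g).
  apply: ler_wpM2l; first by apply: ltW; apply: mulr_gt0 L0; exact: mulr_gt0.
  by rewrite ler_expR [leRHS]mulrAC ler_pM2r ?invr_gt0 ?mulr_gt0//; exact: plip_sqr.
have tf := tame_kcomb m1 n d w.
apply: (@le_trans _ _ ((S ^+ 2)%:E * l2sq m (kcomb m n d w))%E); last first.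
  apply: lee_wpmul2r.
    by apply: integral_ge0 => p _; rewrite lee_fin mulr_ge0 ?sqr_ge0 ?wt_ge0.
  rewrite lee_fin lerXn2r ?nnegrE ?(ltW S0)//.
  by apply: le_trans SM; exact: ltW.
have N'0 : 0 < cmod c * N * e0 by apply: mulr_gt0 (expR_gt0 _); exact: mulr_gt0.
apply: (@schur_bound u v _ _ (cmod c * N * e0) a S) => //.
- exact: tv.1.
- exact: tf.1.
- move=> z.
  under eq_integral do rewrite EFinM.
  rewrite ge0_integralZl//; last 3 first.
  + by apply/measurable_EFinP; exact: rmeas_kap.
  + by move=> p _; rewrite lee_fin kap_ge0.
  + by rewrite lee_fin ltW.
  have -> : S = cmod c * N * e0 * L by rewrite /S; ring.
  rewrite [leRHS]EFinM; apply: lee_wpmul2l; first by rewrite lee_fin ltW.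
  exact: kap_integral.
- move=> z w'; rewrite /v cmodM.
  have alg1 (a1 a2 a3 a4 a5 a6 : R) : a1 * a2 * (a3 * a4) * a5 * a6 = a3 * (a1 * a2 * a4 * a5 * a6) by ring.
  have alg2 (a1 a2 a3 a4 : R) : a1 * a2 * a3 * a4 = a1 * (a2 * a3 * a4) by ring.
  rewrite alg1 [leRHS]alg2; apply: ler_wpM2l; first exact: cmod_ge0.
  exact: hN.
- move=> z; rewrite (TTE z).2 cmodM EFinM; apply: lee_wpmul2l; first by rewrite lee_fin cmod_ge0.
  have tK := tame_KernJ m1 z.
  exact: (cmod_lam_int m1 (tameM (tameM tK (tameJ tv)) tf)).
have -> : TT m u v (kcomb m n d w) = (fun z => u z * kcomb m n (fun j => d j * ((v (w j))^*)%C) w z).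
  by apply/funext => z; rewrite (TTE z).2 toep_conj_kcomb.
by apply: cmeasM; [exact: tu.1|exact: (tame_kcomb m1 n _ w).1].
Qed.

End Sufficiency.

(** * Logarithmic derivative and variance *)

Section RealSeries.
Context {R : realType}.
Local Notation Re := complex.Re.
Implicit Types (c d : nat -> R) (x y a b : R).

Definition creal c : nat -> R[i] := fun k => (c k)%:C%C.
Definition RS c x : R := Re (PS (creal c) x%:C%C).

Lemma RS_ge c x n : pscoef (creal c) -> (forall k, 0 <= c k) -> 0 <= x ->
  \sum_(k < n) c k * x ^+ k <= RS c x.
Proof.
move=> pc c0 x0.
have e k : Re (creal c k * x%:C%C ^+ k) = c k * x ^+ k by rewrite real_complexX ReZl.
under eq_bigr do rewrite -e.
apply: Re_csum_ge; first exact: asum_ps.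
by move=> k; rewrite e mulr_ge0 ?exprn_ge0.
Qed.

Lemma RS_ge0 c x : pscoef (creal c) -> (forall k, 0 <= c k) -> 0 <= x -> 0 <= RS c x.
Proof. by move=> pc c0 x0; have := RS_ge 0 pc c0 x0; rewrite big_ord0. Qed.

Lemma RS_le c x (M : R) : pscoef (creal c) -> (forall n, \sum_(k < n) c k * x ^+ k <= M) -> RS c x <= M.
Proof.
move=> pc h; apply: Re_csum_le; first exact: asum_ps.
by move=> n; apply: le_trans (h n); apply: ler_sum => k _; rewrite real_complexX ReZl.
Qed.

Lemma crealD c d : creal (fun k => c k + d k) = fun k => creal c k + creal d k.
Proof. by apply/funext => k; rewrite /creal rmorphD. Qed.
Lemma crealZ x c : creal (fun k => x * c k) = fun k => x%:C%C * creal c k.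
Proof. by apply/funext => k; rewrite /creal real_complexM. Qed.

Lemma pscoef_crealD c d : pscoef (creal c) -> pscoef (creal d) -> pscoef (creal (fun k => c k + d k)).
Proof. by move=> pc pd; rewrite crealD; exact: pscoefD. Qed.
Lemma pscoef_crealZ x c : pscoef (creal c) -> pscoef (creal (fun k => x * c k)).
Proof. by move=> pc; rewrite crealZ; exact: pscoefZ. Qed.

Lemma RSD c d x : pscoef (creal c) -> pscoef (creal d) -> RS (fun k => c k + d k) x = RS c x + RS d x.
Proof. by move=> pc pd; rewrite /RS crealD PSD// ReD. Qed.
Lemma RSZ y c x : pscoef (creal c) -> RS (fun k => y * c k) x = y * RS c x.
Proof. by move=> pc; rewrite /RS crealZ PSZ// ReZl. Qed.

Lemma pscoef_creal_nat c : pscoef (creal c) -> pscoef (creal (fun k => k%:R * c k)).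
Proof.
move=> /pscoef_nat; congr pscoef; apply/funext => k.
by rewrite /creal real_complexM rmorph_nat.
Qed.

Lemma PS_nat (a : nat -> R[i]) z : pscoef a -> PS (fun k => k%:R * a k) z = z * PS (dcoef a) z.
Proof.
move=> pa; rewrite /PS csum_shift; last exact: (asum_ps z (pscoef_nat pa)).
rewrite mul0r mul0r add0r -csumZ; last exact: (asum_ps z (pscoef_d pa)).
by congr csum; apply/funext => k; rewrite /dcoef exprS; ring.
Qed.

Lemma RS_scale y c x : pscoef (creal c) -> 0 <= y ->
  pscoef (creal (fun k => y ^+ k * c k)) /\ RS (fun k => y ^+ k * c k) x = RS c (y * x).
Proof.
move=> pc y0; split.
  move=> r r0; have [M hM] := pc (y * r) (mulr_ge0 y0 r0); exists M => k.
  apply: le_trans (hM k); rewrite /creal !cmodR normrM (ger0_norm (exprn_ge0 _ y0)).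
  by rewrite exprMn le_eqVlt; apply/orP; left; apply/eqP; ring.
rewrite /RS /PS; congr (Re (csum _)); apply/funext => k.
rewrite /creal (real_complexX (y * x)) (real_complexX x) -(real_complexM (y ^+ k * c k)) -(real_complexM (c k)).
by congr (_%:C%C); rewrite exprMn mulrAC [RHS]mulrC.
Qed.

Lemma RS_comb3 a b c d (e : nat -> R) x : pscoef (creal c) -> pscoef (creal d) -> pscoef (creal e) ->
  pscoef (creal (fun k => c k + a * d k + b * e k)) /\
  RS (fun k => c k + a * d k + b * e k) x = RS c x + a * RS d x + b * RS e x.
Proof.
move=> pc pd pe; have pad := pscoef_crealZ a pd; have pbe := pscoef_crealZ b pe.
have pcd := pscoef_crealD pc pad; split; first exact: pscoef_crealD.
by rewrite (RSD x pcd pbe) (RSD x pc pad) (RSZ a x pd) (RSZ b x pe).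
Qed.

Definition dRS c x : R := Re (PS (dcoef (creal c)) x%:C%C).

Lemma RS_nat c x : pscoef (creal c) -> RS (fun k => k%:R * c k) x = x * dRS c x.
Proof.
move=> pc.
have e : creal (fun k => k%:R * c k) = fun k => k%:R * creal c k.
  by apply/funext => k; rewrite /creal real_complexM rmorph_nat.
by rewrite /RS e PS_nat// ReZl.
Qed.

Lemma RS_derive c x : pscoef (creal c) -> is_derive x 1 (RS c) (dRS c x).
Proof.
move=> pc.
have h0 : cdiff (PS (creal c)) (0 + x%:C%C * 1) (PS (dcoef (creal c)) (x%:C%C)).
  by rewrite add0r mulr1; exact: PS_cdiff.
have [h _] := cdiff_is_derive h0; rewrite mulr1 in h.
by have -> : RS c = (fun s => Re (PS (creal c) (0 + s%:C%C * 1))) by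
  apply/funext => s; rewrite add0r mulr1.
Qed.

End RealSeries.

(** * Mean and variance of the kernel weights *)

Section Variance.
Context {R : realType}.
Local Notation Re := complex.Re.
Implicit Types x y X : R.
Variable m : R.
Hypothesis m1 : 1 <= m.
Let m0 : 0 < m. Proof. exact: lt_le_trans m1. Qed.

Let s0 := mlc m.
Let s1 k : R := k%:R * mlc m k.
Let s2 k : R := k%:R * (k%:R * mlc m k).
Let p0 : pscoef (creal s0). Proof. exact: pscoef_ml. Qed.
Let p1 : pscoef (creal s1). Proof. exact: pscoef_creal_nat. Qed.
Let p2 : pscoef (creal s2). Proof. exact: pscoef_creal_nat. Qed.
Let ml0 k : 0 <= mlc m k. Proof. by rewrite ltW// mlc_gt0. Qed.

Let s10 k : 0 <= s1 k. Proof. exact: mulr_ge0. Qed.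

Lemma RS_ml_gt0 x : 0 <= x -> 0 < RS s0 x.
Proof.
move=> x0; apply: lt_le_trans (RS_ge 1 p0 ml0 x0).
by rewrite big_ord1 expr0 mulr1 mlc_gt0.
Qed.

(* Mean and variance of the probability weights proportional to [mlc m k * x ^+ k]. *)
Definition pmean x : R := RS s1 x / RS s0 x.
Definition pvar x : R := RS s2 x / RS s0 x - pmean x ^+ 2.

Lemma pmean_ge0 x : 0 <= x -> 0 <= pmean x.
Proof. by move=> x0; apply: divr_ge0; [exact: RS_ge0|apply: ltW; exact: RS_ml_gt0]. Qed.

Lemma pmean_derive x : 0 < x -> is_derive x 1 pmean (pvar x / x).
Proof.
move=> x0; have g0 := RS_ml_gt0 (ltW x0).
have d0 := RS_derive x p0; have d1 := RS_derive x p1.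
have n0 : RS s0 x != 0 by rewrite gt_eqF.
have dV : is_derive x 1 (fun y => (RS s0 y)^-1) (- (RS s0 x) ^- 2 *: dRS s0 x) by apply: is_deriveV.
have dM : is_derive x 1 pmean (RS s1 x *: (- (RS s0 x) ^- 2 *: dRS s0 x) + (RS s0 x)^-1 *: dRS s1 x).
  exact: is_deriveM d1 dV.
move: dM.
have e1 : RS s1 x = x * dRS s0 x by exact: RS_nat.
have e2 : RS s2 x = x * dRS s1 x by exact: RS_nat.
have -> : RS s1 x *: (- (RS s0 x) ^- 2 *: dRS s0 x) + (RS s0 x)^-1 *: dRS s1 x = pvar x / x.
  rewrite /pvar /pmean e2 e1; move: (dRS s0 x) (dRS s1 x) (RS s0 x) n0 => a b g g0'.
  change (x * a * (- g ^- 2 * a) + g^-1 * b = (x * b / g - (x * a / g) ^+ 2) / x).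
  by field; rewrite g0' gt_eqF.
by [].
Qed.

(** Jensen's inequality for the exponential, obtained by summing the tangent inequality e^A (1 + k -
    A) <= e^k at the mean A against the weights. *)
Lemma pmean_jensen x : 0 <= x -> expR (pmean x) * RS s0 x <= RS s0 (expR 1 * x).
Proof.
move=> x0; set A := pmean x; have g0 := RS_ml_gt0 x0.
have AE : RS s1 x = A * RS s0 x by rewrite /A /pmean divfK// gt_eqF.
have [pe eE] := RS_scale x p0 (expR_ge0 1).
have [pd dE] := RS_comb3 (- (expR A * (1 - A))) (- expR A) x pe p0 p1.
pose dd k := expR 1 ^+ k * s0 k + (- (expR A * (1 - A))) * s0 k + (- expR A) * s1 k.
have dd0 k : 0 <= dd k.
  have h : expR A * (1 + (k%:R - A)) <= expR 1 ^+ k.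
    have -> : expR 1 ^+ k = expR A * expR (k%:R - A).
      by rewrite -expRD (addrC A) subrK -expRM_natl mulr1.
    by apply: ler_wpM2l (expR_ge0 _) _ _ _; exact: expR_ge1Dx.
  have alg (E s a B q : R) : E * s + - (a * (1 - B)) * s + - a * (q * s) = (E - a * (1 + (q - B))) * s by ring.
  rewrite /dd /s1 /s0 alg; apply: mulr_ge0 _ (ml0 k).
  by rewrite subr_ge0.
have := RS_ge0 pd dd0 x0.
move=> h; rewrite dE eE in h.
have alg2 (a B S g A' : R) : S = A' * g -> 0 <= B + - (a * (1 - A')) * g + - a * S -> a * g <= B.
  move=> -> h'; rewrite -subr_ge0; have -> : B - a * g = B + - (a * (1 - A')) * g + - a * (A' * g) by ring.
  by [].
exact: alg2 AE h.
Qed.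

(** Logarithm of Jensen's inequality: the sum at x is at least its constant term, and the sum at e x
    is bounded by [ml_bound]. *)
Lemma pmean_bound : exists2 D : R, 0 <= D & forall x : R, 1 <= x -> pmean x <= D * x `^ m.
Proof.
have [C C0 hC] := ml_bound m1.
have c0 : 0 < mlc m 0 by exact: mlc_gt0.
pose E1 : R := 1 + expR 1; have E10 : 0 <= E1 by rewrite addr_ge0 ?expR_ge0.
exists (`|ln (C / mlc m 0)| + 2 * E1 `^ m) => [|x x1]; first by rewrite addr_ge0 ?mulr_ge0 ?powR_ge0.
have x0 : 0 <= x by apply: le_trans x1.
pose y := expR 1 * x; have y0 : 0 <= y by rewrite mulr_ge0 ?expR_ge0.
have xm : 1 <= x `^ m by have := @ler_powR R x x1 0 m (ltW m0); rewrite powRr0.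
have yE : (1 + y) `^ m <= E1 `^ m * x `^ m.
  rewrite -powRM//; apply: ge0_ler_powR; rewrite ?nnegrE ?(ltW m0) ?addr_ge0 ?mulr_ge0//.
  by rewrite /E1 mulrDl mul1r lerD2r.
have S0y : RS s0 y <= C * expR (2 * (1 + y) `^ m).
  apply: RS_le => // n; apply: le_trans (hC y n y0) _; rewrite ler_wpM2l ?(ltW C0)//.
  rewrite mulrDl mul1r expRD; apply: ler_pM; rewrite ?powR_ge0 ?expR_ge0//.
    apply: (@le_trans _ _ ((1 + y) `^ m)); first by apply: ler_powR; rewrite ?lerDl// gerBl.
    by apply: le_trans (expR_ge1Dx _); rewrite lerDr.
  rewrite ler_expR; apply: ge0_ler_powR; rewrite ?nnegrE ?(ltW m0) ?addr_ge0//.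
  by rewrite lerDr.
have S0x : mlc m 0 <= RS s0 x.
  by apply: le_trans (RS_ge 1 p0 ml0 x0); rewrite big_ord1 expr0 mulr1.
have h : expR (pmean x) * mlc m 0 <= C * expR (2 * (1 + y) `^ m).
  apply: le_trans S0y; apply: le_trans (pmean_jensen x0).
  by rewrite ler_wpM2l ?expR_ge0.
rewrite -ler_pdivlMr// mulrAC in h.
have cc : 0 < C / mlc m 0 by rewrite divr_gt0.
rewrite -[C / mlc m 0]lnK ?posrE// -expRD ler_expR in h.
apply: (le_trans h); rewrite [leRHS]mulrDl; apply: lerD.
  by apply: (le_trans (ler_norm _)); rewrite ler_peMr.
by rewrite -mulrA ler_wpM2l.
Qed.

(** The mean value theorem on [X, 2 X] produces a point where pvar x = (x / X) (pmean (2 X) - pmean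
    X), which the bound on the mean controls. *)
Lemma small_variance : exists2 D : R, 0 <= D & forall X : R, 1 <= X ->
  exists2 x : R, X <= x & pvar x <= D * x `^ m.
Proof.
have [D D0 hD] := pmean_bound.
exists (2 * (D * 2 `^ m)) => [|X X1]; first by rewrite !mulr_ge0 ?powR_ge0.
have X0 : 0 < X by apply: lt_le_trans X1.
have X2 : X < 2 * X by rewrite ltr_pMl// ltr1n.
have der x : X <= x -> is_derive x 1 pmean (pvar x / x).
  by move=> Xx; apply: pmean_derive; exact: lt_le_trans Xx.
have [||x xI hx] := @MVT R pmean (fun x => pvar x / x) X (2 * X) X2.
- by move=> x; rewrite in_itv /= => /andP[/ltW Xx _]; exact: der.
- apply: continuous_in_subspaceT => x; rewrite inE /= in_itv /= => /andP[Xx _].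
  apply: differentiable_continuous; apply/derivable1_diffP.
  by have [] := der x Xx.
move: xI; rewrite in_itv /= => /andP[Xx x2]; have x0 : 0 < x by apply: lt_trans Xx.
exists x; first exact: ltW.
have vE : pvar x = x / X * (pmean (2 * X) - pmean X).
  rewrite hx (_ : 2 * X - X = X); last by ring.
  by field; rewrite !gt_eqF.
have d1 : pmean (2 * X) - pmean X <= D * (2 * X) `^ m.
  apply: (@le_trans _ _ (pmean (2 * X))); first by rewrite gerBl pmean_ge0// ltW.
  by apply: hD; apply: le_trans (ltW X2).
have xX : x / X <= 2 by rewrite ler_pdivrMr// ltW.
have t0 : 0 <= D * (2 * X) `^ m by rewrite mulr_ge0 ?powR_ge0.
rewrite vE; apply: (@le_trans _ _ (2 * (D * (2 * X) `^ m))).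
  apply: (@le_trans _ _ (x / X * (D * (2 * X) `^ m))).
    by rewrite ler_wpM2l// divr_ge0// ltW.
  by rewrite ler_wpM2r.
rewrite -!mulrA ler_wpM2l// ler_wpM2l// powRM ?(ltW X0)// ler_wpM2l ?powR_ge0//.
by apply: ge0_ler_powR; rewrite ?nnegrE ?(ltW m0) ?(ltW X0) ?(ltW x0)// ltW.
Qed.

Lemma Kd_RS w : Kd m w = m / pi * RS s0 (cmod w ^+ 2).
Proof. by rewrite /Kd Kern_PS mulcJ ReZl. Qed.

(** Bounds the squared norm of the functional w f'(w) - mu f(w): expanding (k - mu)^2 leaves the
    second moment minus the squared mean. *)
Lemma variance_bound (w : R[i]) n :
  \sum_(k < n) cmod ((k%:R - (pmean (cmod w ^+ 2))%:C%C) * w ^+ k) ^+ 2 / gam m k <=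
  Kd m w * pvar (cmod w ^+ 2).
Proof.
set x := cmod w ^+ 2; set A := pmean x.
have x0 : 0 <= x by exact: sqr_ge0.
have g0 := RS_ml_gt0 x0.
have mp : 0 <= m / pi by rewrite divr_ge0 ?(ltW m0)// pi_ge0.
have [pd dE] := RS_comb3 (- (2 * A)) (A ^+ 2) x p2 p1 p0.
pose dd k := s2 k + (- (2 * A)) * s1 k + A ^+ 2 * s0 k.
have ddE k : dd k = (k%:R - A) ^+ 2 * mlc m k by rewrite /dd /s2 /s1 /s0; ring.
have dd0 k : 0 <= dd k by rewrite ddE mulr_ge0 ?sqr_ge0.
have e : Kd m w * pvar x = m / pi * RS dd x.
  have AE : RS s1 x = A * RS s0 x by rewrite /A /pmean divfK// gt_eqF.
  have gn : RS s0 x != 0 by rewrite gt_eqF.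
  rewrite Kd_RS -/x dE AE /pvar -/A -mulrA; congr (_ * _).
  have alg (a g : R) : g != 0 -> g * (a / g - A ^+ 2) = a + - (2 * A) * (A * g) + A ^+ 2 * g.
    by move=> g0'; field.
  exact: alg.
rewrite e; apply: (@le_trans _ _ (m / pi * \sum_(k < n) dd k * x ^+ k)); last first.
  by rewrite ler_wpM2l//; exact: RS_ge.
rewrite mulr_sumr; apply: ler_sum => k _.
have -> : k%:R - A%:C%C = (k%:R - A)%:C%C :> R[i] by rewrite rmorphB rmorph_nat.
rewrite gamV cmodM cmodR cmodX exprMn real_normK ?num_real// ddE -exprM mulnC exprM -/x.
by rewrite le_eqVlt; apply/orP; left; apply/eqP; ring.
Qed.

(* The mean is chosen so that this functional annihilates the kernel itself. *)
Lemma Kern_mean (w : R[i]) :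
  PS (fun k => k%:R * kcoef m w k) w = (pmean (cmod w ^+ 2) * Kd m w)%:C%C.
Proof.
set x := cmod w ^+ 2; have g0 := RS_ml_gt0 (sqr_ge0 (cmod w)).
have mE : pmean x * Kd m w = m / pi * RS s1 x.
  by rewrite Kd_RS /pmean -/x mulrCA divfK// gt_eqF.
have e k : k%:R * kcoef m w k * w ^+ k = (m / pi)%:C%C * (creal s1 k * x%:C%C ^+ k).
  rewrite kcoef_ml /creal /s1 (real_complexM k%:R (mlc m k)) rmorph_nat /mlC /x -mulcJ exprMn.
  by generalize (m / pi)%:C%C (mlc m k)%:C%C => p q; ring.
rewrite mE /PS (_ : (fun k => _) = (fun k => (m / pi)%:C%C * (creal s1 k * x%:C%C ^+ k))).
  2: by apply/funext => k.
rewrite csumZ; last exact: (asum_ps _ p1).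
rewrite (real_complexM (m / pi) (RS s1 x)); congr (_ * _); apply: complex_eq; rewrite //=.
have h := (asum_cvg (asum_ps x%:C%C p1)).2.
have z : (fun n => complex.Im (\sum_(k < n) creal s1 k * x%:C%C ^+ k)) = fun=> 0.
  apply/funext => n; rewrite Im_sum big1// => k _.
  by rewrite real_complexX /creal -real_complexM.
rewrite z in h; exact: (cvg_unique (@Rhausdorff R) h (@cvg_cst _ (0 : R) _ _ _)).
Qed.

End Variance.

(** * The common necessary condition *)

Section StarCondition.
Context {R : realType}.
Local Notation Re := complex.Re.
Local Notation Im := complex.Im.
Local Notation dA := (@dA R).
Implicit Types (z w : R[i]) (u v f : R[i] -> R[i]).
Variable m : R.
Hypothesis m1 : 1 <= m.
Let m0 : 0 < m. Proof. exact: lt_le_trans m1. Qed.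

Lemma cdiff_unique f z d1 d2 : cdiff f z d1 -> cdiff f z d2 -> d1 = d2.
Proof.
move=> h1 h2; apply/eqP; rewrite -subr_eq0 -cmod_eq0; apply/eqP/le_anti.
rewrite cmod_ge0 andbT; apply/ler_addgt0Pr => e e0; rewrite add0r.
have e2 : 0 < e / 2 by rewrite divr_gt0.
have [a a0 ha] := h1 _ e2; have [b b0 hb] := h2 _ e2.
pose t : R := Num.min a b / 2.
have t0 : 0 < t by rewrite divr_gt0// lt_min a0.
have ta : cmod t%:C%C < a.
  by rewrite cmodR ger0_norm ?(ltW t0)// /t ltr_pdivrMr// gt_min ltr_pMr// ltr1n.
have tb : cmod t%:C%C < b.
  by rewrite cmodR ger0_norm ?(ltW t0)// /t ltr_pdivrMr// gt_min [b < _]ltr_pMr// ltr1n orbT.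
have := lerD (hb _ tb) (ha _ ta); rewrite cmodR ger0_norm ?(ltW t0)//.
have -> : e / 2 * t + e / 2 * t = e * t by field.
move=> h; rewrite -(ler_pM2r t0); apply: le_trans h.
apply: le_trans (cmodBD _ _).
have -> : f (z + t%:C%C) - f z - d2 * t%:C%C - (f (z + t%:C%C) - f z - d1 * t%:C%C) =
   (d1 - d2) * t%:C%C by ring.
by rewrite cmodM cmodR ger0_norm ?(ltW t0).
Qed.

Lemma l2sq_scale c f : cmeas f -> (l2sq m (fun z => c * f z)%R = (cmod c ^+ 2)%:E * l2sq m f)%E.
Proof.
move=> mf; rewrite /l2sq -ge0_integralZl//.
- by apply: eq_integral => p _; rewrite cmodM exprMn -mulrA EFinM.
- by apply/measurable_EFinP; exact: rmeasM (rmeas_cmod2 mf) (rmeas_wt m).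
- by move=> p _; rewrite lee_fin mulr_ge0 ?sqr_ge0 ?wt_ge0.
- by rewrite lee_fin sqr_ge0.
Qed.

(* Common consequence of the boundedness of the product, tested on kernel functions, and of the
   boundedness of the product of Berezin transforms. *)
Definition star u v (M : R) := forall w,
  ((cmod (v w) ^+ 2)%:E * l2sq m (fun z => u z * Kern m z w)%R <= (M * Kd m w)%:E)%E.

(** For the necessity part, where the growth of the symbols is unknown and integrability is read off
    the definedness of the operators. *)
Lemma reproducing_lam f z : entire f -> lam_integrable m (fun w => Kern m z w * f w) ->
  lam_int m (fun w => Kern m z w * f w) = f z.
Proof.
move=> /entire_power_series [a [pa fa _]].
have -> : f = PS a by apply/funext => w; exact: fa.
exact: reproducing.
Qed.

(** Tested on the single kernel function K_w, the product yields conj (v w) u K_w, and the squared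
    norm of K_w is at most K(w, w). *)
Lemma star_of_TT u v (M : R) : entire u -> entire v -> TT_bounded_by m u v M -> star u v (M ^+ 2).
Proof.
move=> eu ev hM w; pose f z := Kern m z w.
have kf : kspan m f.
  by exists 1%N, (fun=> 1), (fun=> w) => z; rewrite big_ord1 mul1r.
have [[d1 d2] hl] := hM f kf.
have ek x : entire (fun z => Kern m z x) by exact: entire_Kern.
have toepE x : toep m (cconj v) f x = ((v w)^*)%C * Kern m x w.
  pose h z := Kern m w z * (v z * Kern m z x).
  have alg (a b d : R[i]) : ((a * (b * d))^*)%C = (d^*)%C * (b^*)%C * (a^*)%C.
    by rewrite !conjcM; ring.
  have hE : (fun z => Kern m x z * cconj v z * f z) = (fun z => ((h z)^*)%C).
    by apply/funext => z; rewrite -(KernJ m1 z x) /f -(KernJ m1 w z); apply/esym; exact: alg.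
  have := d1 x; rewrite /toep_defined hE => /lam_integrableJ.
  have -> : (fun z => (((h z)^*)%C^*)%C) = h by apply/funext => z; rewrite conjcK.
  move=> ih; rewrite /toep hE lam_intJ//.
    by rewrite (reproducing_lam (entireM ev (ek x)) ih) conjcM (KernJ m1 w x).
  exact: cmeasM (tame_KernJ m1 w).1 (cmeasM (cmeas_entire ev) (tame_Kern m1 x).1).
have toepF : toep m (cconj v) f = (fun x => ((v w)^*)%C * Kern m x w) by apply/funext => x; exact: toepE.
have TE z : TT m u v f z = ((v w)^*)%C * (u z * Kern m z w).
  have e : entire (fun x => ((v w)^*)%C * (u x * Kern m x w)).
    by apply: entireM (entire_cst _) _; exact: entireM eu (ek w).
  have alg (a b d k : R[i]) : a * b * (d * k) = a * (d * (b * k)) by ring.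
  have hE : (fun x => Kern m z x * u x * toep m (cconj v) f x) =
      (fun x => Kern m z x * (((v w)^*)%C * (u x * Kern m x w))).
    by apply/funext => x; rewrite toepE alg.
  have := d2 z; rewrite /toep_defined hE => ih.
  by rewrite /TT /toep -/(toep m (cconj v) f) hE (reproducing_lam e ih).
have TF : TT m u v f = (fun z => ((v w)^*)%C * (u z * Kern m z w)) by apply/funext => z; exact: TE.
move: hl; rewrite TF l2sq_scale; last by apply: cmeas_entire; exact: entireM eu (ek w).
rewrite cmodJ => hl; apply: (le_trans hl); rewrite [leRHS]EFinM lee_wpmul2l ?lee_fin ?sqr_ge0//.
exact: l2_Kern.
Qed.

Lemma berezinE f w : cmeas f ->
  (berezin m (fun z => (cmod (f z) ^+ 2)%R) w = ((Kd m w)^-1)%:E * l2sq m (fun z => f z * Kern m z w)%R)%E.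
Proof.
move=> mf; have mK : cmeas (fun z => Kern m z w) by exact: (tame_Kern m1 w).1.
have mE : measurable_fun setT (fun p : R * R => (cmod (f (toC p) * Kern m (toC p) w) ^+ 2 * wt m (toC p))%:E).
  by apply/measurable_EFinP; exact: (rmeasM (rmeas_cmod2 (cmeasM mf mK)) (rmeas_wt m)).
have K0 : (0 <= ((Kd m w)^-1)%:E)%E by rewrite lee_fin invr_ge0 ltW// Kd_gt0.
rewrite /l2sq /berezin -(ge0_integralZl dA measurableT mE _ K0); last first.
  by move=> p _; rewrite lee_fin mulr_ge0 ?sqr_ge0 ?wt_ge0.
apply: eq_integral => p _; rewrite -EFinM cmodM exprMn /Kd; congr EFin.
by generalize (cmod (Kern m (toC p) w)) (Re (Kern m w w)) (cmod (f (toC p))) (wt m (toC p)) => a b c d; ring.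
Qed.

Lemma l2sq_ge0 f : (0 <= l2sq m f)%E.
Proof. by apply: integral_ge0 => p _; rewrite lee_fin mulr_ge0 ?sqr_ge0 ?wt_ge0. Qed.

Lemma l2_point f w (E : R) : entire f -> (l2sq m f <= E%:E)%E -> cmod (f w) ^+ 2 <= E * Kd m w.
Proof.
move=> /entire_power_series [a [pa fa _]].
have -> : f = PS a by apply/funext => z; exact: fa.
exact: point_bound.
Qed.

(** The point bound for f K_w, taken at w itself, where K_w equals K(w, w). *)
Lemma berezin_ge f w : entire f -> ((cmod (f w) ^+ 2)%:E <= berezin m (fun z => (cmod (f z) ^+ 2)%R) w)%E.
Proof.
move=> ef; rewrite (berezinE w (cmeas_entire ef)).
have K0 := Kd_gt0 m1 w.
have eF : entire (fun z => f z * Kern m z w) by apply: entireM ef _; exact: entire_Kern.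
have := l2sq_ge0 (fun z => f z * Kern m z w).
case E : (l2sq m (fun z => f z * Kern m z w)) => [x| |] //= x0; last first.
  by rewrite gt0_muley ?lte_fin ?invr_gt0// leey.
have := l2_point w eF; rewrite E => /(_ x (lexx _)).
rewrite (Kern_diag m1) cmodM cmodR exprMn real_normK ?num_real// expr2 mulrA ler_pM2r// => h.
by rewrite -EFinM lee_fin [leRHS]mulrC ler_pdivlMr.
Qed.

(** The transform of |v|^2 is replaced by the smaller |v|^2 itself; that of |u|^2 is already the
    normalised norm of u K_w. *)
Lemma star_of_berezin u v (M : R) : entire u -> entire v ->
  (forall z, (berezin m (fun w => (cmod (u w) ^+ 2)%R) z * berezin m (fun w => (cmod (v w) ^+ 2)%R) z <= M%:E)%E) ->
  star u v M.
Proof.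
move=> eu ev hM w; have K0 := Kd_gt0 m1 w.
have := hM w; rewrite (berezinE w (cmeas_entire eu)).
set L := l2sq m (fun z => u z * Kern m z w); set B := berezin m _ w => h.
have hB : ((cmod (v w) ^+ 2)%:E <= B)%E by exact: berezin_ge.
have L0 : (0 <= L)%E by exact: l2sq_ge0.
have h2 : (((Kd m w)^-1)%:E * L * (cmod (v w) ^+ 2)%:E <= M%:E)%E.
  by apply: le_trans h; rewrite lee_wpmul2l// mule_ge0// lee_fin invr_ge0 ltW.
have -> : ((cmod (v w) ^+ 2)%:E * L = (Kd m w)%:E * (((Kd m w)^-1)%:E * L * (cmod (v w) ^+ 2)%:E))%E.
  by rewrite !muleA -EFinM mulfV ?gt_eqF// mul1e muleC.
by rewrite [X in (_ <= X%:E)%E]mulrC [leRHS]EFinM lee_wpmul2l// lee_fin ltW.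
Qed.

End StarCondition.

(** * From the necessary condition to exponentials *)

Section Necessity.
Context {R : realType}.
Local Notation Re := complex.Re.
Local Notation Im := complex.Im.
Local Notation dA := (@dA R).
Implicit Types (z w : R[i]) (u v f : R[i] -> R[i]).
Variable m : R.
Hypothesis m1 : 1 <= m.
Let m0 : 0 < m. Proof. exact: lt_le_trans m1. Qed.

Section FromStar.
Variables (u v : R[i] -> R[i]) (M : R).
Hypotheses (eu : entire u) (ev : entire v) (un : exists z, u z != 0) (vn : exists z, v z != 0).
Hypothesis hs : star m u v M.

Let M0 : 0 <= M.
Proof.
have h := hs 0; have K0 := Kd_gt0 m1 0.
rewrite -(pmulr_lge0 _ K0) -lee_fin; apply: le_trans h.
by rewrite mule_ge0 ?l2sq_ge0// lee_fin sqr_ge0.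
Qed.

Let l2u w : v w != 0 -> (l2sq m (fun z => u z * Kern m z w)%R <= (M * Kd m w / cmod (v w) ^+ 2)%:E)%E.
Proof.
move=> vw; have v0 : 0 < cmod (v w) ^+ 2 by rewrite exprn_gt0// cmod_gt0.
by have := hs w; rewrite -lee_pdivlMl// -EFinM mulrC.
Qed.

Let euK w : entire (fun z => u z * Kern m z w).
Proof. by apply: entireM eu _; exact: entire_Kern. Qed.

(** Point evaluation of u K_w at w gives |u v|^2 <= M; M + 1 serves as a bound for the square
    root. *)
Let uv_le w : cmod (u w * v w) <= M + 1.
Proof.
rewrite -(@ler_pXn2r _ 2)// ?nnegrE ?cmod_ge0 ?addr_ge0//.
apply: (@le_trans _ _ M); last first.
  have M2 : 0 <= M ^+ 2 by exact: sqr_ge0.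
  have -> : (M + 1) ^+ 2 = M ^+ 2 + 2 * M + 1 by ring.
  have alg (x y : R) : 0 <= x -> 0 <= y -> x <= y + 2 * x + 1 by move=> *; lra.
  exact: alg.
have [vw|vw] := eqVneq (v w) 0; first by rewrite vw mulr0 cmod0 expr0n.
have v0 : 0 < cmod (v w) ^+ 2 by rewrite exprn_gt0// cmod_gt0.
have K0 := Kd_gt0 m1 w.
have := l2_point m1 w (euK w) (l2u vw).
rewrite (Kern_diag m1) cmodM cmodR exprMn real_normK ?num_real// expr2.
rewrite [_ * Kd m w]mulrC; rewrite cmodM exprMn.
have -> : Kd m w * (M * Kd m w / cmod (v w) ^+ 2) = M / cmod (v w) ^+ 2 * (Kd m w * Kd m w) by ring.
by rewrite -expr2 ler_pM2r ?exprn_gt0// ler_pdivlMr.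
Qed.

(** A radius with r^(n - s) >= C / A + 1 would contradict the estimate. With Cauchy's estimate for
    A, bounds on arbitrarily large circles alone remove the coefficients of order above the
    growth. *)
Lemma small_growth (A C s : R) n : 0 <= A -> 0 <= C -> s < n%:R ->
  (forall X : R, 1 <= X -> exists2 r, X <= r & A * r ^+ n <= C * r `^ s) -> A = 0.
Proof.
move=> A0 C0 sn h; apply/eqP; rewrite eq_le A0 andbT leNgt; apply/negP => Ap.
pose t := n%:R - s; have t0 : 0 < t by rewrite subr_gt0.
pose Y := C / A + 1; have Y1 : 1 <= Y by rewrite lerDr divr_ge0.
have X1 : 1 <= Y `^ t^-1.
  by have := @ler_powR R Y Y1 0 t^-1; rewrite powRr0; apply; rewrite invr_ge0 ltW.
have [r Xr hr] := h _ X1.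
have r0 : 0 < r by apply: lt_le_trans Xr; apply: lt_le_trans X1.
have Yr : Y <= r `^ t.
  have -> : Y = (Y `^ t^-1) `^ t by rewrite -powRrM mulVf ?gt_eqF// powRr1// (le_trans ler01).
  by apply: ge0_ler_powR; rewrite ?nnegrE ?powR_ge0 ?(ltW t0) ?(ltW r0).
have rn : r ^+ n = r `^ t * r `^ s.
  by rewrite -(powR_mulrn n (ltW r0)) -powRD ?(gt_eqF r0) ?implybT// subrK.
move: hr; rewrite rn mulrA ler_pM2r ?powR_gt0// -ler_pdivlMl// mulrC => h2.
by have := le_trans Yr h2; rewrite /Y leNgt ltrDl ltr01.
Qed.

(** Liouville's theorem, with growth exponent s = 0. *)
Let uv_cst : exists2 c, c != 0 & forall z, u z * v z = c.
Proof.
have [a [pa ae ac]] := entire_power_series (entireM eu ev).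
have a0 k : (1 <= k)%N -> a k = 0.
  move=> k1; apply/eqP; rewrite -cmod_eq0; apply/eqP.
  apply: (@small_growth _ (2 * (M + 1)) 0 k); rewrite ?cmod_ge0 ?mulr_ge0 ?addr_ge0 ?ltr0n// => X X1.
  exists X => //; rewrite powRr0 mulr1; apply: ac; first exact: lt_le_trans X1.
  by move=> z _; exact: uv_le.
have uvE z : u z * v z = a 0%N.
  by rewrite ae (PS_poly a0) horner_poly big_ord1 expr0 mulr1.
exists (a 0%N) => //.
(* The constant is nonzero: zeros at 0 are isolated, so u and v are both nonzero at some small t >
   0. *)
have [b [pb be _]] := entire_power_series eu; have [b' [pb' be' _]] := entire_power_series ev.
have [|d d0 hd] := PS_isolated pb; first by have [z] := un; rewrite be; exists z.
have [|d' d'0 hd'] := PS_isolated pb'; first by have [z] := vn; rewrite be'; exists z.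
pose t : R := Num.min d d' / 2.
have t0 : 0 < t by rewrite divr_gt0// lt_min d0.
have tn : t%:C%C != 0 :> R[i] by rewrite -cmod_gt0 cmodR ger0_norm ?(ltW t0).
have ta : cmod t%:C%C < d.
  by rewrite cmodR ger0_norm ?(ltW t0)// /t ltr_pdivrMr// gt_min ltr_pMr// ltr1n.
have tb : cmod t%:C%C < d'.
  by rewrite cmodR ger0_norm ?(ltW t0)// /t ltr_pdivrMr// gt_min [d' < _]ltr_pMr// ltr1n orbT.
rewrite -(uvE t%:C%C) be be'; exact: mulf_neq0 (hd _ tn ta) (hd' _ tn tb).
Qed.

Let v_neq0 w : v w != 0.
Proof. by have [c c0 h] := uv_cst; apply/eqP => vw; move: c0; rewrite -(h w) vw mulr0 eqxx. Qed.
Let u_neq0 w : u w != 0.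
Proof. by have [c c0 h] := uv_cst; apply/eqP => vw; move: c0; rewrite -(h w) vw mul0r eqxx. Qed.

(** Since |v| = |c| / |u|, the hypothesis bounds the squared norm of u K_w by M / |c|^2 times
    |u(w)|^2 K(w, w); the derivative functional is then applied to u K_w. *)
Let logderiv_bound b : pscoef b -> (forall z, u z = PS b z) -> exists2 M', 0 <= M' & forall w,
  cmod (w * PS (dcoef b) w / u w) ^+ 2 <= M' * pvar m (cmod w ^+ 2).
Proof.
move=> pb be; have [c c0 uvc] := uv_cst.
have cc : 0 < cmod c ^+ 2 by rewrite exprn_gt0// cmod_gt0.
exists (M / cmod c ^+ 2) => [|w]; first by rewrite divr_ge0// ltW.
have K0 := Kd_gt0 m1 w.
have u0 : 0 < cmod (u w) ^+ 2 by rewrite exprn_gt0// cmod_gt0.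
have hE : (l2sq m (fun z => u z * Kern m z w)%R <= (M / cmod c ^+ 2 * cmod (u w) ^+ 2 * Kd m w)%:E)%E.
  apply: le_trans (l2u (v_neq0 w)) _; rewrite lee_fin -(uvc w) cmodM exprMn.
  have v0 : 0 < cmod (v w) ^+ 2 by rewrite exprn_gt0// cmod_gt0.
  have alg (x y k a : R) : x != 0 -> y != 0 -> a * k / y = a / (x * y) * x * k by move=> ? ?; field; apply/andP.
  by rewrite (alg (cmod (u w) ^+ 2)) ?gt_eqF.
have [a [pa ae _]] := entire_power_series (euK w).
have lE : l2sq m (PS a) = l2sq m (fun z => u z * Kern m z w).
  by congr (l2sq m); apply/funext => z; rewrite -ae.
rewrite -lE in hE.
set k0 := pmean m (cmod w ^+ 2).
have := @functional_bound R m m1 a (fun k => (k%:R - k0%:C%C) * w ^+ k) _ _ (bessel m1 pa hE) (variance_bound m1 w).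
rewrite -/k0.
have dF : cdiff (fun z => u z * Kern m z w) w
    (PS (dcoef b) w * Kern m w w + u w * PS (dcoef (kcoef m w)) w).
  have d1 : cdiff u w (PS (dcoef b) w) by apply: (cdiff_ext _ (PS_cdiff w pb)) => z; rewrite be.
  have d2 : cdiff (fun z => Kern m z w) w (PS (dcoef (kcoef m w)) w).
    by apply: (cdiff_ext _ (PS_cdiff w (pscoef_kcoef m1 w))) => z; rewrite Kern_kcoef.
  exact: cdiffM d1 d2.
have dF2 : cdiff (fun z => u z * Kern m z w) w (PS (dcoef a) w).
  by apply: (cdiff_ext _ (PS_cdiff w pa)) => z; rewrite ae.
have dE := cdiff_unique dF2 dF.
have kE := Kern_mean m1 w; rewrite (PS_nat _ (pscoef_kcoef m1 w)) -/k0 in kE.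
have aw : PS a w = u w * (Kd m w)%:C%C by rewrite -ae (Kern_diag m1).
(* By the product rule the functional gives w u'(w) K(w, w) plus u(w) times its value on K_w, and
   the latter vanishes by [Kern_mean]. *)
have -> : csum (fun k => a k * ((k%:R - k0%:C%C) * w ^+ k)) = w * PS (dcoef b) w * (Kd m w)%:C%C.
  have -> : csum (fun k => a k * ((k%:R - k0%:C%C) * w ^+ k)) =
      PS (fun k => k%:R * a k + (- k0%:C%C) * a k) w.
    by congr csum; apply/funext => k; ring.
  have pna := pscoef_nat pa; have pka := pscoefZ (- k0%:C%C) pa.
  rewrite (PSD _ pna pka) (PSZ _ _ pa) (PS_nat _ pa) aw dE (Kern_diag m1).
  have alg (x p k q c' : R[i]) : x * q = c' * k -> x * (p * k + u w * q) + - c' * (u w * k) = x * p * k.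
    by move=> e; rewrite mulrDr [x * (u w * q)]mulrCA e; ring.
  by apply: alg; rewrite kE real_complexM.
rewrite cmodM cmodR exprMn real_normK ?num_real//.
move: (PS (dcoef b) w) => p h.
rewrite cmodM cmodV exprMn exprVn ler_pdivrMr// -(@ler_pM2r _ (Kd m w ^+ 2)) ?exprn_gt0//.
apply: (le_trans h); rewrite le_eqVlt; apply/orP; left; apply/eqP; ring.
Qed.

Theorem exp_of_star : exists (g : {poly R[i]}) (c : R[i]),
  [/\ deg_le g m, c != 0, forall z, u z = cexp g.[z] & forall z, v z = c * cexp (- g.[z])].
Proof.
have [b [pb be _]] := entire_power_series eu.
have [M' M'0 hM'] := logderiv_bound pb be.
have [D D0 hD] := small_variance m1.
have [c c0 uvc] := uv_cst.
pose q z := PS (dcoef b) z * (u z)^-1.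
have eq_ : entire q.
  by apply: entireM; [apply: entire_PS; exact: pscoef_d|exact: entireV].
have [d [pd de dc]] := entire_power_series eq_.
(* Its square dominates M' D, so it stands in for a square root. *)
pose Q := M' * D + 1; have Q0 : 0 <= Q by rewrite addr_ge0 ?mulr_ge0.
(* Good circles: the variance is taken at |z|^2, so a good point x above X^2 corresponds to the
   radius sqrt x. *)
have circ (X : R) : 1 <= X -> exists2 r : R, X <= r & forall z, cmod z = r -> cmod (q z) <= Q * r `^ (m - 1).
  move=> X1; have X20 : 1 <= X ^+ 2 by rewrite exprn_ege1.
  have [x Xx hx] := hD _ X20; have x1 : 1 <= x by apply: le_trans Xx.
  have x0 : 0 < x by apply: lt_le_trans x1.
  exists (Num.sqrt x) => [|z zr].
    by rewrite -(@ler_pXn2r _ 2)// ?nnegrE ?sqrtr_ge0 ?(le_trans ler01)// sqr_sqrtr// ltW.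
  have zx : cmod z ^+ 2 = x by rewrite zr sqr_sqrtr// ltW.
  have := hM' z; rewrite zx => h.
  have {}h := le_trans h (ler_wpM2l M'0 hx).
  have qE : z * PS (dcoef b) z / u z = z * q z by rewrite /q mulrA.
  rewrite qE cmodM exprMn zx in h.
  have rm : (Num.sqrt x `^ (m - 1)) ^+ 2 * x = x `^ m.
    rewrite -(powR_mulrn 2 (powR_ge0 _ _)) -powRrM mulrC [_ * 2%:R]mulrC powRrM.
    rewrite (powR_mulrn 2 (sqrtr_ge0 _)) sqr_sqrtr ?(ltW x0)//.
    by rewrite -{1}(powRr1 (ltW x0)) -powRD ?(gt_eqF x0) ?implybT// addrC subrK.
  rewrite -rm [_ * x]mulrC !mulrA [M' * D * x]mulrC -!mulrA ler_pM2l// in h.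
  rewrite -(@ler_pXn2r _ 2)// ?nnegrE ?cmod_ge0 ?mulr_ge0 ?powR_ge0// exprMn.
  apply: (le_trans h); rewrite mulrA ler_wpM2r ?sqr_ge0//.
  have MD : 0 <= M' * D by rewrite mulr_ge0.
  by rewrite /Q (_ : (M' * D + 1) ^+ 2 = (M' * D) ^+ 2 + 2 * (M' * D) + 1); [have := sqr_ge0 (M' * D); lra|ring].
pose N := Num.Def.truncn m; have /andP[N1 N2] := truncn_itv (ltW m0).
(* For k >= N one has k + 1 > m, so k exceeds the growth exponent m - 1; the primitive then has
   degree at most N <= m. *)
have d0 k : (N <= k)%N -> d k = 0.
  move=> Nk; apply/eqP; rewrite -cmod_eq0; apply/eqP.
  apply: (@small_growth _ (2 * Q) (m - 1) k); rewrite ?cmod_ge0 ?mulr_ge0//.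
    rewrite ltrBlDr natr1; apply: lt_le_trans N2 _; by rewrite ler_nat.
  move=> X X1; have [r Xr hr] := circ X X1; exists r => //.
  rewrite -mulrA; apply: dc => //; apply: lt_le_trans Xr; exact: lt_le_trans X1.
pose e k : R[i] := if k is k'.+1 then d k' / k'.+1%:R else 0.
have n0 k : (k.+1%:R : R[i]) != 0 by rewrite pnatr_eq0.
have de2 : dcoef e = d by apply/funext => k; rewrite /dcoef /e mulrC divfK.
have pe : pscoef e.
  move=> r r0; have [B hB] := pd r r0; exists (B * r) => -[|k].
    rewrite /e cmod0 mul0r mulr_ge0//; apply: le_trans (hB 0%N).
    by rewrite mulr_ge0 ?cmod_ge0 ?exprn_ge0.
  rewrite /e exprSr mulrA ler_wpM2r//; apply: le_trans (hB k).
  rewrite ler_wpM2r ?exprn_ge0// cmodM ler_piMr ?cmod_ge0// cmodV.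
  by rewrite -(rmorph_nat (@real_complex R)) cmodR ger0_norm// invf_le1// ler1n.
have e0 k : (N.+1 <= k)%N -> e k = 0 by case: k => [//|k] Nk; rewrite /e d0// mul0r.
pose g0 : {poly R[i]} := \poly_(k < N.+1) e k.
have gE z : PS e z = g0.[z] by exact: PS_poly.
have dg z : cdiff (fun x => g0.[x]) z (q z).
  by rewrite de -de2; apply: (cdiff_ext _ (PS_cdiff z pe)).
(* As g0' = u' / u, the function u exp (- g0) is constant; its value, written as an exponential,
   joins the constant term. *)
have dh z : cdiff (fun x => u x * cexp (- g0.[x])) z 0.
  have d1 : cdiff u z (PS (dcoef b) z) by apply: (cdiff_ext _ (PS_cdiff z pb)) => x; rewrite be.
  have d2 : cdiff (fun x => - g0.[x]) z (-1 * q z).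
    by apply: (cdiff_ext _ (cdiffZ (-1) (dg z))) => x; rewrite mulN1r.
  have d3 := cdiffM d1 (@cdiff_comp _ (@cexp R) (fun x => - g0.[x]) z _ _ (cdiff_cexp (- g0.[z])) d2).
  have -> : 0 = PS (dcoef b) z * cexp (- g0.[z]) + u z * (cexp (- g0.[z]) * (-1 * q z)).
    rewrite /q; have uz := u_neq0 z; generalize (PS (dcoef b) z) (cexp (- g0.[z])) (u z) uz => p x y y0.
    by field.
  exact: d3.
have hc := cdiff0_cst dh.
have k0 : u 0 * cexp (- g0.[0]) != 0 by rewrite mulf_neq0 ?cexp_neq0.
have [w0 hw0] := cexp_surj k0.
have uE z : u z = cexp (g0 + w0%:P).[z].
  rewrite hornerD hornerC cexpD -hw0 -(hc z) mulrCA -cexpD subrr cexp0 mulr1//.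
exists (g0 + w0%:P), c; split => // [|z].
  rewrite /deg_le; apply: le_trans N1; rewrite ler_nat.
  have : (size (g0 + w0%:P)%R <= N.+1)%N.
    apply: leq_trans (size_polyD _ _) _; rewrite geq_max size_poly /=.
    by apply: leq_trans (size_polyC_leq1 _) _.
  by case: (size _) => //.
have uz := u_neq0 z.
by rewrite cexpN -uE -(uvc z) mulrAC divff// mul1r.
Qed.

End FromStar.

(** Sufficiency is applied to g and to - g: the resulting bounds are multiples of exp (2 Re g) and
    exp (- 2 Re g), which cancel in the product. *)
Lemma berezin_exp (g : {poly R[i]}) (c : R[i]) : deg_le g m -> c != 0 ->
  exists M : R, forall z,
    (berezin m (fun w => (cmod (cexp g.[w]) ^+ 2)%R) z *
     berezin m (fun w => (cmod (c * cexp (- g.[w])) ^+ 2)%R) z <= M%:E)%E.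
Proof.
move=> dg c0; have cc : 0 < cmod c by rewrite cmod_gt0.
have eexp (p : {poly R[i]}) : entire (fun z => cexp p.[z]).
  by apply: entire_comp; [exact: entire_cexp|exact: entire_horner].
have sexp (p : {poly R[i]}) : deg_le p m -> exists M, star m (fun z => cexp p.[z]) (fun z => 1 * cexp (- p.[z])) M.
  move=> dp; have [C1 [C2 [_ _ h]]] := TT_bounded_exp m1 (oner_neq0 (R[i])).
  eexists; apply: (star_of_TT m1 _ _ (h p dp)) => //.
  apply: entireM (entire_cst 1) _; apply: (entire_ext _ (eexp (- p))) => z.
  by rewrite hornerN.
have dN : deg_le (- g) m by rewrite /deg_le size_polyN.
have [M1 h1] := sexp g dg; have [M2 h2] := sexp (- g) dN.
have bound (p : {poly R[i]}) (M : R) : star m (fun z => cexp p.[z]) (fun z => 1 * cexp (- p.[z])) M ->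
    forall z, (berezin m (fun w => (cmod (cexp p.[w]) ^+ 2)%R) z <= (M * expR (Re p.[z]) ^+ 2)%:E)%E.
  move=> hs z; have K0 := Kd_gt0 m1 z.
  rewrite (berezinE m1 z (cmeas_entire (eexp p))).
  have := hs z; rewrite mul1r cmod_cexp ReN -lee_pdivlMl ?exprn_gt0 ?expR_gt0// -EFinM => h.
  rewrite -lee_pdivlMl ?invr_gt0// invrK -EFinM; apply: (le_trans h).
  rewrite lee_fin expRN exprVn invrK le_eqVlt; apply/orP; left; apply/eqP; ring.
exists (M1 * (cmod c ^+ 2 * M2)) => z.
have b1 := bound _ _ h1 z; have b2 := bound _ _ h2 z.
have mexp (p : {poly R[i]}) : cmeas (fun z => cexp p.[z]) by exact: cmeas_entire.
have -> : (berezin m (fun w => (cmod (c * cexp (- g.[w])) ^+ 2)%R) z =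
   (cmod c ^+ 2)%:E * berezin m (fun w => (cmod (cexp (- g).[w]) ^+ 2)%R) z)%E.
  rewrite (berezinE m1 z (mexp _)).
  have -> : (fun w => cmod (c * cexp (- g.[w])) ^+ 2) = (fun w => cmod (c * cexp (- g).[w]) ^+ 2).
    by apply/funext => w; rewrite hornerN.
  rewrite (berezinE m1 (f := fun w => c * cexp (- g).[w])); last first.
    exact: cmeasM (cmeas_cst c) (mexp _).
  have -> : (fun w => c * cexp (- g).[w] * Kern m w z) = (fun w => c * (cexp (- g).[w] * Kern m w z)).
    by apply/funext => w; rewrite mulrA.
  rewrite l2sq_scale; first by rewrite muleCA.
  by apply: cmeasM (mexp _) _; exact: (tame_Kern m1 z).1.
have ber0 f : (0 <= berezin m (fun w => (cmod (f w) ^+ 2)%R) z)%E.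
  apply: integral_ge0 => p _; rewrite lee_fin; apply: mulr_ge0 (wt_ge0 _ _); apply: divr_ge0.
    by apply: mulr_ge0; exact: sqr_ge0.
  by apply: ltW; exact: (Kd_gt0 m1).
apply: (@le_trans _ _ ((M1 * expR (Re g.[z]) ^+ 2)%:E * ((cmod c ^+ 2)%:E * (M2 * expR (Re (- g).[z]) ^+ 2)%:E))%E).
  apply: lee_pmul => //.
    by rewrite mule_ge0 ?lee_fin ?sqr_ge0.
  by rewrite lee_wpmul2l ?lee_fin ?sqr_ge0.
rewrite -!EFinM lee_fin hornerN ReN expRN exprVn.
have E0 : expR (Re g.[z]) != 0 by rewrite gt_eqF ?expR_gt0.
by rewrite le_eqVlt; apply/orP; left; apply/eqP; field.
Qed.

End Necessity.

Theorem mainTheorem1 (R : realType) (m : R) (hm : 1 <= m) :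
  (forall u v : R[i] -> R[i],
     inF2 m u -> inF2 m v -> (exists z, u z != 0) -> (exists z, v z != 0) ->
     let cond1 := TT_bounded m u v in
     let cond2 := exists (g : {poly R[i]}) (c : R[i]),
         [/\ deg_le g m, c != 0,
             forall z, u z = cexp g.[z] &
             forall z, v z = c * cexp (- g.[z])] in
     let cond3 := exists M : R, forall z : R[i],
         (berezin m (fun w => (cmod (u w) ^+ 2)%R) z
          * berezin m (fun w => (cmod (v w) ^+ 2)%R) z <= M%:E)%E in
     (cond1 <-> cond2) /\ (cond2 <-> cond3))
  /\
  (forall c : R[i], c != 0 ->
     exists C1 C2 : R, [/\ 0 < C1, 0 < C2 &
       forall g : {poly R[i]}, deg_le g m ->
         TT_bounded_by m (fun z => cexp g.[z]) (fun z => c * cexp (- g.[z]))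
                       (C1 * expR (C2 * h2sq g))]).
Proof.
split=> [u v [eu _] [ev _] un vn|c c0]; last exact: TT_bounded_exp.
split; split.
- by move=> [M hM]; apply: (exp_of_star hm eu ev un vn (star_of_TT hm eu ev hM)).
- move=> [g [c [dg c0 ue ve]]].
  have -> : u = (fun z => cexp g.[z]) by apply/funext.
  have -> : v = (fun z => c * cexp (- g.[z])) by apply/funext.
  by have [C1 [C2 [_ _ h]]] := TT_bounded_exp hm c0; eexists; exact: h.
- move=> [g [c [dg c0 ue ve]]].
  have -> : u = (fun z => cexp g.[z]) by apply/funext.
  have -> : v = (fun z => c * cexp (- g.[z])) by apply/funext.
  exact: berezin_exp.
- by move=> [M hM]; apply: (exp_of_star hm eu ev un vn (star_of_berezin hm eu ev hM)).
Qed.
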